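(* Let $d\ge 1$ and let $V\ge 0$ be a Borel measure on $\mathbb{R}^d$ with $V(\{0\})=0$, $V\neq 0$, $\int_{\mathbb{R}^d}\min(|x|^2,1)\,V(dx)<\infty$, and $V$ symmetric, i.e. $V(-B)=V(B)$ for all Borel $B$. Let $\phi:\mathbb{R}^d\to\mathbb{C}$ be Borel measurable, symmetric ($\phi(-z)=\phi(z)$), with $|\phi(z)|\le 1$ for all $z\in\mathbb{R}^d$. Define $$M(\xi)=\frac{\int_{\mathbb{R}^d}(\cos(\xi\cdot z)-1)\,\phi(z)\,V(dz)}{\int_{\mathbb{R}^d}(\cos(\xi\cdot z)-1)\,V(dz)},\qquad \xi\in\mathbb{R}^d,$$ with $M(\xi)=0$ whenever the denominator vanishes, and define the operator $\mathcal{M}$ on $L^2(\mathbb{R}^d)$ by $\widehat{\mathcal{M}f}(\xi)=M(\xi)\hat f(\xi)$. Then for every $1<p<\infty$, $\mathcal{M}$ has a unique bounded linear extension to $L^p(\mathbb{R}^d)$, and $$\|\mathcal{M}f\|_p\le (p^*-1)\|f\|_p,\qquad f\in L^p(\mathbb{R}^d),$$ where $p^*=\max(p,q)$ with $q=p/(p-1)$.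
   Context: The Fourier transform is $\hat g(\xi)=\int_{\mathbb{R}^d}e^{i\xi\cdot z}g(z)\,dz$ for $g\in L^1(\mathbb{R}^d)$, extended to $L^2(\mathbb{R}^d)$ by Plancherel. $L^p(\mathbb{R}^d)$ denotes complex-valued functions with respect to Lebesgue measure. *)

(* Defs.v *)
From HB Require Import structures.
From mathcomp Require Import all_boot all_order all_algebra.
From mathcomp Require Import all_classical all_reals all_analysis.
From mathcomp Require Import complex.
Set Implicit Arguments. Unset Strict Implicit. Unset Printing Implicit Defensive.
Import Order.TTheory GRing.Theory Num.Theory.
Import numFieldNormedType.Exports.
Local Open Scope classical_set_scope.
Local Open Scope ring_scope.

(* R^d is modelled as d.-tuple R, with its product (= Borel) sigma-algebra. *)

Definition dotp {R : realType} {d : nat} (x y : d.-tuple R) : R :=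
  \sum_(i < d) tnth x i * tnth y i.

Definition sqnorm {R : realType} {d : nat} (x : d.-tuple R) : R := dotp x x.

Definition negt {R : realType} {d : nat} (x : d.-tuple R) : d.-tuple R :=
  map_tuple (fun r => - r) x.

Definition zerot (R : realType) (d : nat) : d.-tuple R := nseq_tuple d 0.

(* Lebesgue measure on R^d, characterized by its values on closed boxes
   (this determines it uniquely on the Borel sets). *)
Definition is_lebesgue {R : realType} {d : nat}
  (leb : {measure set (d.-tuple R) -> \bar R}) : Prop :=
  forall a b : d.-tuple R, (forall i, tnth a i <= tnth b i) ->
    leb [set x | forall i, tnth a i <= tnth x i <= tnth b i] =
    ((\prod_(i < d) (tnth b i - tnth a i))%:E)%E.

Definition cRe {R : realType} (z : R[i]) : R := let: Complex a _ := z in a.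
Definition cIm {R : realType} (z : R[i]) : R := let: Complex _ b := z in b.
Definition cabs {R : realType} (z : R[i]) : R := Num.sqrt (cRe z ^+ 2 + cIm z ^+ 2).
Definition expi {R : realType} (t : R) : R[i] := Complex (cos t) (sin t).

Definition cmeasurable {R : realType} {d : nat} (f : d.-tuple R -> R[i]) : Prop :=
  measurable_fun setT (fun x => cRe (f x)) /\ measurable_fun setT (fun x => cIm (f x)).

Definition cintegral {R : realType} {d : nat}
  (mu : {measure set (d.-tuple R) -> \bar R}) (A : set (d.-tuple R))
  (f : d.-tuple R -> R[i]) : R[i] :=
  Complex (Rintegral mu A (fun x => cRe (f x))) (Rintegral mu A (fun x => cIm (f x))).

Definition inLp {R : realType} {d : nat}
  (leb : {measure set (d.-tuple R) -> \bar R}) (p : R) (f : d.-tuple R -> R[i]) : Prop :=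
  cmeasurable f /\ (\int[leb]_x ((cabs (f x)) `^ p)%:E < +oo)%E.

Definition Lpnorm {R : realType} {d : nat}
  (leb : {measure set (d.-tuple R) -> \bar R}) (p : R) (f : d.-tuple R -> R[i]) : R :=
  (fine (\int[leb]_x ((cabs (f x)) `^ p)%:E)) `^ (p^-1).

Definition aeq_c {R : realType} {d : nat}
  (leb : {measure set (d.-tuple R) -> \bar R}) (f g : d.-tuple R -> R[i]) : Prop :=
  leb.-negligible [set x | f x <> g x].

Definition ftrunc {R : realType} {d : nat}
  (leb : {measure set (d.-tuple R) -> \bar R}) (f : d.-tuple R -> R[i]) (n : nat)
  (xi : d.-tuple R) : R[i] :=
  cintegral leb [set z | sqnorm z <= (n%:R) ^+ 2] (fun z => expi (dotp xi z) * f z).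

(* Plancherel Fourier transform on L^2:  F is (a representative of) \hat f,
   i.e. F is the L^2-limit of the Fourier transforms of the truncations of f. *)
Definition is_FT2 {R : realType} {d : nat}
  (leb : {measure set (d.-tuple R) -> \bar R}) (f F : d.-tuple R -> R[i]) : Prop :=
  inLp leb 2 f /\ inLp leb 2 F /\
  (fun n : nat => Lpnorm leb 2 (fun xi => F xi - ftrunc leb f n xi)) @ \oo --> (0 : R).

Definition multM {R : realType} {d : nat}
  (V : {measure set (d.-tuple R) -> \bar R}) (phi : d.-tuple R -> R[i])
  (xi : d.-tuple R) : R[i] :=
  let den := Rintegral V setT (fun z => cos (dotp xi z) - 1) in
  if den == 0 then 0
  else cintegral V setT (fun z => Complex (cos (dotp xi z) - 1) 0 * phi z) / Complex den 0.

Definition is_Mop {R : realType} {d : nat}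
  (leb V : {measure set (d.-tuple R) -> \bar R}) (phi : d.-tuple R -> R[i])
  (f g : d.-tuple R -> R[i]) : Prop :=
  inLp leb 2 f /\ inLp leb 2 g /\
  exists F, is_FT2 leb f F /\ is_FT2 leb g (fun xi => multM V phi xi * F xi).

Definition Lp_linear {R : realType} {d : nat}
  (leb : {measure set (d.-tuple R) -> \bar R}) (p : R)
  (T : (d.-tuple R -> R[i]) -> (d.-tuple R -> R[i])) : Prop :=
  (forall f, inLp leb p f -> inLp leb p (T f)) /\
  forall (a : R[i]) f g, inLp leb p f -> inLp leb p g ->
    aeq_c leb (T (fun y => a * f y + g y)) (fun y => a * T f y + T g y).

Definition extends_M {R : realType} {d : nat}
  (leb V : {measure set (d.-tuple R) -> \bar R}) (phi : d.-tuple R -> R[i]) (p : R)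
  (T : (d.-tuple R -> R[i]) -> (d.-tuple R -> R[i])) : Prop :=
  forall f, inLp leb 2 f -> inLp leb p f -> is_Mop leb V phi f (T f).

(* Main.v *)
(* Burkholder's function U(x, y) = (|y| - (p* - 1)|x|)(|x| + |y|)^(p-1), up to
   a factor, has the midpoint property U(x+h, y+k) + U(x-h, y-k) <= 2 U(x, y)
   for |k| <= |h|, is nonpositive for |y| <= |x|, and a multiple of it majorizes
   |y|^p - (p* - 1)^p |x|^p.  Applied along a finite word of symmetric
   translations by +-v with coefficients |a| <= 1, and integrated against
   Lebesgue measure, it bounds by p* - 1 on L^p the explicit finite convolution
   operator whose multiplier is the sum over the letters (v, a) of the word of
   a sin^2(xi.v) times the product of cos^2(xi.v') over the letters after (v, a).
   Averaging this multiplier over words whose letters are independent and whose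
   length is geometric gives sum_j V_j (cos(xi.z_j) - 1) a_j divided by
   sum_j V_j (cos(xi.z_j) - 1) - delta, which is the symbol of the theorem, up
   to delta, for a finitely supported measure V.  Multipliers with the same L^p
   bound are stable under pointwise limits, so that V is discretized (a_j is the
   average of phi over a cell) and then delta tends to 0.

   Plancherel's identity is only needed up to an unspecified positive constant:
   it follows by integrating the square of the transform against a tent
   function, whose transform is the Fejer kernel, and from the continuity of
   translations in L^2. *)
Require Import Defs.
From HB Require Import structures.
From mathcomp Require Import all_boot all_order all_algebra.
From mathcomp Require Import all_classical all_reals all_analysis.
From mathcomp Require finmap.
From mathcomp Require Import measurable_realfun complex ring lra.
Import Order.TTheory GRing.Theory Num.Theory.
Import numFieldNormedType.Exports.
Local Open Scope classical_set_scope.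
Local Open Scope ring_scope.

(** * Burkholder's function *)

(** A word of letters (v, a) stands for a walk with independent symmetric steps +-v, started from
    Lebesgue measure. Averaging f over the remaining steps gives a martingale along the walk, the
    coefficients a transform its increments, and conditioning on the final position turns the
    transform into a convolution operator. Lebesgue measure is invariant under each step, so letters
    before (v, a) leave no trace, while one sine and one product of cosines come from the martingale
    and a second copy from the conditioning: hence the squares. All of this is carried out by
    iterating a pointwise inequality under translation-invariant integrals, without a probability
    space. A jump z of V becomes the translation z/2, since cos(xi.z) - 1 = -2 sin^2(xi.z/2). The
    number delta is the positive chance of stopping that makes the series over words converge. The
    measure V may be infinite near 0. Cells are therefore built from a rounding that never increases
    a coordinate: cells of nonzero value then have finite measure, and min(|z|^2, 1) dominates every
    integrand. Exponents p < 2 are treated directly rather than by duality: with c = p - 1,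
    convexity becomes concavity and each scalar inequality changes sign. *)

Definition tangent_sign {R : realType} (c : R) : R := if 1 <= c then 1 else -1.

Lemma tangent_sign_sub1 {R : realType} (c : R) : 0 <= tangent_sign c * (c - 1).
Proof. by rewrite /tangent_sign; case: (lerP 1 c) => h; nra. Qed.

(** Young's inequality for S and s^(c-1) with the conjugate exponents c and c/(c-1), multiplied by
    c. At c = 1 the second exponent degenerates and the two sides coincide. *)
Lemma powR_convex_tangent {R : realType} (c s S : R) : 1 <= c -> 0 < s -> 0 <= S ->
  s `^ c + c * s `^ (c - 1) * (S - s) <= S `^ c.
Proof.
rewrite le_eqVlt => /predU1P[<- s0 S0|c1 s0 S0].
  by rewrite subrr powRr0 !powRr1 ?(ltW s0)//; lra.
have c0 : 0 < c by lra.
have cm : 0 < c - 1 by lra.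
have cc : c^-1 + (c / (c - 1))^-1 = 1 by field; rewrite !gt_eqF.
have := @conjugate_powR _ S (s `^ (c - 1)) c (c / (c - 1)) S0 (powR_ge0 _ _) c0
  (divr_gt0 c0 cm) cc.
rewrite -powRrM (_ : (c - 1) * (c / (c - 1)) = c); last by field; rewrite gt_eqF.
have <- : s * s `^ (c - 1) = s `^ c by rewrite mulr_powRB1 // ltW.
set A := s `^ (c - 1); set B := S `^ c => h.
have : c * (S * A) <= c * (B / c + s * A / (c / (c - 1))) by rewrite ler_pM2l.
have -> : c * (B / c + s * A / (c / (c - 1))) = B + (c - 1) * (s * A).
  by field; rewrite !gt_eqF.
lra.
Qed.

(** Young's inequality for S^c and s^(1-c) with the exponents 1/c and 1/(1-c), then multiplication
    by s^(c-1). *)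
Lemma powR_concave_tangent {R : realType} (c s S : R) : 0 < c < 1 -> 0 < s -> 0 <= S ->
  S `^ c <= s `^ c + c * s `^ (c - 1) * (S - s).
Proof.
move=> /andP[c0 c1] s0 S0.
have cm : 0 < 1 - c by lra.
have cc : (c^-1)^-1 + ((1 - c)^-1)^-1 = 1 by rewrite !invrK; lra.
have i0 : 0 < c^-1 by rewrite invr_gt0.
have j0 : 0 < (1 - c)^-1 by rewrite invr_gt0.
have := @conjugate_powR _ (S `^ c) (s `^ (1 - c)) c^-1 (1 - c)^-1 (powR_ge0 _ _)
  (powR_ge0 _ _) i0 j0 cc.
rewrite -!powRrM !divff ?gt_eqF // (powRr1 S0) (powRr1 (ltW s0)) !invrK => h.
have e1 : s `^ (1 - c) * s `^ (c - 1) = 1.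
  rewrite -powRD; last by apply/implyP => _; rewrite gt_eqF.
  by rewrite (_ : 1 - c + (c - 1) = 0) ?powRr0 //; ring.
have e2 : s * s `^ (c - 1) = s `^ c by rewrite mulr_powRB1 // ltW.
have {}h : S `^ c * s `^ (1 - c) * s `^ (c - 1) <= (S * c + s * (1 - c)) * s `^ (c - 1).
  by rewrite ler_pM2r ?powR_gt0.
move: h; rewrite -[X in X <= _]mulrA e1 mulr1 mulrDl -e2.
by set A := s `^ (c - 1); nra.
Qed.

(** The sign merges the convex and the concave case, that is p >= 2 and p < 2. The one-variable
    inequalities that follow are integrated or averaged forms of this one, and so hold in both
    ranges at once. *)
Lemma powR_tangent {R : realType} (c s S : R) : 0 < c -> 0 < s -> 0 <= S ->
  0 <= tangent_sign c * (S `^ c - s `^ c - c * s `^ (c - 1) * (S - s)).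
Proof.
move=> c0 s0 S0; rewrite /tangent_sign; case: (lerP 1 c) => c1.
  by have := powR_convex_tangent _ _ _ c1 s0 S0; lra.
have := powR_concave_tangent c s S _ s0 S0; rewrite c0 c1 => /(_ isT); lra.
Qed.

Lemma ge0_derive_nondecreasing {R : realType} (f df : R -> R) (a b : R) : a <= b ->
  (forall x, a <= x <= b -> is_derive x 1 f (df x)) ->
  (forall x, a <= x <= b -> 0 <= df x) -> f a <= f b.
Proof.
move=> ab dfE df0.
have cf : {within `[a, b], continuous f}.
  apply: derivable_within_continuous => x; rewrite in_itv /= => xab.
  by have [] := dfE x xab.
have dfE' x : x \in `]a, b[ -> is_derive x 1 f (df x).
  by rewrite in_itv /= => /andP[xa xb]; apply: dfE; rewrite !ltW.
have [c cab e] := @MVT_segment R f df a b ab dfE' cf.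
rewrite in_itv /= in cab.
by rewrite -subr_ge0 e mulr_ge0 ?subr_ge0 // df0.
Qed.

(** The signed excess [F] of v^(c+1) over its second-order expansion at 1 vanishes at 1, and its
    derivative is c + 1 times the slack of the tangent inequality at 1. So [F] increases to 0 on
    [u, 1]. *)
Lemma powR_taylor2 {R : realType} (c u : R) : 0 < c -> 0 <= u <= 1 ->
  0 <= tangent_sign c * (1 + (c + 1) * (u - 1) + (c + 1) * c / 2 * (u - 1) ^+ 2
     - u `^ (c + 1)).
Proof.
move=> c0 /andP[u0 u1].
have sg := tangent_sign_sub1 c.
(* Powers are differentiated at positive points only, so u = 0 is settled by hand: the expansion
   there equals c (c - 1) / 2. *)
move: u0; rewrite le_eqVlt => /predU1P[<-|u0].
  by rewrite powR0; [nra|rewrite gt_eqF //; lra].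
pose F v := tangent_sign c * (v `^ (c + 1) - (1 + (c + 1) * (v - 1) + (c + 1) * c / 2 * (v - 1) ^+ 2)).
suff : F u <= F 1 by rewrite /F powR1; lra.
pose dF v := tangent_sign c * ((c + 1) * (v `^ (c + 1 - 1)) - ((c + 1) + (c + 1) * c / 2 * (2 * (v - 1)))).
apply: (@ge0_derive_nondecreasing _ F dF); [exact: u1|move=> x /andP[xu x1]..].
  have x0 : 0 < x by lra.
  have h1 := @is_derive1_powR R (c + 1) x x0.
  rewrite /F /dF.
  by apply: is_derive_eq; rewrite /GRing.scale /=; ring.
have x0 : 0 < x by lra.
have := powR_tangent c 1 x c0 ltr01 (ltW x0).
rewrite /dF !powR1 addrK => h.
rewrite [X in 0 <= X](_ : _ = (c + 1) * (tangent_sign c * (x `^ c - 1 - c * 1 * (x - 1))));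
  last by field.
by rewrite mulr_ge0 //; lra.
Qed.

(** The trapezoid rule for the integral of (c + 1) t^c over [1, u] errs on the side dictated by
    convexity or concavity. The derivative of the error in u is a multiple of the tangent inequality
    at u, evaluated at 1. *)
Lemma powR_trapezoid {R : realType} (c u : R) : 0 < c -> 1 <= u ->
  0 <= tangent_sign c * ((c + 1) / 2 * (u - 1) * (u `^ c + 1) - (u `^ (c + 1) - 1)).
Proof.
move=> c0 u1.
have sg := tangent_sign_sub1 c.
pose F v := tangent_sign c * ((c + 1) / 2 * (v - 1) * (v `^ c + 1) - (v * v `^ c - 1)).
have e x : 0 < x -> x * x `^ c = x `^ (c + 1).
  by move=> x0; rewrite -[c in LHS](addrK 1) mulr_powRB1 ?ltW //; lra.
have u0 : 0 < u by lra.
suff : F 1 <= F u by rewrite /F (e u u0) powR1; lra.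
pose dF v := tangent_sign c * ((c + 1) / 2 * (v `^ c + 1 + (v - 1) * (c * v `^ (c - 1))) -
   (v `^ c + v * (c * v `^ (c - 1)))).
apply: (@ge0_derive_nondecreasing _ F dF); [exact: u1|move=> x /andP[x1 xu]..].
  have x0 : 0 < x by lra.
  have h1 := @is_derive1_powR R c x x0.
  rewrite /F /dF.
  by apply: is_derive_eq; rewrite /GRing.scale /=; ring.
have x0 : 0 < x by lra.
have := powR_tangent c x 1 c0 x0 ler01.
rewrite powR1 /dF -(mulr_powRB1 (ltW x0) c0).
set A := x `^ (c - 1) => h.
rewrite [X in 0 <= X](_ : _ = (c + 1) / 2 * (tangent_sign c * (1 - x * A - c * A * (1 - x))));
  last by field.
by rewrite mulr_ge0 //; lra.
Qed.

(* The factors of the three homogeneous inequalities are written with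
   A = s^(c-1) and B = S^c, so that the remaining arguments are polynomial. *)
Lemma powR_tangent_hom {R : realType} (c s S : R) : 0 < c -> 0 < s -> 0 <= S ->
  0 <= tangent_sign c * (S `^ c - s * s `^ (c - 1) - c * s `^ (c - 1) * (S - s)).
Proof.
move=> c0 s0 S0; have := powR_tangent c s S c0 s0 S0.
by rewrite -(mulr_powRB1 (ltW s0) c0).
Qed.

Lemma powR_hom {R : realType} (c s S : R) : 0 < c -> 0 < s -> 0 <= S ->
  S `^ c = s * s `^ (c - 1) * (S / s) `^ c.
Proof.
move=> c0 s0 S0; rewrite (mulr_powRB1 (ltW s0) c0) -powRM ?divr_ge0 ?(ltW s0) //.
by rewrite mulrC divfK // gt_eqF.
Qed.

Lemma powR_taylor2_hom {R : realType} (c s S : R) : 0 < c -> 0 < s -> 0 <= S <= s ->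
  0 <= tangent_sign c * (s ^+ 2 * s `^ (c - 1) + (c + 1) * s * s `^ (c - 1) * (S - s)
    + (c + 1) * c / 2 * s `^ (c - 1) * (S - s) ^+ 2 - S * S `^ c).
Proof.
move=> c0 s0 /andP[S0 Ss].
have u01 : 0 <= S / s <= 1 by rewrite divr_ge0 ?(ltW s0) //= ler_pdivrMr // mul1r.
have := powR_taylor2 c (S / s) c0 u01.
have u0 : 0 <= S / s by case/andP: u01.
rewrite -(@mulr_powRB1 _ _ (c + 1)) ?addrK //; last by lra.
have := powR_hom c s S c0 s0 S0; set A := s `^ (c - 1); set w := S / s => -> h.
have A0 : 0 < A by rewrite powR_gt0.
have eS : S = s * w by rewrite /w mulrC divfK // gt_eqF.
rewrite eS [X in 0 <= X](_ : _ = (s ^+ 2 * A) * (tangent_sign c * (1 + (c + 1) * (w - 1) + (c + 1) * c / 2 * (w - 1) ^+ 2 -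
    w * w `^ c))); last by ring.
by rewrite mulr_ge0 // mulr_ge0 ?(ltW A0) // exprn_ge0 ?(ltW s0).
Qed.

Lemma powR_trapezoid_hom {R : realType} (c s S : R) : 0 < c -> 0 < s -> s <= S ->
  0 <= tangent_sign c * ((c + 1) / 2 * (S - s) * (S `^ c + s * s `^ (c - 1))
    - (S * S `^ c - s ^+ 2 * s `^ (c - 1))).
Proof.
move=> c0 s0 Ss.
have S0 : 0 <= S by lra.
have u1 : 1 <= S / s by rewrite ler_pdivlMr // mul1r.
have := powR_trapezoid c (S / s) c0 u1.
have u0 : 0 <= S / s by lra.
rewrite -(@mulr_powRB1 _ _ (c + 1)) ?addrK //; last by lra.
have := powR_hom c s S c0 s0 S0; set A := s `^ (c - 1); set w := S / s => -> h.
have A0 : 0 < A by rewrite powR_gt0.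
have eS : S = s * w by rewrite /w mulrC divfK // gt_eqF.
rewrite eS [X in 0 <= X](_ : _ = (s ^+ 2 * A) * (tangent_sign c * ((c + 1) / 2 * (w - 1) * (w `^ c + 1) -
   (w * w `^ c - 1)))); last by ring.
by rewrite mulr_ge0 // mulr_ge0 ?(ltW A0) // exprn_ge0 ?(ltW s0).
Qed.

(* The exponent is p = c + 1; up to a positive factor this is
   (Y - (p* - 1) X) (X + Y)^(p-1). *)
Definition burk {R : realType} (c X Y : R) : R :=
  (if 1 <= c then Y - c * X else c * Y - X) * (X + Y) `^ c.

(* The difference of the two sides is affine in X - x for a fixed value of
   X + Y, and the constraint on |Y - y| bounds X - x from below. *)
Lemma burk_scalar_ge1 {R : realType} (c x y X Y : R) : 1 <= c ->
  0 <= x -> 0 <= y -> 0 <= X -> 0 <= Y -> 0 < x + y -> Y - y <= X + x ->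
  (Y - c * X) * (X + Y) `^ c <= (y - c * x) * ((x + y) * (x + y) `^ (c - 1))
    + (c + 1) / 2 * (x + y) `^ (c - 1) *
      (- c * (X ^+ 2 - x ^+ 2) + (Y ^+ 2 - y ^+ 2) + (c - 1) * (Y - y) ^+ 2
       - 2 * (c - 1) * x * (Y - y)).
Proof.
move=> c1 x0 y0 X0 Y0 s0 YX.
have c0 : 0 < c by lra.
have S0 : 0 <= X + Y by lra.
have h1 := powR_tangent_hom c (x + y) (X + Y) c0 s0 S0.
have h2 := powR_taylor2_hom c (x + y) (X + Y) c0 s0.
have h3 := powR_trapezoid_hom c (x + y) (X + Y) c0 s0.
move: h1 h2 h3; rewrite /tangent_sign c1 !mul1r S0 /=.
set A := (x + y) `^ (c - 1); set B := (X + Y) `^ c.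
set sl := B - _ - _.
move=> h1 h2 h3; rewrite -subr_ge0.
(* The Taylor inequality is used when X + Y decreases, the trapezoid inequality when it increases.
   What is left is a multiple of the tangent slack [sl]: by X in the first case, by X - (X + Y - x -
   y) / 2 = (X + x - (Y - y)) / 2 in the second, which is where the hypothesis on Y - y enters. *)
have [le|lt] := leP (X + Y) (x + y).
  move/(_ le): h2; set t := (X in 0 <= X) => h2.
  rewrite [X in 0 <= X](_ : _ = t + (c + 1) * (X * sl)); last by rewrite /t /sl; field.
  by rewrite addr_ge0 // mulr_ge0 ?mulr_ge0 //; lra.
move/(_ (ltW lt)): h3; set t := (X in 0 <= X) => h3.
rewrite [X in 0 <= X](_ : _ = t + (c + 1) * ((X - (X + Y - (x + y)) / 2) * sl)); last by rewrite /t /sl; field.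
by rewrite addr_ge0 // mulr_ge0 ?mulr_ge0 //; lra.
Qed.

(* k2 stands for the square of the length of the increment of y. *)
Lemma burk_scalar_lt1 {R : realType} (c x y X Y k2 : R) : 0 < c < 1 ->
  0 <= x -> 0 <= y -> 0 <= X -> 0 <= Y -> 0 < x + y -> y - Y <= X + x ->
  k2 <= (X - x) ^+ 2 -> k2 <= (Y + y) ^+ 2 ->
  (c * Y - X) * (X + Y) `^ c <= (c * y - x) * ((x + y) * (x + y) `^ (c - 1))
    + (c + 1) / 2 * (x + y) `^ (c - 1) *
      (c * (Y ^+ 2 - y ^+ 2 - k2) - (X ^+ 2 - x ^+ 2) + (X - x) ^+ 2
       - 2 * (1 - c) * y * (X - x)).
Proof.
move=> /andP[c0 c1] x0 y0 X0 Y0 s0 YX kX kY.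
have S0 : 0 <= X + Y by lra.
have h1 := powR_tangent_hom c (x + y) (X + Y) c0 s0 S0.
have h2 := powR_taylor2_hom c (x + y) (X + Y) c0 s0.
have h3 := powR_trapezoid_hom c (x + y) (X + Y) c0 s0.
move: h1 h2 h3; rewrite /tangent_sign ltNge in c1 *; rewrite (negbTE c1) !mulN1r S0 /=.
have A0 : 0 < (x + y) `^ (c - 1) by rewrite powR_gt0.
set A := (x + y) `^ (c - 1) in A0 *; set B := (X + Y) `^ c.
rewrite -ltNge in c1.
set sl := B - _ - _.
move=> h1 h2 h3.
have [le|lt] := leP (X + Y) (x + y).
  move/(_ le): h2; set t := (X in 0 <= - X) => h2.
  apply: (@le_trans _ _ ((c * y - x) * ((x + y) * A) + (c + 1) / 2 * A *
      (c * (Y ^+ 2 - y ^+ 2 - (X - x) ^+ 2) - (X ^+ 2 - x ^+ 2) + (X - x) ^+ 2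
       - 2 * (1 - c) * y * (X - x)))); last first.
    rewrite lerD2l ler_pM2l; last by rewrite mulr_gt0 //; lra.
    nra.
  rewrite -subr_ge0.
  rewrite [X in 0 <= X](_ : _ = - t + (c + 1) * (Y * - sl)); last by rewrite /t /sl; field.
  by rewrite addr_ge0 // mulr_ge0 ?mulr_ge0 //; lra.
move/(_ (ltW lt)): h3; set t := (X in 0 <= - X) => h3.
(* The test amounts to X - x <= Y + y. It decides which of the two bounds on [k2] to insert: (X -
   x)^2 if it holds, (Y + y)^2 otherwise, when the factor of the tangent slack would have the wrong
   sign. *)
have [le2|lt2] := leP ((X + Y - (x + y)) / 2) Y.
  apply: (@le_trans _ _ ((c * y - x) * ((x + y) * A) + (c + 1) / 2 * A *
      (c * (Y ^+ 2 - y ^+ 2 - (X - x) ^+ 2) - (X ^+ 2 - x ^+ 2) + (X - x) ^+ 2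
       - 2 * (1 - c) * y * (X - x)))); last first.
    rewrite lerD2l ler_pM2l; last by rewrite mulr_gt0 //; lra.
    nra.
  rewrite -subr_ge0.
  rewrite [X in 0 <= X](_ : _ = - t + (c + 1) * ((Y - (X + Y - (x + y)) / 2) * - sl)); last by rewrite /t /sl; field.
  by rewrite addr_ge0 // mulr_ge0 ?mulr_ge0 //; lra.
apply: (@le_trans _ _ ((c * y - x) * ((x + y) * A) + (c + 1) / 2 * A *
      (c * (Y ^+ 2 - y ^+ 2 - (Y + y) ^+ 2) - (X ^+ 2 - x ^+ 2) + (X - x) ^+ 2
       - 2 * (1 - c) * y * (X - x)))); last first.
  rewrite lerD2l ler_pM2l; last by rewrite mulr_gt0 //; lra.
  nra.
rewrite -subr_ge0.
have B1 : (x + y) * A <= B.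
  rewrite /A /B (mulr_powRB1 (ltW s0) c0); apply: ge0_ler_powR; rewrite ?nnegrE; lra.
rewrite [X in 0 <= X](_ : _ = - t + (c + 1) * (((X + Y - (x + y)) / 2 - Y) * (B - (x + y) * A + 2 * c * y * A))); last by rewrite /t; field.
rewrite addr_ge0 // mulr_ge0 ?mulr_ge0 //; [lra|lra|].
have : 0 <= c * y * A by rewrite mulr_ge0 ?mulr_ge0 //; lra.
lra.
Qed.

(** Here [a] and [b] stand for the inner products of x with h and of y with k, and [h2], [k2] for
    |h|^2 and |k|^2. The bound is affine in (a, b), which change sign with (h, k), so two opposite
    increments will add up to the midpoint inequality. At y = 0 the quotient b / y takes the default
    value 0, in accordance with b = 0. *)
Lemma burk_tangent_ge1 {R : realType} (c x y X Y a b h2 k2 : R) : 1 <= c ->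
  0 <= x -> 0 <= y -> 0 <= X -> 0 <= Y -> 0 < x + y ->
  X ^+ 2 = x ^+ 2 + 2 * a + h2 -> Y ^+ 2 = y ^+ 2 + 2 * b + k2 ->
  (Y - y) ^+ 2 <= k2 -> k2 <= h2 -> h2 <= (X + x) ^+ 2 -> (y = 0 -> b = 0) ->
  burk c X Y <= burk c x y - (c + 1) * c * (x + y) `^ (c - 1) * a
    + (c + 1) * (x + y) `^ (c - 1) * b
    - (c + 1) * (c - 1) * (x + y) `^ (c - 1) * x * (b / y).
Proof.
move=> c1 x0 y0 X0 Y0 s0 eX eY Yk kh hX b0.
have YX : Y - y <= X + x.
  have h : (Y - y) ^+ 2 <= (X + x) ^+ 2 by lra.
  rewrite leNgt; apply/negP => lt.
  have : (X + x) ^+ 2 < (Y - y) ^+ 2 by rewrite ltr_sqr // nnegrE; lra.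
  lra.
rewrite /burk c1.
apply: (le_trans (burk_scalar_ge1 c x y X Y c1 x0 y0 X0 Y0 s0 YX)).
rewrite -(mulr_powRB1 (ltW s0) (lt_le_trans ltr01 c1)).
have A0 : 0 < (x + y) `^ (c - 1) by rewrite powR_gt0.
set A := (x + y) `^ (c - 1) in A0 *.
(* Indeed 2 y (Y - y) = Y^2 - y^2 - (Y - y)^2 >= 2 b. *)
have bY : b / y <= Y - y.
  have [->|yn] := eqVneq y 0; first by rewrite invr0 mulr0 subr0.
  have yp : 0 < y by rewrite lt_def yn.
  by rewrite ler_pdivrMr //; nra.
have : 0 <= (c + 1) / 2 * A * (c * h2 - k2 - (c - 1) * (Y - y) ^+ 2 + 2 * (c - 1) * x * (Y - y - b / y)).
  apply: mulr_ge0; first by rewrite mulr_ge0 ?(ltW A0) //; lra.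
  apply: addr_ge0; first by nra.
  by apply: mulr_ge0; [apply: mulr_ge0; lra|lra].
rewrite eX eY; lra.
Qed.

Lemma burk_tangent_lt1 {R : realType} (c x y X Y a b h2 k2 : R) : 0 < c < 1 ->
  0 <= x -> 0 <= y -> 0 <= X -> 0 <= Y -> 0 < x + y ->
  X ^+ 2 = x ^+ 2 + 2 * a + h2 -> Y ^+ 2 = y ^+ 2 + 2 * b + k2 ->
  (Y - y) ^+ 2 <= k2 -> k2 <= h2 -> h2 <= (X + x) ^+ 2 -> k2 <= (Y + y) ^+ 2 ->
  (X - x) ^+ 2 <= h2 -> (x = 0 -> a = 0) ->
  burk c X Y <= burk c x y + (c + 1) * c * (x + y) `^ (c - 1) * b
    - (c + 1) * (x + y) `^ (c - 1) * a
    - (c + 1) * (1 - c) * (x + y) `^ (c - 1) * y * (a / x).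
Proof.
move=> cI x0 y0 X0 Y0 s0 eX eY Yk kh hX kY Xh a0.
have /andP[c0 c1] := cI.
have YX : y - Y <= X + x.
  rewrite leNgt; apply/negP => lt.
  have : (X + x) ^+ 2 < (y - Y) ^+ 2 by rewrite ltr_sqr // nnegrE; lra.
  have -> : (y - Y) ^+ 2 = (Y - y) ^+ 2 by ring.
  lra.
have c1' : (1 <= c) = false by apply/negbTE; rewrite -ltNge.
rewrite /burk c1'.
have A0 : 0 < (x + y) `^ (c - 1) by rewrite powR_gt0.
(* The scalar inequality needs one number below both (X - x)^2 and (Y + y)^2, and [k2] may exceed
   the first. Taking the minimum costs c (k2 - K2), which h2 - (X - x)^2 absorbs because k2 <= h2
   and c < 1. *)
pose K2 := if k2 <= (X - x) ^+ 2 then k2 else (X - x) ^+ 2.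
have K2X : K2 <= (X - x) ^+ 2 by rewrite /K2; case: ifP.
have K2Y : K2 <= (Y + y) ^+ 2 by rewrite /K2; case: (leP k2) => // ?; lra.
apply: (le_trans (burk_scalar_lt1 c x y X Y K2 cI x0 y0 X0 Y0 s0 YX K2X K2Y)).
rewrite -(mulr_powRB1 (ltW s0) c0).
set A := (x + y) `^ (c - 1) in A0 *.
have aX : a / x <= X - x.
  have [->|xn] := eqVneq x 0; first by rewrite invr0 mulr0 subr0.
  have xp : 0 < x by rewrite lt_def xn.
  by rewrite ler_pdivrMr //; nra.
have : 0 <= (c + 1) / 2 * A * (h2 - (X - x) ^+ 2 - c * (k2 - K2) + 2 * (1 - c) * y * (X - x - a / x)).
  apply: mulr_ge0; first by rewrite mulr_ge0 ?(ltW A0) //; lra.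
  apply: addr_ge0; last by apply: mulr_ge0; [apply: mulr_ge0; lra|lra].
  by rewrite /K2; case: (leP k2 ((X - x) ^+ 2)) => h; nra.
rewrite eX eY; lra.
Qed.

Lemma cabs_ge0 {R : realType} (z : R[i]) : 0 <= cabs z.
Proof. exact: sqrtr_ge0. Qed.

Lemma cabs_sqr {R : realType} (z : R[i]) : cabs z ^+ 2 = cRe z ^+ 2 + cIm z ^+ 2.
Proof. by rewrite /cabs sqr_sqrtr // addr_ge0 ?sqr_ge0. Qed.

Lemma cReD {R : realType} (z w : R[i]) : cRe (z + w) = cRe z + cRe w.
Proof. by case: z => a b; case: w. Qed.
Lemma cImD {R : realType} (z w : R[i]) : cIm (z + w) = cIm z + cIm w.
Proof. by case: z => a b; case: w. Qed.
Lemma cReN {R : realType} (z : R[i]) : cRe (- z) = - cRe z.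
Proof. by case: z. Qed.
Lemma cImN {R : realType} (z : R[i]) : cIm (- z) = - cIm z.
Proof. by case: z. Qed.

Lemma cabsN {R : realType} (z : R[i]) : cabs (- z) = cabs z.
Proof. by rewrite /cabs cReN cImN !sqrrN. Qed.

Lemma cdot_le {R : realType} (z w : R[i]) :
  `|cRe z * cRe w + cIm z * cIm w| <= cabs z * cabs w.
Proof.
have h0 : 0 <= cabs z * cabs w by rewrite mulr_ge0 ?cabs_ge0.
rewrite -ler_sqr ?nnegrE // real_normK ?num_real // exprMn !cabs_sqr -subr_ge0.
by rewrite [X in 0 <= X](_ : _ = (cRe z * cIm w - cIm z * cRe w) ^+ 2) ?sqr_ge0 //; ring.
Qed.

Lemma cabs_eq0 {R : realType} (z : R[i]) : cabs z = 0 -> cRe z = 0 /\ cIm z = 0.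
Proof.
move=> h; have := cabs_sqr z; rewrite h expr0n /= => /esym/eqP.
by rewrite paddr_eq0 ?sqr_ge0 // !sqrf_eq0 => /andP[/eqP-> /eqP->].
Qed.

(** The law of cosines and the triangle inequalities, in the form in which the two tangent lemmas
    take them as hypotheses. *)
Lemma cabs_addE {R : realType} (z w : R[i]) :
  [/\ cabs (z + w) ^+ 2 = cabs z ^+ 2 + 2 * (cRe z * cRe w + cIm z * cIm w) + cabs w ^+ 2,
      (cabs (z + w) - cabs z) ^+ 2 <= cabs w ^+ 2,
      cabs w ^+ 2 <= (cabs (z + w) + cabs z) ^+ 2 &
      cabs z = 0 -> cRe z * cRe w + cIm z * cIm w = 0].
Proof.
have e : cabs (z + w) ^+ 2 = cabs z ^+ 2 + 2 * (cRe z * cRe w + cIm z * cIm w) + cabs w ^+ 2.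
  by rewrite !cabs_sqr cReD cImD; ring.
have := cdot_le z (z + w); rewrite ler_norml cReD cImD => /andP[h1 h2].
have := cabs_sqr z => h3.
split => //; [nra|nra|].
by move=> /cabs_eq0[-> ->]; rewrite !mul0r addr0.
Qed.

Lemma burk_le0 {R : realType} (c X Y : R) : 0 < c -> 0 <= Y -> Y <= X -> burk c X Y <= 0.
Proof.
move=> c0 Y0 YX; rewrite /burk mulr_le0_ge0 ?powR_ge0 //.
by case: (leP 1 c) => c1; nra.
Qed.

(** The affine upper bounds at (h, k) and (-h, -k) have opposite linear parts. No such bound is
    available at x = y = 0; there the right side is 0 and both terms on the left are nonpositive
    because |k| <= |h|. *)
Lemma burk_midpoint {R : realType} (c : R) (x y h k : R[i]) : 0 < c -> cabs k <= cabs h ->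
  burk c (cabs (x + h)) (cabs (y + k)) + burk c (cabs (x - h)) (cabs (y - k))
  <= 2 * burk c (cabs x) (cabs y).
Proof.
move=> c0 kh.
have kh2 : cabs k ^+ 2 <= cabs h ^+ 2 by rewrite ler_sqr ?nnegrE ?cabs_ge0.
have x0 := cabs_ge0 x; have y0 := cabs_ge0 y.
have [s0|] := ltP 0 (cabs x + cabs y); last first.
  move=> le0; have xe : cabs x = 0 by lra.
  have ye : cabs y = 0 by lra.
  have -> : x = 0 by case: x {le0 x0} xe => u v /cabs_eq0 /= [-> ->].
  have -> : y = 0 by case: y {le0 y0} ye => u v /cabs_eq0 /= [-> ->].
  rewrite !add0r !cabsN.
  have e0 : cabs (0 : R[i]) = 0 by rewrite /cabs /= expr0n /= addr0 sqrtr0.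
  rewrite e0 {3}/burk mulr0 subr0 if_same mul0r mulr0.
  by have := burk_le0 c _ _ c0 (cabs_ge0 k) kh; lra.
have [e1 l1 u1 z1] := cabs_addE x h; have [e2 l2 u2 z2] := cabs_addE x (- h).
have [e3 l3 u3 z3] := cabs_addE y k; have [e4 l4 u4 z4] := cabs_addE y (- k).
rewrite !cabsN in e2 l2 u2 e4 l4 u4.
have ex : cRe x * cRe (- h) + cIm x * cIm (- h) = - (cRe x * cRe h + cIm x * cIm h).
  by rewrite cReN cImN; ring.
have ey : cRe y * cRe (- k) + cIm y * cIm (- k) = - (cRe y * cRe k + cIm y * cIm k).
  by rewrite cReN cImN; ring.
rewrite ex in e2 z2; rewrite ey in e4 z4.
have [c1|c1] := leP 1 c.
  have := burk_tangent_ge1 c _ _ _ _ _ _ _ _ c1 x0 y0 (cabs_ge0 _) (cabs_ge0 _) s0 e1 e3 l3 kh2 u1 z3.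
  have := burk_tangent_ge1 c _ _ _ _ _ _ _ _ c1 x0 y0 (cabs_ge0 _) (cabs_ge0 _) s0 e2 e4 l4 kh2 u2 z4.
  lra.
have cI : 0 < c < 1 by apply/andP.
have := burk_tangent_lt1 c _ _ _ _ _ _ _ _ cI x0 y0 (cabs_ge0 _) (cabs_ge0 _) s0 e1 e3 l3 kh2 u1 u3 l1 z1.
have := burk_tangent_lt1 c _ _ _ _ _ _ _ _ cI x0 y0 (cabs_ge0 _) (cabs_ge0 _) s0 e2 e4 l4 kh2 u2 u4 l2 z2.
lra.
Qed.

(** * Majorization of the p-th powers by Burkholder's function *)

Lemma powR_D1 {R : realType} (c x : R) : 0 < c -> 0 <= x -> x `^ (c + 1) = x * x `^ c.
Proof. by move=> c0 x0; rewrite -(@mulr_powRB1 _ _ (c + 1)) ?addrK //; lra. Qed.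

(** The tangent inequality at 1, evaluated at c / (1 + c), compares the c-th power of that number
    with 1 / (1 + c). Taking inverses gives the claim. *)
Lemma powR_one_add_inv {R : realType} (c : R) : 0 < c ->
  0 <= tangent_sign c * (1 + c - (1 + c^-1) `^ c).
Proof.
move=> c0.
have q0 : 0 < c / (1 + c) by rewrite divr_gt0 //; lra.
have := powR_tangent c 1 (c / (1 + c)) c0 ltr01 (ltW q0).
rewrite !powR1 mulr1.
have -> : c * (c / (1 + c) - 1) = (1 + c)^-1 - 1 by field; apply/eqP; lra.
have -> : 1 + c^-1 = (c / (1 + c))^-1 by field; apply/andP; split; apply/eqP; lra.
have p0 := powR_gt0 c q0.
rewrite -(powR_inv1 (ltW q0)) -powRrM mulN1r powRN.
set t := _ `^ c in p0 *.
have d0 : 0 < 1 + c by lra.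
have -> : 1 + c - t^-1 = (1 + c) / t * (t - (1 + c)^-1).
  by field; apply/andP; split; apply/eqP; lra.
have -> : t - 1 - ((1 + c)^-1 - 1) = t - (1 + c)^-1 by ring.
move=> h; rewrite mulrCA mulr_ge0 // divr_ge0 ?(ltW p0) ?(ltW d0) //.
Qed.

(** Two-point Jensen inequality: the tangents at the intermediate point, evaluated at 1 and at z,
    are averaged with the weights v and 1 - v. *)
Lemma powR_chord {R : realType} (c v z : R) : 0 < c -> 0 <= v <= 1 -> 1 <= z ->
  0 <= tangent_sign c * (v + (1 - v) * z `^ c - (v + (1 - v) * z) `^ c).
Proof.
move=> c0 /andP[v0 v1] z1.
set w := v + (1 - v) * z.
have w0 : 0 < w by rewrite /w; nra.
have := powR_tangent c w 1 c0 w0 ler01.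
have := powR_tangent c w z c0 w0 (le_trans ler01 z1).
rewrite powR1.
set s := tangent_sign c; set B := w `^ c; set A := w `^ (c - 1); set Z := z `^ c.
move=> h1 h2.
rewrite [X in 0 <= X](_ : _ = v * (s * (1 - B - c * A * (1 - w))) + (1 - v) * (s * (Z - B - c * A * (z - w)))).
  by rewrite addr_ge0 // mulr_ge0 //; lra.
by rewrite /w; ring.
Qed.

(** Burkholder's majorization after scaling: the relation between u and v normalizes |x| + |y|, and
    the two sides meet at u = v = 1. The signed difference [F], as a function of u alone, decreases
    before 1 and increases after it. *)
Lemma powR_secant {R : realType} (c u v : R) : 0 < c -> 0 <= u -> 0 <= v ->
  v = c + 1 - c * u ->
  0 <= tangent_sign c * ((c + 1) * (u - v) - (u `^ (c + 1) - v `^ (c + 1))).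
Proof.
move=> c0 u0 v0 ev.
have sg := tangent_sign_sub1 c.
have iv := powR_one_add_inv c c0.
have ci0 : 0 < c^-1 by rewrite invr_gt0.
have cci : c * c^-1 = 1 by rewrite divff // gt_eqF.
(* The end points u = 0 and v = 0 are treated apart, since powers are differentiated at positive
   points only. *)
move: u0; rewrite le_eqVlt => /predU1P[u0|u0].
  rewrite -u0 mulr0 subr0 in ev; rewrite -u0 ev powR0; last by rewrite gt_eqF //; lra.
  rewrite powR_D1 //; last by lra.
  have := powR_tangent c 1 (c + 1) c0 ltr01 _.
  rewrite powR1 => /(_ (ltac:(lra))).
  set t := (c + 1) `^ c; set s := tangent_sign c => h.
  rewrite [X in 0 <= X](_ : _ = (c + 1) * (s * (t - 1 - c * 1 * (c + 1 - 1)) + c * (s * (c - 1)))); last by ring.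
  by apply: mulr_ge0; [lra|apply: addr_ge0; [exact: h|apply: mulr_ge0; [exact: ltW|exact: sg]]].
move: v0; rewrite le_eqVlt => /predU1P[v0|v0].
  have eu : u = 1 + c^-1 by rewrite -[u]mul1r -cci; nra.
  rewrite -v0 powR0 ?subr0; last by rewrite gt_eqF //; lra.
  rewrite powR_D1 ?(ltW u0) // eu.
  move: iv; set t := (1 + c^-1) `^ c => iv.
  rewrite [X in 0 <= X](_ : _ = (1 + c^-1) * (tangent_sign c * (1 + c - t))); last by ring.
  by rewrite mulr_ge0 //; lra.
pose F x := tangent_sign c * ((c + 1) * (x - (c + 1 - c * x)) - (x `^ (c + 1) - (c + 1 - c * x) `^ (c + 1))).
pose dF x := tangent_sign c * ((c + 1) * ((1 + c) - (x `^ (c + 1 - 1) + c * (c + 1 - c * x) `^ (c + 1 - 1)))).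
have F1 : F 1 = 0 by rewrite /F mulr1 (_ : c + 1 - c = 1) ?powR1; ring.
have dFE x : 0 < x -> 0 < c + 1 - c * x -> is_derive x 1 F (dF x).
  move=> x0 vx0.
  have h1 := @is_derive1_powR R (c + 1) x x0.
  have h2 := @is_derive1_powR R (c + 1) _ vx0.
  have h3 : is_derive x 1 (fun y : R => c + 1 - c * y) (- c).
    by apply: is_derive_eq; rewrite /GRing.scale /=; ring.
  have h4 : is_derive x 1 (fun y : R => (c + 1 - c * y) `^ (c + 1)) (((c + 1) * (c + 1 - c * x) `^ (c + 1 - 1)) * - c).
    have := @is_derive1_comp R (fun y => y `^ (c + 1)) (fun y : R => c + 1 - c * y) x _ _ h2 h3.
    by [].
  rewrite /F /dF.
  by apply: is_derive_eq; rewrite /GRing.scale /=; ring.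
suff : 0 <= F u by rewrite /F -ev.
have [u1|u1] := leP 1 u.
  rewrite -F1; apply: (@ge0_derive_nondecreasing _ F dF); [exact: u1|move=> x /andP[x1 xu]..].
    by apply: dFE; nra.
  have x0 : 0 < x by lra.
  set w := c + 1 - c * x.
  have w0 : 0 <= w by rewrite /w; nra.
  have w1 : w <= 1 by rewrite /w; nra.
  (* For w in [0, 1], x is the mixture w + (1 - w)(1 + 1/c). Hence x^c compares with w + (1 - w)(1 +
     c) by the chord and [powR_one_add_inv], and w^c compares with w; together x^c + c w^c compares
     with 1 + c, which is the sign of [dF]. *)
  have := powR_chord c w (1 + c^-1) c0 (ltac:(apply/andP; split; lra)) (ltac:(lra)).
  have -> : w + (1 - w) * (1 + c^-1) = x.
    by rewrite /w; field; rewrite gt_eqF.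
  have := powR_tangent c 1 w c0 ltr01 w0.
  have hw : 0 <= tangent_sign c * (w - w `^ c).
    move: w0; rewrite le_eqVlt => /predU1P[<-|w0].
      by rewrite powR0 ?gt_eqF // subrr mulr0.
    rewrite /tangent_sign; case: (leP 1 c) => c1.
      by rewrite mul1r subr_ge0 ge1r_powR // w0 w1.
    by rewrite mulN1r oppr_ge0 subr_le0 ger1_powR ?(ltW c1) // w0 w1.
  move=> _; rewrite /dF -/w addrK; move: iv.
  set s := tangent_sign c; set Z := (1 + c^-1) `^ c; set Wc := w `^ c => iv h.
  rewrite [X in 0 <= X](_ : _ = (c + 1) * (s * (w + (1 - w) * Z - x `^ c) + (1 - w) * (s * (1 + c - Z)) + c * (s * (w - Wc)))); last by ring.
  by apply: mulr_ge0; [lra|rewrite !addr_ge0 // mulr_ge0 //; lra].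
suff : - F u <= - F 1 by rewrite F1; lra.
apply: (@ge0_derive_nondecreasing _ (fun x => - F x) (fun x => - dF x)); [exact: ltW|move=> x /andP[x1 xu]..].
  have := dFE x (lt_le_trans u0 x1) (ltac:(nra)).
  by move=> h; apply: is_deriveN.
have x0 : 0 < x by lra.
set w := c + 1 - c * x.
have w1 : 1 <= w by rewrite /w; nra.
(* On this side tangents at 1 suffice: since w - 1 = c (1 - x), the linear terms sum to c (c + 1) (c
   - 1) (1 - x), which has the required sign. *)
have := powR_tangent c 1 w c0 ltr01 (le_trans ler01 w1).
have := powR_tangent c 1 x c0 ltr01 (ltW x0).
rewrite /dF -/w addrK !powR1.
set s := tangent_sign c in sg *; set Xc := x `^ c; set Wc := w `^ c => h1 h2.
rewrite [X in 0 <= X](_ : _ = (c + 1) * (s * (Xc - 1 - c * 1 * (x - 1)) + c * (s * (Wc - 1 - c * 1 * (w - 1))) + c * (c + 1) * (1 - x) * (s * (c - 1)))); last by rewrite /w; ring.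
apply: mulr_ge0; first lra.
apply: addr_ge0; first by apply: addr_ge0; [exact: h1|apply: mulr_ge0; [exact: ltW|exact: h2]].
by apply: mulr_ge0; [apply: mulr_ge0; [apply: mulr_ge0; lra|lra]|exact: sg].
Qed.

Definition burk_const {R : realType} (c : R) : R := if 1 <= c then c else c^-1.

(** For c >= 1 the factor is Burkholder's p (1 - 1/p)^(p-1). For c < 1 the same inequality is read
    with X and Y exchanged, where the sign reverses, and divided by c^(c+1). *)
Lemma burk_majorant {R : realType} (c : R) : 0 < c ->
  exists2 al : R, 0 < al & forall X Y, 0 <= X -> 0 <= Y ->
    Y `^ (c + 1) - burk_const c `^ (c + 1) * X `^ (c + 1) <= al * burk c X Y.
Proof.
move=> c0; have cp : 0 < c + 1 by lra.
have key a b : 0 <= a -> 0 <= b ->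
    0 <= tangent_sign c * ((c + 1) * (c / (c + 1)) `^ c * ((b - c * a) * (a + b) `^ c) -
       (b `^ (c + 1) - (c * a) `^ (c + 1))).
  move=> a0 b0.
  have [s0|s0] := ltP 0 (a + b); last first.
    have -> : a = 0 by lra. have -> : b = 0 by lra.
    have c1n : c + 1 != 0 by rewrite gt_eqF.
    by rewrite mulr0 (powR0 c1n) !(subr0, mul0r, mulr0).
  (* With this scale u = b / m and v = c a / m satisfy c u + v = c + 1, and the contact point u = v
     = 1 corresponds to b = c a. *)
  pose m := c * (a + b) / (c + 1).
  have m0 : 0 < m by rewrite /m divr_gt0 // mulr_gt0.
  have u0 : 0 <= b / m by rewrite divr_ge0 // ltW.
  have v0 : 0 <= c * a / m by rewrite divr_ge0 ?(ltW m0) // mulr_ge0 // ltW.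
  have := powR_secant c _ _ c0 u0 v0.
  have -> : c * a / m = c + 1 - c * (b / m).
    by rewrite /m; field; do ?[apply/andP; split]; apply/eqP; lra.
  move=> /(_ erefl).
  have -> : c + 1 - c * (b / m) = c * a / m.
    by rewrite /m; field; do ?[apply/andP; split]; apply/eqP; lra.
  have eb : b `^ (c + 1) = m `^ (c + 1) * (b / m) `^ (c + 1).
    by rewrite -powRM ?(ltW m0) // mulrC divfK // gt_eqF.
  have ea : (c * a) `^ (c + 1) = m `^ (c + 1) * (c * a / m) `^ (c + 1).
    by rewrite -powRM ?(ltW m0) // [m * _]mulrC divfK // gt_eqF.
  have em : (c / (c + 1)) `^ c * (a + b) `^ c = m `^ c.
    rewrite -powRM ?divr_ge0 ?(ltW c0) ?(ltW cp) ?(ltW s0) //.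
    by congr (_ `^ _); rewrite /m; field; rewrite gt_eqF.
  rewrite ea eb.
  have -> : (c + 1) * (c / (c + 1)) `^ c * ((b - c * a) * (a + b) `^ c) =
      (c + 1) * (b - c * a) * ((c / (c + 1)) `^ c * (a + b) `^ c) by ring.
  rewrite em (powR_D1 c m c0 (ltW m0)).
  set P := (b / m) `^ (c + 1); set Q := (c * a / m) `^ (c + 1); set M := m `^ c => h.
  have M0 : 0 <= M by exact: powR_ge0.
  rewrite [X in 0 <= X](_ : _ = m * M * (tangent_sign c * ((c + 1) * (b / m - c * a / m) - (P - Q)))).
    by apply: mulr_ge0; [exact: mulr_ge0 (ltW m0) M0|exact: h].
  by field; rewrite gt_eqF.
have q0 : 0 < (c + 1) * (c / (c + 1)) `^ c.
  by rewrite mulr_gt0 // powR_gt0 // divr_gt0.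
set al := (c + 1) * _ in key q0.
rewrite /burk /burk_const; move: key; rewrite /tangent_sign; case: (leP 1 c) => c1 key.
  exists al => // X Y X0 Y0; have := key X Y X0 Y0.
  by rewrite powRM ?(ltW c0) //; lra.
have k0 : 0 < c^-1 `^ (c + 1) by rewrite powR_gt0 // invr_gt0.
exists (c^-1 `^ (c + 1) * al); first by rewrite mulr_gt0.
move=> X Y X0 Y0; have := key Y X Y0 X0.
have -> : Y `^ (c + 1) = c^-1 `^ (c + 1) * (c * Y) `^ (c + 1).
  rewrite -powRM ?invr_ge0 ?(ltW c0) ?mulr_ge0 ?(ltW c0) //.
  by rewrite mulrA mulVf ?mul1r // gt_eqF.
rewrite -mulrA -mulrBr ler_pM2l // [Y + X]addrC; lra.
Qed.

Lemma powR_add_le {R : realType} (p x y : R) : 0 <= p -> 0 <= x -> 0 <= y ->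
  (x + y) `^ p <= 2 `^ p * (x `^ p + y `^ p).
Proof.
move=> p0 x0 y0.
have h z : 0 <= z -> x <= z -> y <= z -> (x + y) `^ p <= 2 `^ p * z `^ p.
  move=> z0 xz yz; rewrite -powRM //; apply: ge0_ler_powR; rewrite ?nnegrE //; lra.
have [xy|/ltW yx] := leP x y.
  by apply: (le_trans (h y _ _ _)) => //; rewrite ler_pM2l ?powR_gt0 // lerDr powR_ge0.
by apply: (le_trans (h x _ _ _)) => //; rewrite ler_pM2l ?powR_gt0 // lerDl powR_ge0.
Qed.

(** Gives the integrability of Burkholder's function along two functions of L^p. *)
Lemma burk_growth {R : realType} (c X Y : R) : 0 < c -> 0 <= X -> 0 <= Y ->
  `|burk c X Y| <= (1 + c) * 2 `^ (c + 1) * (X `^ (c + 1) + Y `^ (c + 1)).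
Proof.
move=> c0 X0 Y0.
have s0 : 0 <= X + Y by lra.
rewrite -mulrA; apply: (@le_trans _ _ ((1 + c) * (X + Y) `^ (c + 1))).
  rewrite powR_D1 // /burk normrM (ger0_norm (powR_ge0 _ _)) mulrA.
  apply: ler_wpM2r; first exact: powR_ge0.
  rewrite ler_norml; case: (leP 1 c) => c1; apply/andP; split; nra.
by rewrite ler_pM2l ?powR_add_le //; lra.
Qed.

(** * Lebesgue measure on tuples *)

Definition box {R : realType} {d : nat} (a b : d.-tuple R) : set (d.-tuple R) :=
  [set x | forall i, tnth a i <= tnth x i <= tnth b i].

Definition cube {R : realType} (d n : nat) : set (d.-tuple R) :=
  box [tuple - n%:R | _ < d] [tuple n%:R | _ < d].

Definition boxes {R : realType} (d : nat) : set (set (d.-tuple R)) :=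
  [set A | exists a b, A = box a b].

Lemma measurable_coord {R : realType} (d : nat) (i : 'I_d) :
  measurable_fun setT (fun x : d.-tuple R => tnth x i).
Proof. exact: measurable_tnth. Qed.

Lemma box_bigsetI {R : realType} (d : nat) (a b : d.-tuple R) :
  box a b = \big[setI/setT]_(i < d) ((fun x : d.-tuple R => tnth x i) @^-1` `[tnth a i, tnth b i]).
Proof.
rewrite -bigcap_seq; apply/seteqP; split => [x xab i _|x xab i] /=.
  by rewrite in_itv /= xab.
by have := xab i (mem_index_enum i); rewrite /= in_itv /=.
Qed.

Lemma measurable_box {R : realType} (d : nat) (a b : d.-tuple R) : measurable (box a b).
Proof.
rewrite box_bigsetI; apply: bigsetI_measurable => i _.
rewrite -[X in measurable X]setTI; exact: measurable_coord.
Qed.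

Lemma cube_cover {R : realType} (d : nat) : \bigcup_n (@cube R d n) = setT.
Proof.
apply/seteqP; split => // x _.
pose M := \sum_(i < d) `|tnth x i|.
exists (Num.truncn M).+1 => // i; rewrite !tnth_mktuple -ler_norml.
apply: (@le_trans _ _ M); last exact/ltW/truncnS_gt.
by rewrite /M (bigD1 i) //= lerDl sumr_ge0.
Qed.

Lemma cube_monotone {R : realType} (d m n : nat) : (m <= n)%N -> @cube R d m `<=` cube d n.
Proof.
move=> mn x xm i; have := xm i; rewrite !tnth_mktuple => /andP[h1 h2].
have : m%:R <= n%:R :> R by rewrite ler_nat.
by move=> h; apply/andP; split; lra.
Qed.

Lemma boxes_setI {R : realType} (d : nat) : setI_closed (@boxes R d).
Proof.
move=> _ _ [a [b ->]] [a' [b' ->]].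
exists [tuple Num.max (tnth a i) (tnth a' i) | i < d], [tuple Num.min (tnth b i) (tnth b' i) | i < d].
apply/seteqP; split => [x [h1 h2] i|x h].
  rewrite !tnth_mktuple ge_max le_min; have := h1 i; have := h2 i.
  by move=> /andP[-> ->] /andP[-> ->].
by split => i; have := h i; rewrite !tnth_mktuple ge_max le_min
  => /andP[/andP[e1 e2] /andP[e3 e4]]; rewrite ?e1 ?e2 ?e3 ?e4.
Qed.

Lemma half_space_bigcup {R : realType} (d : nat) (i : 'I_d) (x : R) :
  [set z : d.-tuple R | x <= tnth z i] =
  \bigcup_n box [tuple (if j == i then x else - n%:R) | j < d] [tuple n%:R | _ < d].
Proof.
apply/seteqP; split => [z xz|z [n _ /(_ i)]]; last first.
  by rewrite !tnth_mktuple eqxx => /andP[].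
have : (\bigcup_n (@cube R d n)) z by rewrite cube_cover.
move=> [n _ zn]; exists n => // j; have := zn j.
by rewrite !tnth_mktuple; case: eqP => // -> /andP[_ ->]; rewrite andbT.
Qed.

(** The half-lines that generate the Borel sets of one coordinate pull back to half-spaces, and
    these are countable unions of boxes. *)
Lemma measurable_boxes {R : realType} (d : nat) :
  @measurable _ (d.-tuple R) = <<s boxes d >>.
Proof.
apply/seteqP; split; last first.
  apply: smallest_sub; first exact: sigma_algebra_measurable.
  by move=> _ [a [b ->]]; exact: measurable_box.
pose T1 := g_sigma_algebraType (@boxes R d).
have mid : measurable_fun setT (id : T1 -> d.-tuple R).
  apply/measurable_fun_tnthP => i.
  apply: (measurability (@measurable_realfun.RGenCInfty.G R)) => [|_ [_ [x ->] <-]]; first exact: measurable_realfun.RGenCInfty.measurableE.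
  rewrite setTI (_ : _ @^-1` _ = [set z : d.-tuple R | x <= tnth z i]); last first.
    by apply/seteqP; split => z /=; rewrite in_itv /= andbT.
  rewrite half_space_bigcup; apply: bigcup_measurable => n _.
  by apply: sub_sigma_algebra; eexists; eexists.
by move=> A mA; have := mid measurableT A mA; rewrite setTI preimage_id.
Qed.

(** Boxes are stable under intersection, generate the Borel sets, and the cubes among them exhaust
    the space. Changes of variables are therefore verified on boxes only. *)
Lemma measure_unique_boxes {R : realType} (d : nat)
    (m1 m2 : {measure set (d.-tuple R) -> \bar R}) :
  (forall a b, m1 (box a b) = m2 (box a b)) ->
  (forall n, (m1 (cube d n) < +oo)%E) ->
  forall A, measurable A -> m1 A = m2 A.
Proof.
move=> e fin A mA.
apply: (measure_unique (@boxes R d) (@cube R d)) => //.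
- exact: measurable_boxes.
- exact: boxes_setI.
- by move=> n; eexists; eexists.
- exact: cube_cover.
- by move=> _ [a [b ->]].
Qed.

Lemma lebesgue_box {R : realType} (d : nat) (leb : {measure set (d.-tuple R) -> \bar R}) :
  is_lebesgue leb -> forall a b : d.-tuple R,
  leb (box a b) = (\prod_(i < d) Num.max 0 (tnth b i - tnth a i))%:E.
Proof.
move=> hl a b; have [ab|/existsNP[k]] := pselect (forall k, tnth a k <= tnth b k).
  rewrite hl //; congr (_%:E); apply: eq_bigr => i _.
  by rewrite max_r // subr_ge0.
move=> /negP; rewrite -ltNge => lt.
rewrite (_ : box a b = set0); last first.
  by apply/seteqP; split => // x /(_ k) /andP[h1 h2]; move: (lt_le_trans lt (le_trans h1 h2)); rewrite ltxx.
by rewrite measure0 (bigD1 k) //= max_l ?mul0r //; lra.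
Qed.

Lemma lebesgue_cube {R : realType} (d : nat) (leb : {measure set (d.-tuple R) -> \bar R}) :
  is_lebesgue leb -> forall n, (leb (cube d n) < +oo)%E.
Proof. by move=> hl n; rewrite /cube lebesgue_box // ltry. Qed.

(** Translations, the reflection and dilations are all of this form, so that one change of variables
    serves them all. *)
Definition coord_affine {R : realType} {d : nat} (l : 'I_d -> R) (v x : d.-tuple R) : d.-tuple R :=
  [tuple l i * tnth x i + tnth v i | i < d].

Lemma measurable_coord_affine {R : realType} (d : nat) (l : 'I_d -> R) (v : d.-tuple R) :
  measurable_fun setT (coord_affine l v).
Proof.
apply/measurable_fun_tnthP => i.
rewrite (_ : _ \o _ = fun x => l i * tnth x i + tnth v i); last first.
  by apply/funext => x /=; rewrite tnth_mktuple.
by apply: measurable_funD => //; apply: measurable_funM => //; exact: measurable_coord.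
Qed.

Lemma lebesgue_coord_affine {R : realType} (d : nat) (leb : {measure set (d.-tuple R) -> \bar R})
    (l : 'I_d -> R) (v : d.-tuple R) : is_lebesgue leb -> (forall i, l i != 0) ->
  forall A, measurable A ->
  leb A = ((\prod_(i < d) `|l i|)%:E * leb (coord_affine l v @^-1` A))%E.
Proof.
move=> hl l0 A mA.
have P0 : 0 <= \prod_(i < d) `|l i| by apply: prodr_ge0.
have mc := measurable_coord_affine d l v.
pose m2_ : {measure set (d.-tuple R) -> \bar R} := mscale (NngNum P0) (pushforward leb (coord_affine l v)).
pose m2 := m2_ mc.
rewrite (@measure_unique_boxes _ _ leb m2) //; last exact: lebesgue_cube.
move=> a b; rewrite lebesgue_box //.
change (m2 (box a b)) with ((\prod_(i < d) `|l i|)%:E * leb (coord_affine l v @^-1` box a b))%E.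
(* The preimage of a box is again a box; where [l i] is negative the two end points of that side are
   exchanged. *)
pose f i y := (y - tnth v i) / l i.
rewrite (_ : _ @^-1` _ = box [tuple (if 0 < l i then f i (tnth a i) else f i (tnth b i)) | i < d]
                           [tuple (if 0 < l i then f i (tnth b i) else f i (tnth a i)) | i < d]); last first.
  apply/seteqP; split => x h i; have := h i; rewrite !tnth_mktuple /f.
    case: ltP => [lp|ln].
      by rewrite ler_pdivrMr // ler_pdivlMr //; lra.
    have {}ln : l i < 0 by rewrite lt_def eq_sym l0.
    by rewrite ler_ndivrMr // ler_ndivlMr //; lra.
  case: ltP => [lp|ln].
    by rewrite ler_pdivrMr // ler_pdivlMr //; lra.
  have {}ln : l i < 0 by rewrite lt_def eq_sym l0.
  by rewrite ler_ndivrMr // ler_ndivlMr //; lra.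
rewrite lebesgue_box // -EFinM -big_split /=; congr (_%:E); apply: eq_bigr => i _.
rewrite !tnth_mktuple /f -[X in X * _](@ger0_norm _ `|l i|) //.
rewrite [X in X * _]normr_id maxr_pMr // mulr0; congr (Num.max _ _).
case: ltP => [lp|ln]; first by rewrite gtr0_norm //; field; rewrite gt_eqF.
have {}ln : l i < 0 by rewrite lt_def eq_sym l0.
by rewrite ltr0_norm //; field; rewrite lt_eqF.
Qed.

Lemma ge0_integral_coord_affine {R : realType} (d : nat) (leb : {measure set (d.-tuple R) -> \bar R})
    (l : 'I_d -> R) (v : d.-tuple R) (f : d.-tuple R -> \bar R) : is_lebesgue leb ->
  (forall i, l i != 0) -> measurable_fun setT f -> (forall x, 0 <= f x)%E ->
  (\int[leb]_x f x = (\prod_(i < d) `|l i|)%:E * \int[leb]_x f (coord_affine l v x))%E.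
Proof.
move=> hl l0 mf f0.
have P0 : 0 <= \prod_(i < d) `|l i| by apply: prodr_ge0.
have mc := measurable_coord_affine d l v.
pose m2_ : {measure set (d.-tuple R) -> \bar R} := mscale (NngNum P0) (pushforward leb (coord_affine l v)).
pose m2 := m2_ mc.
transitivity (\int[m2]_x f x)%E.
  by apply: eq_measure_integral => A mA _; rewrite (lebesgue_coord_affine d leb l v).
rewrite ge0_integral_mscale //= ge0_integral_pushforward //.
Qed.

Lemma integral_coord_affine {R : realType} (d : nat) (leb : {measure set (d.-tuple R) -> \bar R})
    (l : 'I_d -> R) (v : d.-tuple R) (f : d.-tuple R -> \bar R) : is_lebesgue leb ->
  (forall i, `|l i| = 1) -> measurable_fun setT f ->
  (\int[leb]_x f (coord_affine l v x) = \int[leb]_x f x)%E.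
Proof.
move=> hl l1 mf.
have l0 i : l i != 0 by rewrite -normr_eq0 l1 oner_neq0.
have P1 : \prod_(i < d) `|l i| = 1 by rewrite big1.
rewrite integralE [RHS]integralE; congr (_ - _)%E.
  rewrite (ge0_integral_coord_affine d leb l v (f^\+)%E) //; last exact: measurable_funepos.
  by rewrite P1 mul1e; apply: eq_integral => x _; rewrite !funeposE.
rewrite (ge0_integral_coord_affine d leb l v (f^\-)%E) //; last exact: measurable_funeneg.
by rewrite P1 mul1e; apply: eq_integral => x _; rewrite !funenegE.
Qed.

Definition addt {R : realType} {d : nat} (x y : d.-tuple R) : d.-tuple R :=
  [tuple tnth x i + tnth y i | i < d].

Lemma tuple_ext {T : Type} (d : nat) (x y : d.-tuple T) :
  (forall i, tnth x i = tnth y i) -> x = y.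
Proof. by move=> h; apply: eq_from_tnth. Qed.

Lemma addtE {R : realType} (d : nat) (x w : d.-tuple R) :
  addt x w = coord_affine (fun=> 1) w x.
Proof. by apply: tuple_ext => i; rewrite !tnth_mktuple mul1r. Qed.

Lemma measurable_addt {R : realType} (d : nat) (w : d.-tuple R) :
  measurable_fun setT (fun x => addt x w).
Proof.
by under eq_fun do rewrite addtE; exact: measurable_coord_affine.
Qed.

Lemma integral_addt {R : realType} (d : nat) (leb : {measure set (d.-tuple R) -> \bar R})
    (w : d.-tuple R) (f : d.-tuple R -> \bar R) : is_lebesgue leb ->
  measurable_fun setT f -> (\int[leb]_x f (addt x w) = \int[leb]_x f x)%E.
Proof.
move=> hl mf; under eq_integral do rewrite addtE.
by rewrite integral_coord_affine // => i; rewrite normr1.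
Qed.

Lemma lebesgue_sigma_finite {R : realType} (d : nat)
    (leb : {measure set (d.-tuple R) -> \bar R}) : is_lebesgue leb ->
  sigma_finite setT leb.
Proof.
move=> hl; exists (@cube R d); first by rewrite cube_cover.
by move=> n; split; [exact: measurable_box|exact: lebesgue_cube].
Qed.

(** The proof that [leb] is Lebesgue measure is made an argument of this copy, so that the
    sigma-finite structure required by Fubini's theorem can be attached to it. *)
Definition sigma_lebesgue {R : realType} {d : nat} {leb : {measure set (d.-tuple R) -> \bar R}}
  (hl : is_lebesgue leb) : set (d.-tuple R) -> \bar R := leb.

HB.instance Definition _ (R : realType) (d : nat) (leb : {measure set (d.-tuple R) -> \bar R})
  (hl : is_lebesgue leb) := Measure.copy (sigma_lebesgue hl) leb.

HB.instance Definition _ (R : realType) (d : nat) (leb : {measure set (d.-tuple R) -> \bar R})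
  (hl : is_lebesgue leb) :=
  @Measure_isSigmaFinite.Build _ _ _ (sigma_lebesgue hl) (lebesgue_sigma_finite d leb hl).

Lemma ge0_Fubini_lebesgue {R : realType} (d : nat)
    (leb : {measure set (d.-tuple R) -> \bar R})
    (f : d.-tuple R * d.-tuple R -> \bar R) : is_lebesgue leb ->
  measurable_fun setT f -> (forall z, 0 <= f z)%E ->
  (\int[leb]_x \int[leb]_y f (x, y) = \int[leb]_y \int[leb]_x f (x, y))%E.
Proof.
move=> hl mf f0.
exact: (@fubini_tonelli _ _ _ _ _ (sigma_lebesgue hl) (sigma_lebesgue hl)).
Qed.

Lemma Fubini_lebesgue {R : realType} (d : nat)
    (leb : {measure set (d.-tuple R) -> \bar R})
    (f : d.-tuple R * d.-tuple R -> \bar R) : is_lebesgue leb ->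
  measurable_fun setT f -> (\int[leb]_x \int[leb]_y `|f (x, y)| < +oo)%E ->
  (\int[leb]_x \int[leb]_y f (x, y) = \int[leb]_y \int[leb]_x f (x, y))%E /\
  leb.-integrable setT (fun x => \int[leb]_y f (x, y))%E.
Proof.
move=> hl mf fin.
have i12 : ((sigma_lebesgue hl) \x (sigma_lebesgue hl))%E.-integrable setT f.
  exact/integrable12ltyP.
split; first exact: (@Fubini _ _ _ _ _ (sigma_lebesgue hl) (sigma_lebesgue hl)).
exact: (@integrable_fubini_F _ _ _ _ _ (sigma_lebesgue hl) (sigma_lebesgue hl)).
Qed.

(** * L^p spaces *)

Lemma cReM {R : realType} (z w : R[i]) : cRe (z * w) = cRe z * cRe w - cIm z * cIm w.
Proof. by case: z => a b; case: w. Qed.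
Lemma cImM {R : realType} (z w : R[i]) : cIm (z * w) = cRe z * cIm w + cIm z * cRe w.
Proof. by case: z => a b; case: w. Qed.
Lemma cRe0 {R : realType} : cRe (0 : R[i]) = 0. Proof. by []. Qed.
Lemma cIm0 {R : realType} : cIm (0 : R[i]) = 0. Proof. by []. Qed.

Lemma complex_ext {R : realType} (z w : R[i]) : cRe z = cRe w -> cIm z = cIm w -> z = w.
Proof. by case: z => a b; case: w => a' b' /= -> ->. Qed.

Lemma cabs0 {R : realType} : cabs (0 : R[i]) = 0.
Proof. by rewrite /cabs /= expr0n /= addr0 sqrtr0. Qed.

Lemma cabsM {R : realType} (z w : R[i]) : cabs (z * w) = cabs z * cabs w.
Proof.
apply/eqP; rewrite -(@eqrXn2 _ 2) ?cabs_ge0 ?mulr_ge0 ?cabs_ge0 //.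
rewrite exprMn !cabs_sqr cReM cImM; apply/eqP; ring.
Qed.

Lemma ler_cabsD {R : realType} (z w : R[i]) : cabs (z + w) <= cabs z + cabs w.
Proof.
rewrite -ler_sqr ?nnegrE ?addr_ge0 ?cabs_ge0 //.
have [-> _ _ _] := cabs_addE z w.
have := cdot_le z w; rewrite ler_norml => /andP[_ h].
by rewrite sqrrD; lra.
Qed.

Lemma cabsB {R : realType} (z w : R[i]) : cabs (z - w) = cabs (w - z).
Proof. by rewrite -cabsN opprB. Qed.

Lemma ler_dist_cabs {R : realType} (z w : R[i]) : `|cabs z - cabs w| <= cabs (z - w).
Proof.
rewrite ler_norml.
have h1 : cabs z <= cabs (z - w) + cabs w.
  by rewrite -[X in cabs X <= _](subrK w); exact: ler_cabsD.
have h2 : cabs w <= cabs (z - w) + cabs z.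
  by rewrite cabsB -[X in cabs X <= _](subrK z); exact: ler_cabsD.
by apply/andP; split; lra.
Qed.

Lemma cabs_eq0P {R : realType} (z : R[i]) : cabs z = 0 -> z = 0.
Proof. by move=> /cabs_eq0[h1 h2]; exact: complex_ext. Qed.

Lemma ler_cRe {R : realType} (z : R[i]) : `|cRe z| <= cabs z.
Proof.
rewrite -ler_sqr ?nnegrE ?cabs_ge0 // real_normK ?num_real // cabs_sqr.
by rewrite lerDl sqr_ge0.
Qed.

Lemma ler_cIm {R : realType} (z : R[i]) : `|cIm z| <= cabs z.
Proof.
rewrite -ler_sqr ?nnegrE ?cabs_ge0 // real_normK ?num_real // cabs_sqr.
by rewrite lerDr sqr_ge0.
Qed.

Lemma cabs_le {R : realType} (z : R[i]) : cabs z <= `|cRe z| + `|cIm z|.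
Proof.
rewrite -ler_sqr ?nnegrE ?addr_ge0 ?cabs_ge0 // cabs_sqr sqrrD !real_normK ?num_real //.
have : 0 <= `|cRe z| * `|cIm z| by rewrite mulr_ge0.
lra.
Qed.

Lemma dist_powR_le {R : realType} (p M a b : R) : 1 <= p -> 0 < M ->
  0 <= a <= M -> 0 <= b <= M -> `|a `^ p - b `^ p| <= p * M `^ (p - 1) * `|a - b|.
Proof.
move=> p1 M0; wlog ab : a b / b <= a => [h ha hb|].
  have [/h|/ltW /h] := leP b a; first exact.
  by rewrite distrC [`|a - b|]distrC; exact.
move=> /andP[a0 aM] /andP[b0 bM].
have mon : b `^ p <= a `^ p by apply: ge0_ler_powR; rewrite ?nnegrE //; lra.
rewrite !ger0_norm ?subr_ge0 //.
move: a0; rewrite le_eqVlt => /predU1P[a0|a0].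
  have -> : b = a by lra.
  by rewrite !subrr mulr0.
have := powR_convex_tangent p a b p1 a0 b0.
have : a `^ (p - 1) <= M `^ (p - 1) by apply: ge0_ler_powR; rewrite ?nnegrE //; lra.
set A := a `^ (p - 1); set B := M `^ (p - 1) => h1 h2.
have : p * A * (a - b) <= p * B * (a - b).
  by rewrite ler_wpM2r ?subr_ge0 // ler_wpM2l //; lra.
lra.
Qed.

(** * Convergence of complex and of extended real sequences *)

Definition ccvg {R : realType} (u : nat -> R[i]) (l : R[i]) :=
  (fun n => cabs (u n - l)) @ \oo --> (0 : R).

Lemma cvgnP {R : realType} (u : nat -> R) (l : R) :
  u @ \oo --> l <-> forall e, 0 < e -> exists N, forall n, (N <= n)%N -> `|l - u n| <= e.
Proof.
split=> [/cvgrPdist_le h e /h [N _ H]|h]; first by exists N => n /H.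
by apply/cvgrPdist_le => e /h[N H]; exists N.
Qed.

Lemma ccvg_cabs {R : realType} (u : nat -> R[i]) (l : R[i]) :
  ccvg u l -> (fun n => cabs (u n)) @ \oo --> cabs l.
Proof.
move=> /cvgnP h; apply/cvgnP => e /h[N H]; exists N => n /H.
rewrite sub0r normrN (ger0_norm (cabs_ge0 _)); apply: le_trans.
by rewrite distrC; exact: ler_dist_cabs.
Qed.

Lemma cvg_powR {R : realType} (p : R) (u : nat -> R) (l : R) : 1 <= p ->
  (forall n, 0 <= u n) -> u @ \oo --> l -> (fun n => u n `^ p) @ \oo --> l `^ p.
Proof.
move=> p1 u0 ul.
have l0 : 0 <= l.
  rewrite leNgt; apply/negP => l0.
  have e0 : 0 < - l / 2 by lra.
  have [N /(_ N (leqnn _))] := (cvgnP _ _).1 ul _ e0.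
  by rewrite ler_norml => /andP[]; have := u0 N; lra.
pose M := l + 1; have M0 : 0 < M by rewrite /M; lra.
pose C := p * M `^ (p - 1) + 1.
have C0 : 0 < C by rewrite /C; have := powR_ge0 M (p - 1); nra.
apply/cvgnP => e e0; have e1 : 0 < Num.min 1 (e / C) by rewrite lt_min ltr01 divr_gt0.
move/cvgnP: ul => /(_ _ e1)[N H]; exists N => n /H.
rewrite le_min => /andP[h1 h2].
have un : u n <= M by rewrite /M; move: h1; rewrite ler_norml => /andP[]; lra.
have := @dist_powR_le _ p M l (u n) p1 M0.
have -> : 0 <= l <= M by apply/andP; split => //; rewrite /M; lra.
have -> : 0 <= u n <= M by apply/andP.
move=> /(_ isT isT) h3; apply: (le_trans h3).
apply: (@le_trans _ _ (C * `|l - u n|)); first by rewrite ler_wpM2r // /C; lra.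
by rewrite mulrC -ler_pdivlMr.
Qed.

(** Meant for nonnegative sequences, hence the one-sided bound. It allows infinite initial values
    and makes comparison arguments direct. *)
Definition tends0 {R : realType} (u : nat -> \bar R) :=
  forall e : R, 0 < e -> exists N, forall n, (N <= n)%N -> (u n <= e%:E)%E.

Lemma tends0_le {R : realType} (u v : nat -> \bar R) :
  (forall n, u n <= v n)%E -> tends0 v -> tends0 u.
Proof. by move=> uv v0 e /v0[N h]; exists N => n /h; exact: le_trans. Qed.

Lemma tends0D {R : realType} (u v : nat -> \bar R) :
  tends0 u -> tends0 v -> tends0 (fun n => u n + v n)%E.
Proof.
move=> u0 v0 e e0.
have e2 : 0 < e / 2 by lra.
have [N1 h1] := u0 _ e2; have [N2 h2] := v0 _ e2.
exists (maxn N1 N2) => n; rewrite geq_max => /andP[/h1 a /h2 b].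
by rewrite [e]splitr EFinD leeD.
Qed.

Lemma tends0Z {R : realType} (C : R) (u : nat -> \bar R) : 0 <= C ->
  tends0 u -> tends0 (fun n => C%:E * u n)%E.
Proof.
move=> C0 u0 e e0.
have e2 : 0 < e / (C + 1) by rewrite divr_gt0 //; lra.
have [N h] := u0 _ e2; exists N => n /h un.
apply: (@le_trans _ _ (C%:E * (e / (C + 1))%:E)%E); first by rewrite lee_wpmul2l ?lee_fin.
rewrite -EFinM lee_fin mulrCA ger_pMr // ler_pdivrMr; lra.
Qed.

Lemma tends0_cst0 {R : realType} (x : \bar R) : (0 <= x)%E -> tends0 (fun=> x) -> x = 0%E.
Proof.
move=> x0 h; apply/eqP; rewrite eq_le x0 andbT.
by apply/lee_addgt0Pr => e /h[N /(_ N (leqnn _))]; rewrite add0e.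
Qed.

Lemma cvg_tends0 {R : realType} (u : nat -> \bar R) :
  u @ \oo --> 0%E -> tends0 u.
Proof.
move=> /fine_cvgP[[N1 _ f1] /cvgnP h] e /h[N2 f2].
exists (maxn N1 N2) => n; rewrite geq_max => /andP[/f1 a /f2 b].
rewrite -(fineK a) lee_fin; apply: le_trans b.
by rewrite sub0r normrN ler_norm.
Qed.

Lemma cmeasurableD {R : realType} (d : nat) (f g : d.-tuple R -> R[i]) :
  cmeasurable f -> cmeasurable g -> cmeasurable (fun x => f x + g x).
Proof.
move=> [f1 f2] [g1 g2]; split.
  by under eq_fun do rewrite cReD; exact: measurable_funD.
by under eq_fun do rewrite cImD; exact: measurable_funD.
Qed.

Lemma cmeasurableM {R : realType} (d : nat) (f g : d.-tuple R -> R[i]) :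
  cmeasurable f -> cmeasurable g -> cmeasurable (fun x => f x * g x).
Proof.
move=> [f1 f2] [g1 g2]; split.
  by under eq_fun do rewrite cReM; apply: measurable_funB; exact: measurable_funM.
by under eq_fun do rewrite cImM; apply: measurable_funD; exact: measurable_funM.
Qed.

Lemma cmeasurableN {R : realType} (d : nat) (f : d.-tuple R -> R[i]) :
  cmeasurable f -> cmeasurable (fun x => - f x).
Proof.
move=> [f1 f2]; split.
  by under eq_fun do rewrite cReN; exact: measurable_funN.
by under eq_fun do rewrite cImN; exact: measurable_funN.
Qed.

Lemma cmeasurableC {R : realType} (d : nat) (a : R[i]) :
  cmeasurable (fun _ : d.-tuple R => a).
Proof. by split; exact: measurable_cst. Qed.

Lemma cmeasurableB {R : realType} (d : nat) (f g : d.-tuple R -> R[i]) :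
  cmeasurable f -> cmeasurable g -> cmeasurable (fun x => f x - g x).
Proof. by move=> hf hg; apply: cmeasurableD => //; exact: cmeasurableN. Qed.

Lemma cmeasurable_comp {R : realType} (d : nat) (f : d.-tuple R -> R[i])
  (h : d.-tuple R -> d.-tuple R) :
  cmeasurable f -> measurable_fun setT h -> cmeasurable (fun x => f (h x)).
Proof.
move=> [f1 f2] mh.
by split; [exact: (measurableT_comp f1)|exact: (measurableT_comp f2)].
Qed.

Lemma measurable_cabs {R : realType} (d : nat) (f : d.-tuple R -> R[i]) :
  cmeasurable f -> measurable_fun setT (fun x => cabs (f x)).
Proof.
move=> [f1 f2].
rewrite (_ : (fun x => _) = (@powR R ^~ 2^-1) \o (fun x => cRe (f x) ^+ 2 + cIm (f x) ^+ 2)); last first.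
  by apply/funext => x /=; rewrite powR12_sqrt // addr_ge0 ?sqr_ge0.
apply: measurableT_comp; first exact: measurable_powR.
by apply: measurable_funD; exact: measurable_funX.
Qed.

Lemma measurable_cabs_powR {R : realType} (d : nat) (p : R) (f : d.-tuple R -> R[i]) :
  cmeasurable f -> measurable_fun setT (fun x => ((cabs (f x)) `^ p)%:E).
Proof.
move=> hf; apply/measurable_EFinP.
apply: (@measurableT_comp _ _ _ _ _ _ (@powR R ^~ p)); first exact: measurable_powR.
exact: measurable_cabs.
Qed.

(** The p-th power of the L^p norm, kept in the extended reals so that estimates need no finiteness.
    Minkowski's inequality is replaced by the quasi-triangle inequality [IpD] with the constant
    2^p. *)
Definition Ip {R : realType} {d : nat} (mu : {measure set (d.-tuple R) -> \bar R})
  (p : R) (f : d.-tuple R -> R[i]) : \bar R := (\int[mu]_x ((cabs (f x)) `^ p)%:E)%E.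

Lemma Ip_ge0 {R : realType} (d : nat) (mu : {measure set (d.-tuple R) -> \bar R})
  (p : R) (f : d.-tuple R -> R[i]) : (0 <= Ip mu p f)%E.
Proof. by apply: integral_ge0 => x _; rewrite lee_fin powR_ge0. Qed.

Lemma Ip_le {R : realType} (d : nat) (mu : {measure set (d.-tuple R) -> \bar R})
  (p : R) (f g : d.-tuple R -> R[i]) : 0 <= p -> cmeasurable f -> cmeasurable g ->
  (forall x, cabs (f x) <= cabs (g x)) -> (Ip mu p f <= Ip mu p g)%E.
Proof.
move=> p0 hf hg fg; apply: ge0_le_integral => //.
- by move=> x _; rewrite lee_fin powR_ge0.
- exact: measurable_cabs_powR.
- exact: measurable_cabs_powR.
- by move=> x _; rewrite lee_fin; apply: ge0_ler_powR; rewrite ?nnegrE ?cabs_ge0.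
Qed.

Lemma IpD {R : realType} (d : nat) (mu : {measure set (d.-tuple R) -> \bar R})
  (p : R) (f g : d.-tuple R -> R[i]) : 0 <= p -> cmeasurable f -> cmeasurable g ->
  (Ip mu p (fun x => f x + g x)%R <= (2 `^ p)%:E * (Ip mu p f + Ip mu p g))%E.
Proof.
move=> p0 hf hg; have pf x : (0 <= ((cabs (f x)) `^ p)%:E)%E by rewrite lee_fin powR_ge0.
have pg x : (0 <= ((cabs (g x)) `^ p)%:E)%E by rewrite lee_fin powR_ge0.
rewrite /Ip -ge0_integralD //; [|exact: measurable_cabs_powR..].
rewrite -ge0_integralZl_EFin ?powR_ge0 //; last 2 first.
- by move=> x _; rewrite adde_ge0.
- by apply: emeasurable_funD; exact: measurable_cabs_powR.
apply: ge0_le_integral => //.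
- by move=> x _; rewrite lee_fin powR_ge0.
- by apply: measurable_cabs_powR; exact: cmeasurableD.
- by apply: measurable_funeM; apply: emeasurable_funD; exact: measurable_cabs_powR.
- move=> x _; rewrite -EFinD -EFinM lee_fin.
  apply: le_trans (powR_add_le p _ _ p0 (cabs_ge0 _) (cabs_ge0 _)).
  by apply: ge0_ler_powR; rewrite ?nnegrE ?addr_ge0 ?cabs_ge0 ?ler_cabsD.
Qed.

Lemma IpN {R : realType} (d : nat) (mu : {measure set (d.-tuple R) -> \bar R})
  (p : R) (f : d.-tuple R -> R[i]) : Ip mu p (fun x => - f x) = Ip mu p f.
Proof. by apply: eq_integral => x _; rewrite cabsN. Qed.

Lemma IpB_sym {R : realType} (d : nat) (mu : {measure set (d.-tuple R) -> \bar R})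
  (p : R) (f g : d.-tuple R -> R[i]) :
  Ip mu p (fun x => f x - g x) = Ip mu p (fun x => g x - f x).
Proof. by apply: eq_integral => x _; rewrite cabsB. Qed.

Lemma IpB {R : realType} (d : nat) (mu : {measure set (d.-tuple R) -> \bar R})
  (p : R) (f g : d.-tuple R -> R[i]) : 0 <= p -> cmeasurable f -> cmeasurable g ->
  (Ip mu p (fun x => f x - g x)%R <= (2 `^ p)%:E * (Ip mu p f + Ip mu p g))%E.
Proof.
move=> p0 hf hg; have := @IpD R d mu p f (fun x => - g x) p0 hf (cmeasurableN _ _ hg).
by rewrite IpN.
Qed.

Lemma IpZ {R : realType} (d : nat) (mu : {measure set (d.-tuple R) -> \bar R})
  (p : R) (a : R[i]) (f : d.-tuple R -> R[i]) : cmeasurable f ->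
  Ip mu p (fun x => a * f x) = ((cabs a `^ p)%:E * Ip mu p f)%E.
Proof.
move=> hf; rewrite /Ip -ge0_integralZl_EFin ?powR_ge0 //.
- by apply: eq_integral => x _; rewrite cabsM powRM ?cabs_ge0 // EFinM.
- by move=> x _; rewrite lee_fin powR_ge0.
- exact: measurable_cabs_powR.
Qed.

Lemma Ip0 {R : realType} (d : nat) (mu : {measure set (d.-tuple R) -> \bar R})
  (p : R) : p != 0 -> Ip mu p (fun=> 0) = 0%E.
Proof.
by move=> p0; rewrite /Ip integral0_eq // => x _; rewrite cabs0 powR0.
Qed.

Lemma Ip_ae_eq {R : realType} (d : nat) (mu : {measure set (d.-tuple R) -> \bar R})
  (p : R) (f g : d.-tuple R -> R[i]) : cmeasurable f -> cmeasurable g ->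
  aeq_c mu f g -> Ip mu p f = Ip mu p g.
Proof.
move=> hf hg [N [mN N0 sN]]; apply: ge0_ae_eq_integral => //.
- exact: measurable_cabs_powR.
- exact: measurable_cabs_powR.
- by move=> x _; rewrite lee_fin powR_ge0.
- by move=> x _; rewrite lee_fin powR_ge0.
- exists N; split => // x /= h; apply: sN => /= e; apply: h => _.
  by rewrite e.
Qed.

Lemma Ip_eq0 {R : realType} (d : nat) (mu : {measure set (d.-tuple R) -> \bar R})
  (p : R) (f g : d.-tuple R -> R[i]) : cmeasurable f -> cmeasurable g ->
  Ip mu p (fun x => f x - g x) = 0%E -> aeq_c mu f g.
Proof.
move=> hf hg h.
have mfg := measurable_cabs_powR _ p _ (cmeasurableB _ _ _ hf hg).
have : (\int[mu]_x `|((cabs (f x - g x)) `^ p)%:E| = 0)%E.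
  by rewrite -[RHS]h; apply: eq_integral => x _; rewrite gee0_abs // lee_fin powR_ge0.
move/ae_eq_integral_abs => /(_ measurableT mfg)[N [mN N0 sN]].
exists N; split => // x /= fg; apply: sN => /= /(_ I) /= [] /powR_eq0_eq0.
by move=> /cabs_eq0P/subr0_eq.
Qed.

Lemma Ip_addt {R : realType} (d : nat) (leb : {measure set (d.-tuple R) -> \bar R})
  (p : R) (w : d.-tuple R) (f : d.-tuple R -> R[i]) : is_lebesgue leb -> cmeasurable f ->
  Ip leb p (fun x => f (addt x w)) = Ip leb p f.
Proof.
move=> hl hf.
exact: (integral_addt d leb w (fun x => ((cabs (f x)) `^ p)%:E) hl (measurable_cabs_powR _ _ _ hf)).
Qed.

Lemma cvg_EFinn {R : realType} (u : nat -> R) (l : R) :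
  u @ \oo --> l -> (fun n => (u n)%:E) @ \oo --> l%:E.
Proof. by move=> h; apply/fine_cvgP; split => //; exact: nearW. Qed.

Lemma measurable_fun_limn_einf {dd} {T : measurableType dd} {R : realType}
  (F : nat -> T -> \bar R) : (forall n, measurable_fun setT (F n)) ->
  measurable_fun setT (fun x => limn_einf (F^~ x)).
Proof.
move=> mF; rewrite (_ : (fun x => _) = fun x => (- limn_esup (fun n => - F n x))%E).
  by apply: measurableT_comp => //; apply: measurable_fun_limn_esup => n; exact: measurableT_comp.
by apply/funext => x; rewrite (limn_esupN (F^~ x)) oppeK.
Qed.

Lemma limn_einf_ge0 {R : realType} (u : nat -> \bar R) : (forall n, 0 <= u n)%E ->
  (0 <= limn_einf u)%E.
Proof.
move=> u0; rewrite limn_einf_lim; apply: lime_ge; first exact: is_cvg_einfs.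
by apply: nearW => n; apply: le_ereal_inf_tmp => _ [k _ <-].
Qed.

(** This is how L^p bounds survive limits that are taken in another sense, such as convergence in
    L^2, which provides an almost everywhere convergent subsequence. *)
Lemma Ip_fatou {R : realType} (d : nat) (mu : {measure set (d.-tuple R) -> \bar R})
  (p : R) (u : nat -> d.-tuple R -> R[i]) (f : d.-tuple R -> R[i]) (B : \bar R) :
  1 <= p -> (forall n, cmeasurable (u n)) -> cmeasurable f ->
  {ae mu, forall x, ccvg (u^~ x) (f x)} -> (forall n, Ip mu p (u n) <= B)%E ->
  (Ip mu p f <= B)%E.
Proof.
move=> p1 hu hf ae hB.
pose F n x := ((cabs (u n x)) `^ p)%:E.
have mF n : measurable_fun setT (F n) by exact: measurable_cabs_powR.
have F0 n x : (0 <= F n x)%E by rewrite lee_fin powR_ge0.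
apply: (@le_trans _ _ (\int[mu]_x limn_einf (F^~ x))%E).
  rewrite /Ip le_eqVlt; apply/orP; left; apply/eqP.
  apply: ge0_ae_eq_integral => //.
  - exact: measurable_cabs_powR.
  - exact: measurable_fun_limn_einf.
  - by move=> x _; rewrite lee_fin powR_ge0.
  - by move=> x _; apply: limn_einf_ge0 => n; exact: F0.
  - case: ae => N [mN N0 sN]; exists N; split => // x /= h; apply: sN => /= hx; apply: h => _.
    have h2 := cvg_powR p _ _ p1 (fun n => cabs_ge0 (u n x)) (ccvg_cabs _ _ hx).
    have h3 : F^~ x @ \oo --> ((cabs (f x)) `^ p)%:E by exact: cvg_EFinn.
    by rewrite (cvg_limn_einf_sup h3).1.
apply: (le_trans (fatou mu measurableT mF (fun n x _ => F0 n x))).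
rewrite limn_einf_lim; apply: lime_le; first exact: is_cvg_einfs.
apply: nearW => n; apply: ereal_inf_le; exists (Ip mu p (u n)) => //.
by exists n => //=.
Qed.

Lemma Ip_dominated {R : realType} (d : nat) (mu : {measure set (d.-tuple R) -> \bar R})
  (p : R) (u : nat -> d.-tuple R -> R[i]) (f h : d.-tuple R -> R[i]) :
  1 <= p -> (forall n, cmeasurable (u n)) -> cmeasurable f -> cmeasurable h ->
  {ae mu, forall x, ccvg (u^~ x) (f x)} -> (Ip mu p h < +oo)%E ->
  (forall n x, cabs (u n x - f x) <= cabs (h x)) ->
  tends0 (fun n => Ip mu p (fun x => u n x - f x)).
Proof.
move=> p1 hu hf hh uf fin dom; apply: cvg_tends0.
have p0 : 0 <= p by lra.
have p0' : p != 0 by rewrite gt_eqF //; lra.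
pose g n x := ((cabs (u n x - f x)) `^ p)%:E.
have mg n : measurable_fun setT (g n) by apply: measurable_cabs_powR; exact: cmeasurableB.
have mh := measurable_cabs_powR d p h hh.
have := @dominated_convergence _ _ _ mu setT measurableT g (cst 0%E) _ mg
  (measurable_cst _).
move=> /(_ (fun x => ((cabs (h x)) `^ p)%:E)) [].
- apply: filterS uf => x uf _.
  have -> : cst 0%E x = (0 `^ p)%:E :> \bar R by rewrite powR0.
  by apply: cvg_EFinn; apply: cvg_powR => // n; exact: cabs_ge0.
- apply/integrableP; split => //.
  rewrite (_ : (\int[mu]_x _)%E = Ip mu p h) //.
  by apply: eq_integral => x _; rewrite gee0_abs // lee_fin powR_ge0.
- apply: aeW => x n _; rewrite gee0_abs ?lee_fin ?powR_ge0 //.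
  by apply: ge0_ler_powR; rewrite ?nnegrE ?cabs_ge0.
- by move=> _ _; rewrite integral0.
Qed.

Lemma nneseries_half_lty {R : realType} :
  (\sum_(0 <= k <oo) ((2 : R) ^- k.+1)%:E < +oo)%E.
Proof.
have h := @cvg_geometric_eseries_half R 1 0.
have -> : (\sum_(0 <= k <oo) ((2 : R) ^- k.+1)%:E)%E = (1 / 2 ^+ 0)%:E.
  apply/cvg_lim => //; apply: cvg_trans h; apply: near_eq_cvg.
  apply: nearW => n; rewrite /eseries /=; apply: eq_bigr => k _.
  by rewrite addn1 natrX div1r.
by rewrite ltry.
Qed.

(** The sum over k of 2^(k+1) |h_k|^p has finite integral, hence is finite almost everywhere. Each
    of its terms is below the sum S, so |h_k|^p <= S 2^-k. *)
Lemma Ip_fast_ae {R : realType} (d : nat) (mu : {measure set (d.-tuple R) -> \bar R})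
  (p : R) (h : nat -> d.-tuple R -> R[i]) : 1 <= p -> (forall k, cmeasurable (h k)) ->
  (forall k, Ip mu p (h k) <= (4 ^- k.+1)%:E)%E ->
  {ae mu, forall x, exists C : R, 0 <= C /\ forall k, cabs (h k x) <= C * ((2 `^ (- p^-1)) ^+ k)}.
Proof.
move=> p1 mh hh.
have p0 : 0 < p by lra.
pose F k x := ((2 : R) ^+ k.+1 * (cabs (h k x)) `^ p)%:E.
have F0 k x : (0 <= F k x)%E by rewrite lee_fin mulr_ge0 ?exprn_ge0 ?powR_ge0.
have mF k : measurable_fun setT (F k).
  apply/measurable_EFinP; apply: measurable_funM => //.
  by apply/measurable_EFinP; exact: measurable_cabs_powR.
pose S x := (\sum_(0 <= k <oo) F k x)%E.
have mS : measurable_fun setT S.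
  by apply: ge0_emeasurable_sum => // k x _ _; exact: F0.
have S0 x : (0 <= S x)%E by apply: nneseries_ge0 => k _ _; exact: F0.
have iS : (\int[mu]_x S x < +oo)%E.
  rewrite /S integral_nneseries //.
  apply: le_lt_trans (@nneseries_half_lty R); apply: lee_nneseries.
    by move=> k _ _; apply: integral_ge0 => x _; exact: F0.
  move=> k _; rewrite /F.
  under eq_integral do rewrite EFinM.
  rewrite ge0_integralZl_EFin ?exprn_ge0 //; last 2 first.
  - by move=> x _; rewrite lee_fin powR_ge0.
  - exact: measurable_cabs_powR.
  apply: (@le_trans _ _ ((2 ^+ k.+1)%:E * (4 ^- k.+1)%:E)%E).
    by apply: lee_wpmul2l; [rewrite lee_fin exprn_ge0|exact: hh].
  rewrite -EFinM lee_fin (_ : 4 = 2 * 2 :> R); last by ring.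
  by rewrite exprMn invfM mulrA divff ?mul1r // expf_neq0.
have iS' : mu.-integrable setT S.
  apply/integrableP; split => //.
  by under eq_integral do rewrite gee0_abs //.
have := integrable_ae measurableT iS'.
case=> N [mN N0 sN]; exists N; split => // x /= nh; apply: sN => /= fin; apply: nh.
have {fin} := fin I => fin.
exists ((fine (S x)) `^ p^-1); split; first exact: powR_ge0.
move=> k.
have le1 : (F k x <= S x)%E.
  apply: le_trans (nneseries_lim_ge k.+1 (fun n _ _ => F0 n x)).
  by rewrite big_nat_recr //= leeDr // sume_ge0.
have {}le1 : 2 ^+ k.+1 * (cabs (h k x)) `^ p <= fine (S x).
  by rewrite -lee_fin fineK.
have le2 : (cabs (h k x)) `^ p <= fine (S x) * 2 ^- k.
  rewrite ler_pdivlMr ?exprn_gt0 // mulrC; apply: le_trans le1.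
  by rewrite ler_wpM2r ?powR_ge0 // exprS ler_peMl ?exprn_ge0 //; lra.
have Sx0 : 0 <= fine (S x) by exact: fine_ge0.
have -> : (2 `^ (- p^-1)) ^+ k = (2 ^- k) `^ p^-1 :> R.
  by rewrite -powR_mulrn ?powR_ge0 // -powRrM -powR_invn // -powRrM; congr (_ `^ _); ring.
rewrite -powRM ?invr_ge0 ?exprn_ge0 //.
have -> : cabs (h k x) = (cabs (h k x) `^ p) `^ p^-1.
  by rewrite -powRrM divff ?powRr1 ?cabs_ge0 // gt_eqF.
by apply: ge0_ler_powR; rewrite ?nnegrE ?powR_ge0 ?invr_ge0 ?(ltW p0) ?mulr_ge0 ?invr_ge0 ?exprn_ge0.
Qed.

Lemma powR_half_lt1 {R : realType} (p : R) : 0 < p -> 0 < (2 : R) `^ (- p^-1) < 1.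
Proof.
move=> p0; rewrite powR_gt0 //= powRN invf_lt1 ?powR_gt0 //.
have i0 : 0 < p^-1 by rewrite invr_gt0.
have : (1 : R) `^ p^-1 < 2 `^ p^-1 by apply: gt0_ltr_powR; rewrite ?nnegrE //; lra.
by rewrite powR1.
Qed.

Lemma geometric_ccvg {R : realType} (u : nat -> R[i]) (l : R[i]) (C r : R) : 0 < r < 1 ->
  0 <= C -> (forall k, cabs (u k - l) <= C * r ^+ k) -> ccvg u l.
Proof.
move=> /andP[r0 r1] C0 h.
have hg : (fun k => C * r ^+ k) @ \oo --> (0 : R).
  by apply: cvg_geometric; rewrite ger0_norm // ltW.
apply/cvgnP => e e0; have [N H] := (cvgnP _ _).1 hg _ e0.
exists N => n /H; rewrite !sub0r !normrN (ger0_norm (cabs_ge0 _)) => h2.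
by apply: le_trans (le_trans (ler_norm _) h2); exact: h.
Qed.

Lemma tends0_subseq {R : realType} (u : nat -> \bar R) : tends0 u ->
  exists phi : nat -> nat, forall k n, (phi k <= n)%N -> (u n <= (4 ^- k.+1)%:E)%E.
Proof.
move=> hu; have e0 k : 0 < (4 : R) ^- k.+1 by rewrite invr_gt0 exprn_gt0.
by have [phi h] := choice (fun k => hu _ (e0 k)); exists phi.
Qed.

Lemma Ip_subseq_ae {R : realType} (d : nat) (mu : {measure set (d.-tuple R) -> \bar R})
  (p : R) (u : nat -> d.-tuple R -> R[i]) (f : d.-tuple R -> R[i]) : 1 <= p ->
  (forall k, cmeasurable (u k)) -> cmeasurable f ->
  tends0 (fun n => Ip mu p (fun x => u n x - f x)) ->
  exists phi : nat -> nat, {ae mu, forall x, ccvg (fun k => u (phi k) x) (f x)}.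
Proof.
move=> p1 mu_ mf /tends0_subseq[phi hphi]; exists phi.
have := @Ip_fast_ae R d mu p (fun k x => u (phi k) x - f x) p1
  (fun k => cmeasurableB _ _ _ (mu_ _) mf) (fun k => hphi k _ (leqnn _)).
case=> N [mN N0 sN]; exists N; split => // x /= nh; apply: sN => /= -[C [C0 hC]]; apply: nh.
by apply: geometric_ccvg C0 hC; apply: powR_half_lt1; lra.
Qed.

Lemma geometric_cauchy_cvg {R : realType} (u : nat -> R) (C r : R) : 0 < r < 1 -> 0 <= C ->
  (forall k, `|u k.+1 - u k| <= C * r ^+ k) -> cvgn u.
Proof.
move=> /andP[r0 r1] C0 h.
have hs : cvgn (series (fun k => u k.+1 - u k)).
  apply: normed_cvg; apply: (@series_le_cvg _ _ (geometric C r)).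
  - by move=> n; exact: normr_ge0.
  - by move=> n; rewrite /geometric /= mulr_ge0 // exprn_ge0 // ltW.
  - by move=> n; exact: h.
  - by apply: is_cvg_geometric_series; rewrite ger0_norm // ltW.
have -> : u = (fun n => u 0%N + series (fun k => u k.+1 - u k) n).
  by apply/funext => n; rewrite /series /= telescope_sumr // addrC subrK.
by apply: is_cvgD => //; exact: is_cvg_cst.
Qed.

(** Riesz-Fischer: a subsequence with increments of size 4^-(k+1) converges geometrically almost
    everywhere, and Fatou's lemma applied to u_n minus the subsequence gives convergence of the
    whole sequence. *)
Lemma Lp_complete {R : realType} (d : nat) (mu : {measure set (d.-tuple R) -> \bar R})
  (p : R) (u : nat -> d.-tuple R -> R[i]) : 1 <= p -> (forall k, cmeasurable (u k)) ->
  (forall e : R, 0 < e -> exists N, forall n m, (N <= n)%N -> (N <= m)%N ->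
     (Ip mu p (fun x => (u n x - u m x)%R) <= e%:E)%E) ->
  exists f, cmeasurable f /\ tends0 (fun n => Ip mu p (fun x => u n x - f x)).
Proof.
move=> p1 mu_ hC.
have p0 : 0 < p by lra.
have e0 k : 0 < (4 : R) ^- k.+1 by rewrite invr_gt0 exprn_gt0.
have [N_ hN_] := choice (fun k => hC _ (e0 k)).
pose phi := fix phi k := if k is k'.+1 then maxn (phi k').+1 (N_ k) else N_ 0%N.
have phiS k : (phi k < phi k.+1)%N by rewrite /= leq_max leqnn.
have phiG k : (k <= phi k)%N by elim: k => // k /leq_ltn_trans; apply.
have phiN k : (N_ k <= phi k)%N by case: k => //= k; rewrite leq_maxr.
have hae := @Ip_fast_ae R d mu p (fun k x => u (phi k.+1) x - u (phi k) x) p1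
  (fun k => cmeasurableB _ _ _ (mu_ _) (mu_ _))
  (fun k => hN_ k _ _ (leq_trans (phiN k) (ltnW (phiS k))) (phiN k)).
(* Upper limits of the components define a measurable function everywhere; they agree with the
   limits wherever the subsequence converges. *)
pose f x := Complex (fine (limn_esup (fun k => (cRe (u (phi k) x))%:E)))
                    (fine (limn_esup (fun k => (cIm (u (phi k) x))%:E))).
have mf : cmeasurable f.
  split.
    apply: (measurableT_comp (@fine_measurable R setT measurableT)).
    by apply: measurable_fun_limn_esup => k; apply/measurable_EFinP; case: (mu_ (phi k)).
  apply: (measurableT_comp (@fine_measurable R setT measurableT)).
  by apply: measurable_fun_limn_esup => k; apply/measurable_EFinP; case: (mu_ (phi k)).
exists f; split => //.
have r01 := powR_half_lt1 p p0.
have hcv : {ae mu, forall x, ccvg (fun k => u (phi k) x) (f x)}.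
  case: hae => N [mN N0 sN]; exists N; split => // x /= nh; apply: sN => /= -[C [C0 hc]]; apply: nh.
  have cvR : cvgn (fun k => cRe (u (phi k) x)).
    apply: (geometric_cauchy_cvg _ C _ r01 C0) => k; apply: le_trans (hc k).
    by rewrite -cReN -cReD; exact: ler_cRe.
  have cvI : cvgn (fun k => cIm (u (phi k) x)).
    apply: (geometric_cauchy_cvg _ C _ r01 C0) => k; apply: le_trans (hc k).
    by rewrite -cImN -cImD; exact: ler_cIm.
  move/cvg_ex: cvR => [a ha]; move/cvg_ex: cvI => [b hb].
  have fa : f x = Complex a b.
    by rewrite /f (cvg_limn_einf_sup (cvg_EFinn _ _ ha)).2 (cvg_limn_einf_sup (cvg_EFinn _ _ hb)).2.
  rewrite fa /ccvg.
  apply/cvgnP => e ep; have e2 : 0 < e / 2 by lra.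
  have [N1 h1] := (cvgnP _ _).1 ha _ e2; have [N2 h2] := (cvgnP _ _).1 hb _ e2.
  exists (maxn N1 N2) => n; rewrite geq_max => /andP[/h1 l1 /h2 l2].
  rewrite sub0r normrN (ger0_norm (cabs_ge0 _)); apply: (le_trans (cabs_le _)).
  rewrite cReD cImD cReN cImN /= distrC [`|cIm _ - b|]distrC.
  lra.
move=> e ep; have [N hN] := hC _ ep; exists N => n Nn.
apply: (@Ip_fatou R d mu p (fun k x => u n x - u (phi (k + N)%N) x)) => //.
- by move=> k; exact: cmeasurableB.
- exact: cmeasurableB.
- case: hcv => A [mA A0 sA]; exists A; split => // x /= nh; apply: sA => /= hx; apply: nh.
  apply/cvgnP => e' e'0; have [M hM] := (cvgnP _ _).1 hx _ e'0.
  exists M => k Mk; have := hM (k + N)%N (leq_trans Mk (leq_addr _ _)).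
  rewrite !sub0r !normrN (_ : u n x - _ - _ = - (u (phi (k + N)%N) x - f x)); last by ring.
  by rewrite cabsN.
- move=> k; apply: hN => //.
  by apply: leq_trans (phiG _); rewrite leq_addl.
Qed.

(** * Product integrals and the Fejer kernel *)

Definition tcons {R : realType} {d : nat} (t : R) (y : d.-tuple R) : d.+1.-tuple R :=
  [tuple of t :: y].

Definition tbehead {R : realType} {d : nat} (x : d.+1.-tuple R) : d.-tuple R :=
  [tuple tnth x (lift ord0 i) | i < d].

Lemma tnth_tcons0 {R : realType} (d : nat) (t : R) (y : d.-tuple R) : tnth (tcons t y) ord0 = t.
Proof. by []. Qed.

Lemma tnth_tconsS {R : realType} (d : nat) (t : R) (y : d.-tuple R) (k : 'I_d) :
  tnth (tcons t y) (lift ord0 k) = tnth y k.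
Proof. by rewrite tnthS. Qed.

Lemma tbehead_tcons {R : realType} (d : nat) (t : R) (y : d.-tuple R) : tbehead (tcons t y) = y.
Proof. by apply: tuple_ext => k; rewrite tnth_mktuple tnth_tconsS. Qed.

Lemma measurable_tbehead {R : realType} (d : nat) : measurable_fun setT (@tbehead R d).
Proof.
apply/measurable_fun_tnthP => k.
rewrite (_ : _ \o _ = fun x => tnth x (lift ord0 k)); last first.
  by apply/funext => x /=; rewrite tnth_mktuple.
exact: measurable_coord.
Qed.

Lemma forall_ordS (d : nat) (P : 'I_d.+1 -> Prop) :
  (forall k, P k) <-> P ord0 /\ forall k : 'I_d, P (lift ord0 k).
Proof.
split=> [h|[h0 h1] k]; first by split.
by case: (unliftP ord0 k) => [j ->|->].
Qed.

(** Induction on the dimension needs a Lebesgue measure one dimension lower, whereas only [leb] is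
    given. The slab where the first coordinate lies in [0, 1] has unit thickness, so projecting the
    restriction of [leb] to it gives one. *)
Lemma lebesgue_behead {R : realType} (d : nat) (leb : {measure set (d.+1.-tuple R) -> \bar R}) :
  is_lebesgue leb -> exists leb' : {measure set (d.-tuple R) -> \bar R}, is_lebesgue leb'.
Proof.
move=> hl.
pose D : set (d.+1.-tuple R) := (fun x => tnth x ord0) @^-1` `[0, 1].
have mD : measurable D.
  by rewrite -[D]setTI; apply: measurable_coord => //; exact: measurable_itv.
pose m_ : {measure set (d.-tuple R) -> \bar R} := pushforward (mrestr leb mD) (@tbehead R d).
exists (m_ (measurable_tbehead d)) => a b ab.
change (leb ((@tbehead R d @^-1` (box a b)) `&` D) = (\prod_(i < d) (tnth b i - tnth a i))%:E).
rewrite (_ : _ `&` D = box (tcons 0 a) (tcons 1 b)); last first.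
  apply/seteqP; split => x /=.
    move=> [h]; rewrite /D /= in_itv /= => h0; apply/forall_ordS; split => [|k].
      by rewrite !tnth_tcons0.
    by rewrite !tnth_tconsS; have := h k; rewrite tnth_mktuple.
  move=> /forall_ordS[h0 h]; split => [k|]; last by rewrite /D /= in_itv.
  by rewrite tnth_mktuple; have := h k; rewrite !tnth_tconsS.
rewrite hl; last by apply/forall_ordS; split => [|k]; rewrite ?tnth_tcons0 ?ler01 // !tnth_tconsS.
rewrite big_ord_recl !tnth_tcons0 subr0 mul1r; congr (_%:E).
by apply: eq_bigr => k _; rewrite !tnth_tconsS.
Qed.

Lemma measurable_tcons {R : realType} (d : nat) :
  measurable_fun setT (fun z : R * d.-tuple R => tcons z.1 z.2).
Proof. exact: measurable_cons. Qed.

Lemma lebesgue_tcons {R : realType} (d : nat) (leb : {measure set (d.+1.-tuple R) -> \bar R})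
   (leb' : {measure set (d.-tuple R) -> \bar R}) (hl : is_lebesgue leb) (hl' : is_lebesgue leb') :
  forall A, measurable A ->
  leb A = ((@lebesgue_measure R) \x (sigma_lebesgue hl'))%E ((fun z => tcons z.1 z.2) @^-1` A).
Proof.
move=> A mA.
pose m_ : {measure set (d.+1.-tuple R) -> \bar R} :=
  pushforward ((@lebesgue_measure R) \x (sigma_lebesgue hl'))%E (fun z => tcons z.1 z.2).
rewrite (@measure_unique_boxes _ _ leb (m_ (measurable_tcons d))) //; last exact: lebesgue_cube.
move=> a b; rewrite lebesgue_box //.
change (m_ (measurable_tcons d) (box a b)) with (((@lebesgue_measure R) \x (sigma_lebesgue hl'))%E ((fun z => tcons z.1 z.2) @^-1` (box a b))).
rewrite (_ : _ @^-1` _ = `[tnth a ord0, tnth b ord0] `*` box (tbehead a) (tbehead b)); last first.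
  apply/seteqP; split => -[t y] /=.
    move=> /forall_ordS[h0 h]; split; first by rewrite in_itv /=.
    by move=> k; have := h k; rewrite !tnth_mktuple tnth_tconsS.
  rewrite in_itv /= => -[h0 h]; apply/forall_ordS; split => // k.
  by rewrite tnth_tconsS; have := h k; rewrite !tnth_mktuple.
rewrite product_measure1E //; last exact: measurable_box.
rewrite /= lebesgue_measure_itv /= /sigma_lebesgue lebesgue_box // big_ord_recl.
under [in RHS]eq_bigr do rewrite !tnth_mktuple.
case: ltP => [h|h]; last by rewrite max_l ?mul0r ?mul0e // subr_le0 -lee_fin.
by rewrite max_r ?subr_ge0 ?ltW // -EFinD -EFinM.
Qed.

(** Peels off one coordinate of a product integrand, which is the inductive step for integrals of
    the tents and of their transforms. *)
Lemma integral_tcons_prod {R : realType} (d : nat) (leb : {measure set (d.+1.-tuple R) -> \bar R})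
   (leb' : {measure set (d.-tuple R) -> \bar R}) (g : R -> R) (G : d.-tuple R -> R) :
  is_lebesgue leb -> is_lebesgue leb' ->
  (@lebesgue_measure R).-integrable setT (EFin \o g) -> leb'.-integrable setT (EFin \o G) ->
  leb.-integrable setT (fun x => (g (tnth x ord0) * G (tbehead x))%:E) /\
  \int[leb]_x (g (tnth x ord0) * G (tbehead x)) =
  (\int[lebesgue_measure]_t g t) * \int[leb']_y G y.
Proof.
move=> hl hl' ig iG.
have mg : measurable_fun setT g by apply/measurable_EFinP; exact: measurable_int ig.
have mG : measurable_fun setT G by apply/measurable_EFinP; exact: measurable_int iG.
pose F x : \bar R := (g (tnth x ord0) * G (tbehead x))%:E.
pose mu := @lebesgue_measure R.
pose nu := sigma_lebesgue hl'.
pose phi := (fun z : R * d.-tuple R => tcons z.1 z.2).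
have mphi : measurable_fun setT phi by exact: measurable_tcons.
have mF : measurable_fun setT F.
  apply/measurable_EFinP; apply: measurable_funM.
    by apply: (measurableT_comp mg); exact: measurable_coord.
  by apply: (measurableT_comp mG); exact: measurable_tbehead.
have FE t y : (F \o phi) (t, y) = (g t * G y)%:E by rewrite /F /phi /= tbehead_tcons.
have [_ fg] := integrableP _ _ _ ig; have [_ fG] := integrableP _ _ _ iG.
have iF : (mu \x nu)%E.-integrable setT (F \o phi).
  apply/integrable12ltyP; first exact: measurableT_comp.
  rewrite (_ : (\int[_]_x _)%E = (\int[mu]_x (`|g x|%:E * \int[leb']_y `|G y|%:E))%E); last first.
    apply: eq_integral => t _.
    rewrite -ge0_integralZl_EFin //; last by apply/measurable_EFinP; exact: measurableT_comp.
    by apply: eq_integral => y _; rewrite FE abse_EFin normrM.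
  have fG' : (\int[leb']_y `|G y|%:E)%E \is a fin_num.
    by rewrite ge0_fin_numE ?integral_ge0 //.
  rewrite -(fineK fG'); under eq_integral do rewrite muleC.
  rewrite ge0_integralZl_EFin //; last 2 first.
    by apply/measurable_EFinP; exact: measurableT_comp.
    by apply: fine_ge0; apply: integral_ge0.
  by rewrite lte_mul_pinfty // lee_fin fine_ge0 // integral_ge0.
pose m_ : {measure set (d.+1.-tuple R) -> \bar R} := pushforward (mu \x nu)%E phi.
have eqm f : (\int[leb]_x f x = \int[m_ mphi]_x f x)%E.
  by apply: eq_measure_integral => A mA _; exact: lebesgue_tcons.
have iF' : leb.-integrable setT F.
  apply/integrableP; split => //; rewrite eqm ge0_integral_pushforward //.
    by case/integrableP : iF.
  exact: (measurableT_comp (@abse_measurable R setT) mF).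
split; first exact: iF'.
rewrite /Rintegral -fineM; last 2 first.
- exact: integrable_fin_num.
- exact: integrable_fin_num.
congr fine; rewrite eqm integral_pushforward // preimage_setT.
rewrite -(@integral12_prod_meas1 _ _ _ _ _ mu nu) //.
have fG' : (\int[leb']_y (G y)%:E)%E \is a fin_num by exact: integrable_fin_num.
have inner t : fubini_F nu (F \o phi) t = ((g t)%:E * \int[leb']_y (G y)%:E)%E.
  rewrite -(@integralZl _ _ _ leb' setT measurableT (EFin \o G)) //.
  by rewrite /fubini_F; apply: eq_integral => y _; rewrite FE EFinM.
transitivity (\int[mu]_t ((g t)%:E * (fine (\int[leb']_y (G y)%:E))%:E))%E.
  by apply: eq_integral => t _; rewrite (fineK fG') -inner.
by rewrite integralZr // fineK.
Qed.

Lemma is_derivePP {R : realType} (F : R -> R) (x l : R) :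
  is_derive x 1 F l -> derivable F x 1 /\ 'D_1 F x = l.
Proof. by case. Qed.

Lemma Rintegral_FTC {R : realType} (f F : R -> R) (a b : R) : a < b ->
  (forall x : R, derivable F x 1 /\ 'D_1 F x = f x) -> continuous f ->
  \int[lebesgue_measure]_(x in `[a, b]) f x = F b - F a.
Proof.
move=> ab dF cf.
have cF : continuous F.
  by move=> x; apply: differentiable_continuous; apply/derivable1_diffP; have [] := dF x.
rewrite /Rintegral (@continuous_FTC2 _ f F) //.
- exact: continuous_subspaceT.
- split.
  + by move=> x _; have [] := dF x.
  + exact/cvg_at_right_filter/cF.
  + exact/cvg_at_left_filter/cF.
- by move=> x _; rewrite derive1E; have [_ ->] := dF x.
Qed.

(** * The tent function and its cosine transform *)

Definition tent {R : realType} (a s : R) : R := Num.max 0 (1 - `|s| / a).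

Lemma tent_ge0 {R : realType} (a s : R) : 0 <= tent a s.
Proof. by rewrite /tent le_max lexx. Qed.

Lemma tent_out {R : realType} (a s : R) : 0 < a -> a <= `|s| -> tent a s = 0.
Proof.
move=> a0 h; rewrite /tent max_l // subr_le0 ler_pdivlMr // mul1r //.
Qed.

Lemma continuous_tent {R : realType} (a : R) : continuous (tent a).
Proof.
move=> s; rewrite /tent.
apply: (@continuous_max R _ (cst 0) (fun s => 1 - `|s| / a)); first exact: cvg_cst.
apply: cvgB; first exact: cvg_cst.
by apply: cvgMr_tmp; apply: norm_continuous.
Qed.

(** The one-dimensional Fejer kernel, with its continuous value at t = 0. *)
Definition kern {R : realType} (a t : R) : R :=
  if t == 0 then a else 2 * (1 - cos (a * t)) / (a * t ^+ 2).

Lemma continuous_cosM {R : realType} (t : R) : continuous (fun s : R => cos (t * s)).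
Proof.
move=> s; apply: (@continuous_comp _ _ _ (fun s => t * s) cos).
  exact: mulrl_continuous.
exact: continuous_cos.
Qed.

Lemma Rintegral_tent_cos {R : realType} (a t : R) : 0 < a ->
  (@lebesgue_measure R).-integrable setT (fun s => (tent a s * cos (t * s))%:E) /\
  \int[lebesgue_measure]_s (tent a s * cos (t * s)) = kern a t.
Proof.
move=> a0.
pose f s := tent a s * cos (t * s).
have cf : continuous f.
  by move=> s; apply: cvgM; [exact: continuous_tent|exact: continuous_cosM].
have fE : f = f \_ `[- a, a].
  apply/funext => s; rewrite patchE; case: ifPn => // /negP h.
  rewrite /f tent_out ?mul0r // leNgt; apply/negP => lt; apply: h.
  by rewrite inE /= in_itv /= -ler_norml ltW.
have icf x y : (@lebesgue_measure R).-integrable `[x, y] (EFin \o f).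
  by apply: continuous_compact_integrable; [exact: segment_compact|exact: continuous_subspaceT].
have iT : (@lebesgue_measure R).-integrable setT (EFin \o f).
  rewrite fE.
  have -> : EFin \o (f \_ `[- a, a]) = (EFin \o f) \_ `[- a, a].
    by apply/funext => s /=; rewrite !patchE; case: ifPn.
  by rewrite -integrable_mkcond.
split; first exact: iT.
rewrite -/f [in LHS]fE -Rintegral_mkcond.
have := @Rintegral_itvB R f (BLeft (- a)) (BRight a) 0 (icf _ _).
have leN : - a <= 0 by lra.
have le0 : 0 <= a by lra.
rewrite !bnd_simp => /(_ leN le0).
rewrite Rintegral_itv_obnd_cbnd; last first.
  by apply: integrableS (icf 0 a) => //; exact: subset_itv_oc_cc.
move=> /eqP; rewrite subr_eq => /eqP ->.
have h1 : {in `[0, a]%classic, f =1 (fun s => (1 - s / a) * cos (t * s))}.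
  move=> s; rewrite inE /= in_itv /= => /andP[s0 sa].
  by rewrite /f /tent max_r ger0_norm // subr_ge0 ler_pdivrMr ?mul1r.
have h2 : {in `[- a, 0]%classic, f =1 (fun s => (1 + s / a) * cos (t * s))}.
  move=> s; rewrite inE /= in_itv /= => /andP[s0 sa].
  have -> : 1 + s / a = 1 - (- s) / a by rewrite mulNr opprK.
  by rewrite /f /tent max_r ler0_norm // subr_ge0 ler_pdivrMr ?mul1r //; lra.
transitivity (\int[lebesgue_measure]_(s in `[0, a]) ((1 - s / a) * cos (t * s)) +
  \int[lebesgue_measure]_(s in `[- a, 0]) ((1 + s / a) * cos (t * s))).
  by congr (_ + _); apply: eq_Rintegral.
have an : a != 0 by rewrite gt_eqF.
(* The antiderivatives found by integration by parts divide by t, so the quadratic case t = 0 is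
   computed separately. Each half of the support has its own antiderivative because of the absolute
   value. *)
rewrite /kern; case: eqVneq => [->|t0].
  rewrite (@Rintegral_FTC _ _ (fun s => s - s ^+ 2 / (2 * a))) //; first last.
  - move=> s; apply: cvgM; last exact: continuous_cosM.
    apply: cvgB; first exact: cvg_cst. exact: mulrr_continuous.
  - move=> s; apply: is_derivePP; apply: is_derive_eq; rewrite /GRing.scale /= mul0r cos0 ?expr1.
    by field.
  rewrite (@Rintegral_FTC _ _ (fun s => s + s ^+ 2 / (2 * a))) //; first last.
  - move=> s; apply: cvgM; last exact: continuous_cosM.
    apply: cvgD; first exact: cvg_cst. exact: mulrr_continuous.
  - move=> s; apply: is_derivePP; apply: is_derive_eq; rewrite /GRing.scale /= mul0r cos0 ?expr1.
    by field.
  - by lra.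
  by field.
have dsin (s : R) : is_derive s 1 (fun s : R => sin (t * s)) (t * cos (t * s)).
  have h3 : is_derive s 1 (fun y : R => t * y) t.
    by apply: is_derive_eq; rewrite /GRing.scale /=; ring.
  have h4 := @is_derive1_comp R sin (fun y : R => t * y) s _ _ (is_derive_sin _) h3.
  by rewrite mulrC.
have dcos (s : R) : is_derive s 1 (fun s : R => cos (t * s)) (- t * sin (t * s)).
  have h3 : is_derive s 1 (fun y : R => t * y) t.
    by apply: is_derive_eq; rewrite /GRing.scale /=; ring.
  have h4 := @is_derive1_comp R cos (fun y : R => t * y) s _ _ (is_derive_cos _) h3.
  by rewrite mulrC mulrN -mulNr.
rewrite (@Rintegral_FTC _ _ (fun s => (1 - s / a) * sin (t * s) / t - cos (t * s) / (a * t ^+ 2))) //; first last.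
- move=> s; apply: cvgM; last exact: continuous_cosM.
  apply: cvgB; first exact: cvg_cst. exact: mulrr_continuous.
- move=> s; apply: is_derivePP; apply: is_derive_eq; rewrite /GRing.scale /=.
  by field; rewrite an t0.
rewrite (@Rintegral_FTC _ _ (fun s => (1 + s / a) * sin (t * s) / t + cos (t * s) / (a * t ^+ 2))) //; first last.
- move=> s; apply: cvgM; last exact: continuous_cosM.
  apply: cvgD; first exact: cvg_cst. exact: mulrr_continuous.
- move=> s; apply: is_derivePP; apply: is_derive_eq; rewrite /GRing.scale /=.
  by field; rewrite an t0.
- by lra.
rewrite !mulr0 cos0 sin0 mulrN cosN [t * a]mulrC.
by field; rewrite an t0.
Qed.

Lemma cos_le1n {R : realType} (t : R) : 0 <= 1 - cos t.
Proof. by rewrite subr_ge0; exact: cos_le1. Qed.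

Lemma kern_ge0 {R : realType} (a t : R) : 0 < a -> 0 <= kern a t.
Proof.
move=> a0; rewrite /kern; case: eqP => _; first exact: ltW.
apply: divr_ge0; first by apply: mulr_ge0 => //; exact: cos_le1n.
by apply: mulr_ge0; [exact: ltW|exact: sqr_ge0].
Qed.

Lemma kern_scale {R : realType} (a t : R) : 0 < a -> kern a t = a * kern 1 (a * t).
Proof.
move=> a0; rewrite /kern mulf_eq0 (gt_eqF a0) /=; case: (eqVneq t 0) => [_|t0]; first by rewrite mulr1.
by rewrite !mul1r; field; rewrite t0 gt_eqF.
Qed.

Lemma integrable_tent {R : realType} (a : R) : 0 < a ->
  (@lebesgue_measure R).-integrable setT (EFin \o tent a).
Proof.
move=> a0; have [h _] := Rintegral_tent_cos a 0 a0.
by apply: eq_integrable h => // s _; rewrite /= mul0r cos0 mulr1.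
Qed.

Lemma measurable_tent {R : realType} (a : R) : measurable_fun setT (tent a).
Proof. by apply: continuous_measurable_fun; exact: continuous_tent. Qed.

(** The integral representation with cos <= 1; the value at t = 0 is attained when the cosine is
    identically 1. *)
Lemma kern_le {R : realType} (a t : R) : 0 < a -> kern a t <= a.
Proof.
move=> a0; have [h e] := Rintegral_tent_cos a t a0.
have [h0 e0] := Rintegral_tent_cos a 0 a0.
apply: (@le_trans _ _ (kern a 0)); last by rewrite /kern eqxx.
rewrite -e -e0; apply: le_Rintegral => // s _.
by rewrite mul0r cos0 mulr1 ler_piMr ?tent_ge0 ?cos_le1.
Qed.

(** Inversion is discontinuous at 0, hence the factorization through the sign and a power of |x|.
    The sign vanishes at 0 and so reproduces the convention that the inverse of 0 is 0. *)
Lemma measurable_invr {R : realType} : measurable_fun setT (@GRing.inv R).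
Proof.
have -> : @GRing.inv R = (fun x => Num.sg x * `|x| `^ (-1)).
  apply/funext => x; rewrite powR_inv1 //.
  have [->|x0] := eqVneq x 0; first by rewrite sgr0 invr0 mul0r.
  have [xp|xn] := ltP 0 x; first by rewrite gtr0_sg // gtr0_norm // mul1r.
  have {}xn : x < 0 by rewrite lt_def eq_sym x0.
  by rewrite ltr0_sg // ltr0_norm // invrN mulN1r opprK.
apply: measurable_funM.
  rewrite (_ : Num.sg = fun x : R => if x == 0 then 0 else if x < 0 then -1 else 1).
    apply: measurable_fun_ifT => //; first exact: measurable_fun_eqr.
    by apply: measurable_fun_ifT => //; exact: measurable_fun_ltr.
  by apply/funext => x; rewrite /Num.sg.
apply: (@measurableT_comp _ _ _ _ _ _ (@powR R ^~ (-1))); first exact: measurable_powR.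
exact: normr_measurable.
Qed.

Lemma measurable_cos {R : realType} : measurable_fun setT (@cos R).
Proof. by apply: continuous_measurable_fun; exact: continuous_cos. Qed.
Lemma measurable_sin {R : realType} : measurable_fun setT (@sin R).
Proof. by apply: continuous_measurable_fun; exact: continuous_sin. Qed.

Lemma measurable_kern {R : realType} (a : R) : measurable_fun setT (kern a).
Proof.
rewrite /kern; apply: measurable_fun_ifT => //.
  by apply: measurable_fun_eqr => //; exact: measurable_cst.
apply: measurable_funM.
  apply: measurable_funM => //; apply: measurable_funB => //.
  by apply: continuous_measurable_fun; exact: continuous_cosM.
apply: (@measurableT_comp _ _ _ _ _ _ (@GRing.inv R)); first exact: measurable_invr.
by apply: measurable_funM => //; exact: measurable_funX.
Qed.

(** For t^2 <= 1 from [kern 1 t <= 1], otherwise from the decay 4 / t^2. The right side is a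
    multiple of the derivative of the arctangent, which is integrable. *)
Lemma kern1_le {R : realType} (t : R) : kern 1 t <= 8 * (oneDsqr t)^-1.
Proof.
have o0 : 0 < oneDsqr t by rewrite /oneDsqr ltr_pwDl // sqr_ge0.
rewrite ler_pdivlMr //.
have [h|h] := leP (t ^+ 2) 1.
  have := kern_le 1 t ltr01; have := kern_ge0 1 t ltr01; rewrite /oneDsqr; nra.
rewrite /kern; case: eqVneq => [t0|t0]; first by rewrite t0 expr0n /= in h; lra.
rewrite !mul1r mulrAC ler_pdivrMr; last lra.
have := cos_geN1 t; have := cos_le1 t; rewrite /oneDsqr; nra.
Qed.

Lemma integrable_kern1 {R : realType} :
  (@lebesgue_measure R).-integrable setT (EFin \o kern 1).
Proof.
have io : (@lebesgue_measure R).-integrable setT (fun t => (8 * (oneDsqr t)^-1)%:E).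
  have o0 (t : R) : 0 <= (oneDsqr t)^-1 by rewrite invr_ge0 /oneDsqr addr_ge0 ?sqr_ge0.
  have mo : measurable_fun setT (fun t : R => (oneDsqr t)^-1).
    by apply: continuous_measurable_fun; exact: continuous_oneDsqrV.
  under eq_fun do rewrite EFinM.
  apply: integrableZl => //; apply/integrableP; split; first exact/measurable_EFinP.
  under eq_integral do rewrite gee0_abs ?lee_fin //.
  rewrite ge0_symfun_integralT //; last 2 first.
  - exact: continuous_oneDsqrV.
  - by move=> t; rewrite /= /oneDsqr sqrrN.
  by rewrite -set_itvcy integral0y_oneDsqr -EFinM ltry.
apply: le_integrable io => //.
  by apply/measurable_EFinP; exact: measurable_kern.
move=> t _; rewrite !abse_EFin lee_fin ger0_norm ?kern_ge0 //.
by apply: le_trans (ler_norm _); exact: kern1_le.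
Qed.

(** If the integral vanished, the kernel would be 0 almost everywhere. It is positive on ]0, 1[,
    because sin t > 0 there excludes cos t = 1. *)
Lemma Rintegral_kern1_gt0 {R : realType} :
  0 < \int[lebesgue_measure]_t (kern 1 t : R).
Proof.
rewrite lt_def Rintegral_ge0 ?andbT; last by move=> t _; exact: kern_ge0.
apply/eqP => h.
have mk : measurable_fun setT (EFin \o @kern R 1) by apply/measurable_EFinP; exact: measurable_kern.
have : (\int[lebesgue_measure]_t `|(EFin \o @kern R 1) t| = 0)%E.
  rewrite (_ : 0%E = (\int[lebesgue_measure]_t kern (1 : R) t)%:E); last by rewrite h.
  rewrite /Rintegral fineK; last exact: integrable_fin_num integrable_kern1.
  by apply: eq_integral => t _; rewrite /= ger0_norm ?kern_ge0.
move/ae_eq_integral_abs => /(_ measurableT mk)[N [mN N0 sN]].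
have : (lebesgue_measure (`]0%R, 1%R[ : set R) <= lebesgue_measure N)%E.
  apply: le_measure; rewrite ?inE //=.
  move=> t; rewrite /= in_itv /= => /andP[t0 t1]; apply: sN => /= /(_ I) /= [].
  rewrite /kern gt_eqF // !mul1r => /eqP; rewrite mulf_eq0 mulf_eq0 pnatr_eq0 /= invr_eq0 sqrf_eq0.
  rewrite (gt_eqF t0) orbF subr_eq0 => /eqP/esym c1.
  have : 0 < sin t by apply: sin_gt0_pi; rewrite t0 /=; have := @pi_ge2 R; lra.
  have := cos2Dsin2 t; rewrite c1 => h2; nra.
by rewrite N0 lebesgue_measure_itv /= lte01 oppr0 adde0 lee_fin ler10.
Qed.

Definition Wtent {R : realType} {d : nat} (a : R) (s : d.-tuple R) : R :=
  \prod_(i < d) tent a (tnth s i).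

Definition Kern {R : realType} {d : nat} (a : R) (x : d.-tuple R) : R :=
  \prod_(i < d) kern a (tnth x i).

Lemma prod_tcons {R : realType} (d : nat) (g : R -> R) (x : d.+1.-tuple R) :
  \prod_(i < d.+1) g (tnth x i) = g (tnth x ord0) * \prod_(i < d) g (tnth (tbehead x) i).
Proof.
rewrite big_ord_recl; congr (_ * _); apply: eq_bigr => k _.
by rewrite tnth_mktuple.
Qed.

Lemma dotp_tcons {R : realType} (d : nat) (x y : d.+1.-tuple R) :
  dotp x y = tnth x ord0 * tnth y ord0 + dotp (tbehead x) (tbehead y).
Proof.
rewrite /dotp big_ord_recl; congr (_ + _); apply: eq_bigr => k _.
by rewrite !tnth_mktuple.
Qed.

Lemma lebesgue_dim0 {R : realType} (leb : {measure set (0.-tuple R) -> \bar R}) :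
  is_lebesgue leb -> leb setT = 1%E.
Proof.
move=> hl; have := hl [tuple] [tuple]; rewrite big_ord0 => <-; last by case.
by congr (leb _); apply/seteqP; split => // x _ [].
Qed.

Lemma Rintegral_dim0_cst {R : realType} (leb : {measure set (0.-tuple R) -> \bar R}) (c : R) :
  is_lebesgue leb -> leb.-integrable setT (fun=> c%:E) /\ \int[leb]_x c = c.
Proof.
move=> hl; split.
  apply/integrableP; split; first exact: measurable_cst.
  by rewrite integral_cst // (lebesgue_dim0 leb hl) mule1 ltry.
by rewrite /Rintegral integral_cst // (lebesgue_dim0 leb hl) mule1.
Qed.

Lemma Rintegral_prod_coord {R : realType} (d : nat) (leb : {measure set (d.-tuple R) -> \bar R})
  (g : R -> R) : is_lebesgue leb -> (@lebesgue_measure R).-integrable setT (EFin \o g) ->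
  leb.-integrable setT (fun x => (\prod_(i < d) g (tnth x i))%:E) /\
  \int[leb]_x (\prod_(i < d) g (tnth x i)) = (\int[lebesgue_measure]_t g t) ^+ d.
Proof.
move=> + ig; elim: d leb => [|d IH] leb hl.
  have [h1 h2] := Rintegral_dim0_cst leb 1 hl.
  split; first by apply: eq_integrable h1 => // x _; rewrite big_ord0.
  by rewrite expr0 -[RHS]h2; apply: eq_Rintegral => x _; rewrite big_ord0.
have [leb' hl'] := lebesgue_behead d leb hl.
have [i1 e1] := IH leb' hl'.
have [i2 e2] := integral_tcons_prod d leb leb' g _ hl hl' ig i1.
split; first by apply: eq_integrable i2 => // x _; rewrite prod_tcons.
by rewrite exprS -e1 -e2; apply: eq_Rintegral => x _; rewrite prod_tcons.
Qed.

Lemma integral_neg {R : realType} (d : nat) (leb : {measure set (d.-tuple R) -> \bar R})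
   (f : d.-tuple R -> \bar R) : is_lebesgue leb -> measurable_fun setT f ->
  (\int[leb]_x f (negt x) = \int[leb]_x f x)%E.
Proof.
move=> hl mf; rewrite -(integral_coord_affine d leb (fun=> -1) (zerot R d) f hl) //.
  apply: eq_integral => x _; congr f; apply: tuple_ext => k.
  by rewrite !tnth_mktuple tnth_map tnth_nseq addr0 mulN1r.
by move=> k; rewrite normrN normr1.
Qed.

Lemma measurable_dotp {R : realType} (d : nat) (x : d.-tuple R) :
  measurable_fun setT (dotp x).
Proof.
apply: measurable_sum => k; apply: measurable_funM => //; exact: measurable_coord.
Qed.

Lemma measurable_negt {R : realType} (d : nat) : measurable_fun setT (@negt R d).
Proof.
apply/measurable_fun_tnthP => k.
rewrite (_ : _ \o _ = fun x => - tnth x k); last by apply/funext => x /=; rewrite tnth_map.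
by apply: measurable_funN; exact: measurable_coord.
Qed.

Lemma dotpN {R : realType} (d : nat) (x y : d.-tuple R) : dotp x (negt y) = - dotp x y.
Proof. by rewrite /dotp -sumrN; apply: eq_bigr => k _; rewrite tnth_map mulrN. Qed.

Lemma dotpC {R : realType} (d : nat) (x y : d.-tuple R) : dotp x y = dotp y x.
Proof. by apply: eq_bigr => k _; rewrite mulrC. Qed.

Lemma dotpDr {R : realType} (d : nat) (x y z : d.-tuple R) :
  dotp x (addt y z) = dotp x y + dotp x z.
Proof. by rewrite /dotp -big_split; apply: eq_bigr => k _; rewrite tnth_mktuple mulrDr. Qed.

Lemma measurable_Wtent {R : realType} (d : nat) (a : R) : measurable_fun setT (@Wtent R d a).
Proof.
apply: measurable_prod => k _.
exact: (measurableT_comp (measurable_tent a) (measurable_coord d k)).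
Qed.

Lemma tent_neg {R : realType} (a s : R) : tent a (- s) = tent a s.
Proof. by rewrite /tent normrN. Qed.

Lemma integrable_Wtent {R : realType} (d : nat) (leb : {measure set (d.-tuple R) -> \bar R})
   (a : R) : is_lebesgue leb -> 0 < a -> leb.-integrable setT (EFin \o Wtent a).
Proof. by move=> hl a0; have [] := Rintegral_prod_coord d leb (tent a) hl (integrable_tent a a0). Qed.

Lemma Wtent_ge0 {R : realType} (d : nat) (a : R) (s : d.-tuple R) : 0 <= Wtent a s.
Proof. by apply: prodr_ge0 => k _; exact: tent_ge0. Qed.

Lemma integrable_bounded_mul {dd} {T : measurableType dd} {R : realType}
  (mu : {measure set T -> \bar R}) (b g : T -> R) :
  measurable_fun setT b -> (forall x, `|b x| <= 1) -> mu.-integrable setT (EFin \o g) ->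
  mu.-integrable setT (fun x => (b x * g x)%:E).
Proof.
move=> mb b1 ig; have mg : measurable_fun setT g by apply/measurable_EFinP; exact: measurable_int ig.
apply: le_integrable ig => //; first by apply/measurable_EFinP; exact: measurable_funM.
by move=> x _; rewrite /= lee_fin normrM ler_piMl.
Qed.

Lemma integrable_cos_Wtent {R : realType} (d : nat) (leb : {measure set (d.-tuple R) -> \bar R})
   (a : R) (x : d.-tuple R) : is_lebesgue leb -> 0 < a ->
  leb.-integrable setT (fun s => (cos (dotp x s) * Wtent a s)%:E).
Proof.
move=> hl a0; apply: integrable_bounded_mul; last exact: integrable_Wtent.
  exact: (measurableT_comp measurable_cos (measurable_dotp d x)).
by move=> s; exact: cos_max.
Qed.

Lemma integrable_sin_Wtent {R : realType} (d : nat) (leb : {measure set (d.-tuple R) -> \bar R})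
   (a : R) (x : d.-tuple R) : is_lebesgue leb -> 0 < a ->
  leb.-integrable setT (fun s => (sin (dotp x s) * Wtent a s)%:E).
Proof.
move=> hl a0; apply: integrable_bounded_mul; last exact: integrable_Wtent.
  exact: (measurableT_comp measurable_sin (measurable_dotp d x)).
by move=> s; exact: sin_max.
Qed.

Lemma Rintegral_sin_Wtent {R : realType} (d : nat) (leb : {measure set (d.-tuple R) -> \bar R})
   (a : R) (x : d.-tuple R) : is_lebesgue leb -> 0 < a ->
  \int[leb]_s (sin (dotp x s) * Wtent a s) = 0.
Proof.
move=> hl a0; have i1 := integrable_sin_Wtent d leb a x hl a0.
have h : \int[leb]_s (sin (dotp x s) * Wtent a s) = - (\int[leb]_s (sin (dotp x s) * Wtent a s)).
  have -> : - (\int[leb]_s (sin (dotp x s) * Wtent a s)) = \int[leb]_s (-1 * (sin (dotp x s) * Wtent a s)).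
    by rewrite RintegralZl // mulN1r.
  rewrite {1}/Rintegral -integral_neg //; last exact: measurable_int i1.
  congr fine; apply: eq_integral => s _; rewrite dotpN sinN !mulNr mul1r; congr (- (_ * _))%:E.
  by apply: eq_bigr => k _; rewrite tnth_map tent_neg.
lra.
Qed.

(** Induction on the dimension through the addition formula for the cosine; the product of sines
    integrates to 0 by oddness of the sine. *)
Lemma Rintegral_cos_Wtent {R : realType} (d : nat) (leb : {measure set (d.-tuple R) -> \bar R})
   (a : R) (x : d.-tuple R) : is_lebesgue leb -> 0 < a ->
  \int[leb]_s (cos (dotp x s) * Wtent a s) = Kern a x.
Proof.
move=> + a0; elim: d leb x => [|d IH] leb x hl.
  have [h1 h2] := Rintegral_dim0_cst leb 1 hl.
  rewrite /Kern big_ord0 -[RHS]h2; apply: eq_Rintegral => s _.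
  by rewrite /dotp /Wtent !big_ord0 cos0 mulr1.
have [leb' hl'] := lebesgue_behead d leb hl.
have [i0 e0] := Rintegral_tent_cos a (tnth x ord0) a0.
have i0' : (@lebesgue_measure R).-integrable setT (fun s => (sin (tnth x ord0 * s) * tent a s)%:E).
  apply: integrable_bounded_mul; last exact: integrable_tent.
    apply: (@measurableT_comp _ _ _ _ _ _ (@sin R)); first exact: measurable_sin.
    by apply: measurable_funM.
  by move=> s; exact: sin_max.
have [j1 f1] := integral_tcons_prod d leb leb' _ _ hl hl' i0 (integrable_cos_Wtent d leb' a (tbehead x) hl' a0).
have [j2 f2] := integral_tcons_prod d leb leb' _ _ hl hl' i0' (integrable_sin_Wtent d leb' a (tbehead x) hl' a0).
rewrite Rintegral_sin_Wtent // mulr0 in f2.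
rewrite IH // e0 in f1.
rewrite /Kern prod_tcons -/(Kern a (tbehead x)) -f1 -[RHS]subr0 -f2 -RintegralB //.
apply: eq_Rintegral => s _; rewrite dotp_tcons cosD /Wtent prod_tcons; ring.
Qed.

Lemma Kern_ge0 {R : realType} (d : nat) (a : R) (x : d.-tuple R) : 0 < a -> 0 <= Kern a x.
Proof. by move=> a0; apply: prodr_ge0 => k _; exact: kern_ge0. Qed.

Lemma measurable_Kern {R : realType} (d : nat) (a : R) : measurable_fun setT (@Kern R d a).
Proof.
apply: measurable_prod => k _.
exact: (measurableT_comp (measurable_kern a) (measurable_coord d k)).
Qed.

Lemma Kern_scale {R : realType} (d : nat) (a : R) (x : d.-tuple R) : 0 < a ->
  Kern a x = a ^+ d * Kern 1 (coord_affine (fun=> a) (zerot R d) x).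
Proof.
move=> a0; rewrite /Kern -[X in a ^+ X](card_ord d) -prodr_const -big_split /=.
by apply: eq_bigr => k _; rewrite kern_scale // tnth_mktuple tnth_nseq addr0.
Qed.

Lemma integrable_Kern1 {R : realType} (d : nat) (leb : {measure set (d.-tuple R) -> \bar R}) :
  is_lebesgue leb -> leb.-integrable setT (EFin \o Kern 1) /\ 0 < \int[leb]_x Kern 1 x.
Proof.
move=> hl; have [h1 h2] := Rintegral_prod_coord d leb (kern 1) hl integrable_kern1.
by split => //; rewrite h2 exprn_gt0 // Rintegral_kern1_gt0.
Qed.

(** * Continuity of translations in L^2 *)

Definition scalet {R : realType} {d : nat} (c : R) (u : d.-tuple R) : d.-tuple R :=
  [tuple c * tnth u i | i < d].

(** Continuity is asked only along u / (n + 1), for each fixed u and without uniformity in u.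
    Dominated convergence under the Fejer kernel needs no more. *)
Definition shift_continuous {R : realType} {d : nat}
  (leb : {measure set (d.-tuple R) -> \bar R}) (f : d.-tuple R -> R[i]) :=
  forall u, tends0 (fun n => Ip leb 2 (fun x => f (addt x (scalet n.+1%:R^-1 u)) - f x)).

Lemma cmeasurable_addt {R : realType} (d : nat) (f : d.-tuple R -> R[i]) (w : d.-tuple R) :
  cmeasurable f -> cmeasurable (fun x => f (addt x w)).
Proof. by move=> hf; apply: cmeasurable_comp => //; exact: measurable_addt. Qed.

Lemma shift_continuousD {R : realType} {d : nat}
  (leb : {measure set (d.-tuple R) -> \bar R}) (f g : d.-tuple R -> R[i]) :
  cmeasurable f -> cmeasurable g -> shift_continuous leb f -> shift_continuous leb g ->
  shift_continuous leb (fun x => f x + g x).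
Proof.
move=> mf mg hf hg u.
apply: (tends0_le _ _ _ (tends0Z (2 `^ 2) _ (powR_ge0 _ _) (tends0D _ _ (hf u) (hg u)))) => n.
apply: le_trans (IpD _ _ _ _ _ (ler0n _ 2) _ _); last 2 first.
- by apply: cmeasurableB => //; exact: cmeasurable_addt.
- by apply: cmeasurableB => //; exact: cmeasurable_addt.
rewrite le_eqVlt; apply/orP; left; apply/eqP; congr Ip; apply/funext => x; ring.
Qed.

Lemma shift_continuousZ {R : realType} {d : nat}
  (leb : {measure set (d.-tuple R) -> \bar R}) (a : R[i]) (f : d.-tuple R -> R[i]) :
  cmeasurable f -> shift_continuous leb f -> shift_continuous leb (fun x => a * f x).
Proof.
move=> mf hf u.
apply: (tends0_le _ _ _ (tends0Z (cabs a `^ 2) _ (powR_ge0 _ _) (hf u))) => n.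
rewrite -IpZ; last by apply: cmeasurableB => //; exact: cmeasurable_addt.
by under eq_fun do rewrite -mulrBr.
Qed.

(** Translation invariance makes the error f - g as small after the shift as before it. *)
Lemma shift_continuous_limit {R : realType} {d : nat}
  (leb : {measure set (d.-tuple R) -> \bar R}) (f : d.-tuple R -> R[i]) :
  is_lebesgue leb -> cmeasurable f ->
  (forall e : R, 0 < e -> exists g, [/\ cmeasurable g, shift_continuous leb g &
     (Ip leb 2 (fun x => (f x - g x)%R) <= e%:E)%E]) ->
  shift_continuous leb f.
Proof.
move=> hl mf h u e e0.
(* The quasi-triangle constant for p = 2 is 4 and is used twice: 4 (1 + 4 (1 + 1)) = 36 <= 40. *)
have e40 : 0 < e / 40 by lra.
have [g [mg cg fg]] := h _ e40.
have [N hN] := cg u _ e40; exists N => n /hN hn.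
set w := scalet _ u in hn *.
have E4 : (2 : R) `^ 2 = 4 by rewrite -[2 in X in _ `^ X]/(2%:R) powR_mulrn //; ring.
have m1 : cmeasurable (fun x => g (addt x w) - g x).
  by apply: cmeasurableB => //; exact: cmeasurable_addt.
have m2 : cmeasurable (fun x => f x - g x) by exact: cmeasurableB.
have m3 := cmeasurable_addt d _ w m2.
have i3 := Ip_addt d leb 2 w _ hl m2.
have -> : (fun x => f (addt x w) - f x) =
  (fun x => (g (addt x w) - g x) + ((f (addt x w) - g (addt x w)) - (f x - g x))).
  by apply/funext => x; ring.
have k1 := IpD d leb 2 _ _ (ler0n _ 2) m1 (cmeasurableB _ _ _ m3 m2).
have k2 := IpB d leb 2 _ _ (ler0n _ 2) m3 m2.
rewrite E4 in k1 k2.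
apply: (le_trans k1); apply: (@le_trans _ _ (4%:E * ((e / 40)%:E + 4%:E * ((e / 40)%:E + (e / 40)%:E)))%E).
  apply: lee_wpmul2l; first by [].
  apply: leeD; first exact: hn.
  apply: (le_trans k2); apply: lee_wpmul2l; first by [].
  by apply: leeD; [rewrite i3; exact: fg|exact: fg].
change ((4 * (e / 40 + 4 * (e / 40 + e / 40)))%:E <= e%:E)%E; rewrite lee_fin.
by rewrite [X in X <= _](_ : _ = 36 / 40 * e); [lra|field].
Qed.

Lemma shift_continuousM {R : realType} {d : nat}
  (leb : {measure set (d.-tuple R) -> \bar R}) (f g : d.-tuple R -> R[i]) :
  cmeasurable f -> cmeasurable g -> (forall x, cabs (f x) <= 1) -> (forall x, cabs (g x) <= 1) ->
  shift_continuous leb f -> shift_continuous leb g ->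
  shift_continuous leb (fun x => f x * g x).
Proof.
move=> mf mg f1 g1 hf hg u.
apply: (tends0_le _ _ _ (tends0Z (2 `^ 2) _ (powR_ge0 _ _) (tends0D _ _ (hg u) (hf u)))) => n.
set w := scalet _ u.
have mfw := cmeasurable_addt d _ w mf; have mgw := cmeasurable_addt d _ w mg.
have -> : (fun x => f (addt x w) * g (addt x w) - f x * g x) =
  (fun x => f (addt x w) * (g (addt x w) - g x) + (f (addt x w) - f x) * g x).
  by apply/funext => x; ring.
have m1 : cmeasurable (fun x => g (addt x w) - g x) by exact: cmeasurableB.
have m2 : cmeasurable (fun x => f (addt x w) - f x) by exact: cmeasurableB.
apply: (le_trans (IpD _ _ _ _ _ (ler0n _ 2) (cmeasurableM _ _ _ mfw m1) (cmeasurableM _ _ _ m2 mg))).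
apply: lee_wpmul2l; first by rewrite lee_fin powR_ge0.
apply: leeD; apply: Ip_le => //; try exact: cmeasurableM.
- by move=> x; rewrite cabsM ler_piMl ?cabs_ge0.
- by move=> x; rewrite cabsM ler_piMr ?cabs_ge0.
Qed.

Definition cindic {R : realType} {d : nat} (A : set (d.-tuple R)) (x : d.-tuple R) : R[i] :=
  Complex (\1_A x) 0.

Lemma cmeasurable_cindic {R : realType} {d : nat} (A : set (d.-tuple R)) :
  measurable A -> cmeasurable (@cindic R d A).
Proof. by move=> mA; split; [exact: measurable_indic|exact: measurable_cst]. Qed.

Lemma cabs_real {R : realType} (r : R) : cabs (Complex r 0) = `|r|.
Proof. by rewrite /cabs /= expr0n /= addr0 sqrtr_sqr. Qed.

Lemma cabs_cindic {R : realType} {d : nat} (A : set (d.-tuple R)) x : cabs (cindic A x) = \1_A x.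
Proof. by rewrite cabs_real ger0_norm. Qed.

Lemma cabs_cindic_le1 {R : realType} {d : nat} (A : set (d.-tuple R)) x : cabs (cindic A x) <= 1.
Proof. by rewrite cabs_cindic indicE lern1 leq_b1. Qed.

Lemma Ip_cindic {R : realType} {d : nat} (mu : {measure set (d.-tuple R) -> \bar R}) (p : R)
  (A : set (d.-tuple R)) : p != 0 -> measurable A -> Ip mu p (cindic A) = mu A.
Proof.
move=> p0 mA; rewrite /Ip -[X in _ = mu X](setIT A) -integral_indic //.
apply: eq_integral => x _; rewrite cabs_cindic indicE.
by case: (_ \in _); rewrite ?powR1 ?powR0.
Qed.

Lemma cindicI {R : realType} {d : nat} (A B : set (d.-tuple R)) x :
  cindic (A `&` B) x = cindic A x * cindic B x.
Proof.
by rewrite /cindic indicI; apply: complex_ext; rewrite ?cReM ?cImM /= !(mulr0, mul0r, subr0, addr0).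
Qed.

Lemma ae_coord_neq {R : realType} {d : nat} (leb : {measure set (d.-tuple R) -> \bar R})
  (k : 'I_d) (c : R) : is_lebesgue leb -> {ae leb, forall x, tnth x k != c}.
Proof.
move=> hl.
pose B n := box [tuple (if j == k then c else - n%:R) | j < d] [tuple (if j == k then c else n%:R) | j < d].
have hB n : leb.-negligible (B n).
  exists (B n); split; [exact: measurable_box| |by []].
  rewrite lebesgue_box // (bigD1 k) //= !tnth_mktuple eqxx subrr.
  by rewrite maxxx mul0r.
apply: negligibleS (negligible_bigcup hB) => x /= /negP; rewrite negbK => /eqP xk.
have [n _ hn] : (\bigcup_n (@cube R d n)) x by rewrite cube_cover.
exists n => // j; have := hn j; rewrite !tnth_mktuple; case: eqP => // -> _.
by rewrite xk lexx.
Qed.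

(** The hyperplanes that carry the faces are null sets, and off them membership in the box is
    unchanged by small shifts. The indicator of the box enlarged by |u_k| in each direction
    dominates all the differences. *)
Lemma shift_continuous_box {R : realType} {d : nat}
  (leb : {measure set (d.-tuple R) -> \bar R}) (a b : d.-tuple R) : is_lebesgue leb ->
  shift_continuous leb (cindic (box a b)).
Proof.
move=> hl u.
pose a' := [tuple tnth a k - `|tnth u k| | k < d].
pose b' := [tuple tnth b k + `|tnth u k| | k < d].
have mB := measurable_box d a b; have mB' := measurable_box d a' b'.
have inv1 n : 0 < (n.+1%:R : R)^-1 <= 1 by rewrite invr_gt0 ltr0n /= invf_le1 ?ltr0n // ler1n.
have small n k : `|tnth (scalet n.+1%:R^-1 u) k| <= `|tnth u k|.
  have /andP[i0 i1] := inv1 n.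
  by rewrite tnth_mktuple normrM (gtr0_norm i0) ler_piMl.
apply: (@Ip_dominated R d leb 2 (fun n x => cindic (box a b) (addt x (scalet n.+1%:R^-1 u)))
   (cindic (box a b)) (cindic (box a' b'))).
- by rewrite ler1n.
- by move=> n; apply: cmeasurable_addt; exact: cmeasurable_cindic.
- exact: cmeasurable_cindic.
- exact: cmeasurable_cindic.
- have h1 : {ae leb, forall x, forall k, tnth x k != tnth a k}.
    by apply: filter_forall => k; exact: ae_coord_neq.
  have h2 : {ae leb, forall x, forall k, tnth x k != tnth b k}.
    by apply: filter_forall => k; exact: ae_coord_neq.
  apply: filterS2 h1 h2 => x xa xb.
  have hk k : exists N, forall n, (N <= n)%N ->
     (tnth a k <= tnth (addt x (scalet n.+1%:R^-1 u)) k <= tnth b k) = (tnth a k <= tnth x k <= tnth b k).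
    pose dl := Num.min `|tnth x k - tnth a k| `|tnth x k - tnth b k|.
    have dl0 : 0 < dl by rewrite /dl lt_min !normr_gt0 !subr_eq0 xa xb.
    (* From this rank on, the k-th coordinate of u / (n + 1) is below the distance [dl] from x to
       the two hyperplanes of direction k. *)
    exists (Num.truncn (`|tnth u k| / dl)) => n Nn.
    have lt : `|tnth (scalet n.+1%:R^-1 u) k| < dl.
      rewrite tnth_mktuple normrM (gtr0_norm (andP (inv1 n)).1) mulrC ltr_pdivrMr ?ltr0n // mulrC -ltr_pdivrMr //.
      apply: lt_le_trans (truncnS_gt _) _; by rewrite ler_nat.
    move: lt; rewrite /dl lt_min => /andP[l1 l2].
    rewrite tnth_mktuple; set z := tnth (scalet _ u) k in l1 l2 *.
    have {}xa := xa k; have {}xb := xb k.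
    move: l1 l2 xa xb; set X := tnth x k; set A := tnth a k; set B := tnth b k => l1 l2 xa xb.
    have eA : (A <= X + z) = (A <= X).
      move: l1; have [AX|XA] := leP A X.
        by rewrite (@ger0_norm _ (X - A)) ?subr_ge0 // ltr_norml => /andP[? ?]; apply/idP; lra.
      by rewrite (@ltr0_norm _ (X - A)) ?subr_lt0 // ltr_norml => /andP[? ?]; apply/negbTE; rewrite -ltNge; lra.
    have eB : (X + z <= B) = (X <= B).
      move: l2; have [XB|BX] := leP X B.
        by rewrite (@ler0_norm _ (X - B)) ?subr_le0 // ltr_norml => /andP[? ?]; apply/idP; lra.
      by rewrite (@gtr0_norm _ (X - B)) ?subr_gt0 // ltr_norml => /andP[? ?]; apply/negbTE; rewrite -ltNge; lra.
    by rewrite eA eB.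
  have [N hN] := choice hk.
  apply/cvgnP => e e0; exists (\max_k N k) => n Nn.
  rewrite (_ : cindic _ (addt _ _) = cindic (box a b) x) ?subrr ?cabs0 ?subrr ?normr0 ?ltW //.
  rewrite /cindic !indicE; congr (Complex (nat_of_bool _)%:R _).
  apply/idP/idP; rewrite !inE => h k; have := h k; rewrite hN //.
    by apply: leq_trans Nn; exact: leq_bigmax.
  by apply: leq_trans Nn; exact: leq_bigmax.
- by rewrite Ip_cindic ?pnatr_eq0 // lebesgue_box // ltry.
- move=> n x; rewrite cabs_cindic.
  have -> : cindic (box a b) (addt x (scalet n.+1%:R^-1 u)) - cindic (box a b) x =
     Complex (\1_(box a b) (addt x (scalet n.+1%:R^-1 u)) - \1_(box a b) x) 0.
    by apply: complex_ext; rewrite ?cReD ?cReN ?cImD ?cImN /= ?subr0.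
  rewrite cabs_real !indicE.
  have [xb|xb] := boolP (x \in box a' b').
    by case: (_ \in _); case: (_ \in _); rewrite /= ?subrr ?subr0 ?sub0r ?normrN ?normr1 ?normr0 ?ler01.
  have -> : (x \in box a b) = false.
    apply/negP; rewrite inE => h; move/negP: xb; apply; rewrite inE => k.
    have := h k; rewrite !tnth_mktuple => /andP[h1 h2].
    by have := normr_ge0 (tnth u k) => h3; apply/andP; split; lra.
  have -> : (addt x (scalet n.+1%:R^-1 u) \in box a b) = false.
    apply/negP; rewrite inE => h; move/negP: xb; apply; rewrite inE => k.
    have := h k; have := small n k; rewrite ![tnth (addt _ _) _]tnth_mktuple.
    set z := tnth (scalet _ _) k; rewrite ler_norml => /andP[h3 h4] /andP[h1 h2].
    by rewrite !tnth_mktuple; apply/andP; split; lra.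
  by rewrite subrr normr0.
Qed.

Section FiniteRange.
Import finmap HBSimple HBNNSimple.

Lemma ccvg_eventually {R : realType} (u : nat -> R[i]) (l : R[i]) (N : nat) :
  (forall n, (N <= n)%N -> u n = l) -> ccvg u l.
Proof.
move=> h; apply/cvgnP => e e0; exists N => n /h ->.
by rewrite subrr cabs0 subrr normr0 ltW.
Qed.

(** Intersecting with every cube keeps the indicators in L^2, so that the class can be closed under
    complements. *)
Definition shift_continuous_sets {R : realType} {d : nat}
  (leb : {measure set (d.-tuple R) -> \bar R}) : set (set (d.-tuple R)) :=
  [set A | measurable A /\ forall N, shift_continuous leb (cindic (A `&` cube d N))].

Lemma measurable_cube {R : realType} (d n : nat) : measurable (@cube R d n).
Proof. exact: measurable_box. Qed.

Lemma cindic_box_cube {R : realType} (d : nat) (a b : d.-tuple R) N :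
  exists a' b' : d.-tuple R, box a b `&` cube d N = box a' b'.
Proof.
have [a' [b' ->]] : boxes d (box a b `&` cube d N).
  by apply: boxes_setI; eexists; eexists.
by exists a', b'.
Qed.

Lemma shift_continuous_cube {R : realType} (d : nat)
  (leb : {measure set (d.-tuple R) -> \bar R}) N : is_lebesgue leb ->
  shift_continuous leb (cindic (cube d N)).
Proof. by move=> hl; exact: shift_continuous_box. Qed.

Lemma shift_continuous_sets_setU {R : realType} (d : nat)
  (leb : {measure set (d.-tuple R) -> \bar R}) A B : is_lebesgue leb ->
  shift_continuous_sets leb A -> shift_continuous_sets leb B ->
  shift_continuous_sets leb (A `|` B).
Proof.
move=> hl [mA hA] [mB hB]; split; first exact: measurableU.
move=> N; have mC := @measurable_cube R d N.
have mAC := measurableI _ _ mA mC; have mBC := measurableI _ _ mB mC.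
have cA := cmeasurable_cindic _ mAC; have cB := cmeasurable_cindic _ mBC.
have -> : cindic ((A `|` B) `&` cube d N) =
  (fun x => (cindic (A `&` cube d N) x + cindic (B `&` cube d N) x) +
     (-1) * (cindic (A `&` cube d N) x * cindic (B `&` cube d N) x)).
  apply/funext => x; rewrite !cindicI.
  have -> : cindic (A `|` B) x = cindic A x + cindic B x - cindic A x * cindic B x.
    rewrite /cindic !indicE in_setU.
    by apply: complex_ext; rewrite ?cReD ?cImD ?cReN ?cImN ?cReM ?cImM /=;
      case: (_ \in A); case: (_ \in B); rewrite /= ; ring.
  have : cindic (cube d N) x * cindic (cube d N) x = cindic (cube d N) x :> R[i].
    by rewrite -cindicI setIid.
  set a := cindic A x; set b := cindic B x; set c := cindic _ x => cc.
  rewrite (_ : a * c * (b * c) = a * b * (c * c)); last by ring.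
  by rewrite cc; ring.
apply: shift_continuousD.
- exact: cmeasurableD.
- by apply: cmeasurableM; [exact: cmeasurableC|exact: cmeasurableM].
- exact: shift_continuousD.
- apply: shift_continuousZ; first exact: cmeasurableM.
  by apply: shift_continuousM => //; exact: cabs_cindic_le1.
Qed.

Lemma shift_continuous_sigma_algebra {R : realType} (d : nat)
  (leb : {measure set (d.-tuple R) -> \bar R}) : is_lebesgue leb ->
  sigma_algebra setT (shift_continuous_sets leb).
Proof.
move=> hl.
have h0 : shift_continuous_sets leb set0.
  split; first exact: measurable0.
  move=> N u e e0; exists 0%N => n _; rewrite set0I.
  have -> : (fun x => cindic (set0 : set (d.-tuple R)) (addt x (scalet n.+1%:R^-1 u)) - cindic set0 x) = (fun=> 0 : R[i]).
    by apply/funext => x; rewrite /cindic !indic0 subrr.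
  by rewrite Ip0 ?pnatr_eq0 // lee_fin ltW.
split; [exact: h0|move=> A [mA hA]|move=> A hA].
  split; first by rewrite setTD; exact: measurableC.
  move=> N; have mC := @measurable_cube R d N.
  have mAC := measurableI _ _ mA mC.
  have -> : cindic ((setT `\` A) `&` cube d N) =
    (fun x => cindic (cube d N) x + (-1) * cindic (A `&` cube d N) x).
    rewrite setTD; apply/funext => x; rewrite /cindic !indicE !in_setI in_setC /=.
    by apply: complex_ext; rewrite ?cReD ?cImD ?cReN ?cImN ?cReM ?cImM /=;
      case: (_ \in A); case: (_ \in cube _ _); rewrite /= ; ring.
  apply: shift_continuousD.
  - exact: cmeasurable_cindic.
  - by apply: cmeasurableM; [exact: cmeasurableC|exact: cmeasurable_cindic].
  - exact: shift_continuous_cube.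
  - by apply: shift_continuousZ => //; exact: cmeasurable_cindic.
have mA n : measurable (A n) := (hA n).1.
have mU : measurable (\bigcup_k A k) by exact: bigcup_measurable.
split; first exact: mU.
move=> N; have mC := @measurable_cube R d N.
pose B m := \big[setU/set0]_(k < m) A k.
have hB m : shift_continuous_sets leb (B m).
  elim: m => [|m IH]; first (rewrite /B big_ord0; exact: h0).
  rewrite /B big_ord_recr /=; exact: (shift_continuous_sets_setU _ _ _ _ hl IH (hA m)).
have mB m : measurable (B m) := (hB m).1.
apply: shift_continuous_limit => //; first by apply: cmeasurable_cindic; exact: measurableI.
move=> e e0.
suff hT : tends0 (fun m => Ip leb 2 (fun x => cindic (B m `&` cube d N) x -
    cindic (\bigcup_k A k `&` cube d N) x)).
  have [M hM] := hT _ e0; exists (cindic (B M `&` cube d N)); split.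
  - by apply: cmeasurable_cindic; exact: measurableI.
  - exact: (hB M).2.
  - by rewrite IpB_sym; exact: (hM M (leqnn M)).
apply: (@Ip_dominated R d leb 2 (fun m => cindic (B m `&` cube d N))
   (cindic (\bigcup_k A k `&` cube d N)) (cindic (cube d N))).
- by rewrite ler1n.
- by move=> m; apply: cmeasurable_cindic; exact: measurableI.
- by apply: cmeasurable_cindic; exact: measurableI.
- exact: cmeasurable_cindic.
- apply: aeW => x; have [[k _ Akx]|nx] := pselect ((\bigcup_k A k) x).
    apply: (@ccvg_eventually _ _ _ k.+1) => n kn.
    rewrite !cindicI; congr (_ * _); rewrite /cindic !indicE.
    have hx1 : x \in \bigcup_k A k by apply/mem_set; exists k.
    have hx2 : x \in B n by apply/mem_set; rewrite /B -bigcup_mkord; exists k.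
    by rewrite hx1 hx2.
  apply: (@ccvg_eventually _ _ _ 0) => n _.
  rewrite !cindicI; congr (_ * _); rewrite /cindic !indicE.
  have hx1 : (x \in \bigcup_k A k) = false by apply/memNset.
  have hx2 : (x \in B n) = false.
    by apply/memNset; rewrite /B -bigcup_mkord => -[k /= _ Akx]; apply: nx; exists k.
  by rewrite hx1 hx2.
- by rewrite Ip_cindic ?pnatr_eq0 //; exact: lebesgue_cube.
- move=> n x; rewrite !cindicI -mulrBl cabsM ler_piMl ?cabs_ge0 //.
  rewrite /cindic (_ : Complex _ _ - Complex _ _ = Complex (\1_(B n) x - \1_(\bigcup_k A k) x) 0).
    rewrite cabs_real !indicE.
    by case: (_ \in _); case: (_ \in _); rewrite /= ?subrr ?subr0 ?sub0r ?normrN ?normr1 ?normr0 ?ler01.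
  by apply: complex_ext; rewrite ?cReD ?cReN ?cImD ?cImN /= ?subr0.
Qed.

(** The class contains the boxes and is a sigma-algebra, hence it contains every Borel set; for a
    set inside a cube the intersection with that cube changes nothing. *)
Lemma shift_continuous_indic {R : realType} (d : nat)
  (leb : {measure set (d.-tuple R) -> \bar R}) (A : set (d.-tuple R)) N : is_lebesgue leb ->
  measurable A -> A `<=` cube d N -> shift_continuous leb (cindic A).
Proof.
move=> hl mA AN.
have : (<<s boxes d >>) `<=` shift_continuous_sets leb.
  apply: smallest_sub; first exact: shift_continuous_sigma_algebra.
  move=> _ [a [b ->]]; split; first exact: measurable_box.
  by move=> M; have [a' [b' ->]] := cindic_box_cube d a b M; exact: shift_continuous_box.
rewrite -measurable_boxes => /(_ A mA)[_ /(_ N)].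
by rewrite setIidl.
Qed.

Lemma shift_continuous_ge0 {R : realType} (d : nat)
  (leb : {measure set (d.-tuple R) -> \bar R}) (g : d.-tuple R -> R) N : is_lebesgue leb ->
  measurable_fun setT g -> (forall x, 0 <= g x) -> (forall x, ~ cube d N x -> g x = 0) ->
  (Ip leb 2 (fun x => Complex (g x) 0%R) < +oo)%E ->
  shift_continuous leb (fun x => Complex (g x) 0).
Proof.
move=> hl mg g0 gN fin.
have mcg : cmeasurable (fun x => Complex (g x) 0) by split => //; exact: measurable_cst.
have mEg : measurable_fun setT (EFin \o g) by exact/measurable_EFinP.
have g0' x : setT x -> (0 <= (EFin \o g) x)%E by move=> _; rewrite /= lee_fin.
pose s := nnsfun_approx measurableT mEg.
have s_g n x : s n x <= g x.
  by rewrite /s nnsfun_approxE -lee_fin; exact: le_approx.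
have ms n : cmeasurable (fun x => Complex (s n x) 0) by split => //; exact: measurable_cst.
have scs n : shift_continuous leb (fun x => Complex (s n x) 0).
  have -> : (fun x => Complex (s n x) 0) = (fun x => \sum_(y <- fset_set (range (s n)))
     Complex y 0 * cindic ((s n) @^-1` [set y]) x).
    apply/funext => x; apply: complex_ext.
      rewrite (big_morph cRe cReD cRe0) [LHS]/= fimfunE fsbig_finite //.
      by apply: eq_bigr => y _; rewrite cReM /= mul0r subr0.
    rewrite (big_morph cIm cImD cIm0) [LHS]/= big1 // => y _.
    by rewrite cImM /= mulr0 mul0r addr0.
  have mpre y : measurable ((s n) @^-1` [set y]) by [].
  have hsum (I : Type) (r : seq I) (F : I -> d.-tuple R -> R[i]) :
     (forall k, cmeasurable (F k) /\ shift_continuous leb (F k)) ->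
     cmeasurable (fun x => \sum_(k <- r) F k x) /\ shift_continuous leb (fun x => \sum_(k <- r) F k x).
    move=> hF; elim: r => [|k r [IH1 IH2]].
      under eq_fun do rewrite big_nil; split; first exact: cmeasurableC.
      move=> u e e0; exists 0%N => j _; under eq_fun do rewrite subrr.
      by rewrite Ip0 ?pnatr_eq0 // lee_fin ltW.
    have [h1 h2] := hF k.
    have -> : (fun x => \sum_(j <- k :: r) F j x) = (fun x => F k x + \sum_(j <- r) F j x).
      by apply/funext => x; rewrite big_cons.
    split; first exact: (cmeasurableD _ _ _ h1 IH1).
    exact: (shift_continuousD _ _ _ h1 IH1 h2 IH2).
  refine (hsum _ _ (fun y x => Complex y 0 * cindic ((s n) @^-1` [set y]) x) _).2 => y.
  split; first by apply: cmeasurableM; [exact: cmeasurableC|exact: cmeasurable_cindic].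
  (* The level set of the value 0 need not lie in the cube, but its coefficient is 0. Every other
     level set lies where g is positive. *)
  have [->|y0] := eqVneq y 0.
    move=> u e e0; exists 0%N => j _; under eq_fun do rewrite !mul0r subrr.
    by rewrite Ip0 ?pnatr_eq0 // lee_fin ltW.
  apply: shift_continuousZ; first exact: cmeasurable_cindic.
  apply: (shift_continuous_indic _ _ _ N) => //.
  move=> x /= sx; apply: contrapT => /gN gx; have := s_g n x.
  rewrite gx sx => le0; have : 0 <= s n x by [].
  by rewrite sx => ge0; move/eqP: y0; apply; apply/eqP; rewrite eq_le le0 ge0.
apply: shift_continuous_limit => // e e0.
have dE n x : Complex (s n x) 0 - Complex (g x) 0 = Complex (s n x - g x) 0.
  by apply: complex_ext; rewrite ?cReD ?cReN ?cImD ?cImN /= ?subr0.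
suff hT : tends0 (fun n => Ip leb 2 (fun x => Complex (s n x) 0 - Complex (g x) 0)).
  have [M hM] := hT _ e0; exists (fun x => Complex (s M x) 0); split; [exact: ms|exact: scs|].
  by rewrite IpB_sym; exact: (hM M (leqnn M)).
apply: (@Ip_dominated R d leb 2 (fun n x => Complex (s n x) 0) (fun x => Complex (g x) 0)
  (fun x => Complex (g x) 0)) => //.
- by rewrite ler1n.
- apply: aeW => x.
  have hx : (fun n => s n x) @ \oo --> g x.
    exact: fine_cvg (@cvg_nnsfun_approx _ _ _ _ measurableT _ mEg g0' x I).
  apply/cvgnP => e' e'0; have [M hM] := (cvgnP _ _).1 hx _ e'0; exists M => n /hM.
  by rewrite dE cabs_real sub0r normrN normr_id distrC.
- move=> n x; rewrite dE !cabs_real (ger0_norm (g0 x)) ler0_norm ?subr_le0 // opprB.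
  by rewrite gerBl.
Qed.

End FiniteRange.

(** * Plancherel *)

Lemma measurable_Rintegral_param {R : realType} {d : nat}
  (leb : {measure set (d.-tuple R) -> \bar R}) (Phi : d.-tuple R * d.-tuple R -> R) :
  is_lebesgue leb -> measurable_fun setT Phi ->
  measurable_fun setT (fun s => \int[leb]_x Phi (s, x)).
Proof.
move=> hl mP.
have mE : measurable_fun setT (EFin \o Phi) by exact/measurable_EFinP.
rewrite /Rintegral.
apply: (measurableT_comp (@fine_measurable R setT measurableT)).
rewrite (_ : (fun s => _) = (fun s => \int[leb]_x ((EFin \o Phi)^\+ (s, x)) - \int[leb]_x ((EFin \o Phi)^\- (s, x)))%E).
  apply: emeasurable_funB.
    apply: (@measurable_fun_fubini_tonelli_F _ _ _ _ _ (sigma_lebesgue hl)) => //.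
    exact: measurable_funepos.
  apply: (@measurable_fun_fubini_tonelli_F _ _ _ _ _ (sigma_lebesgue hl)) => //.
  exact: measurable_funeneg.
by apply/funext => s; rewrite integralE; congr (_ - _)%E; apply: eq_integral => x _; rewrite ?funeposE ?funenegE.
Qed.

Lemma measurable_pair1 {R : realType} {d : nat} (Phi : d.-tuple R * d.-tuple R -> R) s :
  measurable_fun setT Phi -> measurable_fun setT (fun x => Phi (s, x)).
Proof. by move=> mP; apply: measurableT_comp => //; exact: measurable_pair2. Qed.

(** A majorant of product form gives the absolute integrability needed for Fubini's theorem as well
    as the integrability of every section, so that the real-valued integrals lose no information. *)
Lemma RFubini_prod {R : realType} {d : nat}
  (leb : {measure set (d.-tuple R) -> \bar R}) (Phi : d.-tuple R * d.-tuple R -> R)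
  (G H : d.-tuple R -> R) :
  is_lebesgue leb -> measurable_fun setT Phi ->
  leb.-integrable setT (EFin \o G) -> leb.-integrable setT (EFin \o H) ->
  (forall x y, `|Phi (x, y)| <= `|G x| * `|H y|) ->
  [/\ \int[leb]_x (\int[leb]_y Phi (x, y)) = \int[leb]_y (\int[leb]_x Phi (x, y)),
     leb.-integrable setT (fun x => (\int[leb]_y Phi (x, y))%:E) &
     forall x, leb.-integrable setT (fun y => (Phi (x, y))%:E)].
Proof.
move=> hl mP iG iH bnd.
have mE : measurable_fun setT (EFin \o Phi) by exact/measurable_EFinP.
have [mG fG] := integrableP _ _ _ iG; have [mH fH] := integrableP _ _ _ iH.
have mGa : measurable_fun setT (fun x => `|G x|%:E).
  by apply/measurable_EFinP; apply: measurableT_comp => //; exact/measurable_EFinP.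
have mHa : measurable_fun setT (fun x => `|H x|%:E).
  by apply/measurable_EFinP; apply: measurableT_comp => //; exact/measurable_EFinP.
have i1 x : leb.-integrable setT (fun y => (Phi (x, y))%:E).
  apply: (@le_integrable _ _ _ _ _ measurableT _ (fun y => (G x * H y)%:E)).
  - by apply/measurable_EFinP; exact: measurable_pair1.
  - by move=> y _; rewrite /= lee_fin normrM.
  - by under eq_fun do rewrite EFinM; exact: integrableZl.
have i2 y : leb.-integrable setT (fun x => (Phi (x, y))%:E).
  apply: (@le_integrable _ _ _ _ _ measurableT _ (fun x => (H y * G x)%:E)).
  - apply/measurable_EFinP; apply: measurableT_comp => //.
  - by move=> x _; rewrite /= lee_fin normrM mulrC.
  - by under eq_fun do rewrite EFinM; exact: integrableZl.
have fin : (\int[leb]_x \int[leb]_y `|(EFin \o Phi) (x, y)| < +oo)%E.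
  have fH' : (\int[leb]_y `|H y|%:E)%E \is a fin_num by rewrite ge0_fin_numE ?integral_ge0.
  apply: (@le_lt_trans _ _ (\int[leb]_x ((fine (\int[leb]_y `|H y|%:E))%:E * `|G x|%:E))%E).
    apply: ge0_le_integral => //.
    - by move=> x _; exact: integral_ge0.
    - apply: (@measurable_fun_fubini_tonelli_F _ _ _ _ _ (sigma_lebesgue hl) (fun z => `|(EFin \o Phi) z|%E)) => //.
      exact: measurableT_comp.
    - by apply: measurable_funeM.
    - move=> x _; rewrite (fineK fH') muleC -ge0_integralZl_EFin //.
      apply: ge0_le_integral => //.
      + by apply: measurableT_comp => //; case/integrableP: (i1 x).
      + by apply: measurable_funeM.
      + by move=> y _; rewrite /= lee_fin.
  rewrite ge0_integralZl_EFin //; last by apply: fine_ge0; exact: integral_ge0.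
  by rewrite lte_mul_pinfty // lee_fin fine_ge0 // integral_ge0.
have e1 x : (\int[leb]_y (EFin \o Phi) (x, y))%E = (\int[leb]_y Phi (x, y))%:E.
  by rewrite /Rintegral fineK //; apply: integrable_fin_num => //; exact: i1.
have e2 y : (\int[leb]_x (EFin \o Phi) (x, y))%E = (\int[leb]_x Phi (x, y))%:E.
  by rewrite /Rintegral fineK //; apply: integrable_fin_num => //; exact: i2.
have [F1 F2] := Fubini_lebesgue d leb (EFin \o Phi) hl mE fin.
split => //.
- rewrite [LHS]/Rintegral [RHS]/Rintegral; congr fine.
  under eq_integral do rewrite -e1.
  by rewrite F1; apply: eq_integral => y _; rewrite e2.
- by apply: eq_integrable F2 => // x _; rewrite e1.
Qed.

Lemma Rintegral_coord_affine {R : realType} (d : nat) (leb : {measure set (d.-tuple R) -> \bar R})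
    (l : 'I_d -> R) (v : d.-tuple R) (f : d.-tuple R -> R) : is_lebesgue leb ->
  (forall i, l i != 0) -> leb.-integrable setT (EFin \o f) ->
  leb.-integrable setT (fun x => (f (coord_affine l v x))%:E) /\
  \int[leb]_x f x = (\prod_(i < d) `|l i|) * \int[leb]_x f (coord_affine l v x).
Proof.
move=> hl l0 intf; have [mf ff] := integrableP _ _ _ intf.
have P0 : 0 < \prod_(i < d) `|l i| by apply: prodr_gt0 => i _; rewrite normr_gt0.
set P := \prod_(i < d) _ in P0 *.
have mfa : measurable_fun setT (fun x => (f (coord_affine l v x))%:E).
  by apply: (measurableT_comp mf); exact: measurable_coord_affine.
have hp := ge0_integral_coord_affine d leb l v _ hl l0 (measurable_funepos mf) (fun x => funepos_ge0 _ x).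
have hn := ge0_integral_coord_affine d leb l v _ hl l0 (measurable_funeneg mf) (fun x => funeneg_ge0 _ x).
have ha := ge0_integral_coord_affine d leb l v _ hl l0 (measurableT_comp (@abse_measurable R setT) mf) (fun x => abse_ge0 _).
have ifa : leb.-integrable setT (fun x => (f (coord_affine l v x))%:E).
  apply/integrableP; split => //.
  move: ff; rewrite [X in (X < _)%E](_ : _ = (\int[leb]_x (abse \o (EFin \o f)) x)%E) // ha -/P.
  set I := (\int[_]_x _)%E; move: I => [r|//|//]; rewrite ?ltry //.
  by rewrite mulry gtr0_sg // mul1e.
split => //; rewrite /Rintegral integralE hp hn -/P [in RHS]integralE.
have fp := integrable_pos_fin_num measurableT ifa.
have fn := integrable_neg_fin_num measurableT ifa.
have ep : (\int[leb]_x (EFin \o f)^\+ (coord_affine l v x) = \int[leb]_x (fun x => (f (coord_affine l v x))%:E)^\+ x)%E.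
  by apply: eq_integral => x _; rewrite !funeposE.
have en : (\int[leb]_x (EFin \o f)^\- (coord_affine l v x) = \int[leb]_x (fun x => (f (coord_affine l v x))%:E)^\- x)%E.
  by apply: eq_integral => x _; rewrite !funenegE.
rewrite ep en -(fineK fp) -(fineK fn) -!EFinM -!EFinB /=; ring.
Qed.

(** * Energy of the transform against a tent *)

Definition cosT {R : realType} {d : nat} (leb : {measure set (d.-tuple R) -> \bar R})
  (f : d.-tuple R -> R) (s : d.-tuple R) : R := \int[leb]_x (cos (dotp s x) * f x).

Definition sinT {R : realType} {d : nat} (leb : {measure set (d.-tuple R) -> \bar R})
  (f : d.-tuple R -> R) (s : d.-tuple R) : R := \int[leb]_x (sin (dotp s x) * f x).

Lemma measurable_dotp2 {R : realType} {d : nat} :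
  measurable_fun setT (fun z : d.-tuple R * d.-tuple R => dotp z.1 z.2).
Proof.
apply: measurable_sum => k; apply: measurable_funM.
  by apply: (measurableT_comp (measurable_coord d k)).
by apply: (measurableT_comp (measurable_coord d k)).
Qed.

Lemma integrable_cos_mul {R : realType} {d : nat} (leb : {measure set (d.-tuple R) -> \bar R})
  (f : d.-tuple R -> R) (s : d.-tuple R) : leb.-integrable setT (EFin \o f) ->
  leb.-integrable setT (fun x => (cos (dotp s x) * f x)%:E).
Proof.
move=> intf; apply: integrable_bounded_mul => //.
  exact: (measurableT_comp measurable_cos (measurable_dotp d s)).
by move=> x; exact: cos_max.
Qed.

Lemma integrable_sin_mul {R : realType} {d : nat} (leb : {measure set (d.-tuple R) -> \bar R})
  (f : d.-tuple R -> R) (s : d.-tuple R) : leb.-integrable setT (EFin \o f) ->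
  leb.-integrable setT (fun x => (sin (dotp s x) * f x)%:E).
Proof.
move=> intf; apply: integrable_bounded_mul => //.
  exact: (measurableT_comp measurable_sin (measurable_dotp d s)).
by move=> x; exact: sin_max.
Qed.

Lemma cosT_le {R : realType} {d : nat} (leb : {measure set (d.-tuple R) -> \bar R})
  (f : d.-tuple R -> R) (s : d.-tuple R) : leb.-integrable setT (EFin \o f) ->
  `|cosT leb f s| <= \int[leb]_x `|f x|.
Proof.
move=> intf; have ic := integrable_cos_mul leb f s intf.
apply: (le_trans (le_normr_Rintegral measurableT ic)).
apply: le_Rintegral => //; [exact: integrable_norm|exact: integrable_norm|].
by move=> x _; rewrite normrM ler_piMl // cos_max.
Qed.

Lemma sinT_le {R : realType} {d : nat} (leb : {measure set (d.-tuple R) -> \bar R})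
  (f : d.-tuple R -> R) (s : d.-tuple R) : leb.-integrable setT (EFin \o f) ->
  `|sinT leb f s| <= \int[leb]_x `|f x|.
Proof.
move=> intf; have ic := integrable_sin_mul leb f s intf.
apply: (le_trans (le_normr_Rintegral measurableT ic)).
apply: le_Rintegral => //; [exact: integrable_norm|exact: integrable_norm|].
by move=> x _; rewrite normrM ler_piMl // sin_max.
Qed.

Lemma measurable_cosT {R : realType} {d : nat} (leb : {measure set (d.-tuple R) -> \bar R})
  (f : d.-tuple R -> R) : is_lebesgue leb -> measurable_fun setT f ->
  measurable_fun setT (cosT leb f).
Proof.
move=> hl mf; apply: (@measurable_Rintegral_param R d leb (fun z => cos (dotp z.1 z.2) * f z.2)) => //.
apply: measurable_funM; first exact: (measurableT_comp measurable_cos measurable_dotp2).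
exact: (measurableT_comp mf).
Qed.

Lemma measurable_sinT {R : realType} {d : nat} (leb : {measure set (d.-tuple R) -> \bar R})
  (f : d.-tuple R -> R) : is_lebesgue leb -> measurable_fun setT f ->
  measurable_fun setT (sinT leb f).
Proof.
move=> hl mf; apply: (@measurable_Rintegral_param R d leb (fun z => sin (dotp z.1 z.2) * f z.2)) => //.
apply: measurable_funM; first exact: (measurableT_comp measurable_sin measurable_dotp2).
exact: (measurableT_comp mf).
Qed.

Lemma measurable_swapT {R : realType} {d : nat} (Phi : d.-tuple R * d.-tuple R -> R) :
  measurable_fun setT Phi -> measurable_fun setT (fun z : d.-tuple R * d.-tuple R => Phi (z.2, z.1)).
Proof.
move=> mP.
have h : measurable_fun setT (fun z : d.-tuple R * d.-tuple R => (z.2, z.1)).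
  by apply: measurable_fun_pair; [exact: measurable_snd|exact: measurable_fst].
by have q := measurableT_comp mP h.
Qed.

Lemma addt_negtK {R : realType} {d : nat} (x z : d.-tuple R) : addt (addt z x) (negt x) = z.
Proof. by apply: tuple_ext => k; rewrite !tnth_mktuple tnth_map addrK. Qed.

Lemma addtC {R : realType} {d : nat} (x z : d.-tuple R) : addt x z = addt z x.
Proof. by apply: tuple_ext => k; rewrite !tnth_mktuple addrC. Qed.

Lemma scaletE {R : realType} {d : nat} (c : R) (u : d.-tuple R) :
  scalet c u = coord_affine (fun=> c) (zerot R d) u.
Proof. by apply: tuple_ext => k; rewrite !tnth_mktuple tnth_nseq addr0. Qed.

Lemma Kern_scalet {R : realType} {d : nat} (a : R) (u : d.-tuple R) : 0 < a ->
  Kern a (scalet a^-1 u) = a ^+ d * Kern 1 u.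
Proof.
move=> a0; rewrite Kern_scale //; congr (_ * Kern _ _); apply: tuple_ext => k.
by rewrite !tnth_mktuple tnth_nseq addr0 mulrA divff ?mul1r // gt_eqF.
Qed.

Lemma Kern_le {R : realType} {d : nat} (a : R) (x : d.-tuple R) : 0 < a -> Kern a x <= a ^+ d.
Proof.
move=> a0; apply: (@le_trans _ _ (\prod_(i < d) a)); last by rewrite prodr_const card_ord.
by apply: ler_prod => k _; rewrite kern_ge0 //= kern_le.
Qed.

(** Substituting y = x + u / a, the Jacobian cancels the factor a^d of the kernel. The parameter a
    thus moves from the kernel into the translation, where letting it grow is continuity of
    translations. *)
Lemma Rintegral_Kern_shift {R : realType} {d : nat} (leb : {measure set (d.-tuple R) -> \bar R})
  (f : d.-tuple R -> R) (a : R) (x : d.-tuple R) : is_lebesgue leb -> 0 < a ->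
  leb.-integrable setT (EFin \o f) ->
  leb.-integrable setT (fun u => (f (addt x (scalet a^-1 u)) * Kern 1 u)%:E) /\
  \int[leb]_y (f y * Kern a (addt y (negt x))) =
  \int[leb]_u (f (addt x (scalet a^-1 u)) * Kern 1 u).
Proof.
move=> hl a0 intf; have mf : measurable_fun setT f by apply/measurable_EFinP; exact: measurable_int intf.
have mg : measurable_fun setT (fun y => f y * Kern a (addt y (negt x))).
  apply: measurable_funM => //; apply: (measurableT_comp (measurable_Kern d a)).
  exact: measurable_addt.
have -> : \int[leb]_y (f y * Kern a (addt y (negt x))) = \int[leb]_z (f (addt z x) * Kern a z).
  rewrite /Rintegral -(integral_addt d leb x _ hl); last exact/measurable_EFinP.
  by congr fine; apply: eq_integral => z _; rewrite addt_negtK.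
have ad0 : 0 < a ^+ d by rewrite exprn_gt0.
have iz : leb.-integrable setT (fun z => (f (addt z x) * Kern a z)%:E).
  have mfx : measurable_fun setT (fun z => f (addt z x)).
    by apply: (measurableT_comp mf); exact: measurable_addt.
  apply: (@le_integrable _ _ _ _ _ measurableT _ (fun z => (a ^+ d * f (addt z x))%:E)).
  - by apply/measurable_EFinP; apply: measurable_funM => //; exact: measurable_Kern.
  - move=> z _; rewrite /= lee_fin !normrM mulrC ler_wpM2r // !ger0_norm ?Kern_ge0 ?(ltW ad0) //.
    exact: Kern_le.
  - under eq_fun do rewrite EFinM; apply: integrableZl => //.
    apply/integrableP; split; first exact/measurable_EFinP.
    have [_ ff] := integrableP _ _ _ intf.
    rewrite -(integral_addt d leb x _ hl) in ff; first exact: ff.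
    by apply: (measurableT_comp (@abse_measurable R setT)); exact/measurable_EFinP.
have l0 (k : 'I_d) : a^-1 != 0 by rewrite invr_eq0 gt_eqF.
have [j1 j2] := Rintegral_coord_affine d leb (fun=> a^-1) (zerot R d) _ hl l0 iz.
have eu u : f (addt (coord_affine (fun=> a^-1) (zerot R d) u) x) * Kern a (coord_affine (fun=> a^-1) (zerot R d) u)
   = a ^+ d * (f (addt x (scalet a^-1 u)) * Kern 1 u).
  by rewrite -scaletE Kern_scalet // addtC; ring.
have i3 : leb.-integrable setT (fun u => (f (addt x (scalet a^-1 u)) * Kern 1 u)%:E).
  have := integrableZl measurableT ((a ^+ d)^-1) j1; apply: eq_integrable => // u _.
  have an0 : a ^+ d != 0 by rewrite gt_eqF.
  by rewrite /= eu -EFinM (mulrA (a ^+ d)^-1) (mulVf an0) mul1r.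
split => //; rewrite j2 prodr_const card_ord.
under eq_Rintegral do rewrite eu.
rewrite RintegralZl // mulrA.
have -> : `|a^-1| ^+ d * a ^+ d = 1.
  have ai0 : 0 <= a^-1 by rewrite invr_ge0 (ltW a0).
  by rewrite -exprMn (ger0_norm ai0) mulVf ?expr1n // gt_eqF.
by rewrite mul1r.
Qed.

(** The square of the transform is a double integral over x and y of f(x) f(y) cos(s.(y - x));
    integrating in s first turns the tent into the Fejer kernel at y - x. *)
Lemma energy_tent {R : realType} {d : nat} (leb : {measure set (d.-tuple R) -> \bar R})
  (f : d.-tuple R -> R) (a : R) : is_lebesgue leb -> 0 < a ->
  leb.-integrable setT (EFin \o f) ->
  [/\ leb.-integrable setT (fun s => (Wtent a s * (cosT leb f s ^+ 2 + sinT leb f s ^+ 2))%:E),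
      leb.-integrable setT (fun x => (f x * \int[leb]_u (f (addt x (scalet a^-1 u)) * Kern 1 u))%:E) &
  \int[leb]_s (Wtent a s * (cosT leb f s ^+ 2 + sinT leb f s ^+ 2)) =
  \int[leb]_x (f x * \int[leb]_u (f (addt x (scalet a^-1 u)) * Kern 1 u))].
Proof.
move=> hl a0 intf; have mf : measurable_fun setT f by apply/measurable_EFinP; exact: measurable_int intf.
set L1 := \int[leb]_x `|f x|.
have L0 : 0 <= L1 by apply: Rintegral_ge0.
have mc := measurable_cosT leb f hl mf; have ms := measurable_sinT leb f hl mf.
have mW := @measurable_Wtent R d a.
(* One copy of f stays inside [cosT] and [sinT], which are bounded by the L^1 norm of f. The triple
   integral is thereby handled by two successive exchanges of two variables. *)
pose Phi (z : d.-tuple R * d.-tuple R) := Wtent a z.1 * (f z.2 * (cos (dotp z.1 z.2) * cosT leb f z.1 + sin (dotp z.1 z.2) * sinT leb f z.1)).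
have mP : measurable_fun setT Phi.
  apply: measurable_funM; first exact: (measurableT_comp mW).
  apply: measurable_funM; first exact: (measurableT_comp mf).
  apply: measurable_funD; apply: measurable_funM.
  - exact: (measurableT_comp measurable_cos measurable_dotp2).
  - exact: (measurableT_comp mc).
  - exact: (measurableT_comp measurable_sin measurable_dotp2).
  - exact: (measurableT_comp ms).
have iW := integrable_Wtent d leb a hl a0.
have iG : leb.-integrable setT (EFin \o (fun s => (L1 + L1) * Wtent a s)).
  rewrite (_ : EFin \o _ = (fun s => (L1 + L1)%:E * (EFin \o Wtent a) s)%E).
    exact: integrableZl.
  by apply/funext => s /=; rewrite EFinM.
have bP s x : `|Phi (s, x)| <= `|(L1 + L1) * Wtent a s| * `|f x|.
  rewrite /Phi /= !normrM (ger0_norm (addr_ge0 L0 L0)).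
  rewrite (_ : `|Wtent a s| * (_ * _) = `|cos (dotp s x) * cosT leb f s + sin (dotp s x) * sinT leb f s| * (`|Wtent a s| * `|f x|)); last by ring.
  rewrite -(mulrA (L1 + L1)); apply: ler_wpM2r; first exact: mulr_ge0.
  apply: (le_trans (ler_normD _ _)); rewrite !normrM; apply: lerD.
    by apply: (le_trans _ (cosT_le leb f s intf)); rewrite ler_piMl // cos_max.
  by apply: (le_trans _ (sinT_le leb f s intf)); rewrite ler_piMl // sin_max.
have [F1 F2 F3] := RFubini_prod leb Phi _ f hl mP iG intf bP.
have mP' : measurable_fun setT (fun z : d.-tuple R * d.-tuple R => Phi (z.2, z.1)).
  exact: measurable_swapT.
have bP' x s : `|Phi (s, x)| <= `|f x| * `|(L1 + L1) * Wtent a s| by rewrite mulrC; exact: bP.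
have [_ F4 _] := RFubini_prod leb (fun z => Phi (z.2, z.1)) f _ hl mP' intf iG bP'.
have e0 (al be : R) s : leb.-integrable setT (fun x => ((al * cos (dotp s x) + be * sin (dotp s x)) * f x)%:E) /\
    \int[leb]_x ((al * cos (dotp s x) + be * sin (dotp s x)) * f x) = al * cosT leb f s + be * sinT leb f s.
  have ic := integrable_cos_mul leb f s intf; have is_ := integrable_sin_mul leb f s intf.
  have ic2 : leb.-integrable setT (fun x => (al * (cos (dotp s x) * f x))%:E).
    by under eq_fun do rewrite EFinM; exact: integrableZl.
  have is2 : leb.-integrable setT (fun x => (be * (sin (dotp s x) * f x))%:E).
    by under eq_fun do rewrite EFinM; exact: integrableZl.
  have ef x : (al * cos (dotp s x) + be * sin (dotp s x)) * f x =
    al * (cos (dotp s x) * f x) + be * (sin (dotp s x) * f x) by ring.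
  split; first by under eq_fun do rewrite ef EFinD; exact: integrableD.
  under eq_Rintegral do rewrite ef.
  rewrite (RintegralD measurableT ic2 is2); congr (_ + _); exact: RintegralZl.
have e1 s : \int[leb]_x Phi (s, x) = Wtent a s * (cosT leb f s ^+ 2 + sinT leb f s ^+ 2).
  have [j1 j2] := e0 (cosT leb f s) (sinT leb f s) s.
  transitivity (Wtent a s * (cosT leb f s * cosT leb f s + sinT leb f s * sinT leb f s)); last by ring.
  rewrite -j2; transitivity (\int[leb]_x (Wtent a s * ((cosT leb f s * cos (dotp s x) + sinT leb f s * sin (dotp s x)) * f x))).
    by apply: eq_Rintegral => x _; rewrite /Phi /=; ring.
  exact: RintegralZl.
have e2 x : \int[leb]_s Phi (s, x) = f x * \int[leb]_u (f (addt x (scalet a^-1 u)) * Kern 1 u).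
  have [_ <-] := Rintegral_Kern_shift leb f a x hl a0 intf.
  pose Phi2 (z : d.-tuple R * d.-tuple R) := Wtent a z.1 * (cos (dotp z.1 (addt z.2 (negt x))) * f z.2).
  have mP2 : measurable_fun setT Phi2.
    apply: measurable_funM; first exact: (measurableT_comp mW).
    apply: measurable_funM; last exact: (measurableT_comp mf).
    apply: (measurableT_comp measurable_cos).
    have -> : (fun z : d.-tuple R * d.-tuple R => dotp z.1 (addt z.2 (negt x))) =
      (fun z => dotp z.1 z.2 - dotp x z.1).
      by apply/funext => z; rewrite dotpDr dotpN [dotp z.1 x]dotpC.
    apply: measurable_funB; first exact: measurable_dotp2.
    exact: (measurableT_comp (measurable_dotp d x)).
  have bP2 s y : `|Phi2 (s, y)| <= `|Wtent a s| * `|f y|.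
    rewrite /Phi2 /= !normrM; apply: ler_wpM2l; first exact: normr_ge0.
    by apply: ler_piMl; [exact: normr_ge0|exact: cos_max].
  have [G1 G2 G3] := RFubini_prod leb Phi2 _ f hl mP2 iW intf bP2.
  have h1 s : \int[leb]_y Phi2 (s, y) = Wtent a s * (cos (dotp s x) * cosT leb f s + sin (dotp s x) * sinT leb f s).
    have [j1 j2] := e0 (cos (dotp s x)) (sin (dotp s x)) s.
    rewrite -j2; transitivity (\int[leb]_y (Wtent a s * ((cos (dotp s x) * cos (dotp s y) + sin (dotp s x) * sin (dotp s y)) * f y))); last exact: RintegralZl.
    apply: eq_Rintegral => y _; rewrite /Phi2 /= dotpDr dotpN cosD cosN sinN; ring.
  have h2 y : \int[leb]_s Phi2 (s, y) = f y * Kern a (addt y (negt x)).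
    rewrite -(Rintegral_cos_Wtent d leb a _ hl a0).
    transitivity (\int[leb]_s (f y * (cos (dotp (addt y (negt x)) s) * Wtent a s))).
      by apply: eq_Rintegral => s _; rewrite /Phi2 /= [dotp s _]dotpC; ring.
    exact: (RintegralZl _ measurableT (integrable_cos_Wtent d leb a _ hl a0)).
  have -> : \int[leb]_s Phi (s, x) = \int[leb]_s (f x * \int[leb]_y Phi2 (s, y)).
    by apply: eq_Rintegral => s _; rewrite h1 /Phi /=; ring.
  transitivity (f x * \int[leb]_s \int[leb]_y Phi2 (s, y)).
    exact: (RintegralZl _ measurableT G2).
  rewrite G1; congr (_ * _); apply: eq_Rintegral => y _; exact: h2.
split.
- rewrite (_ : (fun s => _) = (fun s => (\int[leb]_x Phi (s, x))%:E)); first exact: F2.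
  by apply/funext => s; rewrite e1.
- rewrite (_ : (fun x => _) = (fun x => (\int[leb]_s Phi (s, x))%:E)); first exact: F4.
  by apply/funext => x; rewrite e2.
- transitivity (\int[leb]_s \int[leb]_x Phi (s, x)); first by apply: eq_Rintegral => s _; rewrite e1.
  by rewrite F1; apply: eq_Rintegral => x _; rewrite e2.
Qed.

Lemma Rintegral_lincomb3 {dd} {T : measurableType dd} {R : realType}
  (mu : {measure set T -> \bar R}) (f g h : T -> R) (a b c : R) :
  mu.-integrable setT (EFin \o f) -> mu.-integrable setT (EFin \o g) ->
  mu.-integrable setT (EFin \o h) ->
  mu.-integrable setT (EFin \o (fun x => a * f x + b * g x + c * h x)) /\
  \int[mu]_x (a * f x + b * g x + c * h x) =
  a * (\int[mu]_x f x) + b * (\int[mu]_x g x) + c * (\int[mu]_x h x).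
Proof.
move=> i1 i2 i3.
have Z (k : R) (u : T -> R) : mu.-integrable setT (EFin \o u) ->
    mu.-integrable setT (EFin \o (fun x => k * u x)).
  by move=> iu; have := integrableZl measurableT k iu.
have D (u v : T -> R) : mu.-integrable setT (EFin \o u) -> mu.-integrable setT (EFin \o v) ->
    mu.-integrable setT (EFin \o (fun x => u x + v x)).
  by move=> iu iv; have := integrableD measurableT iu iv.
have i12 := D _ _ (Z a f i1) (Z b g i2).
split; first exact: (D _ _ i12 (Z c h i3)).
rewrite (RintegralD measurableT i12 (Z c h i3)) (RintegralD measurableT (Z a f i1) (Z b g i2)).
congr (_ + _ + _); exact: RintegralZl.
Qed.

Definition autocor {R : realType} {d : nat} (leb : {measure set (d.-tuple R) -> \bar R})
  (f : d.-tuple R -> R) (w : d.-tuple R) : R := \int[leb]_x (f x * f (addt x w)).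

(** Polarization: 2 f(x) f(x + w) = f(x)^2 + f(x + w)^2 - (f(x + w) - f(x))^2, with translation
    invariance for the second term. It reduces the continuity of the autocorrelation at 0 to the
    continuity of translations in L^2. *)
Lemma autocorE {R : realType} {d : nat} (leb : {measure set (d.-tuple R) -> \bar R})
  (f : d.-tuple R -> R) (w : d.-tuple R) : is_lebesgue leb -> measurable_fun setT f ->
  leb.-integrable setT (EFin \o (fun x => f x ^+ 2)) ->
  [/\ leb.-integrable setT (EFin \o (fun x => f x * f (addt x w))),
      leb.-integrable setT (EFin \o (fun x => (f (addt x w) - f x) ^+ 2)),
      autocor leb f w = \int[leb]_x (f x ^+ 2) - 2^-1 * \int[leb]_x ((f (addt x w) - f x) ^+ 2) &
      \int[leb]_x `|f x * f (addt x w)| <= \int[leb]_x (f x ^+ 2)].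
Proof.
move=> hl mf i1.
have msh : measurable_fun setT (fun x => f (addt x w)) by exact: (measurableT_comp mf (measurable_addt d w)).
have i2 : leb.-integrable setT (EFin \o (fun x => f (addt x w) ^+ 2)).
  apply/integrableP; split; first by apply/measurable_EFinP; apply: measurable_funX.
  have [_ ff] := integrableP _ _ _ i1.
  rewrite -(integral_addt d leb w _ hl) in ff; first exact: ff.
  apply: (measurableT_comp (@abse_measurable R setT)); apply/measurable_EFinP; exact: measurable_funX.
have e2 : \int[leb]_x (f (addt x w) ^+ 2) = \int[leb]_x (f x ^+ 2).
  rewrite /Rintegral (integral_addt d leb w (fun x => (f x ^+ 2)%:E) hl) //.
  by apply/measurable_EFinP; exact: measurable_funX.
have [i12 e12] := Rintegral_lincomb3 leb _ _ _ (2^-1) (2^-1) 0 i1 i2 i2.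
have ab x : `|f x * f (addt x w)| <= 2^-1 * f x ^+ 2 + 2^-1 * f (addt x w) ^+ 2 + 0 * f (addt x w) ^+ 2.
  have h1 := sqr_ge0 (f x - f (addt x w)); have h2 := sqr_ge0 (f x + f (addt x w)).
  by rewrite ler_norml; apply/andP; split; nra.
have iM : leb.-integrable setT (EFin \o (fun x => f x * f (addt x w))).
  apply: (le_integrable measurableT _ _ i12).
    by apply/measurable_EFinP; exact: measurable_funM.
  by move=> x _ /=; rewrite lee_fin; apply: (le_trans (ab x)); exact: ler_norm.
have [i3 e3] := Rintegral_lincomb3 leb _ _ _ 1 1 (- 2) i1 i2 iM.
have sqE x : (f (addt x w) - f x) ^+ 2 = 1 * f x ^+ 2 + 1 * f (addt x w) ^+ 2 + (- 2) * (f x * f (addt x w)) by ring.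
have iD : leb.-integrable setT (EFin \o (fun x => (f (addt x w) - f x) ^+ 2)).
  rewrite (_ : EFin \o _ = EFin \o (fun x => 1 * f x ^+ 2 + 1 * f (addt x w) ^+ 2 + (- 2) * (f x * f (addt x w)))); first exact: i3.
  by apply/funext => x; rewrite /comp sqE.
split => //.
- have -> : \int[leb]_x ((f (addt x w) - f x) ^+ 2) = \int[leb]_x (1 * f x ^+ 2 + 1 * f (addt x w) ^+ 2 + (- 2) * (f x * f (addt x w))).
    by apply: eq_Rintegral => x _; rewrite sqE.
  by rewrite e3 e2 /autocor; field.
- apply: (@le_trans _ _ (\int[leb]_x (2^-1 * f x ^+ 2 + 2^-1 * f (addt x w) ^+ 2 + 0 * f (addt x w) ^+ 2))).
    apply: (le_Rintegral measurableT (integrable_norm iM) i12) => x _; exact: ab.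
  by rewrite e12 e2; lra.
Qed.

Lemma autocor_bounds {R : realType} {d : nat} (leb : {measure set (d.-tuple R) -> \bar R})
  (f : d.-tuple R -> R) (w : d.-tuple R) : is_lebesgue leb -> measurable_fun setT f ->
  leb.-integrable setT (EFin \o (fun x => f x ^+ 2)) ->
  `|autocor leb f w| <= \int[leb]_x (f x ^+ 2).
Proof.
move=> hl mf i1; have [iM _ _ le1] := autocorE leb f w hl mf i1.
exact: le_trans (le_normr_Rintegral measurableT iM) le1.
Qed.

Lemma measurable_addt_scalet {R : realType} {d : nat} (c : R) :
  measurable_fun setT (fun z : d.-tuple R * d.-tuple R => addt z.1 (scalet c z.2)).
Proof.
apply/measurable_fun_tnthP => i.
rewrite (_ : _ \o _ = fun z : d.-tuple R * d.-tuple R => tnth z.1 i + c * tnth z.2 i); last first.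
  by apply/funext => x /=; rewrite !tnth_mktuple.
apply: measurable_funD; first exact: (measurableT_comp (measurable_coord d i)).
apply: measurable_funM => //; exact: (measurableT_comp (measurable_coord d i)).
Qed.

(** Exchanges the integrals in x and u. Absolute convergence follows from the bound of the
    autocorrelation by the L^2 energy, uniformly in the shift, times the integrable kernel. *)
Lemma energy_autocor {R : realType} {d : nat} (leb : {measure set (d.-tuple R) -> \bar R})
  (f : d.-tuple R -> R) (a : R) : is_lebesgue leb -> 0 < a ->
  leb.-integrable setT (EFin \o f) ->
  leb.-integrable setT (EFin \o (fun x => f x ^+ 2)) ->
  (\int[leb]_s (Wtent a s * (cosT leb f s ^+ 2 + sinT leb f s ^+ 2))%:E =
   \int[leb]_u (autocor leb f (scalet a^-1 u) * Kern 1 u)%:E)%E.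
Proof.
move=> hl a0 intf isq.
have mf : measurable_fun setT f by apply/measurable_EFinP; exact: measurable_int intf.
have [E1_ E2_ E3_] := energy_tent leb f a hl a0 intf.
pose Phi (z : d.-tuple R * d.-tuple R) := f z.1 * (f (addt z.1 (scalet a^-1 z.2)) * Kern 1 z.2).
have mK := @measurable_Kern R d 1.
have mP : measurable_fun setT Phi.
  apply: measurable_funM; first exact: (measurableT_comp mf).
  apply: measurable_funM; last exact: (measurableT_comp mK).
  exact: (measurableT_comp mf (measurable_addt_scalet a^-1)).
have [iK _] := integrable_Kern1 d leb hl.
have iac u := autocorE leb f (scalet a^-1 u) hl mf isq.
set F := \int[leb]_x (f x ^+ 2) in iac.
have F0 : 0 <= F by apply: Rintegral_ge0 => x _; exact: sqr_ge0.
have inner x : (\int[leb]_u (Phi (x, u))%:E = (f x * \int[leb]_u (f (addt x (scalet a^-1 u)) * Kern 1 u))%:E)%E.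
  have [ik _] := Rintegral_Kern_shift leb f a x hl a0 intf.
  rewrite -(RintegralZl (f x) measurableT ik) /Rintegral fineK //.
  apply: integrable_fin_num => //; have := integrableZl measurableT (f x) ik; exact.
have outer u : (\int[leb]_x (Phi (x, u))%:E = (autocor leb f (scalet a^-1 u) * Kern 1 u)%:E)%E.
  have [iM _ _ _] := iac u.
  have eP x : Phi (x, u) = Kern 1 u * (f x * f (addt x (scalet a^-1 u))) by rewrite /Phi /=; ring.
  under eq_integral do rewrite eP.
  rewrite mulrC -(RintegralZl (Kern 1 u) measurableT iM) /Rintegral fineK //.
  apply: integrable_fin_num => //; have := integrableZl measurableT (Kern 1 u) iM; exact.
have mPE : measurable_fun setT (fun z => (Phi z)%:E) by exact/measurable_EFinP.
have fin : (\int[leb]_x \int[leb]_u `|(Phi (x, u))%:E| < +oo)%E.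
  rewrite (ge0_Fubini_lebesgue d leb (fun z => `|(Phi z)%:E|)%E hl); last 2 first.
  - exact: (measurableT_comp (@abse_measurable R setT) mPE).
  - by move=> z.
  apply: (@le_lt_trans _ _ (\int[leb]_u (F * Kern 1 u)%:E)%E).
    apply: ge0_le_integral => //.
    - move=> u _; apply: integral_ge0 => x _ //.
    - have mA : measurable_fun setT (fun z => `|(Phi z)%:E|)%E.
        exact: (measurableT_comp (@abse_measurable R setT) mPE).
      have pA z : (0 <= `|(Phi z)%:E|)%E by exact: abse_ge0.
      have q := @measurable_fun_fubini_tonelli_G _ _ _ _ _ (sigma_lebesgue hl) _ mA pA.
      exact: q.
    - by apply/measurable_EFinP; apply: measurable_funM.
    move=> u _; have [iM _ _ le1] := iac u.
    have eP x : `|(Phi (x, u))%:E|%E = (Kern 1 u * `|f x * f (addt x (scalet a^-1 u))|)%:E.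
      by rewrite abse_EFin /Phi /=; congr EFin; rewrite mulrA normrM mulrC; congr (_ * _); rewrite ger0_norm ?Kern_ge0.
    under eq_integral do rewrite eP.
    have iN := integrable_norm iM.
    have -> : (\int[leb]_x (Kern 1 u * `|f x * f (addt x (scalet a^-1 u))|)%:E)%E =
      (\int[leb]_x (Kern 1 u * `|f x * f (addt x (scalet a^-1 u))|))%:E.
      rewrite /Rintegral fineK //; apply: integrable_fin_num => //.
      have := integrableZl measurableT (Kern 1 u) iN; exact.
    rewrite lee_fin (RintegralZl (Kern 1 u) measurableT iN) mulrC; apply: ler_wpM2r => //.
    exact: Kern_ge0.
  have [_ fi] := integrableP _ _ _ (integrableZl measurableT F iK).
  rewrite (_ : integral _ _ _ = (\int[leb]_x `|(F%:E * (EFin \o Kern 1) x)%E|)%E) //.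
  by apply: eq_integral => u _; rewrite /= ger0_norm // mulr_ge0 // Kern_ge0.
have [fub _] := Fubini_lebesgue d leb (fun z => (Phi z)%:E) hl mPE fin.
transitivity (\int[leb]_x (f x * \int[leb]_u (f (addt x (scalet a^-1 u)) * Kern 1 u))%:E)%E.
  have := congr1 EFin E3_; rewrite {1 2}/Rintegral fineK; last exact: integrable_fin_num.
  by rewrite fineK; last exact: integrable_fin_num.
transitivity (\int[leb]_x \int[leb]_u (Phi (x, u))%:E)%E; first by apply: eq_integral => x _; rewrite inner.
by rewrite fub; apply: eq_integral => u _; rewrite outer.
Qed.

Lemma cvg_tent {R : realType} (s : R) : (fun n => tent n.+1%:R s) @ \oo --> (1 : R).
Proof.
apply: (@squeeze_cvgr _ _ _ _ (fun n => 1 - `|s| * harmonic n) (fun=> 1)).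
- apply: nearW => n; rewrite /tent le_max lexx orbT /= ge_max ler01 /=.
  by rewrite gerBl mulr_ge0 // invr_ge0.
- rewrite -[X in _ --> X]subr0 -[X in 1 - X](mulr0 `|s|).
  apply: cvgB; first exact: cvg_cst.
  by apply: cvgM; [exact: cvg_cst|exact: cvg_harmonic].
- exact: cvg_cst.
Qed.

Lemma cvg_Wtent {R : realType} {d : nat} (s : d.-tuple R) :
  (fun n => Wtent n.+1%:R s) @ \oo --> (1 : R).
Proof.
suff : (fun n => Wtent n.+1%:R s) @ \oo --> \prod_(i < d) (1 : R) by rewrite big1.
apply: cvg_big => [|i _]; first exact: mul_continuous.
exact: cvg_tent.
Qed.

Lemma Wtent_nondecreasing {R : realType} {d : nat} (s : d.-tuple R) (n m : nat) :
  (n <= m)%N -> Wtent n.+1%:R s <= Wtent m.+1%:R s.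
Proof.
move=> nm; apply: ler_prod => i _; rewrite tent_ge0 /= /tent.
rewrite ge_max !le_max lexx /=; apply/orP; right.
by rewrite lerD2l lerN2; apply: ler_wpM2l => //; rewrite lef_pV2 ?posrE ?ltr0Sn // ler_nat.
Qed.

Lemma cvg_autocor {R : realType} {d : nat} (leb : {measure set (d.-tuple R) -> \bar R})
  (f : d.-tuple R -> R) (u : d.-tuple R) : is_lebesgue leb -> measurable_fun setT f ->
  leb.-integrable setT (EFin \o (fun x => f x ^+ 2)) ->
  shift_continuous leb (fun x => Complex (f x) 0) ->
  (fun n => autocor leb f (scalet n.+1%:R^-1 u)) @ \oo --> \int[leb]_x (f x ^+ 2).
Proof.
move=> hl mf i1 hS; apply/cvgnP => e e0.
have [N hN] := hS u _ e0; exists N => n Nn.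
have [_ iD -> _] := autocorE leb f (scalet n.+1%:R^-1 u) hl mf i1.
have := hN _ Nn.
have -> : Ip leb 2 (fun x => Complex (f (addt x (scalet n.+1%:R^-1 u))) 0 - Complex (f x) 0) =
  (\int[leb]_x ((f (addt x (scalet n.+1%:R^-1 u)) - f x) ^+ 2))%:E.
  rewrite /Rintegral fineK; last exact: integrable_fin_num.
  apply: eq_integral => x _; congr EFin.
  rewrite (_ : _ - _ = Complex (f (addt x (scalet n.+1%:R^-1 u)) - f x) 0); last first.
    by apply: complex_ext; rewrite ?cReD ?cImD ?cReN ?cImN //= subrr.
  by rewrite cabs_real powR_mulrn // -normrX ger0_norm // sqr_ge0.
rewrite lee_fin => h.
have : 0 <= \int[leb]_x ((f (addt x (scalet n.+1%:R^-1 u)) - f x) ^+ 2).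
  by apply: Rintegral_ge0 => x _; exact: sqr_ge0.
move: (\int[leb]_x ((f (addt x (scalet n.+1%:R^-1 u)) - f x) ^+ 2)) h => D h D0.
by rewrite opprD addrA subrr sub0r opprK ger0_norm; lra.
Qed.

(** With a = n + 1 the tents increase to 1, so the left side of [energy_autocor] converges
    monotonically. The right side converges under the majorant [F * Kern 1 u], the autocorrelation
    at u / (n + 1) tending to the energy of f. *)
Lemma plancherel_real {R : realType} {d : nat} (leb : {measure set (d.-tuple R) -> \bar R})
  (f : d.-tuple R -> R) : is_lebesgue leb ->
  leb.-integrable setT (EFin \o f) ->
  leb.-integrable setT (EFin \o (fun x => f x ^+ 2)) ->
  shift_continuous leb (fun x => Complex (f x) 0) ->
  (\int[leb]_s (cosT leb f s ^+ 2 + sinT leb f s ^+ 2)%:E =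
   ((\int[leb]_x Kern 1 x) * (\int[leb]_x (f x ^+ 2)))%:E)%E.
Proof.
move=> hl intf i1 hS.
have mf : measurable_fun setT f by apply/measurable_EFinP; exact: measurable_int intf.
have mc := measurable_cosT leb f hl mf; have ms := measurable_sinT leb f hl mf.
have mK := @measurable_Kern R d 1.
have [iK _] := integrable_Kern1 d leb hl.
set F := \int[leb]_x (f x ^+ 2).
have K0 u : 0 <= @Kern R d 1 u by exact: Kern_ge0.
pose g s := cosT leb f s ^+ 2 + sinT leb f s ^+ 2.
have g0 s : 0 <= g s by rewrite addr_ge0 // sqr_ge0.
have mg : measurable_fun setT g by apply: measurable_funD; exact: measurable_funX.
pose G n s := (Wtent n.+1%:R s * g s)%:E.
have cG s : G^~ s @ \oo --> (g s)%:E.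
  apply: cvg_EFinn; rewrite -[X in _ --> X]mul1r.
  by apply: cvgM; [exact: cvg_Wtent|exact: cvg_cst].
have L1 : (fun n => \int[leb]_s G n s)%E @ \oo --> (\int[leb]_s (g s)%:E)%E.
  rewrite (_ : (\int[leb]_s (g s)%:E)%E = (\int[leb]_s (limn (G^~ s)))%E); last first.
    by apply: eq_integral => s _; apply/esym/cvg_lim => //; exact: cG.
  apply: cvg_monotone_convergence => //.
  - move=> n; apply/measurable_EFinP; apply: measurable_funM => //; exact: measurable_Wtent.
  - by move=> n s _; rewrite lee_fin mulr_ge0 // Wtent_ge0.
  - move=> s _ n m nm; rewrite lee_fin; apply: ler_wpM2r; first exact: g0.
    exact: Wtent_nondecreasing.
have L2 : (fun n => \int[leb]_s G n s)%E @ \oo --> (\int[leb]_u (F * Kern 1 u)%:E)%E.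
  rewrite (_ : (fun n => _) = (fun n => \int[leb]_u (autocor leb f (scalet n.+1%:R^-1 u) * Kern 1 u)%:E)%E); last first.
    by apply/funext => n; exact: energy_autocor.
  have iFK : leb.-integrable setT (fun u => (F * Kern 1 u)%:E).
    have := integrableZl measurableT F iK; exact.
  apply: (dominated_cvg measurableT _ _ _ iFK).
  - move=> n; apply/measurable_EFinP; apply: measurable_funM => //.
    apply: (@measurable_Rintegral_param R d leb (fun z => f z.2 * f (addt z.2 (scalet n.+1%:R^-1 z.1)))) => //.
    apply: measurable_funM; first exact: (measurableT_comp mf).
    by have := measurable_swapT _ (measurableT_comp mf (@measurable_addt_scalet R d n.+1%:R^-1)).
  - move=> u _; apply: cvg_EFinn; apply: cvgM; last exact: cvg_cst.
    exact: cvg_autocor.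
  - by [].
  - move=> n u _; rewrite abse_EFin lee_fin normrM (ger0_norm (K0 u)); apply: ler_wpM2r => //.
    exact: autocor_bounds.
have -> : ((\int[leb]_x Kern 1 x) * F)%:E = (\int[leb]_u (F * Kern 1 u)%:E)%E.
  rewrite mulrC -(RintegralZl F measurableT iK) /Rintegral fineK //.
  by apply: integrable_fin_num => //; have := integrableZl measurableT F iK; exact.
exact: (cvg_unique _ L1 L2).
Qed.

(** Bounded support makes these functions integrable, so their transform is an honest integral. The
    truncations in [is_FT2] belong to this class. *)
Definition L2b {R : realType} {d : nat} (leb : {measure set (d.-tuple R) -> \bar R})
  (f : d.-tuple R -> R[i]) : Prop :=
  [/\ cmeasurable f, exists N, forall x, ~ cube d N x -> f x = 0 & (Ip leb 2 f < +oo)%E].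

Lemma L2b_component {R : realType} {d : nat} (leb : {measure set (d.-tuple R) -> \bar R})
  (f : d.-tuple R -> R[i]) (u : d.-tuple R -> R) : is_lebesgue leb -> L2b leb f ->
  measurable_fun setT u -> (forall x, `|u x| <= cabs (f x)) ->
  [/\ leb.-integrable setT (EFin \o u),
      leb.-integrable setT (EFin \o (fun x => u x ^+ 2)) &
      shift_continuous leb (fun x => Complex (u x) 0)].
Proof.
move=> hl [mf [N hN] fin] mu uf.
have cm (v : d.-tuple R -> R) : measurable_fun setT v -> cmeasurable (fun x => Complex (v x) 0).
  by move=> mv; split => //; exact: measurable_cst.
have u0 x : ~ cube d N x -> u x = 0.
  by move=> /hN fx; apply/eqP; rewrite -normr_le0 (le_trans (uf x)) // fx cabs0.
have i2 : leb.-integrable setT (EFin \o (fun x => u x ^+ 2)).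
  apply/integrableP; split; first by apply/measurable_EFinP; exact: measurable_funX.
  apply: le_lt_trans fin; apply: ge0_le_integral => //.
  - by apply: measurableT_comp => //; apply/measurable_EFinP; exact: measurable_funX.
  - exact: measurable_cabs_powR.
  - move=> x _; rewrite lee_fin powR_mulrn ?cabs_ge0 // normrX.
    by rewrite lerXn2r ?nnegrE ?cabs_ge0.
split => //.
- have i1 : leb.-integrable setT (EFin \o \1_(cube d N)).
    apply/integrableP; split; first by apply/measurable_EFinP; apply: measurable_indic; exact: measurable_cube.
    under eq_integral => x _ do rewrite /= ger0_norm //.
    by rewrite integral_indic ?setIT; [exact: lebesgue_cube|exact: measurableT|exact: measurable_cube].
  (* On the cube |u| <= 1 + u^2, and off it u vanishes. *)
  have := integrableD measurableT i1 i2; apply: le_integrable => //.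
    exact/measurable_EFinP.
  move=> x _; rewrite /= lee_fin.
  have [xN|xN] := pselect (cube d N x); last by rewrite (u0 x xN) normr0.
  rewrite indicE mem_set //= [X in _ <= X]ger0_norm ?addr_ge0 ?sqr_ge0 //.
  have := sqr_ge0 (`|u x| - 1); rewrite -(real_normK (num_real (u x))).
  by have := normr_ge0 (u x); move: `|u x| => r; nra.
- have bnd (v : d.-tuple R -> R) : measurable_fun setT v -> (forall x, 0 <= v x) ->
      (forall x, v x <= `|u x|) -> shift_continuous leb (fun x => Complex (v x) 0).
    move=> mv v0 vu; apply: (shift_continuous_ge0 _ _ _ N hl mv v0).
      by move=> x /u0 ux; apply/le_anti; rewrite v0 andbT (le_trans (vu x)) // ux normr0.
    apply: le_lt_trans fin; apply: (Ip_le _ _ _ _ _ (ler0n _ 2) (cm v mv) mf) => x.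
    by rewrite cabs_real ger0_norm // (le_trans (vu x)).
  have mp : measurable_fun setT (fun x => Num.max (u x) 0) by exact: measurable_maxr.
  have mn : measurable_fun setT (fun x => Num.max (- u x) 0).
    by apply: measurable_maxr => //; exact: measurable_funN.
  have h1 : shift_continuous leb (fun x => Complex (Num.max (u x) 0) 0).
    apply: bnd => // x; first by rewrite le_max lexx orbT.
    by rewrite ge_max normr_ge0 ler_norm.
  have h2 : shift_continuous leb (fun x => Complex (Num.max (- u x) 0) 0).
    apply: bnd => // x; first by rewrite le_max lexx orbT.
    by rewrite ge_max normr_ge0 andbT -normrN ler_norm.
  rewrite (_ : (fun x => Complex (u x) 0) = (fun x => Complex (Num.max (u x) 0) 0 + (-1) * Complex (Num.max (- u x) 0) 0)).
    apply: shift_continuousD; [exact: cm| |exact: h1|].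
      by apply: cmeasurableM; [exact: cmeasurableC|exact: cm].
    by apply: shift_continuousZ; [exact: cm|exact: h2].
  apply/funext => x; apply: complex_ext; rewrite ?cReD ?cImD ?cReM ?cImM /= ?oppr0 ?mulr0 ?mul0r ?subr0 ?addr0 //.
  by case: (lerP (u x) 0) => h1'; case: (lerP (- u x) 0) => h2'; lra.
Qed.

Definition FTb {R : realType} {d : nat} (leb : {measure set (d.-tuple R) -> \bar R})
  (f : d.-tuple R -> R[i]) (xi : d.-tuple R) : R[i] :=
  cintegral leb setT (fun z => expi (dotp xi z) * f z).

Lemma L2b_cRe {R : realType} {d : nat} (leb : {measure set (d.-tuple R) -> \bar R})
  (f : d.-tuple R -> R[i]) : is_lebesgue leb -> L2b leb f ->
  [/\ leb.-integrable setT (EFin \o (fun x => cRe (f x))),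
      leb.-integrable setT (EFin \o (fun x => cRe (f x) ^+ 2)) &
      shift_continuous leb (fun x => Complex (cRe (f x)) 0)].
Proof.
by move=> hl hf; apply: (L2b_component _ f) => //; [case: hf => -[]|move=> x; exact: ler_cRe].
Qed.

Lemma L2b_cIm {R : realType} {d : nat} (leb : {measure set (d.-tuple R) -> \bar R})
  (f : d.-tuple R -> R[i]) : is_lebesgue leb -> L2b leb f ->
  [/\ leb.-integrable setT (EFin \o (fun x => cIm (f x))),
      leb.-integrable setT (EFin \o (fun x => cIm (f x) ^+ 2)) &
      shift_continuous leb (fun x => Complex (cIm (f x)) 0)].
Proof.
by move=> hl hf; apply: (L2b_component _ f) => //; [case: hf => -[]|move=> x; exact: ler_cIm].
Qed.

Lemma FTbE {R : realType} {d : nat} (leb : {measure set (d.-tuple R) -> \bar R})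
  (f : d.-tuple R -> R[i]) (xi : d.-tuple R) : is_lebesgue leb -> L2b leb f ->
  FTb leb f xi = Complex (cosT leb (fun x => cRe (f x)) xi - sinT leb (fun x => cIm (f x)) xi)
                         (sinT leb (fun x => cRe (f x)) xi + cosT leb (fun x => cIm (f x)) xi).
Proof.
move=> hl hf; have [iu _ _] := L2b_cRe leb f hl hf; have [iv _ _] := L2b_cIm leb f hl hf.
have h1 := integrable_cos_mul leb _ xi iu; have h2 := integrable_sin_mul leb _ xi iv.
have h3 := integrable_sin_mul leb _ xi iu; have h4 := integrable_cos_mul leb _ xi iv.
rewrite /FTb /cintegral; congr Complex.
  under eq_Rintegral do rewrite cReM /=.
  exact: (RintegralB measurableT h1 h2).
under eq_Rintegral do rewrite cImM /= addrC.
exact: (RintegralD measurableT h3 h4).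
Qed.

(** The cross terms between the transforms of the real and imaginary parts are odd in xi. Adding the
    values at xi and -xi cancels them and doubles the two real energies. *)
Lemma plancherel_bounded {R : realType} {d : nat} (leb : {measure set (d.-tuple R) -> \bar R})
  (f : d.-tuple R -> R[i]) : is_lebesgue leb -> L2b leb f ->
  cmeasurable (FTb leb f) /\ (Ip leb 2 (FTb leb f) = (\int[leb]_x Kern 1 x)%:E * Ip leb 2 f)%E.
Proof.
move=> hl hf; have [iu iu2 su] := L2b_cRe leb f hl hf; have [iv iv2 sv] := L2b_cIm leb f hl hf.
set u := (fun x => cRe (f x)) in iu iu2 su; set v := (fun x => cIm (f x)) in iv iv2 sv.
have [mu mv] : cmeasurable f by case: hf.
have mcu := measurable_cosT leb u hl mu; have msu := measurable_sinT leb u hl mu.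
have mcv := measurable_cosT leb v hl mv; have msv := measurable_sinT leb v hl mv.
have FE : FTb leb f = fun xi => Complex (cosT leb u xi - sinT leb v xi) (sinT leb u xi + cosT leb v xi).
  by apply/funext => xi; exact: FTbE.
have mF : cmeasurable (FTb leb f).
  by rewrite FE; split; [exact: measurable_funB|exact: measurable_funD].
split => //.
have ccN (w : d.-tuple R -> R) xi : cosT leb w (negt xi) = cosT leb w xi.
  by apply: eq_Rintegral => x _; rewrite dotpC dotpN cosN dotpC.
have ssN (w : d.-tuple R -> R) xi : leb.-integrable setT (EFin \o w) ->
    sinT leb w (negt xi) = - sinT leb w xi.
  move=> iw; have h := integrable_sin_mul leb w xi iw.
  rewrite -mulN1r -(RintegralZl (- 1) measurableT h); apply: eq_Rintegral => x _.
  by rewrite dotpC dotpN sinN dotpC; ring.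
pose Q xi := cabs (FTb leb f xi) ^+ 2.
have QE xi : Q xi = (cosT leb u xi - sinT leb v xi) ^+ 2 + (sinT leb u xi + cosT leb v xi) ^+ 2.
  by rewrite /Q FE cabs_sqr.
have mQ : measurable_fun setT Q by apply: measurable_funX; exact: measurable_cabs.
have Q0 xi : 0 <= Q xi by exact: sqr_ge0.
have mQE : measurable_fun setT (fun xi => (Q xi)%:E) by exact/measurable_EFinP.
have IQ : (Ip leb 2 (FTb leb f) = \int[leb]_xi (Q xi)%:E)%E.
  by apply: eq_integral => xi _; rewrite (powR_mulrn 2 (cabs_ge0 _)).
have IQN : (\int[leb]_xi (Q (negt xi))%:E = \int[leb]_xi (Q xi)%:E)%E.
  exact: (integral_neg d leb (fun xi => (Q xi)%:E) hl mQE).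
pose g w s := (cosT leb w s ^+ 2 + sinT leb w s ^+ 2)%:E.
have b1 w s : setT s -> (0 <= g w s)%E by move=> _; rewrite /g lee_fin; apply: addr_ge0; exact: sqr_ge0.
have b2 w : measurable_fun setT (cosT leb w) -> measurable_fun setT (sinT leb w) -> measurable_fun setT (g w).
    by move=> mcw msw; apply/measurable_EFinP; apply: measurable_funD; exact: measurable_funX.
have s1 : (\int[leb]_xi (Q xi)%:E + \int[leb]_xi (Q xi)%:E =
   2%:E * (\int[leb]_s g u s + \int[leb]_s g v s))%E.
  have a1 xi : setT xi -> (0 <= (Q (negt xi))%:E)%E by move=> _; rewrite lee_fin.
  have a2 xi : setT xi -> (0 <= (Q xi)%:E)%E by move=> _; rewrite lee_fin.
  have a3 : measurable_fun setT (fun xi => (Q (negt xi))%:E).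
    by apply/measurable_EFinP; exact: (measurableT_comp mQ (measurable_negt d)).
  rewrite -{1}IQN -(ge0_integralD leb measurableT a1 a3 a2 mQE).
  rewrite -(ge0_integralD leb measurableT (b1 u) (b2 u mcu msu) (b1 v) (b2 v mcv msv)).
  rewrite -ge0_integralZl_EFin; last 4 first.
  - exact: measurableT.
  - by move=> s _; apply: adde_ge0; exact: b1.
  - by apply: emeasurable_funD; exact: b2.
  - exact: ler0n.
  apply: eq_integral => xi _; rewrite /g -!EFinD -EFinM; congr EFin.
  rewrite !QE (ccN u) (ccN v) (ssN u _ iu) (ssN v _ iv).
  move: (cosT leb u xi) (cosT leb v xi) (sinT leb u xi) (sinT leb v xi) => c1 c2 s1 s2; ring.
have Iff : (Ip leb 2 f = (\int[leb]_x (u x ^+ 2) + \int[leb]_x (v x ^+ 2))%:E)%E.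
  rewrite -(RintegralD measurableT iu2 iv2) /Rintegral fineK; last first.
    by apply: integrable_fin_num; [exact: measurableT|have := integrableD measurableT iu2 iv2; exact].
  apply: eq_integral => x _; congr EFin.
  by rewrite (powR_mulrn 2 (cabs_ge0 (f x))) cabs_sqr.
have p1 := plancherel_real leb u hl iu iu2 su; have p2 := plancherel_real leb v hl iv iv2 sv.
rewrite [X in (_ = 2%:E * (X + _))%E]p1 [X in (_ = 2%:E * (_ + X))%E]p2 in s1.
(* Twice the integral equals a finite number, which excludes infinite values before the factor 2 is
   cancelled. *)
rewrite IQ Iff -EFinM; move: s1; case: (\int[leb]_xi (Q xi)%:E)%E => [r|//|//].
by rewrite -!EFinD -EFinM => -[h]; congr EFin; lra.
Qed.

Definition btrunc {R : realType} {d : nat} (f : d.-tuple R -> R[i]) (n : nat) (x : d.-tuple R) : R[i] :=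
  cindic [set z | sqnorm z <= (n%:R) ^+ 2] x * f x.

Lemma measurable_ball {R : realType} (d n : nat) :
  measurable [set z : d.-tuple R | sqnorm z <= (n%:R) ^+ 2].
Proof.
have m : measurable_fun setT (@sqnorm R d).
  by apply: measurable_sum => k; apply: measurable_funM; exact: measurable_coord.
have := m measurableT `]-oo, (n%:R : R) ^+ 2]%classic (measurable_itv _).
by rewrite setTI; congr measurable; apply/seteqP; split => z /=; rewrite in_itv.
Qed.

Lemma sqnorm_coord_le {R : realType} {d : nat} (x : d.-tuple R) (k : 'I_d) :
  tnth x k ^+ 2 <= sqnorm x.
Proof.
rewrite /sqnorm /dotp (bigD1 k) //= expr2 lerDl; apply: sumr_ge0 => i _.
by rewrite -expr2 sqr_ge0.
Qed.

Lemma ball_cube {R : realType} (d n : nat) (x : d.-tuple R) :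
  sqnorm x <= (n%:R) ^+ 2 -> cube d n x.
Proof.
move=> h i; rewrite !tnth_mktuple -ler_norml.
have := le_trans (sqnorm_coord_le x i) h.
by rewrite -(real_normK (num_real (tnth x i))) ler_pXn2r // ?nnegrE.
Qed.

Lemma cube_ball {R : realType} (d N n : nat) (x : d.-tuple R) :
  (d * N <= n)%N -> cube d N x -> sqnorm x <= (n%:R) ^+ 2.
Proof.
move=> dN cx; have : sqnorm x <= \sum_(i < d) (N%:R : R) ^+ 2.
  apply: ler_sum => i _; rewrite -expr2 -(real_normK (num_real (tnth x i))).
  by rewrite lerXn2r ?nnegrE //; have := cx i; rewrite !tnth_mktuple -ler_norml.
move=> /le_trans; apply; rewrite sumr_const card_ord -!natrX -mulrnA ler_nat; apply: leq_trans (_ : ((d * N) ^ 2 <= _)%N); last by rewrite leq_exp2r.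
have dd : (d <= d ^ 2)%N by case: (d) => // k; rewrite -{1}[k.+1]expn1 leq_pexp2l.
by rewrite expnMn mulnC leq_mul2r dd orbT.
Qed.

Lemma cabs_btrunc_le {R : realType} {d : nat} (f : d.-tuple R -> R[i]) n x :
  cabs (btrunc f n x) <= cabs (f x).
Proof. by rewrite /btrunc cabsM ler_piMl ?cabs_ge0 // cabs_cindic_le1. Qed.

Lemma cmeasurable_btrunc {R : realType} {d : nat} (f : d.-tuple R -> R[i]) n :
  cmeasurable f -> cmeasurable (btrunc f n).
Proof. by move=> mf; apply: cmeasurableM => //; apply: cmeasurable_cindic; exact: measurable_ball. Qed.

Lemma L2b_btrunc {R : realType} {d : nat} (leb : {measure set (d.-tuple R) -> \bar R})
  (f : d.-tuple R -> R[i]) n : inLp leb 2 f -> L2b leb (btrunc f n).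
Proof.
move=> [mf fin]; have mb := cmeasurable_btrunc f n mf; split; first exact: mb.
- exists n => x nx; rewrite /btrunc /cindic indicE memNset; last by move=> /= /ball_cube.
  by apply: complex_ext; rewrite ?cReM ?cImM /= !mul0r ?subr0 ?addr0.
- apply: le_lt_trans fin; apply: (Ip_le _ _ _ _ _ (ler0n _ 2) mb mf) => x.
  exact: cabs_btrunc_le.
Qed.

Lemma ftruncE {R : realType} {d : nat} (leb : {measure set (d.-tuple R) -> \bar R})
  (f : d.-tuple R -> R[i]) n : ftrunc leb f n = FTb leb (btrunc f n).
Proof.
apply/funext => xi; rewrite /ftrunc /FTb /cintegral; congr Complex; rewrite Rintegral_mkcond.
  apply: eq_Rintegral => x _; rewrite patchE /btrunc /cindic indicE.
  by case: (_ \in _); rewrite !cReM /= ?mul0r ?mul1r ?cImM /= ?mul0r ?mul1r ?subr0 ?addr0 ?mulr0 ?subr0.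
apply: eq_Rintegral => x _; rewrite patchE /btrunc /cindic indicE.
by case: (_ \in _); rewrite !cImM /= ?cReM ?cImM /= ?mul0r ?mul1r ?subr0 ?addr0 ?mulr0 ?subr0 ?addr0.
Qed.

Lemma btrunc_eventually {R : realType} {d : nat} (f : d.-tuple R -> R[i]) x :
  exists M, forall n, (M <= n)%N -> btrunc f n x = f x.
Proof.
exists (d * (Num.truncn (\sum_(i < d) `|tnth x i|)).+1)%N => n h.
rewrite /btrunc /cindic indicE mem_set.
  by apply: complex_ext; rewrite ?cReM ?cImM /= !mul0r ?mul1r ?subr0 ?addr0.
apply: cube_ball h _ => i; rewrite !tnth_mktuple -ler_norml.
apply: (@le_trans _ _ (\sum_(i < d) `|tnth x i|)).
  by rewrite (bigD1 i) //= lerDl sumr_ge0.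
by apply: ltW; rewrite truncnS_gt.
Qed.

Lemma btrunc_tends0 {R : realType} {d : nat} (leb : {measure set (d.-tuple R) -> \bar R})
  (f : d.-tuple R -> R[i]) : inLp leb 2 f ->
  tends0 (fun n => Ip leb 2 (fun x => btrunc f n x - f x)).
Proof.
move=> [mf fin]; have mb n := cmeasurable_btrunc f n mf.
apply: (Ip_dominated _ _ 2 (btrunc f) f f _ mb mf mf _ fin).
- by rewrite ler1n.
- by apply: aeW => x; have [M hM] := btrunc_eventually f x; exact: ccvg_eventually hM.
- move=> n x; rewrite /btrunc /cindic indicE; case: (_ \in _).
    rewrite (_ : _ - _ = 0) ?cabs0 ?cabs_ge0 //.
    by apply: complex_ext; rewrite ?cReD ?cImD ?cReN ?cImN ?cReM ?cImM /= !mul0r ?mul1r ?subr0 ?addr0 subrr.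
  rewrite (_ : _ - _ = - f x) ?cabsN //.
  by apply: complex_ext; rewrite ?cReD ?cImD ?cReN ?cImN ?cReM ?cImM /= !mul0r ?subr0 ?addr0 ?add0r ?sub0r.
Qed.

Lemma inLp_lincomb {R : realType} {d : nat} (leb : {measure set (d.-tuple R) -> \bar R}) (p : R)
  (a : R[i]) (f g : d.-tuple R -> R[i]) : 0 <= p -> inLp leb p f -> inLp leb p g ->
  inLp leb p (fun x => a * f x + g x).
Proof.
move=> p0 [mf ff] [mg fg]; have maf := cmeasurableM _ _ _ (cmeasurableC d a) mf.
split; first exact: cmeasurableD.
apply: (le_lt_trans (IpD _ leb p _ _ p0 maf mg)).
have fin : ((2 `^ p)%:E \is a fin_num) by [].
have lef (r : R) : (0 <= (r `^ p)%:E)%E by rewrite lee_fin powR_ge0.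
apply: lte_mul_pinfty; [exact: lef|exact: fin|].
rewrite (IpZ _ _ _ a _ mf); apply: lte_add_pinfty; last exact: fg.
by apply: lte_mul_pinfty; [exact: lef| |exact: ff].
Qed.

Lemma L2b_lincomb {R : realType} {d : nat} (leb : {measure set (d.-tuple R) -> \bar R})
  (a : R[i]) (f g : d.-tuple R -> R[i]) : L2b leb f -> L2b leb g ->
  L2b leb (fun x => a * f x + g x).
Proof.
move=> [mf [N hN] ff] [mg [M hM] fg].
have [m fin] := inLp_lincomb leb 2 a f g (ler0n _ 2) (conj mf ff) (conj mg fg).
split; [exact: m| |exact: fin]; exists (maxn N M) => x nx.
rewrite hN ?hM ?mulr0 ?addr0 // => h; apply: nx; apply: cube_monotone h.
  exact: leq_maxr.
exact: leq_maxl.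
Qed.

Lemma FTb_lincomb {R : realType} {d : nat} (leb : {measure set (d.-tuple R) -> \bar R})
  (a : R[i]) (f g : d.-tuple R -> R[i]) xi : is_lebesgue leb -> L2b leb f -> L2b leb g ->
  FTb leb (fun x => a * f x + g x) xi = a * FTb leb f xi + FTb leb g xi.
Proof.
move=> hl hf hg; have hfg := L2b_lincomb leb a f g hf hg.
rewrite !FTbE //.
have [u1 _ _] := L2b_cRe leb f hl hf; have [v1 _ _] := L2b_cIm leb f hl hf.
have [u2 _ _] := L2b_cRe leb g hl hg; have [v2 _ _] := L2b_cIm leb g hl hg.
have cl (w1 w2 w3 w : d.-tuple R -> R) (p q r : R) : leb.-integrable setT (EFin \o w1) ->
    leb.-integrable setT (EFin \o w2) -> leb.-integrable setT (EFin \o w3) ->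
    (forall x, w x = p * w1 x + q * w2 x + r * w3 x) ->
    cosT leb w xi = p * cosT leb w1 xi + q * cosT leb w2 xi + r * cosT leb w3 xi /\
    sinT leb w xi = p * sinT leb w1 xi + q * sinT leb w2 xi + r * sinT leb w3 xi.
  move=> i1 i2 i3 we; split.
    have [_ <-] := Rintegral_lincomb3 leb _ _ _ p q r (integrable_cos_mul leb w1 xi i1)
      (integrable_cos_mul leb w2 xi i2) (integrable_cos_mul leb w3 xi i3).
    by apply: eq_Rintegral => x _; rewrite we; ring.
  have [_ <-] := Rintegral_lincomb3 leb _ _ _ p q r (integrable_sin_mul leb w1 xi i1)
    (integrable_sin_mul leb w2 xi i2) (integrable_sin_mul leb w3 xi i3).
  by apply: eq_Rintegral => x _; rewrite we; ring.
have eR x : cRe (a * f x + g x) = cRe a * cRe (f x) + (- cIm a) * cIm (f x) + 1 * cRe (g x).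
  by rewrite cReD cReM; ring.
have eI x : cIm (a * f x + g x) = cRe a * cIm (f x) + cIm a * cRe (f x) + 1 * cIm (g x).
  by rewrite cImD cImM; ring.
have [cR sR] := cl _ _ _ (fun x => cRe (a * f x + g x)) _ _ _ u1 v1 u2 eR.
have [cI sI] := cl _ _ _ (fun x => cIm (a * f x + g x)) _ _ _ v1 u1 v2 eI.
rewrite cR sR cI sI; apply: complex_ext; rewrite ?cReD ?cImD ?cReM ?cImM /=; ring.
Qed.

(** * The Fourier transform on L^2 *)

Lemma Ip_triangle {R : realType} (d : nat) (mu : {measure set (d.-tuple R) -> \bar R})
  (p : R) (f g h : d.-tuple R -> R[i]) : 0 <= p -> cmeasurable f -> cmeasurable g -> cmeasurable h ->
  (Ip mu p (fun x => f x - h x)%R <= (2 `^ p)%:E *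
     (Ip mu p (fun x => f x - g x)%R + Ip mu p (fun x => g x - h x)%R))%E.
Proof.
move=> p0 mf mg mh.
have := IpD _ mu p _ _ p0 (cmeasurableB _ _ _ mf mg) (cmeasurableB _ _ _ mg mh).
rewrite (_ : (fun x => (f x - g x) + (g x - h x)) = (fun x => f x - h x)); first exact: id.
by apply/funext => x; rewrite addrA subrK.
Qed.

Lemma Ip_limit_unique {R : realType} (d : nat) (mu : {measure set (d.-tuple R) -> \bar R})
  (p : R) (u : nat -> d.-tuple R -> R[i]) (f g : d.-tuple R -> R[i]) : 0 <= p ->
  (forall n, cmeasurable (u n)) -> cmeasurable f -> cmeasurable g ->
  tends0 (fun n => Ip mu p (fun x => u n x - f x)) ->
  tends0 (fun n => Ip mu p (fun x => u n x - g x)) -> aeq_c mu f g.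
Proof.
move=> p0 hu mf mg h1 h2; apply: (Ip_eq0 _ mu p) => //.
apply: tends0_cst0; first exact: Ip_ge0.
apply: (tends0_le _ _ _ (tends0Z (2 `^ p) _ (powR_ge0 _ _) (tends0D _ _ h1 h2))) => n.
by rewrite (IpB_sym _ mu p (u n) f); exact: Ip_triangle.
Qed.

(** [is_FT2] rewritten with [Ip] and with plain transforms of the cut-off functions; [is_FT2P] is
    the equivalence. *)
Definition FT {R : realType} {d : nat} (leb : {measure set (d.-tuple R) -> \bar R})
  (f F : d.-tuple R -> R[i]) : Prop :=
  [/\ inLp leb 2 f, inLp leb 2 F &
   tends0 (fun n => Ip leb 2 (fun xi => FTb leb (btrunc f n) xi - F xi))].

Lemma cmeasurable_FTb_btrunc {R : realType} {d : nat} (leb : {measure set (d.-tuple R) -> \bar R})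
  (f : d.-tuple R -> R[i]) n : is_lebesgue leb -> inLp leb 2 f -> cmeasurable (FTb leb (btrunc f n)).
Proof. by move=> hl hf; have [] := plancherel_bounded leb _ hl (L2b_btrunc leb f n hf). Qed.

Lemma fin_Ip_limit {R : realType} (d : nat) (mu : {measure set (d.-tuple R) -> \bar R})
  (p : R) (u : nat -> d.-tuple R -> R[i]) (f : d.-tuple R -> R[i]) : 0 <= p ->
  (forall n, inLp mu p (u n)) -> cmeasurable f ->
  tends0 (fun n => Ip mu p (fun x => u n x - f x)) -> inLp mu p f.
Proof.
move=> p0 hu mf h; split => //; have [N /(_ N (leqnn N)) hN] := h _ ltr01.
have [mN fN] := hu N.
have := IpD _ mu p _ _ p0 mN (cmeasurableB _ _ _ mf mN).
rewrite (_ : (fun x => _ + _) = f); last by apply/funext => x; rewrite addrC subrK.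
move/le_lt_trans; apply; apply: lte_mul_pinfty; [by rewrite lee_fin powR_ge0|by []|].
apply: lte_add_pinfty; first exact: fN.
by rewrite IpB_sym; apply: le_lt_trans hN _; exact: ltry.
Qed.

(** By linearity and Plancherel's identity, the transforms of the truncations are Cauchy because the
    truncations are. *)
Lemma FT_exists {R : realType} {d : nat} (leb : {measure set (d.-tuple R) -> \bar R})
  (f : d.-tuple R -> R[i]) : is_lebesgue leb -> inLp leb 2 f -> exists F, FT leb f F.
Proof.
move=> hl hf; have mb n := cmeasurable_FTb_btrunc leb f n hl hf.
have [_ K0] := integrable_Kern1 d leb hl.
have p0 : (0 : R) <= 2 by [].
have hb n := L2b_btrunc leb f n hf.
have h := btrunc_tends0 leb f hf.
have mt n : cmeasurable (btrunc f n) by exact: cmeasurable_btrunc (proj1 hf).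
have mf := proj1 hf.
have Ib n m : (Ip leb 2 (fun xi => (FTb leb (btrunc f n) xi - FTb leb (btrunc f m) xi)%R) <=
  (\int[leb]_x Kern 1 x)%:E * ((2 `^ 2)%:E * (Ip leb 2 (fun x => (btrunc f n x - f x)%R) + Ip leb 2 (fun x => (btrunc f m x - f x)%R))))%E.
  have hd := L2b_lincomb leb (-1) _ _ (hb m) (hb n).
  have [_ e] := plancherel_bounded leb _ hl hd.
  rewrite (_ : (fun xi => _ - _) = FTb leb (fun x => -1 * btrunc f m x + btrunc f n x)); last first.
    by apply/funext => xi; rewrite (FTb_lincomb leb (-1) _ _ xi hl (hb m) (hb n)) mulN1r addrC.
  rewrite e; apply: lee_wpmul2l; first by rewrite lee_fin ltW.
  rewrite (IpB_sym _ leb 2 (btrunc f m)).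
  rewrite (_ : (fun x => -1 * _ + _) = (fun x => btrunc f n x - btrunc f m x)); last first.
    by apply/funext => x; rewrite mulN1r addrC.
  exact: Ip_triangle.
have [|F [mF hF]] := Lp_complete d leb 2 (fun n => FTb leb (btrunc f n)) (ler1n _ 2) mb.
  move=> e e0.
  have c0 : 0 < \int[leb]_x Kern 1 x * (2 `^ 2 * 2) by rewrite mulr_gt0 // mulr_gt0 // powR_gt0.
  have [N hN] := h _ (divr_gt0 e0 c0); exists N => n m Nn Nm.
  apply: (le_trans (Ib n m)).
  apply: (@le_trans _ _ ((\int[leb]_x Kern 1 x)%:E * ((2 `^ 2)%:E * ((e / (\int[leb]_x Kern 1 x * (2 `^ 2 * 2)))%:E + (e / (\int[leb]_x Kern 1 x * (2 `^ 2 * 2)))%:E)))%E).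
    apply: lee_wpmul2l; first by rewrite lee_fin ltW.
    apply: lee_wpmul2l; first by rewrite lee_fin powR_ge0.
    by apply: leeD; [exact: hN|exact: hN].
  rewrite -EFinD -!EFinM lee_fin le_eqVlt; apply/orP; left; apply/eqP.
  have k0 : \int[leb]_x Kern 1 x != 0 by rewrite gt_eqF.
  have k2 : 2 `^ 2 != 0 :> R by rewrite gt_eqF // powR_gt0.
  by field; rewrite k0 k2.
exists F; split; [exact: hf| |exact: hF].
apply: (fin_Ip_limit _ leb 2 _ _ p0 _ mF hF) => n; split; first exact: mb.
have [_ e] := plancherel_bounded leb _ hl (hb n); rewrite -/(Ip leb 2 _) e.
by apply: lte_mul_pinfty; [rewrite lee_fin ltW|by []|case: (hb n)].
Qed.

Lemma FT_le {R : realType} {d : nat} (leb : {measure set (d.-tuple R) -> \bar R})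
  (f F : d.-tuple R -> R[i]) : is_lebesgue leb -> FT leb f F ->
  (Ip leb 2 F <= (\int[leb]_x Kern 1 x)%:E * Ip leb 2 f)%E.
Proof.
move=> hl [hf hF hT]; have mb n := cmeasurable_FTb_btrunc leb f n hl hf.
have [_ K0] := integrable_Kern1 d leb hl.
have [phi hphi] := Ip_subseq_ae d leb 2 _ F (ler1n _ 2) mb (proj1 hF) hT.
apply: (Ip_fatou d leb 2 (fun k => FTb leb (btrunc f (phi k))) F _ (ler1n _ 2) (fun k => mb _) (proj1 hF) hphi) => n.
have [_ ->] := plancherel_bounded leb _ hl (L2b_btrunc leb f (phi n) hf).
apply: lee_wpmul2l; first by rewrite lee_fin ltW.
apply: (Ip_le _ _ _ _ _ (ler0n _ 2) _ (proj1 hf)); first exact: cmeasurable_btrunc (proj1 hf).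
exact: cabs_btrunc_le.
Qed.

(** The factor 2^2 is the price of the quasi-triangle inequality. It is harmless, since the bound
    serves to prove injectivity and to recognize Cauchy sequences. *)
Lemma FT_ge {R : realType} {d : nat} (leb : {measure set (d.-tuple R) -> \bar R})
  (f F : d.-tuple R -> R[i]) : is_lebesgue leb -> FT leb f F ->
  ((\int[leb]_x Kern 1 x)%:E * Ip leb 2 f <= (2 `^ 2)%:E * Ip leb 2 F)%E.
Proof.
move=> hl [hf hF hT]; have mb n := cmeasurable_FTb_btrunc leb f n hl hf.
have [_ K0] := integrable_Kern1 d leb hl.
set C := \int[leb]_x Kern 1 x in K0 *.
have c0 : (0 : R) < 2 `^ 2 by rewrite powR_gt0.
apply/lee_addgt0Pr => e e0.
have [N hN] := hT _ (divr_gt0 e0 c0).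
have -> : ((2 `^ 2)%:E * Ip leb 2 F + e%:E = (2 `^ 2)%:E * (Ip leb 2 F + (e / 2 `^ 2)%:E))%E.
  have h0 : (0 <= (e / 2 `^ 2)%:E)%E by rewrite lee_fin divr_ge0 // ltW.
  rewrite (ge0_muleDr _ (Ip_ge0 _ leb 2 F) h0) -EFinM; congr (_ + EFin _)%E.
  by rewrite mulrC divfK // gt_eqF.
rewrite muleC -lee_pdivlMr //.
apply: (Ip_fatou d leb 2 (fun k => btrunc f (N + k)) f _ (ler1n _ 2) _ (proj1 hf)).
- by move=> k; apply: cmeasurable_btrunc; case: hf.
- apply: aeW => x; have [M hM] := btrunc_eventually f x.
  by apply: (ccvg_eventually _ _ M) => n Mn; apply: hM; rewrite (leq_trans Mn) // leq_addl.
move=> k; rewrite lee_pdivlMr // muleC.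
have [_ <-] := plancherel_bounded leb _ hl (L2b_btrunc leb f (N + k) hf).
have := IpD _ leb 2 _ _ (ler0n _ 2) (proj1 hF) (cmeasurableB _ _ _ (mb (N + k)%N) (proj1 hF)).
rewrite (_ : (fun x => F x + _) = FTb leb (btrunc f (N + k))); last first.
  by apply/funext => x; rewrite addrC subrK.
move/le_trans; apply; apply: lee_wpmul2l; first by rewrite lee_fin powR_ge0.
by apply: leeD2l; apply: hN; rewrite leq_addr.
Qed.

Lemma btrunc_lincomb {R : realType} {d : nat} (a : R[i]) (f g : d.-tuple R -> R[i]) n :
  btrunc (fun x => a * f x + g x) n = (fun x => a * btrunc f n x + btrunc g n x).
Proof. by apply/funext => x; rewrite /btrunc mulrDr mulrCA. Qed.

Lemma FT_lincomb {R : realType} {d : nat} (leb : {measure set (d.-tuple R) -> \bar R})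
  (a : R[i]) (f g F G : d.-tuple R -> R[i]) : is_lebesgue leb -> FT leb f F -> FT leb g G ->
  FT leb (fun x => a * f x + g x) (fun xi => a * F xi + G xi).
Proof.
move=> hl [hf hF hT] [hg hG hT']; split.
- by apply: inLp_lincomb.
- by apply: inLp_lincomb.
have mb n := cmeasurable_FTb_btrunc leb f n hl hf; have mb' n := cmeasurable_FTb_btrunc leb g n hl hg.
have k1 : 0 <= cabs a `^ 2 by exact: powR_ge0.
have k2 : (0 : R) <= 2 `^ 2 by exact: powR_ge0.
apply: (tends0_le _ _ _ (tends0Z _ _ k2 (tends0D _ _ (tends0Z _ _ k1 hT) hT'))) => n.
have mB := cmeasurableB _ _ _ (mb n) (proj1 hF); have mB' := cmeasurableB _ _ _ (mb' n) (proj1 hG).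
rewrite -(IpZ _ leb 2 a _ mB).
have e : (fun xi => FTb leb (btrunc (fun x => a * f x + g x) n) xi - (a * F xi + G xi)) =
    (fun xi => a * (FTb leb (btrunc f n) xi - F xi) + (FTb leb (btrunc g n) xi - G xi)).
  apply/funext => xi; rewrite btrunc_lincomb (FTb_lincomb leb a _ _ xi hl (L2b_btrunc leb f n hf) (L2b_btrunc leb g n hg)).
  by rewrite mulrBr opprD addrACA.
by rewrite e; exact: (IpD _ leb 2 _ _ (ler0n _ 2) (cmeasurableM _ _ _ (cmeasurableC d a) mB) mB').
Qed.

Lemma cmulN1D {R : realType} (x y : R[i]) : -1 * x + y = y - x.
Proof. by rewrite mulN1r addrC. Qed.

Lemma FTB {R : realType} {d : nat} (leb : {measure set (d.-tuple R) -> \bar R})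
  (f g F G : d.-tuple R -> R[i]) : is_lebesgue leb -> FT leb f F -> FT leb g G ->
  FT leb (fun x => f x - g x) (fun xi => F xi - G xi).
Proof.
move=> hl h1 h2; have := FT_lincomb leb (-1) _ _ _ _ hl h2 h1.
rewrite (_ : (fun x => -1 * g x + f x) = (fun x => f x - g x)); last first.
  by apply/funext => x; rewrite cmulN1D.
rewrite (_ : (fun x => -1 * G x + F x) = (fun x => F x - G x)); first exact: id.
by apply/funext => x; rewrite cmulN1D.
Qed.

Lemma FT_aeq {R : realType} {d : nat} (leb : {measure set (d.-tuple R) -> \bar R})
  (f g F G : d.-tuple R -> R[i]) : is_lebesgue leb -> FT leb f F -> FT leb g G ->
  aeq_c leb f g -> aeq_c leb F G.
Proof.
move=> hl h1 h2 fg; have [_ [mF _] _] := h1; have [_ [mG _] _] := h2.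
have [[mf _] _ _] := h1; have [[mg _] _ _] := h2.
apply: (Ip_eq0 _ leb 2 F G mF mG); apply/eqP; rewrite eq_le Ip_ge0 andbT.
apply: (le_trans (FT_le leb _ _ hl (FTB leb _ _ _ _ hl h1 h2))).
rewrite (_ : Ip leb 2 (fun x => f x - g x) = 0%E); first by rewrite mule0.
have n2 : (2 : R) != 0 by rewrite gt_eqF.
rewrite -(Ip0 d leb 2 n2); apply: Ip_ae_eq; [apply: cmeasurableB; assumption|exact: cmeasurableC|].
have [N [mN N0 sN]] := fg; exists N; split => // x /= h; apply: sN => /= h'.
by apply: h; rewrite h' subrr.
Qed.

Lemma FT_inj {R : realType} {d : nat} (leb : {measure set (d.-tuple R) -> \bar R})
  (f g F G : d.-tuple R -> R[i]) : is_lebesgue leb -> FT leb f F -> FT leb g G ->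
  aeq_c leb F G -> aeq_c leb f g.
Proof.
move=> hl h1 h2 fg; have [_ [mF _] _] := h1; have [_ [mG _] _] := h2.
have [[mf _] _ _] := h1; have [[mg _] _ _] := h2.
have [_ K0] := integrable_Kern1 d leb hl.
apply: (Ip_eq0 _ leb 2 f g mf mg); apply/eqP; rewrite eq_le Ip_ge0 andbT.
have := FT_ge leb _ _ hl (FTB leb _ _ _ _ hl h1 h2).
rewrite (_ : Ip leb 2 (fun x => F x - G x) = 0%E).
  by rewrite mule0 pmule_rle0.
have n2 : (2 : R) != 0 by rewrite gt_eqF.
rewrite -(Ip0 d leb 2 n2); apply: Ip_ae_eq; [apply: cmeasurableB; assumption|exact: cmeasurableC|].
have [N [mN N0 sN]] := fg; exists N; split => // x /= h; apply: sN => /= h'.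
by apply: h; rewrite h' subrr.
Qed.

Lemma aeq_cC {R : realType} {d : nat} (leb : {measure set (d.-tuple R) -> \bar R})
  (f g : d.-tuple R -> R[i]) : aeq_c leb f g -> aeq_c leb g f.
Proof.
by case=> N [mN N0 sN]; exists N; split => // x /= h; apply: sN => /= /esym.
Qed.

Lemma aeq_c_trans {R : realType} {d : nat} (leb : {measure set (d.-tuple R) -> \bar R})
  (g f h : d.-tuple R -> R[i]) : aeq_c leb f g -> aeq_c leb g h -> aeq_c leb f h.
Proof.
move=> fg gh; have := negligibleU fg gh; apply: negligibleS => x /= fh.
by have [e|?] := pselect (f x = g x); [right; rewrite -e|left].
Qed.

Lemma FT_ae {R : realType} {d : nat} (leb : {measure set (d.-tuple R) -> \bar R})
  (f g F G : d.-tuple R -> R[i]) : is_lebesgue leb -> FT leb f F -> inLp leb 2 g -> inLp leb 2 G ->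
  aeq_c leb f g -> aeq_c leb F G -> FT leb g G.
Proof.
move=> hl h1 hg hG fg FG; have [G' h2] := FT_exists leb g hl hg.
have [_ hG' hT] := h2.
have GG : aeq_c leb G' G.
  by apply: (aeq_c_trans leb F) FG; apply: aeq_cC; exact: FT_aeq hl h1 h2 fg.
split; [exact: hg|exact: hG|]; apply: (tends0_le _ _ _ hT) => n.
have mb := cmeasurable_FTb_btrunc leb g n hl hg.
rewrite le_eqVlt; apply/orP; left; apply/eqP.
apply: Ip_ae_eq; [exact: cmeasurableB mb (proj1 hG)|exact: cmeasurableB mb (proj1 hG')|].
apply: negligibleS GG => x /= h e; apply: h; by rewrite e.
Qed.

(** The graph of the transform is closed: by [FT_le], the functions U_k also converge to a transform
    G of f, and limits in L^2 are unique almost everywhere. *)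
Lemma FT_closed {R : realType} {d : nat} (leb : {measure set (d.-tuple R) -> \bar R})
  (u U : nat -> d.-tuple R -> R[i]) (f F : d.-tuple R -> R[i]) : is_lebesgue leb ->
  (forall k, FT leb (u k) (U k)) -> inLp leb 2 f -> inLp leb 2 F ->
  tends0 (fun k => Ip leb 2 (fun x => u k x - f x)) ->
  tends0 (fun k => Ip leb 2 (fun x => U k x - F x)) -> FT leb f F.
Proof.
move=> hl hu hf hF h1 h2; have [G hG] := FT_exists leb f hl hf.
have [_ G2 _] := hG; have [_ K0] := integrable_Kern1 d leb hl.
have mU k : cmeasurable (U k) by have [_ [mk _] _] := hu k.
apply: (FT_ae leb f f G F hl hG hf hF).
  by exists set0; split; [exact: measurable0|exact: measure0|move=> x /= h; case: h].
apply: (Ip_limit_unique d leb 2 U G F (ler0n _ 2) mU (proj1 G2) (proj1 hF) _ h2).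
apply: (tends0_le _ _ _ (tends0Z _ _ (ltW K0) h1)) => k.
exact: FT_le leb _ _ hl (FTB leb _ _ _ _ hl (hu k) hG).
Qed.

Lemma FT_L2b {R : realType} {d : nat} (leb : {measure set (d.-tuple R) -> \bar R})
  (f : d.-tuple R -> R[i]) : is_lebesgue leb -> L2b leb f -> FT leb f (FTb leb f).
Proof.
move=> hl hf; have [mF eF] := plancherel_bounded leb f hl hf.
have [mf [N hN] ff] := hf; have [_ K0] := integrable_Kern1 d leb hl.
split; first exact: (conj mf ff).
  split; first exact: mF.
  rewrite -/(Ip leb 2 _) eF.
  by apply: lte_mul_pinfty; [rewrite lee_fin ltW|by []|exact: ff].
move=> e e0; exists (d * N)%N => n Nn.
rewrite (_ : btrunc f n = f).
  have n2 : (2 : R) != 0 by rewrite gt_eqF.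
  rewrite (_ : (fun xi => FTb leb f xi - FTb leb f xi) = fun=> 0); last by apply/funext => x; rewrite subrr.
  by rewrite (Ip0 d leb 2 n2) lee_fin ltW.
apply/funext => x; have [h|/hN h] := pselect (cube d N x); last by rewrite /btrunc h mulr0.
rewrite /btrunc /cindic indicE mem_set; last exact: cube_ball Nn h.
by apply: complex_ext; rewrite ?cReM ?cImM /= !mul0r ?mul1r ?subr0 ?addr0.
Qed.

Lemma cintegral_addt {R : realType} {d : nat} (leb : {measure set (d.-tuple R) -> \bar R})
  (w : d.-tuple R) (g : d.-tuple R -> R[i]) : is_lebesgue leb -> cmeasurable g ->
  cintegral leb setT (fun x => g (addt x w)) = cintegral leb setT g.
Proof.
move=> hl [m1 m2]; rewrite /cintegral /Rintegral; congr (Complex (fine _) (fine _)).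
  by apply: (integral_addt d leb w (fun x => (cRe (g x))%:E) hl); exact/measurable_EFinP.
by apply: (integral_addt d leb w (fun x => (cIm (g x))%:E) hl); exact/measurable_EFinP.
Qed.

Lemma cabs_expi {R : realType} (t : R) : cabs (expi t) = 1.
Proof. by rewrite /cabs /= cos2Dsin2 sqrtr1. Qed.

Lemma expiD {R : realType} (s t : R) : expi (s + t) = expi s * expi t.
Proof. by apply: complex_ext; rewrite ?cReM ?cImM /= ?cosD ?sinD; ring. Qed.

Lemma cmeasurable_expi {R : realType} {d : nat} (h : d.-tuple R -> R) :
  measurable_fun setT h -> cmeasurable (fun x => expi (h x)).
Proof.
move=> mh; split; first exact: (measurableT_comp measurable_cos mh).
exact: (measurableT_comp measurable_sin mh).
Qed.

Lemma L2b_addt {R : realType} {d : nat} (leb : {measure set (d.-tuple R) -> \bar R})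
  (w : d.-tuple R) (f : d.-tuple R -> R[i]) : is_lebesgue leb -> L2b leb f ->
  L2b leb (fun x => f (addt x w)).
Proof.
move=> hl [mf [N hN] ff]; split; first exact: cmeasurable_addt.
  exists (N + (Num.truncn (\sum_(i < d) `|tnth w i|)).+1)%N => x nx; apply: hN => cx; apply: nx => i.
  have := cx i; rewrite !tnth_mktuple -!ler_norml natrD => h.
  have hw : `|tnth w i| <= (Num.truncn (\sum_(i < d) `|tnth w i|)).+1%:R.
    apply: (@le_trans _ _ (\sum_(i < d) `|tnth w i|)).
      by rewrite (bigD1 i) //= lerDl sumr_ge0.
    by apply: ltW; rewrite truncnS_gt.
  rewrite -[tnth x i](addrK (tnth w i)); apply: (le_trans (ler_normB _ _)).
  exact: lerD.
by rewrite Ip_addt.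
Qed.

Lemma FTb_addt {R : realType} {d : nat} (leb : {measure set (d.-tuple R) -> \bar R})
  (w : d.-tuple R) (f : d.-tuple R -> R[i]) xi : is_lebesgue leb -> L2b leb f ->
  FTb leb (fun x => f (addt x w)) xi = expi (- dotp xi w) * FTb leb f xi.
Proof.
move=> hl hf; have mf : cmeasurable f by case: hf.
set a := expi (- dotp xi w).
(* The product a F is split as (a - 1) F + F to match the shape of the linearity lemma. *)
have <- : (a - 1) * FTb leb f xi + FTb leb f xi = a * FTb leb f xi by rewrite mulrBl mul1r subrK.
rewrite -(FTb_lincomb leb (a - 1) f f xi hl hf hf).
pose g z := expi (dotp xi z) * ((a - 1) * f z + f z).
have mg : cmeasurable g.
  apply: cmeasurableM; first exact: (cmeasurable_expi _ (measurable_dotp d xi)).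
  by apply: cmeasurableD => //; apply: cmeasurableM => //; exact: cmeasurableC.
rewrite /FTb -[RHS](cintegral_addt leb w g hl mg); congr (cintegral leb setT _).
apply/funext => x; rewrite /g dotpDr mulrBl mul1r subrK /a !mulrA -expiD.
by rewrite addrK.
Qed.

Lemma inLp_addt {R : realType} {d : nat} (leb : {measure set (d.-tuple R) -> \bar R}) (p : R)
  (w : d.-tuple R) (f : d.-tuple R -> R[i]) : is_lebesgue leb -> inLp leb p f ->
  inLp leb p (fun x => f (addt x w)).
Proof.
move=> hl [mf ff]; split; first exact: cmeasurable_addt.
by have := Ip_addt d leb p w f hl mf; rewrite /Ip => ->.
Qed.

Lemma inLp_bounded_mul {R : realType} {d : nat} (leb : {measure set (d.-tuple R) -> \bar R}) (p : R)
  (m f : d.-tuple R -> R[i]) : 0 <= p -> cmeasurable m -> (forall x, cabs (m x) <= 1) ->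
  inLp leb p f -> inLp leb p (fun x => m x * f x).
Proof.
move=> p0 mm m1 [mf ff]; have mmf := cmeasurableM _ _ _ mm mf; split; first exact: mmf.
apply: le_lt_trans ff; apply: (Ip_le _ leb p _ _ p0 mmf mf) => x.
by rewrite cabsM; apply: ler_piMl; [exact: cabs_ge0|exact: m1].
Qed.

Lemma FT_addt {R : realType} {d : nat} (leb : {measure set (d.-tuple R) -> \bar R})
  (w : d.-tuple R) (f F : d.-tuple R -> R[i]) : is_lebesgue leb -> FT leb f F ->
  FT leb (fun x => f (addt x w)) (fun xi => expi (- dotp xi w) * F xi).
Proof.
move=> hl [hf hF hT].
have me : cmeasurable (fun xi => expi (- dotp xi w)).
  apply: cmeasurable_expi; apply: measurable_funN.
  by rewrite (_ : (fun x => dotp x w) = dotp w); [exact: measurable_dotp|apply/funext => x; exact: dotpC].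
have e1 xi : cabs (expi (- dotp xi w)) <= 1 by rewrite cabs_expi.
apply: (FT_closed leb (fun k x => btrunc f k (addt x w)) (fun k xi => expi (- dotp xi w) * FTb leb (btrunc f k) xi) _ _ hl).
- move=> k; have hb := L2b_btrunc leb f k hf.
  have := FT_L2b leb _ hl (L2b_addt leb w _ hl hb).
  rewrite (_ : FTb leb (fun x => btrunc f k (addt x w)) = fun xi => expi (- dotp xi w) * FTb leb (btrunc f k) xi); first exact: id.
  by apply/funext => xi; exact: FTb_addt.
- exact: inLp_addt.
- exact: (inLp_bounded_mul leb 2 _ _ (ler0n _ 2) me e1 hF).
- have h := btrunc_tends0 leb f hf; apply: (tends0_le _ _ _ h) => k.
  have mfk := cmeasurableB _ _ _ (cmeasurable_btrunc f k (proj1 hf)) (proj1 hf).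
  by rewrite (Ip_addt d leb 2 w (fun x => btrunc f k x - f x) hl mfk).
- apply: (tends0_le _ _ _ hT) => k; rewrite le_eqVlt; apply/orP; left; apply/eqP.
  by apply: eq_integral => xi _; rewrite -mulrBr cabsM cabs_expi mul1r.
Qed.

Lemma tends0_Lpnorm {R : realType} {d : nat} (leb : {measure set (d.-tuple R) -> \bar R}) (p : R)
  (u : nat -> d.-tuple R -> R[i]) : 0 < p -> (forall n, (Ip leb p (u n) < +oo)%E) ->
  ((fun n => Lpnorm leb p (u n)) @ \oo --> (0 : R)) <-> tends0 (fun n => Ip leb p (u n)).
Proof.
move=> p0 fin.
have fn n : (fine (Ip leb p (u n)))%:E = Ip leb p (u n) by rewrite fineK // ge0_fin_numE ?Ip_ge0.
have f0 n : 0 <= fine (Ip leb p (u n)) by rewrite fine_ge0 // Ip_ge0.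
have pi0 : 0 < p^-1 by rewrite invr_gt0.
have nE n : Lpnorm leb p (u n) = fine (Ip leb p (u n)) `^ p^-1 by [].
split=> [/cvgnP h e e0|h].
  have [N hN] := h _ (powR_gt0 p^-1 e0); exists N => n /hN.
  rewrite sub0r normrN nE ger0_norm ?powR_ge0 // -fn lee_fin => hh.
  rewrite leNgt; apply/negP => /(gt0_ltr_powR pi0); rewrite !nnegrE => /(_ (ltW e0) (f0 n)).
  by rewrite ltNge hh.
apply/cvgnP => e e0; have [N hN] := h _ (powR_gt0 p e0); exists N => n /hN.
rewrite -fn lee_fin sub0r normrN nE ger0_norm ?powR_ge0 // => hh.
apply: (@le_trans _ _ ((e `^ p) `^ p^-1)).
  by apply: ge0_ler_powR; rewrite ?nnegrE ?powR_ge0 ?(ltW pi0).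
by rewrite -powRrM divff ?gt_eqF // powRr1 // ltW.
Qed.

Lemma is_FT2P {R : realType} {d : nat} (leb : {measure set (d.-tuple R) -> \bar R})
  (f F : d.-tuple R -> R[i]) : is_lebesgue leb -> is_FT2 leb f F <-> FT leb f F.
Proof.
move=> hl.
have key : inLp leb 2 f -> inLp leb 2 F ->
    ((fun n : nat => Lpnorm leb 2 (fun xi => F xi - ftrunc leb f n xi)) @ \oo --> (0 : R)) <->
    tends0 (fun n => Ip leb 2 (fun xi => FTb leb (btrunc f n) xi - F xi)).
  move=> hf hF; have fin n : (Ip leb 2 (fun xi => (F xi - ftrunc leb f n xi)%R) < +oo)%E.
    rewrite ftruncE; have [_ [mb fb] _] := FT_L2b leb _ hl (L2b_btrunc leb f n hf).
    apply: (le_lt_trans (IpB _ leb 2 _ _ (ler0n _ 2) (proj1 hF) mb)).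
    apply: lte_mul_pinfty; [by rewrite lee_fin powR_ge0|by []|].
    by apply: lte_add_pinfty; [exact: (proj2 hF)|exact: fb].
  apply: (iff_trans (tends0_Lpnorm leb 2 (fun n xi => F xi - ftrunc leb f n xi) (ltr0Sn _ 1) fin)).
  have e n : Ip leb 2 (fun xi => F xi - ftrunc leb f n xi) = Ip leb 2 (fun xi => FTb leb (btrunc f n) xi - F xi).
    by rewrite ftruncE IpB_sym.
  by split => h; apply: (tends0_le _ _ _ h) => n; rewrite e.
split=> [[hf [hF h]]|[hf hF h]].
  by split; [exact: hf|exact: hF|exact: (proj1 (key hf hF) h)].
by split; [exact: hf|split; [exact: hF|exact: (proj2 (key hf hF) h)]].
Qed.

(** * Martingale transforms along words of translations *)

Definition avgt {R : realType} {d : nat} (v : d.-tuple R) (f : d.-tuple R -> R[i]) x : R[i] :=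
  Complex 2^-1 0 * (f (addt x v) + f (addt x (negt v))).

Definition dift {R : realType} {d : nat} (v : d.-tuple R) (f : d.-tuple R -> R[i]) x : R[i] :=
  Complex 2^-1 0 * (f (addt x v) - f (addt x (negt v))).

(** The transition operator of the walk attached to the word: the average of f over all signed sums
    of its translations. The coefficients are ignored. *)
Fixpoint Pop {R : realType} {d : nat} (L : seq (d.-tuple R * R[i])) (f : d.-tuple R -> R[i])
  : d.-tuple R -> R[i] :=
  if L is l :: L' then avgt l.1 (Pop L' f) else f.

(** [dift l.1 (Pop L' f)] is the increment of the martingale at the letter [l], up to the random
    sign. Since [avgt] is self-adjoint and the adjoint of [dift v] is [dift (negt v)], the outer
    operators are the adjoint of the same map and represent conditioning on the final position. *)
Fixpoint Top {R : realType} {d : nat} (L : seq (d.-tuple R * R[i])) (f : d.-tuple R -> R[i])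
  : d.-tuple R -> R[i] :=
  if L is l :: L' then
    fun x => Top L' f x + l.2 * dift (negt l.1) (Pop L' (dift l.1 (Pop L' f))) x
  else fun=> 0.

Lemma addtA {R : realType} {d : nat} (x y z : d.-tuple R) : addt (addt x y) z = addt x (addt y z).
Proof. by apply: tuple_ext => k; rewrite !tnth_mktuple addrA. Qed.

Lemma negtK {R : realType} {d : nat} (x : d.-tuple R) : negt (negt x) = x.
Proof. by apply: tuple_ext => k; rewrite !tnth_map opprK. Qed.

Lemma addtK {R : realType} {d : nat} (x w : d.-tuple R) : addt (addt x w) (negt w) = x.
Proof. by rewrite addt_negtK. Qed.

Lemma addtNK {R : realType} {d : nat} (x w : d.-tuple R) : addt (addt x (negt w)) w = x.
Proof. by rewrite -{2}(negtK w) addtK. Qed.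

Lemma Pop_addt {R : realType} {d : nat} (L : seq (d.-tuple R * R[i])) (f : d.-tuple R -> R[i]) w x :
  Pop L (fun y => f (addt y w)) x = Pop L f (addt x w).
Proof.
elim: L x => [//|l L IH] x /=; rewrite /avgt !IH !addtA.
by rewrite (addtC l.1) (addtC (negt l.1)).
Qed.

Lemma Pop_lincomb {R : realType} {d : nat} (L : seq (d.-tuple R * R[i])) (a : R[i])
  (f g : d.-tuple R -> R[i]) x :
  Pop L (fun y => a * f y + g y) x = a * Pop L f x + Pop L g x.
Proof. by elim: L x => [//|l L IH] x /=; rewrite /avgt !IH; ring. Qed.

Lemma inLp0 {R : realType} {d : nat} (leb : {measure set (d.-tuple R) -> \bar R}) (p : R) :
  0 < p -> inLp leb p (fun=> 0).
Proof.
move=> p0; split; first exact: cmeasurableC.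
have pn : p != 0 by rewrite gt_eqF.
by have := Ip0 d leb p pn; rewrite /Ip => ->; exact: ltry.
Qed.

Lemma inLp_avgt {R : realType} {d : nat} (leb : {measure set (d.-tuple R) -> \bar R}) (p : R)
  v (f : d.-tuple R -> R[i]) : is_lebesgue leb -> 0 < p -> inLp leb p f -> inLp leb p (avgt v f).
Proof.
move=> hl p0 hf; have h1 := inLp_addt leb p v f hl hf; have h2 := inLp_addt leb p (negt v) f hl hf.
have h3 := inLp_lincomb leb p 1 _ _ (ltW p0) h1 h2.
have h4 := inLp_lincomb leb p (Complex 2^-1 0) _ _ (ltW p0) h3 (inLp0 leb p p0).
rewrite (_ : avgt v f = fun x => Complex 2^-1 0 * (1 * f (addt x v) + f (addt x (negt v))) + 0); first exact: h4.
by apply/funext => x; rewrite mul1r addr0.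
Qed.

Lemma inLp_dift {R : realType} {d : nat} (leb : {measure set (d.-tuple R) -> \bar R}) (p : R)
  v (f : d.-tuple R -> R[i]) : is_lebesgue leb -> 0 < p -> inLp leb p f -> inLp leb p (dift v f).
Proof.
move=> hl p0 hf; have h1 := inLp_addt leb p v f hl hf; have h2 := inLp_addt leb p (negt v) f hl hf.
have h3 := inLp_lincomb leb p (-1) _ _ (ltW p0) h2 h1.
have h4 := inLp_lincomb leb p (Complex 2^-1 0) _ _ (ltW p0) h3 (inLp0 leb p p0).
rewrite (_ : dift v f = fun x => Complex 2^-1 0 * (-1 * f (addt x (negt v)) + f (addt x v)) + 0); first exact: h4.
by apply/funext => x; rewrite cmulN1D addr0.
Qed.

Lemma inLp_Pop {R : realType} {d : nat} (leb : {measure set (d.-tuple R) -> \bar R}) (p : R)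
  L (f : d.-tuple R -> R[i]) : is_lebesgue leb -> 0 < p -> inLp leb p f -> inLp leb p (Pop L f).
Proof. by move=> hl p0 hf; elim: L => [//|l L IH] /=; exact: inLp_avgt. Qed.

Lemma inLp_Top {R : realType} {d : nat} (leb : {measure set (d.-tuple R) -> \bar R}) (p : R)
  L (f : d.-tuple R -> R[i]) : is_lebesgue leb -> 0 < p -> inLp leb p f -> inLp leb p (Top L f).
Proof.
move=> hl p0 hf; elim: L => [|l L IH] /=; first exact: inLp0.
rewrite (_ : (fun x => _) = fun x => l.2 * dift (negt l.1) (Pop L (dift l.1 (Pop L f))) x + Top L f x).
  apply: (inLp_lincomb leb p _ _ _ (ltW p0) _ IH).
  exact: (inLp_dift leb p _ _ hl p0 (inLp_Pop leb p L _ hl p0 (inLp_dift leb p _ _ hl p0 (inLp_Pop leb p L _ hl p0 hf)))).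
by apply/funext => x; rewrite addrC.
Qed.

Lemma powR_midpoint {R : realType} (p : R) (x y : R[i]) : 1 <= p ->
  cabs (Complex 2^-1 0 * (x + y)) `^ p <= 2^-1 * (cabs x `^ p) + 2^-1 * (cabs y `^ p).
Proof.
move=> p1; have x0 := cabs_ge0 x; have y0 := cabs_ge0 y.
have p0 : 0 <= p by lra.
set s := 2^-1 * (cabs x + cabs y).
have s0 : 0 <= s by rewrite mulr_ge0 // addr_ge0.
apply: (@le_trans _ _ (s `^ p)).
  apply: ge0_ler_powR; rewrite ?nnegrE ?cabs_ge0 //.
  by rewrite cabsM cabs_real ger0_norm //; apply: ler_wpM2l => //; exact: ler_cabsD.
have [s00|sp] := eqVneq s 0.
  have pn : p != 0 by rewrite gt_eqF //; lra.
  rewrite s00 (powR0 pn); apply: addr_ge0; apply: mulr_ge0 => //; exact: powR_ge0.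
have {}s0 : 0 < s by rewrite lt_neqAle eq_sym sp.
have h1 := powR_convex_tangent p s (cabs x) p1 s0 x0.
have h2 := powR_convex_tangent p s (cabs y) p1 s0 y0.
have e : p * s `^ (p - 1) * (cabs x - s) + p * s `^ (p - 1) * (cabs y - s) = 0.
  have e0 : (cabs x - s) + (cabs y - s) = 0 by rewrite /s; field.
  by rewrite -mulrDr e0 mulr0.
lra.
Qed.

Lemma Rintegral_addt {R : realType} {d : nat} (leb : {measure set (d.-tuple R) -> \bar R})
  (w : d.-tuple R) (h : d.-tuple R -> R) : is_lebesgue leb -> measurable_fun setT h ->
  \int[leb]_x h (addt x w) = \int[leb]_x h x.
Proof.
by move=> hl mh; rewrite /Rintegral (integral_addt d leb w (fun x => (h x)%:E) hl) //; exact/measurable_EFinP.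
Qed.

Lemma integrable_cabs_powR {R : realType} {d : nat} (leb : {measure set (d.-tuple R) -> \bar R})
  (p : R) (f : d.-tuple R -> R[i]) : inLp leb p f ->
  leb.-integrable setT (EFin \o (fun x => cabs (f x) `^ p)).
Proof.
move=> [mf ff]; apply/integrableP; split; first exact: measurable_cabs_powR.
rewrite (_ : integral _ _ _ = (\int[leb]_x (cabs (f x) `^ p)%:E)%E) //.
by apply: eq_integral => x _; rewrite /= ger0_norm // powR_ge0.
Qed.

Lemma integrable_burk {R : realType} {d : nat} (leb : {measure set (d.-tuple R) -> \bar R})
  (c : R) (f g : d.-tuple R -> R[i]) : 0 < c -> inLp leb (c + 1) f -> inLp leb (c + 1) g ->
  leb.-integrable setT (EFin \o (fun x => burk c (cabs (f x)) (cabs (g x)))).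
Proof.
move=> c0 hf hg; have i1 := integrable_cabs_powR leb _ _ hf; have i2 := integrable_cabs_powR leb _ _ hg.
have [mf _] := hf; have [mg _] := hg.
have mcf := measurable_cabs _ _ mf; have mcg := measurable_cabs _ _ mg.
have [i3 _] := Rintegral_lincomb3 leb _ _ _ ((1 + c) * 2 `^ (c + 1)) ((1 + c) * 2 `^ (c + 1)) 0 i1 i2 i2.
apply: (le_integrable measurableT _ _ i3).
  apply/measurable_EFinP; apply: measurable_funM.
    case: (1 <= c); apply: measurable_funB => //; exact: measurable_funM.
  apply: (@measurableT_comp _ _ _ _ _ _ (@powR R ^~ c)); first exact: measurable_powR.
  exact: measurable_funD.
move=> x _ /=; rewrite lee_fin; apply: (le_trans _ (ler_norm _)).
by rewrite mul0r addr0 -mulrDr; apply: burk_growth => //; exact: cabs_ge0.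
Qed.

(* The induction is on the word with g arbitrary: the first letter (v, a)
   replaces g by the two functions g(x -+ v) +- a D(x -+ v), which translation
   invariance turns into the two summands of burk_midpoint. *)
Lemma Top_burk_le {R : realType} {d : nat} (leb : {measure set (d.-tuple R) -> \bar R})
  (c al : R) (L : seq (d.-tuple R * R[i])) (f g : d.-tuple R -> R[i]) :
  is_lebesgue leb -> 0 < c -> 0 < al ->
  (forall X Y, 0 <= X -> 0 <= Y ->
    Y `^ (c + 1) - burk_const c `^ (c + 1) * X `^ (c + 1) <= al * burk c X Y) ->
  (forall l, l \in L -> cabs l.2 <= 1) -> inLp leb (c + 1) f -> inLp leb (c + 1) g ->
  \int[leb]_x (cabs (Pop L g x + Top L f x) `^ (c + 1)) <=
  burk_const c `^ (c + 1) * (\int[leb]_x (cabs (f x) `^ (c + 1))) +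
  al * \int[leb]_x (burk c (cabs (Pop L f x)) (cabs (g x))).
Proof.
move=> hl c0 al0 hmaj hL hf; have p0 : 0 < c + 1 by lra.
have c1 : 1 <= c + 1 by lra.
have arith2 (x1 x2 x3 : R) : 1 * x1 + 1 * x2 + 0 * x2 <= 2 * x3 + 0 * x3 + 0 * x3 -> x1 + x2 <= 2 * x3 by lra.
have arith (k x1 x2 x3 x4 x5 x6 : R) : x1 <= 2^-1 * x2 + 2^-1 * x3 -> x4 + x5 <= 2 * x6 ->
    x2 <= k + al * x4 -> x3 <= k + al * x5 -> x1 <= k + al * x6.
  move=> h1 h2 h3 h4; have : al * (x4 + x5) <= al * (2 * x6) by rewrite ler_pM2l.
  by rewrite mulrDr; lra.
have i1 := integrable_cabs_powR leb _ _ hf.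
set If := \int[leb]_x (cabs (f x) `^ (c + 1)).
elim: L hL g => [|l L IH] hL g hg.
  have ib := integrable_burk leb c f g c0 hf hg.
  have [i3 e3] := Rintegral_lincomb3 leb _ _ _ (burk_const c `^ (c + 1)) al 0 i1 ib ib.
  rewrite mul0r addr0 in e3; rewrite -[X in _ <= X]e3.
  rewrite (_ : \int[leb]_x _ = \int[leb]_x (cabs (g x) `^ (c + 1))); last first.
    by apply: eq_Rintegral => x _; rewrite /= addr0.
  apply: (le_Rintegral measurableT (integrable_cabs_powR leb _ _ hg) i3) => x _.
  have := hmaj _ _ (cabs_ge0 (f x)) (cabs_ge0 (g x)); rewrite mul0r addr0; lra.
set v := l.1; set a := l.2.
have a1 : cabs a <= 1 by apply: hL; rewrite mem_head.
have {}IH := IH (fun l' h => hL l' (mem_behead (s := l :: L) h)).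
pose PL := Pop L f; have hP : inLp leb (c + 1) PL := inLp_Pop leb _ L _ hl p0 hf.
pose D := dift v PL; have hD : inLp leb (c + 1) D := inLp_dift leb _ v _ hl p0 hP.
have hA : inLp leb (c + 1) (avgt v PL) := inLp_avgt leb _ v _ hl p0 hP.
pose gp x := a * D (addt x (negt v)) + g (addt x (negt v)).
pose gm x := - a * D (addt x v) + g (addt x v).
have hgp : inLp leb (c + 1) gp.
  by apply: (inLp_lincomb leb _ _ _ _ (ltW p0)); exact: inLp_addt.
have hgm : inLp leb (c + 1) gm.
  by apply: (inLp_lincomb leb _ _ _ _ (ltW p0)); exact: inLp_addt.
have hT := inLp_Top leb _ L _ hl p0 hf.
have Pp := inLp_lincomb leb _ 1 _ _ (ltW p0) (inLp_Pop leb _ L _ hl p0 hgp) hT.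
have Pm := inLp_lincomb leb _ 1 _ _ (ltW p0) (inLp_Pop leb _ L _ hl p0 hgm) hT.
(* Both branches carry the same [Top L f]. As [Pop L] commutes with translations, the half-sum of
   the two increments is a times [dift (negt v) (Pop L D)], the new term of [Top]. *)
have key x : Pop (l :: L) g x + Top (l :: L) f x =
   Complex 2^-1 0 * ((1 * Pop L gp x + Top L f x) + (1 * Pop L gm x + Top L f x)).
  rewrite /= /gp /gm (Pop_addt L (fun y => a * D y + g y)) (Pop_addt L (fun y => - a * D y + g y)).
  rewrite !Pop_lincomb /avgt -/v -/a -/PL -/D.
  have -> : dift (negt v) (Pop L D) x = Complex 2^-1 0 * (Pop L D (addt x (negt v)) - Pop L D (addt x v)).
    by rewrite /dift negtK.
  have h2 : (Complex 2^-1 0 + Complex 2^-1 0 : R[i]) = 1.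
    by apply: complex_ext; rewrite ?cReD ?cImD /=; field.
  rewrite !mul1r -[Top L f x in LHS]mul1r -h2; ring.
have IP : \int[leb]_x (cabs (1 * Pop L gp x + Top L f x) `^ (c + 1)) <=
    burk_const c `^ (c + 1) * If + al * \int[leb]_x (burk c (cabs (PL x)) (cabs (gp x))).
  apply: le_trans (IH gp hgp); rewrite le_eqVlt; apply/orP; left; apply/eqP.
  by apply: eq_Rintegral => x _; rewrite mul1r.
have IM : \int[leb]_x (cabs (1 * Pop L gm x + Top L f x) `^ (c + 1)) <=
    burk_const c `^ (c + 1) * If + al * \int[leb]_x (burk c (cabs (PL x)) (cabs (gm x))).
  apply: le_trans (IH gm hgm); rewrite le_eqVlt; apply/orP; left; apply/eqP.
  by apply: eq_Rintegral => x _; rewrite mul1r.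
have iP := integrable_cabs_powR leb _ _ Pp; have iM := integrable_cabs_powR leb _ _ Pm.
have [i3 e3] := Rintegral_lincomb3 leb _ _ _ (2^-1) (2^-1) 0 iP iM iM.
have L1 : \int[leb]_x (cabs (Pop (l :: L) g x + Top (l :: L) f x) `^ (c + 1)) <=
    2^-1 * (\int[leb]_x (cabs (1 * Pop L gp x + Top L f x) `^ (c + 1))) +
    2^-1 * (\int[leb]_x (cabs (1 * Pop L gm x + Top L f x) `^ (c + 1))).
  have hW := inLp_lincomb leb _ 1 _ _ (ltW p0) (inLp_Pop leb _ (l :: L) _ hl p0 hg) (inLp_Top leb _ (l :: L) _ hl p0 hf).
  have iW := integrable_cabs_powR leb _ _ hW.
  rewrite mul0r addr0 in e3; rewrite -[X in _ <= X]e3.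
  apply: (@le_trans _ _ (\int[leb]_x (cabs (1 * Pop (l :: L) g x + Top (l :: L) f x) `^ (c + 1)))).
    rewrite le_eqVlt; apply/orP; left; apply/eqP; apply: eq_Rintegral => x _; by rewrite mul1r.
  apply: (le_Rintegral measurableT iW i3) => x _.
  by rewrite mul1r key mul0r addr0; exact: powR_midpoint.
have mb (u w : d.-tuple R -> R[i]) : inLp leb (c + 1) u -> inLp leb (c + 1) w ->
    measurable_fun setT (fun x => burk c (cabs (u x)) (cabs (w x))).
  by move=> hu hw; apply/measurable_EFinP; exact: measurable_int (integrable_burk leb c u w c0 hu hw).
have eP : \int[leb]_x (burk c (cabs (PL x)) (cabs (gp x))) =
    \int[leb]_x (burk c (cabs (PL (addt x v))) (cabs (gp (addt x v)))).
  exact: (esym (Rintegral_addt leb v (fun x => burk c (cabs (PL x)) (cabs (gp x))) hl (mb _ _ hP hgp))).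
have eM : \int[leb]_x (burk c (cabs (PL x)) (cabs (gm x))) =
    \int[leb]_x (burk c (cabs (PL (addt x (negt v)))) (cabs (gm (addt x (negt v))))).
  exact: (esym (Rintegral_addt leb (negt v) (fun x => burk c (cabs (PL x)) (cabs (gm x))) hl (mb _ _ hP hgm))).
have ibA := integrable_burk leb c _ _ c0 hA hg.
have ib1 := integrable_burk leb c _ _ c0 (inLp_addt leb _ v _ hl hP) (inLp_addt leb _ v _ hl hgp).
have ib2 := integrable_burk leb c _ _ c0 (inLp_addt leb _ (negt v) _ hl hP) (inLp_addt leb _ (negt v) _ hl hgm).
have [i4 e4] := Rintegral_lincomb3 leb _ _ _ 1 1 0 ib1 ib2 ib2.
have [i5 e5] := Rintegral_lincomb3 leb _ _ _ 2 0 0 ibA ibA ibA.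
have h2 : (Complex 2^-1 0 + Complex 2^-1 0 : R[i]) = 1.
  by apply: complex_ext; rewrite ?cReD ?cImD /=; field.
(* After translation the two branches sit at [avgt v PL] +- D and g +- a D, and |a D| <= |D| is the
   condition of the midpoint inequality. *)
have L2 : \int[leb]_x (burk c (cabs (PL (addt x v))) (cabs (gp (addt x v)))) +
    \int[leb]_x (burk c (cabs (PL (addt x (negt v)))) (cabs (gm (addt x (negt v))))) <=
    2 * \int[leb]_x (burk c (cabs (avgt v PL x)) (cabs (g x))).
  apply: arith2; rewrite -[X in X <= _]e4 -[X in _ <= X]e5.
  apply: (le_Rintegral measurableT i4 i5) => x _; rewrite !mul0r !mul1r !addr0.
  have e1 : PL (addt x v) = avgt v PL x + D x.
    by rewrite /avgt /D /dift -[LHS]mul1r -h2; ring.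
  have e2 : PL (addt x (negt v)) = avgt v PL x - D x.
    by rewrite /avgt /D /dift -[LHS]mul1r -h2; ring.
  have e6 : gp (addt x v) = g x + a * D x by rewrite /gp addtK addrC.
  have e7 : gm (addt x (negt v)) = g x - a * D x by rewrite /gm addtNK addrC mulNr.
  rewrite e1 e2 e6 e7; apply: (burk_midpoint c _ _ _ _ c0).
  by rewrite cabsM; apply: ler_piMl; [exact: cabs_ge0|exact: a1].
rewrite eP in IP; rewrite eM in IM.
exact: (arith _ _ _ _ _ _ _ L1 L2 IP IM).
Qed.

(** The case g = 0 of the induction: the remaining Burkholder term is nonpositive, since its second
    argument is 0. *)
Lemma Top_le {R : realType} {d : nat} (leb : {measure set (d.-tuple R) -> \bar R})
  (c : R) (L : seq (d.-tuple R * R[i])) (f : d.-tuple R -> R[i]) :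
  is_lebesgue leb -> 0 < c -> (forall l, l \in L -> cabs l.2 <= 1) -> inLp leb (c + 1) f ->
  (Ip leb (c + 1) (Top L f) <= (burk_const c `^ (c + 1))%:E * Ip leb (c + 1) f)%E.
Proof.
move=> hl c0 hL hf; have p0 : 0 < c + 1 by lra.
have [al al0 hmaj] := burk_majorant c c0.
have h0 : inLp leb (c + 1) (fun=> 0) := inLp0 leb _ p0.
have := Top_burk_le leb c al L f (fun=> 0) hl c0 al0 hmaj hL hf h0.
have P0 x : Pop L (fun=> 0) x = 0.
  by elim: (L) x => [//|l L' IH] x /=; rewrite /avgt !IH addr0 mulr0.
have fin g : inLp leb (c + 1) g -> ((\int[leb]_x (cabs (g x) `^ (c + 1)))%:E = Ip leb (c + 1) g)%E.
  move=> hg; rewrite /Rintegral fineK //; apply: integrable_fin_num => //.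
  exact: (integrable_cabs_powR leb _ _ hg).
rewrite (_ : \int[leb]_x (cabs (Pop L (fun=> 0) x + _) `^ _) = \int[leb]_x (cabs (Top L f x) `^ (c + 1))); last first.
  by apply: eq_Rintegral => x _; rewrite P0 add0r.
have : \int[leb]_x (burk c (cabs (Pop L f x)) (cabs 0)) <= 0.
  rewrite -oppr_ge0 -[X in 0 <= X]mulN1r.
  have ib := integrable_burk leb c _ _ c0 (inLp_Pop leb _ L _ hl p0 hf) h0.
  rewrite -(RintegralZl (-1) measurableT ib); apply: Rintegral_ge0 => x _.
  by rewrite mulN1r oppr_ge0 cabs0; apply: burk_le0 => //; exact: cabs_ge0.
rewrite -(fin _ hf) -(fin _ (inLp_Top leb _ L _ hl p0 hf)) -EFinM lee_fin.
move: (\int[leb]_x _) (\int[leb]_x _) (\int[leb]_x _) => x1 x2 x3; nra.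
Qed.

(** * Fourier multipliers of the word operators *)

Definition cosL {R : realType} {d : nat} (L : seq (d.-tuple R * R[i])) (xi : d.-tuple R) : R :=
  \prod_(l <- L) cos (dotp xi l.1).

Fixpoint mulL {R : realType} {d : nat} (L : seq (d.-tuple R * R[i])) (xi : d.-tuple R) : R[i] :=
  if L is l :: L' then
    mulL L' xi + l.2 * Complex (sin (dotp xi l.1) ^+ 2 * cosL L' xi ^+ 2) 0
  else 0.

Lemma FT0 {R : realType} {d : nat} (leb : {measure set (d.-tuple R) -> \bar R}) :
  is_lebesgue leb -> FT leb (fun=> 0) (fun=> 0).
Proof.
move=> hl; have h0 : inLp leb 2 (fun=> 0) by exact: inLp0.
have [F h] := FT_exists leb (fun=> 0) hl h0.
have := FTB leb _ _ _ _ hl h h.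
rewrite (_ : (fun x : d.-tuple R => 0 - 0 : R[i]) = fun=> 0); last by apply/funext => x; rewrite subrr.
by rewrite (_ : (fun x => F x - F x) = fun=> 0) //; apply/funext => x; rewrite subrr.
Qed.

Lemma FT_avgt {R : realType} {d : nat} (leb : {measure set (d.-tuple R) -> \bar R}) v
  (f F : d.-tuple R -> R[i]) : is_lebesgue leb -> FT leb f F ->
  FT leb (avgt v f) (fun xi => Complex (cos (dotp xi v)) 0 * F xi).
Proof.
move=> hl h; have h1 := FT_addt leb v _ _ hl h; have h2 := FT_addt leb (negt v) _ _ hl h.
have h3 := FT_lincomb leb 1 _ _ _ _ hl h1 h2.
have h4 := FT_lincomb leb (Complex 2^-1 0) _ _ _ _ hl h3 (FT0 leb hl).
rewrite (_ : avgt v f = fun x => Complex 2^-1 0 * (1 * f (addt x v) + f (addt x (negt v))) + 0); last first.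
  by apply/funext => x; rewrite mul1r addr0.
rewrite (_ : (fun xi => Complex (cos (dotp xi v)) 0 * F xi) =
  fun xi => Complex 2^-1 0 * (1 * (expi (- dotp xi v) * F xi) + expi (- dotp xi (negt v)) * F xi) + 0); first exact: h4.
apply/funext => xi; rewrite mul1r addr0 -mulrDl mulrA; congr (_ * _).
rewrite dotpN; apply: complex_ext; rewrite ?cReM ?cImM ?cReD ?cImD /= ?cosN ?sinN ?opprK; lra.
Qed.

Lemma FT_dift {R : realType} {d : nat} (leb : {measure set (d.-tuple R) -> \bar R}) v
  (f F : d.-tuple R -> R[i]) : is_lebesgue leb -> FT leb f F ->
  FT leb (dift v f) (fun xi => Complex 0 (- sin (dotp xi v)) * F xi).
Proof.
move=> hl h; have h1 := FT_addt leb v _ _ hl h; have h2 := FT_addt leb (negt v) _ _ hl h.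
have h3 := FT_lincomb leb (-1) _ _ _ _ hl h2 h1.
have h4 := FT_lincomb leb (Complex 2^-1 0) _ _ _ _ hl h3 (FT0 leb hl).
rewrite (_ : dift v f = fun x => Complex 2^-1 0 * (-1 * f (addt x (negt v)) + f (addt x v)) + 0); last first.
  by apply/funext => x; rewrite cmulN1D addr0.
rewrite (_ : (fun xi => Complex 0 (- sin (dotp xi v)) * F xi) =
  fun xi => Complex 2^-1 0 * (-1 * (expi (- dotp xi (negt v)) * F xi) + expi (- dotp xi v) * F xi) + 0); first exact: h4.
apply/funext => xi; rewrite cmulN1D addr0 -mulrBl mulrA; congr (_ * _).
rewrite dotpN; apply: complex_ext; rewrite ?cReM ?cImM ?cReD ?cImD ?cReN ?cImN /= ?cosN ?sinN ?opprK; lra.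
Qed.

Lemma FT_Pop {R : realType} {d : nat} (leb : {measure set (d.-tuple R) -> \bar R}) L
  (f F : d.-tuple R -> R[i]) : is_lebesgue leb -> FT leb f F ->
  FT leb (Pop L f) (fun xi => Complex (cosL L xi) 0 * F xi).
Proof.
move=> hl h; elim: L => [|l L IH] /=.
  rewrite (_ : (fun xi => _) = F) //; apply/funext => xi.
  by rewrite /cosL big_nil (_ : Complex 1 0 = 1) ?mul1r.
have := FT_avgt leb l.1 _ _ hl IH.
rewrite (_ : (fun xi => Complex (cos (dotp xi l.1)) 0 * (Complex (cosL L xi) 0 * F xi)) =
   fun xi => Complex (cosL (l :: L) xi) 0 * F xi); first exact: id.
apply/funext => xi; rewrite mulrA /cosL big_cons; congr (_ * _).
by apply: complex_ext; rewrite ?cReM ?cImM /=; ring.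
Qed.

Lemma FT_Top {R : realType} {d : nat} (leb : {measure set (d.-tuple R) -> \bar R}) L
  (f F : d.-tuple R -> R[i]) : is_lebesgue leb -> FT leb f F ->
  FT leb (Top L f) (fun xi => mulL L xi * F xi).
Proof.
move=> hl h; elim: L => [|l L IH] /=.
  by rewrite (_ : (fun xi => 0 * F xi) = fun=> 0); [exact: FT0|apply/funext => xi; rewrite mul0r].
have h1 := FT_dift leb (negt l.1) _ _ hl (FT_Pop leb L _ _ hl (FT_dift leb l.1 _ _ hl (FT_Pop leb L _ _ hl h))).
have := FT_lincomb leb l.2 _ _ _ _ hl h1 IH.
rewrite (_ : (fun x => l.2 * _ + _) = fun x => Top L f x + l.2 * dift (negt l.1) (Pop L (dift l.1 (Pop L f))) x); last first.
  by apply/funext => x; rewrite addrC.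
set G1 := (X in FT leb _ X); set G2 := (X in _ -> FT leb _ X).
rewrite (_ : G1 = G2); first exact: id.
apply/funext => xi; rewrite /G1 /G2 mulrDl addrC; congr (_ + _); rewrite !mulrA; congr (_ * _).
rewrite -!mulrA; congr (_ * _).
(* The two differences contribute -i sin and +i sin, with product sin^2; the two averages contribute
   the square of the cosine product. *)
rewrite dotpN; apply: complex_ext; rewrite ?cReM ?cImM /= ?sinN; ring.
Qed.

(** Telescoping: if C is the squared cosine product of the later letters, the new term is at most
    sin^2 C = C - cos^2 C. *)
Lemma cabs_mulL {R : realType} {d : nat} (L : seq (d.-tuple R * R[i])) xi :
  (forall l, l \in L -> cabs l.2 <= 1) -> cabs (mulL L xi) <= 1 - cosL L xi ^+ 2.
Proof.
elim: L => [|l L IH] hL /=.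
  by rewrite cabs0 /cosL big_nil expr1n subrr.
have {}IH := IH (fun l' h => hL l' (mem_behead (s := l :: L) h)).
apply: (le_trans (ler_cabsD _ _)).
have h1 : cabs (l.2 * Complex (sin (dotp xi l.1) ^+ 2 * cosL L xi ^+ 2) 0) <= sin (dotp xi l.1) ^+ 2 * cosL L xi ^+ 2.
  have s0 : 0 <= sin (dotp xi l.1) ^+ 2 * cosL L xi ^+ 2 by rewrite mulr_ge0 // sqr_ge0.
  rewrite cabsM cabs_real ger0_norm //; apply: ler_piMl => //.
  by apply: hL; rewrite mem_head.
apply: (le_trans (lerD IH h1)); rewrite le_eqVlt; apply/orP; left; apply/eqP.
rewrite [cosL (l :: L) xi]/cosL big_cons -/(cosL L xi) exprMn.
have := cos2Dsin2 (dotp xi l.1); move=> /(canRL (addrK _)) ->; ring.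
Qed.

Lemma measurable_cosL {R : realType} {d : nat} (L : seq (d.-tuple R * R[i])) :
  measurable_fun setT (cosL L).
Proof.
apply: measurable_prod => l _; apply: (measurableT_comp measurable_cos).
by rewrite (_ : (fun x => dotp x l.1) = dotp l.1); [exact: measurable_dotp|apply/funext => x; exact: dotpC].
Qed.

Lemma cmeasurable_mulL {R : realType} {d : nat} (L : seq (d.-tuple R * R[i])) : cmeasurable (mulL L).
Proof.
elim: L => [|l L IH] /=; first exact: cmeasurableC.
apply: cmeasurableD => //; apply: cmeasurableM; first exact: cmeasurableC.
split => /=; last exact: measurable_cst.
apply: measurable_funM; apply: measurable_funX; last exact: measurable_cosL.
apply: (measurableT_comp measurable_sin).
by rewrite (_ : (fun x => dotp x l.1) = dotp l.1); [exact: measurable_dotp|apply/funext => x; exact: dotpC].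
Qed.

(** * Multipliers bounded on L^p *)

(** K is the p-th power of an operator bound. The estimate is asked for every f in L^2 with possibly
    infinite integrals, so limits and mixtures need no case distinction on membership in L^p. *)
Definition Good {R : realType} {d : nat} (leb : {measure set (d.-tuple R) -> \bar R}) (p K : R)
  (m : d.-tuple R -> R[i]) : Prop :=
  [/\ cmeasurable m, forall xi, cabs (m xi) <= 1 &
   forall f F, FT leb f F -> exists g, FT leb g (fun xi => m xi * F xi) /\
     (Ip leb p g <= K%:E * Ip leb p f)%E].

Lemma Good_mulL {R : realType} {d : nat} (leb : {measure set (d.-tuple R) -> \bar R}) (c : R) L :
  is_lebesgue leb -> 0 < c -> (forall l, l \in L -> cabs l.2 <= 1) ->
  Good leb (c + 1) (burk_const c `^ (c + 1)) (mulL L).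
Proof.
move=> hl c0 hL; split; first exact: cmeasurable_mulL.
  by move=> xi; apply: (le_trans (cabs_mulL L xi hL)); rewrite gerBl sqr_ge0.
move=> f F h; exists (Top L f); split; first exact: FT_Top.
have [hf _ _] := h.
have [fin|inf] := ltP (Ip leb (c + 1) f) +oo%E; first exact: (Top_le leb c L f hl c0 hL (conj (proj1 hf) fin)).
have -> : Ip leb (c + 1) f = +oo%E by apply/eqP; rewrite eq_le inf leey.
rewrite gt0_muley ?leey // lte_fin; apply: powR_gt0.
by rewrite /burk_const; case: ifP => // _; rewrite invr_gt0.
Qed.

(** The products u_n F converge in L^2 by dominated convergence, so the functions g_n are Cauchy in
    L^2 by [FT_ge]. Their limit has the right transform, and Fatou's lemma along an almost
    everywhere convergent subsequence keeps the L^p bound. *)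
Lemma Good_lim {R : realType} {d : nat} (leb : {measure set (d.-tuple R) -> \bar R}) (p K : R)
  (u : nat -> d.-tuple R -> R[i]) (m : d.-tuple R -> R[i]) : is_lebesgue leb -> 1 <= p ->
  (forall n, Good leb p K (u n)) -> cmeasurable m -> (forall xi, cabs (m xi) <= 1) ->
  (forall xi, ccvg (u^~ xi) (m xi)) -> Good leb p K m.
Proof.
move=> hl p1 hu mm m1 um; split; [exact: mm|exact: m1|] => f F hF.
have [_ K0] := integrable_Kern1 d leb hl.
set C := \int[leb]_x Kern 1 x in K0.
have [hf hF2 _] := hF.
have mu n : cmeasurable (u n) by have [] := hu n.
have hg n : exists g, FT leb g (fun xi => u n xi * F xi) /\ (Ip leb p g <= K%:E * Ip leb p f)%E.
  by have [_ _ h] := hu n; exact: h.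
have [g gP] := choice hg.
have gFT n : FT leb (g n) (fun xi => u n xi * F xi) by have [] := gP n.
have mg n : cmeasurable (g n) by have [[mgn _] _ _] := gFT n.
have muF n := cmeasurableM _ _ _ (mu n) (proj1 hF2).
have mmF := cmeasurableM _ _ _ mm (proj1 hF2).
have mF2 : inLp leb 2 (fun xi => m xi * F xi) := inLp_bounded_mul leb 2 _ _ (ler0n _ 2) mm m1 hF2.
have T : tends0 (fun n => Ip leb 2 (fun xi => u n xi * F xi - m xi * F xi)).
  have m2F := cmeasurableM _ _ _ (cmeasurableC d (Complex 2 0)) (proj1 hF2).
  apply: (Ip_dominated _ leb 2 _ _ (fun xi => Complex 2 0 * F xi) (ler1n _ 2) muF mmF m2F).
  - apply: aeW => xi; have := um xi; rewrite /ccvg => h.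
    rewrite (_ : (fun n => cabs (u n xi * F xi - m xi * F xi)) = fun n => cabs (u n xi - m xi) * cabs (F xi)); last first.
      by apply/funext => n; rewrite -mulrBl cabsM.
    by rewrite -[X in _ --> X](mul0r (cabs (F xi))); apply: cvgM => //; exact: cvg_cst.
  - rewrite (IpZ _ leb 2 _ _ (proj1 hF2)); apply: lte_mul_pinfty; [by rewrite lee_fin powR_ge0|by []|].
    exact: (proj2 hF2).
  - move=> n xi; rewrite -mulrBl !cabsM cabs_real; apply: ler_wpM2r; first exact: cabs_ge0.
    rewrite ger0_norm //; apply: (le_trans (ler_cabsD _ _)); rewrite cabsN.
    by have [_ un1 _] := hu n; have := un1 xi; have := m1 xi; lra.
have k0 : (0 : R) < 2 `^ 2 by rewrite powR_gt0.
have [gl [mgl hgl]] : exists gl, cmeasurable gl /\ tends0 (fun n => Ip leb 2 (fun x => g n x - gl x)).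
  apply: (Lp_complete d leb 2 g (ler1n _ 2) mg) => e e0.
  (* One factor 2^2 comes from [FT_ge], the other from the quasi-triangle inequality, and 2 counts
     the two error terms. *)
  have c0 : 0 < e * C / (2 `^ 2 * (2 `^ 2 * 2)) by rewrite !(mulr_gt0, divr_gt0).
  have [N hN] := T _ c0; exists N => n l Nn Nl.
  rewrite -(lee_pmul2l (x := C%:E)) //; apply: (le_trans (FT_ge leb _ _ hl (FTB leb _ _ _ _ hl (gFT n) (gFT l)))).
  apply: (@le_trans _ _ ((2 `^ 2)%:E * ((2 `^ 2)%:E * ((e * C / (2 `^ 2 * (2 `^ 2 * 2)))%:E + (e * C / (2 `^ 2 * (2 `^ 2 * 2)))%:E)))%E).
    apply: lee_wpmul2l; first by rewrite lee_fin ltW.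
    apply: (le_trans (Ip_triangle _ leb 2 _ _ _ (ler0n _ 2) (muF n) mmF (muF l))).
    apply: lee_wpmul2l; first by rewrite lee_fin ltW.
    by apply: leeD; [exact: hN|rewrite IpB_sym; exact: hN].
  rewrite -EFinD -!EFinM lee_fin le_eqVlt; apply/orP; left; apply/eqP.
  have k2 : 2 `^ 2 != 0 :> R by rewrite gt_eqF.
  by field.
have g2 n : inLp leb 2 (g n) by have [] := gFT n.
have hgl2 : inLp leb 2 gl := fin_Ip_limit _ leb 2 g gl (ler0n _ 2) g2 mgl hgl.
exists gl; split; first exact: (FT_closed leb g _ _ _ hl gFT hgl2 mF2 hgl T).
have [phi hphi] := Ip_subseq_ae d leb 2 g gl (ler1n _ 2) mg mgl hgl.
apply: (Ip_fatou d leb p (fun k => g (phi k)) gl _ p1 (fun k => mg _) mgl hphi) => n.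
by have [] := gP (phi n).
Qed.

Lemma powR_convex2 {R : realType} (p th : R) (x y : R[i]) : 1 <= p -> 0 <= th -> th <= 1 ->
  cabs (Complex th 0 * x + Complex (1 - th) 0 * y) `^ p <= th * (cabs x `^ p) + (1 - th) * (cabs y `^ p).
Proof.
move=> p1 th0 th1; have x0 := cabs_ge0 x; have y0 := cabs_ge0 y.
have p0 : 0 <= p by lra.
have th1' : 0 <= 1 - th by lra.
set s := th * cabs x + (1 - th) * cabs y.
have s0 : 0 <= s by apply: addr_ge0; exact: mulr_ge0.
apply: (@le_trans _ _ (s `^ p)).
  apply: ge0_ler_powR; rewrite ?nnegrE ?cabs_ge0 //.
  by apply: (le_trans (ler_cabsD _ _)); rewrite !cabsM !cabs_real !ger0_norm.
have [s00|sp] := eqVneq s 0.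
  have pn : p != 0 by rewrite gt_eqF //; lra.
  rewrite s00 (powR0 pn); apply: addr_ge0; apply: mulr_ge0 => //; exact: powR_ge0.
have {}s0 : 0 < s by rewrite lt_neqAle eq_sym sp.
have h1 := ler_wpM2l th0 (powR_convex_tangent p s (cabs x) p1 s0 x0).
have h2 := ler_wpM2l th1' (powR_convex_tangent p s (cabs y) p1 s0 y0).
have e : th * (p * s `^ (p - 1) * (cabs x - s)) + (1 - th) * (p * s `^ (p - 1) * (cabs y - s)) = 0.
  have e0 : th * (cabs x - s) + (1 - th) * (cabs y - s) = 0 by rewrite /s; ring.
  by rewrite mulrCA [(1 - th) * _]mulrCA -mulrDr e0 mulr0.
move: h1 h2 e; rewrite !mulrDr.
move: (th * (p * s `^ (p - 1) * (cabs x - s))) ((1 - th) * (p * s `^ (p - 1) * (cabs y - s))).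
move=> a b h1 h2 e; lra.
Qed.

(** Convexity of the p-th power is used instead of the quasi-triangle inequality, so that the
    constant K is preserved exactly. *)
Lemma Good_convex {R : realType} {d : nat} (leb : {measure set (d.-tuple R) -> \bar R}) (p K th : R)
  (m1 m2 : d.-tuple R -> R[i]) : is_lebesgue leb -> 1 <= p -> 0 <= K -> 0 <= th -> th <= 1 ->
  Good leb p K m1 -> Good leb p K m2 ->
  Good leb p K (fun xi => Complex th 0 * m1 xi + Complex (1 - th) 0 * m2 xi).
Proof.
move=> hl p1 K0 th0 th1 [mm1 b1 h1] [mm2 b2 h2].
have th1' : 0 <= 1 - th by lra.
split.
- by apply: cmeasurableD; apply: cmeasurableM => //; exact: cmeasurableC.
- move=> xi; apply: (le_trans (ler_cabsD _ _)); rewrite !cabsM !cabs_real !ger0_norm //.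
  have := ler_wpM2l th0 (b1 xi); have := ler_wpM2l th1' (b2 xi); lra.
move=> f F hF; have [g1 [hg1 l1]] := h1 f F hF; have [g2 [hg2 l2]] := h2 f F hF.
have := FT_lincomb leb (Complex th 0) _ _ _ _ hl hg1 (FT_lincomb leb (Complex (1 - th) 0) _ _ _ _ hl hg2 (FT0 leb hl)).
set G1 := (X in FT leb _ X) => hG.
exists (fun x => Complex th 0 * g1 x + (Complex (1 - th) 0 * g2 x + 0)); split.
  rewrite (_ : (fun xi => _ * F xi) = G1); first exact: hG.
  by apply/funext => xi; rewrite /G1 addr0 mulrDl !mulrA.
have [[mg1 _] _ _] := hg1; have [[mg2 _] _ _] := hg2.
have q1 x : (0 <= (cabs (g1 x) `^ p)%:E)%E by rewrite lee_fin powR_ge0.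
have q2 x : (0 <= (cabs (g2 x) `^ p)%:E)%E by rewrite lee_fin powR_ge0.
have n1 := measurable_cabs_powR _ p _ mg1; have n2 := measurable_cabs_powR _ p _ mg2.
apply: (@le_trans _ _ (th%:E * Ip leb p g1 + (1 - th)%:E * Ip leb p g2)%E).
  rewrite /Ip -(ge0_integralZl_EFin _ measurableT (fun x _ => q1 x) n1 th0).
  rewrite -(ge0_integralZl_EFin _ measurableT (fun x _ => q2 x) n2 th1').
  rewrite -ge0_integralD; last 5 first.
  - exact: measurableT.
  - by move=> x _; rewrite -EFinM lee_fin mulr_ge0 // powR_ge0.
  - by apply: measurable_funeM; exact: n1.
  - by move=> x _; rewrite -EFinM lee_fin mulr_ge0 // powR_ge0.
  - by apply: measurable_funeM; exact: n2.
  apply: ge0_le_integral.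
  - exact: measurableT.
  - by move=> x _; rewrite lee_fin powR_ge0.
  - apply: measurable_cabs_powR; apply: cmeasurableD; first by apply: cmeasurableM => //; exact: cmeasurableC.
    by apply: cmeasurableD; [apply: cmeasurableM => //; exact: cmeasurableC|exact: cmeasurableC].
  - by apply: emeasurable_funD; apply: measurable_funeM; [exact: n1|exact: n2].
  - by move=> x _; rewrite -!EFinM -EFinD lee_fin addr0; exact: powR_convex2.
apply: (@le_trans _ _ (th%:E * (K%:E * Ip leb p f) + (1 - th)%:E * (K%:E * Ip leb p f))%E).
  apply: leeD.
    by apply: lee_wpmul2l; [rewrite lee_fin|exact: l1].
  by apply: lee_wpmul2l; [rewrite lee_fin|exact: l2].
have e1 : (0 <= th%:E)%E by rewrite lee_fin.
have e2 : (0 <= (1 - th)%:E)%E by rewrite lee_fin.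
rewrite -(ge0_muleDl _ e1 e2) -EFinD (_ : th + (1 - th) = 1); last by ring.
by rewrite mul1e.
Qed.

Lemma Good0 {R : realType} {d : nat} (leb : {measure set (d.-tuple R) -> \bar R}) (p K : R) :
  is_lebesgue leb -> 0 < p -> 0 <= K -> Good leb p K (fun=> 0).
Proof.
move=> hl p0 K0; split; first exact: cmeasurableC.
  by move=> xi; rewrite cabs0.
move=> f F hF; exists (fun=> 0); split.
  by rewrite (_ : (fun xi => 0 * F xi) = fun=> 0); [exact: FT0|apply/funext => xi; rewrite mul0r].
have pn : p != 0 by rewrite gt_eqF.
by rewrite (Ip0 d leb p pn); apply: mule_ge0; [rewrite lee_fin|exact: Ip_ge0].
Qed.

(* Mixtures of total weight s of word multipliers: prepending a letter (v, a) to
   all words maps (M, C) to (M + a sin^2(xi.v) C, cos^2(xi.v) C). *)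
Definition Mix {R : realType} {d : nat} (s : R) (M : d.-tuple R -> R[i]) (C : d.-tuple R -> R) : Prop :=
  exists W : seq (R * seq (d.-tuple R * R[i])),
  [/\ forall w, w \in W -> 0 <= w.1 /\ forall l, l \in w.2 -> cabs l.2 <= 1,
      s = \sum_(w <- W) w.1,
      forall xi, M xi = \sum_(w <- W) Complex w.1 0 * mulL w.2 xi &
      forall xi, C xi = \sum_(w <- W) w.1 * cosL w.2 xi ^+ 2].

Lemma ComplexD {R : realType} (a b : R) : Complex (a + b) 0 = Complex a 0 + Complex b 0.
Proof. by apply: complex_ext; rewrite ?cReD ?cImD /= ?addr0. Qed.

Lemma ComplexM {R : realType} (a b : R) : Complex (a * b) 0 = Complex a 0 * Complex b 0.
Proof. by apply: complex_ext; rewrite ?cReM ?cImM /= ?mulr0 ?mul0r ?subr0 ?addr0. Qed.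

Lemma Complex_sum {R : realType} (I : Type) (r : seq I) (F : I -> R) :
  Complex (\sum_(i <- r) F i) 0 = \sum_(i <- r) Complex (F i) 0.
Proof.
elim: r => [|i r IH]; first by rewrite !big_nil.
by rewrite !big_cons ComplexD IH.
Qed.

(** The list is absorbed letter by letter into a normalized convex combination, with 0 chosen when
    the total weight vanishes. The missing weight 1 - s is then given to the zero multiplier. *)
Lemma Mix_Good {R : realType} {d : nat} (leb : {measure set (d.-tuple R) -> \bar R}) (c s : R)
  (M : d.-tuple R -> R[i]) (C : d.-tuple R -> R) :
  is_lebesgue leb -> 0 < c -> s <= 1 -> Mix s M C ->
  Good leb (c + 1) (burk_const c `^ (c + 1)) M.
Proof.
move=> hl c0 s1 [W [hW es eM _]].
have p1 : 1 <= c + 1 by lra.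
have p0 : 0 < c + 1 by lra.
set K := burk_const c `^ (c + 1); have K0 : 0 <= K by exact: powR_ge0.
have [m [hm mE sW]] : exists m, [/\ Good leb (c + 1) K m,
    forall xi, \sum_(w <- W) Complex w.1 0 * mulL w.2 xi = Complex (\sum_(w <- W) w.1) 0 * m xi &
    0 <= \sum_(w <- W) w.1].
  elim: W hW {es eM} => [|[q L] W IH] hW.
    exists (fun=> 0); split; first exact: Good0.
      by move=> xi; rewrite !big_nil mulr0.
    by rewrite big_nil.
  have [m' [hm' mE' s0']] := IH (fun w hw => hW w (mem_behead (s := (q, L) :: W) hw)).
  have [q0 hL] := hW (q, L) (mem_head _ _).
  set s' := \sum_(w <- W) w.1 in mE' s0'.
  have hmL := Good_mulL leb c L hl c0 hL.
  have [z|nz] := eqVneq (q + s') 0.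
    exists (fun=> 0); split; first exact: Good0.
      move=> xi; rewrite !big_cons mE' -/s' z mulr0.
      have [-> ->] : q = 0 /\ s' = 0 by move: q0 => /= q0; split; lra.
      by rewrite !mul0r addr0.
    by rewrite big_cons -/s' z.
  have sp : 0 < q + s' by rewrite lt_neqAle eq_sym nz addr_ge0.
  have th0 : 0 <= q / (q + s') by rewrite divr_ge0 // ltW.
  have th1 : q / (q + s') <= 1 by rewrite ler_pdivrMr // mul1r lerDl.
  exists (fun xi => Complex (q / (q + s')) 0 * mulL L xi + Complex (1 - q / (q + s')) 0 * m' xi).
  split.
  - exact: (Good_convex leb (c + 1) K _ _ _ hl p1 K0 th0 th1 hmL hm').
  - move=> xi; rewrite !big_cons mE' -/s' mulrDr !mulrA -!ComplexM /=.
    have -> : (q + s') * (q / (q + s')) = q by field.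
    by have -> : (q + s') * (1 - q / (q + s')) = s' by field.
  - by rewrite big_cons -/s' ltW.
rewrite -es in mE sW.
have s1' : 0 <= s by [].
have := Good_convex leb (c + 1) K s m (fun=> 0) hl p1 K0 s1' s1 hm (Good0 leb _ K hl p0 K0).
rewrite (_ : (fun xi => Complex s 0 * m xi + Complex (1 - s) 0 * 0) = M); first exact: id.
by apply/funext => xi; rewrite mulr0 addr0 eM mE.
Qed.

Lemma Mix_nil {R : realType} {d : nat} : @Mix R d 1 (fun=> 0) (fun=> 1).
Proof.
exists [:: (1, [::])]; split.
- by move=> w; rewrite mem_seq1 => /eqP -> /=; split.
- by rewrite big_seq1.
- by move=> xi; rewrite big_seq1 /= mulr0.
- by move=> xi; rewrite big_seq1 /= /cosL big_nil expr1n mulr1.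
Qed.

Lemma Mix0 {R : realType} {d : nat} : @Mix R d 0 (fun=> 0) (fun=> 0).
Proof. by exists [::]; split => // [|xi|xi]; rewrite big_nil. Qed.

Lemma Mix_add {R : realType} {d : nat} (s1 s2 : R) (M1 M2 : d.-tuple R -> R[i]) (C1 C2 : d.-tuple R -> R) :
  Mix s1 M1 C1 -> Mix s2 M2 C2 ->
  Mix (s1 + s2) (fun xi => M1 xi + M2 xi) (fun xi => C1 xi + C2 xi).
Proof.
move=> [W1 [h1 e1 f1 g1]] [W2 [h2 e2 f2 g2]]; exists (W1 ++ W2); split.
- by move=> w; rewrite mem_cat => /orP[/h1|/h2].
- by rewrite big_cat e1 e2.
- by move=> xi; rewrite big_cat f1 f2.
- by move=> xi; rewrite big_cat g1 g2.
Qed.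

Lemma Mix_scale {R : realType} {d : nat} (q s : R) (M : d.-tuple R -> R[i]) (C : d.-tuple R -> R) :
  0 <= q -> Mix s M C ->
  Mix (q * s) (fun xi => Complex q 0 * M xi) (fun xi => q * C xi).
Proof.
move=> q0 [W [h e f g]]; exists [seq (q * w.1, w.2) | w <- W]; split.
- by move=> w /mapP[w' /h[w0 hw] ->] /=; split => //; exact: mulr_ge0.
- by rewrite big_map e mulr_sumr.
- by move=> xi; rewrite big_map f mulr_sumr; apply: eq_bigr => w _; rewrite /= ComplexM mulrA.
- by move=> xi; rewrite big_map g mulr_sumr; apply: eq_bigr => w _; rewrite /= mulrA.
Qed.

Lemma Mix_letter {R : realType} {d : nat} (l : d.-tuple R * R[i]) (s : R) (M : d.-tuple R -> R[i])
  (C : d.-tuple R -> R) : cabs l.2 <= 1 -> Mix s M C ->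
  Mix s (fun xi => M xi + l.2 * Complex (sin (dotp xi l.1) ^+ 2 * C xi) 0)
    (fun xi => cos (dotp xi l.1) ^+ 2 * C xi).
Proof.
move=> hl [W [h e f g]]; exists [seq (w.1, l :: w.2) | w <- W]; split.
- move=> w /mapP[w' /h[w0 hw] ->] /=; split => // l'.
  by rewrite inE => /predU1P[-> //|/hw].
- by rewrite big_map e.
- move=> xi; rewrite big_map f g mulr_sumr Complex_sum mulr_sumr -big_split; apply: eq_bigr => w _ /=.
  rewrite !ComplexM; ring.
- move=> xi; rewrite big_map g mulr_sumr; apply: eq_bigr => w _ /=.
  by rewrite /cosL big_cons exprMn mulrCA.
Qed.

(** * Random words of geometric length *)

Definition letters_mass {R : realType} {d : nat} (J : seq (R * (d.-tuple R * R[i]))) : R :=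
  \sum_(j <- J) j.1.
Definition letters_cos {R : realType} {d : nat} (J : seq (R * (d.-tuple R * R[i]))) (xi : d.-tuple R) : R :=
  \sum_(j <- J) j.1 * cos (dotp xi j.2.1) ^+ 2.
Definition letters_num {R : realType} {d : nat} (J : seq (R * (d.-tuple R * R[i]))) (xi : d.-tuple R) : R[i] :=
  \sum_(j <- J) Complex (j.1 * sin (dotp xi j.2.1) ^+ 2) 0 * j.2.2.

Lemma eq_Mix {R : realType} {d : nat} (s s' : R) (M M' : d.-tuple R -> R[i]) (C C' : d.-tuple R -> R) :
  s = s' -> M =1 M' -> C =1 C' -> Mix s M C -> Mix s' M' C'.
Proof. by move=> -> /funext -> /funext ->. Qed.

(** A letter distributed according to [J] is prepended to all the words. Summing the effect of
    single letters gives a linear recursion for the pair (M, C). *)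
Lemma Mix_letters {R : realType} {d : nat} (J : seq (R * (d.-tuple R * R[i]))) (s : R)
  (M : d.-tuple R -> R[i]) (C : d.-tuple R -> R) :
  (forall j, j \in J -> 0 <= j.1 /\ cabs j.2.2 <= 1) -> Mix s M C ->
  Mix (letters_mass J * s)
    (fun xi => Complex (letters_mass J) 0 * M xi + letters_num J xi * Complex (C xi) 0)
    (fun xi => letters_cos J xi * C xi).
Proof.
move=> hJ hM; elim: J hJ => [|j J IH] hJ.
  apply: eq_Mix Mix0 => [|xi|xi]; rewrite /letters_mass /letters_num /letters_cos !big_nil ?mul0r //.
  by rewrite addr0.
have {}IH := IH (fun k h => hJ k (mem_behead (s := j :: J) h)).
have [j0 ja] := hJ j (mem_head _ _).
have := Mix_add _ _ _ _ _ _ (Mix_scale j.1 _ _ _ j0 (Mix_letter j.2 _ _ _ ja hM)) IH.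
apply: eq_Mix => [|xi|xi].
- by rewrite /letters_mass big_cons mulrDl.
- rewrite /letters_mass /letters_num !big_cons -/(letters_mass J) -/(letters_num J xi).
  by rewrite ComplexD !ComplexM; ring.
- by rewrite /letters_cos big_cons -/(letters_cos J xi); ring.
Qed.

Lemma letters_cosE {R : realType} {d : nat} (J : seq (R * (d.-tuple R * R[i]))) xi :
  letters_cos J xi = letters_mass J - \sum_(j <- J) j.1 * sin (dotp xi j.2.1) ^+ 2.
Proof.
rewrite /letters_cos /letters_mass -sumrB; apply: eq_bigr => j _.
have := cos2Dsin2 (dotp xi j.2.1); move=> /(canRL (addrK _)) ->; ring.
Qed.

Lemma cabs_letters_num {R : realType} {d : nat} (J : seq (R * (d.-tuple R * R[i]))) xi :
  (forall j, j \in J -> 0 <= j.1 /\ cabs j.2.2 <= 1) ->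
  cabs (letters_num J xi) <= \sum_(j <- J) j.1 * sin (dotp xi j.2.1) ^+ 2.
Proof.
rewrite /letters_num; elim: J => [|j J IH] hJ; first by rewrite !big_nil cabs0.
rewrite !big_cons; apply: (le_trans (ler_cabsD _ _)); apply: lerD.
  have [j0 ja] := hJ j (mem_head _ _).
  have js : 0 <= j.1 * sin (dotp xi j.2.1) ^+ 2 by rewrite mulr_ge0 // sqr_ge0.
  by rewrite cabsM cabs_real ger0_norm //; apply: ler_piMr.
exact: IH (fun k h => hJ k (mem_behead (s := j :: J) h)).
Qed.

Lemma letters_sin_ge0 {R : realType} {d : nat} (J : seq (R * (d.-tuple R * R[i]))) xi :
  (forall j, j \in J -> 0 <= j.1 /\ cabs j.2.2 <= 1) ->
  0 <= \sum_(j <- J) j.1 * sin (dotp xi j.2.1) ^+ 2.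
Proof. by move=> /cabs_letters_num h; exact: le_trans (cabs_ge0 _) (h xi). Qed.

Lemma letters_mass_ge0 {R : realType} {d : nat} (J : seq (R * (d.-tuple R * R[i]))) :
  (forall j, j \in J -> 0 <= j.1 /\ cabs j.2.2 <= 1) -> 0 <= letters_mass J.
Proof. by move=> h; rewrite /letters_mass big_seq; apply: sumr_ge0 => j /h[]. Qed.

Lemma letters_cos_ge0 {R : realType} {d : nat} (J : seq (R * (d.-tuple R * R[i]))) xi :
  (forall j, j \in J -> 0 <= j.1 /\ cabs j.2.2 <= 1) -> 0 <= letters_cos J xi.
Proof.
by move=> h; rewrite /letters_cos big_seq; apply: sumr_ge0 => j /h[j0 _]; rewrite mulr_ge0 // sqr_ge0.
Qed.

Lemma cmeasurable_real {R : realType} {d : nat} (h : d.-tuple R -> R) :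
  measurable_fun setT h -> cmeasurable (fun x => Complex (h x) 0).
Proof. by move=> mh; split => /=; [exact: mh|exact: measurable_cst]. Qed.

Lemma cmeasurable_letters_num {R : realType} {d : nat} (J : seq (R * (d.-tuple R * R[i]))) :
  cmeasurable (letters_num J).
Proof.
rewrite /letters_num; elim: J => [|j J IH].
  by rewrite (_ : (fun xi => _) = fun=> 0); [exact: cmeasurableC|apply/funext => xi; rewrite big_nil].
rewrite (_ : (fun xi => _) = fun xi => Complex (j.1 * sin (dotp xi j.2.1) ^+ 2) 0 * j.2.2 +
   \sum_(k <- J) Complex (k.1 * sin (dotp xi k.2.1) ^+ 2) 0 * k.2.2); last first.
  by apply/funext => xi; rewrite big_cons.
apply: cmeasurableD => //; apply: cmeasurableM; last exact: cmeasurableC.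
apply: cmeasurable_real; apply: measurable_funM; first exact: measurable_cst.
apply: measurable_funX; apply: (measurableT_comp measurable_sin).
by rewrite (_ : (fun x => dotp x j.2.1) = dotp j.2.1); [exact: measurable_dotp|apply/funext => x; exact: dotpC].
Qed.

Lemma measurable_letters_cos {R : realType} {d : nat} (J : seq (R * (d.-tuple R * R[i]))) :
  measurable_fun setT (letters_cos J).
Proof.
apply: measurable_sum => j; apply: measurable_funM; first exact: measurable_cst.
apply: measurable_funX; apply: (measurableT_comp measurable_cos).
by rewrite (_ : (fun x => dotp x j.2.1) = dotp j.2.1); [exact: measurable_dotp|apply/funext => x; exact: dotpC].
Qed.

(** C_n is a partial geometric sum with limit 1 / (1 - ka). The limit of M_n is then the fixed point
    nu / ((1 - ka) (1 - th)), and multiplying by 1 - th removes the dependence on [th]. *)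
Lemma geometric_pair_cvg {R : realType} (th ka : R) (nu : R[i]) (M : nat -> R[i]) (C : nat -> R) :
  0 <= ka -> ka <= th -> th < 1 -> M 0%N = 0 -> C 0%N = 0 ->
  (forall n, M n.+1 = Complex th 0 * M n + nu * Complex (C n) 0) ->
  (forall n, C n.+1 = 1 + ka * C n) ->
  ccvg (fun n => Complex (1 - th) 0 * M n) (nu * Complex (1 - ka)^-1 0).
Proof.
move=> ka0 kath th1 M0 C0 MS CS.
have th0 : 0 <= th by lra.
have ka1 : 1 - ka != 0 by rewrite gt_eqF //; lra.
have th1' : 1 - th != 0 by rewrite gt_eqF //; lra.
have CE n : C n = (1 - ka ^+ n) / (1 - ka).
  elim: n => [|n IH]; first by rewrite C0 expr0 subrr mul0r.
  by rewrite CS IH exprS; field.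
(* The source term decays like ka^n, possibly as slowly as th^n. This resonance would produce n
   th^n, hence a rate strictly between [th] and 1. *)
set r := (1 + th) / 2.
have r0 : 0 < r by rewrite /r; lra.
have r1 : r < 1 by rewrite /r; lra.
set h := r - th; have h0 : 0 < h by rewrite /h /r; lra.
set Mi := nu * Complex ((1 - ka) * (1 - th))^-1 0.
set b := cabs nu / (1 - ka).
have b0 : 0 <= b by rewrite divr_ge0 ?cabs_ge0 //; lra.
set B := b / h + cabs Mi.
have B0 : 0 <= B by rewrite addr_ge0 ?cabs_ge0 // divr_ge0 // ltW.
have bnd n : cabs (M n - Mi) <= B * r ^+ n.
  elim: n => [|n IH].
    by rewrite M0 sub0r cabsN expr0 mulr1 /B lerDr divr_ge0 // ltW.
  have -> : M n.+1 - Mi = Complex th 0 * (M n - Mi) + nu * Complex (- ka ^+ n / (1 - ka)) 0.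
    have eMi : Mi = Complex th 0 * Mi + nu * Complex (1 - ka)^-1 0.
      rewrite /Mi mulrCA -mulrDr -ComplexM -ComplexD; congr (nu * Complex _ 0); field.
      by rewrite ka1 th1'.
    rewrite [X in _ - X]eMi MS CE; have -> : Complex ((1 - ka ^+ n) / (1 - ka)) 0 = Complex (1 - ka)^-1 0 + Complex (- ka ^+ n / (1 - ka)) 0.
      by rewrite -ComplexD; congr Complex; ring.
    by ring.
  apply: (le_trans (ler_cabsD _ _)); rewrite !cabsM !cabs_real (ger0_norm th0).
  have -> : `|- ka ^+ n / (1 - ka)| = ka ^+ n / (1 - ka).
    by rewrite mulNr normrN ger0_norm // divr_ge0 ?exprn_ge0 //; lra.
  have knr : ka ^+ n <= r ^+ n by rewrite lerXn2r ?nnegrE //; [lra|rewrite /r; lra].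
  have rn0 : 0 <= r ^+ n by rewrite exprn_ge0 // ltW.
  apply: (@le_trans _ _ (th * (B * r ^+ n) + b * r ^+ n)).
    apply: lerD; first exact: ler_wpM2l.
    by rewrite (_ : cabs nu * (ka ^+ n / (1 - ka)) = b * ka ^+ n); [exact: ler_wpM2l|rewrite /b; ring].
  have bh : b <= h * B.
    rewrite /B mulrDr (_ : h * (b / h) = b); last by field; rewrite gt_eqF.
    by rewrite lerDl mulr_ge0 ?cabs_ge0 // ltW.
  have := ler_wpM2r rn0 bh.
  rewrite exprS (_ : th = r - h); last by rewrite /h; ring.
  by move: (r ^+ n) => x; nra.
have rc : (fun n => B * r ^+ n) @ \oo --> (0 : R).
  rewrite -[X in _ --> X](mulr0 B); apply: cvgM; first exact: cvg_cst.
  by apply: cvg_expr; rewrite ger0_norm // ltW.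
have -> : nu * Complex (1 - ka)^-1 0 = Complex (1 - th) 0 * Mi.
  rewrite /Mi mulrCA -ComplexM; congr (nu * Complex _ 0); field.
  by rewrite ka1 th1'.
apply: (@squeeze_cvgr _ _ _ _ (fun=> 0) (fun n => B * r ^+ n)) => //; last exact: cvg_cst.
apply: nearW => n; rewrite cabs_ge0 /= -mulrBr cabsM cabs_real ger0_norm; last by lra.
by apply: le_trans (bnd n); apply: ler_piMl; [exact: cabs_ge0|lra].
Qed.

(** [M n] mixes the words with fewer than n letters, each word weighted by the product of the
    weights of its letters. Multiplying by one minus the mass of [J] makes the total weight at most
    1, and the denominator is the sum of the geometric series in [letters_cos]. *)
Lemma Good_ratio {R : realType} {d : nat} (leb : {measure set (d.-tuple R) -> \bar R}) (c : R)
  (J : seq (R * (d.-tuple R * R[i]))) : is_lebesgue leb -> 0 < c ->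
  (forall j, j \in J -> 0 <= j.1 /\ cabs j.2.2 <= 1) -> letters_mass J < 1 ->
  Good leb (c + 1) (burk_const c `^ (c + 1))
    (fun xi => letters_num J xi * Complex (1 - letters_cos J xi)^-1 0).
Proof.
move=> hl c0 hJ th1; set th := letters_mass J in th1.
have th0 : 0 <= th by exact: letters_mass_ge0.
have kth xi : letters_cos J xi <= th by rewrite letters_cosE gerBl letters_sin_ge0.
have k1 xi : 0 < 1 - letters_cos J xi by have := kth xi; lra.
pose M := fix M n : d.-tuple R -> R[i] := if n is n'.+1 then
  fun xi => Complex th 0 * M n' xi + letters_num J xi * Complex ((fix C n xi := if n is n'.+1 then 1 + letters_cos J xi * C n' xi else 0 : R) n' xi) 0
  else fun=> 0.
pose C := fix C n xi := if n is n'.+1 then 1 + letters_cos J xi * C n' xi else 0 : R.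
pose s := fix s n := if n is n'.+1 then 1 + th * s n' else 0 : R.
have hM n : Mix (s n) (M n) (C n).
  elim: n => [|n IH]; first exact: Mix0.
  have := Mix_add _ _ _ _ _ _ (@Mix_nil R d) (Mix_letters J _ _ _ hJ IH).
  by apply: eq_Mix => // xi; rewrite add0r.
have s1 n : (1 - th) * s n <= 1.
  elim: n => [|n IH] /=; first by rewrite mulr0.
  have := ler_wpM2l th0 IH; rewrite mulrDr mulrCA; lra.
have th1' : 0 <= 1 - th by lra.
apply: (Good_lim leb (c + 1) _ (fun n xi => Complex (1 - th) 0 * M n xi) _ hl); first by lra.
- by move=> n; exact: (Mix_Good leb c _ _ _ hl c0 (s1 n) (Mix_scale _ _ _ _ th1' (hM n))).
- apply: cmeasurableM; first exact: cmeasurable_letters_num.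
  apply: cmeasurable_real; apply: (measurableT_comp measurable_invr).
  by apply: measurable_funB => //; exact: measurable_letters_cos.
- move=> xi; rewrite cabsM cabs_real ger0_norm ?invr_ge0 ?(ltW (k1 xi)) // ler_pdivrMr // mul1r.
  by apply: (le_trans (cabs_letters_num J xi hJ)); have := th1; rewrite letters_cosE -/th; lra.
- move=> xi; apply: (geometric_pair_cvg th (letters_cos J xi) (letters_num J xi) (fun n => M n xi) (fun n => C n xi)) => //.
  exact: letters_cos_ge0.
Qed.

(** * From letters to a finitely supported measure *)

Lemma cos_sub1 {R : realType} (t : R) : cos t - 1 = - 2 * sin (t / 2) ^+ 2.
Proof.
have -> : cos t = cos (t / 2 + t / 2) by congr cos; field.
by rewrite cosD; have := cos2Dsin2 (t / 2); rewrite !expr2; lra.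
Qed.

(** The bound [kern 1 t <= 1] for the Fejer kernel, solved for the cosine. *)
Lemma one_sub_cos_le {R : realType} (t : R) : 1 - cos t <= t ^+ 2 / 2.
Proof.
have [->|t0] := eqVneq t 0; first by rewrite cos0 subrr divr_ge0 // sqr_ge0.
have := kern_le 1 t ltr01; rewrite /kern (negbTE t0) !mul1r ler_pdivrMr; first by lra.
by rewrite exprn_even_gt0.
Qed.

Lemma dotp_scalet {R : realType} {d : nat} (xi z : d.-tuple R) (c : R) :
  dotp xi (scalet c z) = c * dotp xi z.
Proof. by rewrite /dotp mulr_sumr; apply: eq_bigr => k _; rewrite tnth_mktuple mulrCA. Qed.

Lemma Good_discrete {R : realType} {d : nat} (leb : {measure set (d.-tuple R) -> \bar R}) (c de : R)
  (J : seq (R * (d.-tuple R * R[i]))) : is_lebesgue leb -> 0 < c -> 0 < de ->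
  (forall j, j \in J -> 0 <= j.1 /\ cabs j.2.2 <= 1) ->
  Good leb (c + 1) (burk_const c `^ (c + 1)) (fun xi =>
    (\sum_(j <- J) Complex (j.1 * (cos (dotp xi j.2.1) - 1)) 0 * j.2.2) *
    Complex ((\sum_(j <- J) j.1 * (cos (dotp xi j.2.1) - 1)) - de)^-1 0).
Proof.
move=> hl c0 de0 hJ.
have lam0 : 0 <= letters_mass J by exact: letters_mass_ge0.
set lam := letters_mass J in lam0.
(* Dividing by lam + de / 2 brings the mass below 1. With S the rescaled sine sum, one minus the
   cosine sum is then ep de / 2 + S, and multiplication by -2 / ep produces exactly the term -
   de. *)
pose ep := (lam + de / 2)^-1.
have ep0 : 0 < ep by rewrite invr_gt0; lra.
(* The translations are halved because cos t - 1 = -2 sin^2(t/2). *)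
pose J' := [seq (ep * j.1, (scalet 2^-1 j.2.1, j.2.2)) | j <- J].
have hJ' j : j \in J' -> 0 <= j.1 /\ cabs j.2.2 <= 1.
  by move=> /mapP[k /hJ[k0 k1] ->] /=; split => //; rewrite mulr_ge0 // ltW.
have mJ' : letters_mass J' = ep * lam.
  by rewrite /letters_mass big_map /= -mulr_sumr.
have lt1 : letters_mass J' < 1.
  by rewrite mJ' /ep mulrC ltr_pdivrMr ?mul1r; lra.
have := Good_ratio leb c J' hl c0 hJ' lt1.
set G1 := (X in Good _ _ _ X); set G2 := (X in _ -> Good _ _ _ X).
rewrite (_ : G1 = G2); first exact: id.
apply/funext => xi; rewrite /G1 /G2.
have e1 : \sum_(j <- J) j.1 * (cos (dotp xi j.2.1) - 1) = (- 2 / ep) * \sum_(j <- J') j.1 * sin (dotp xi j.2.1) ^+ 2.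
  rewrite big_map mulr_sumr; apply: eq_bigr => j _ /=.
  rewrite dotp_scalet mulrC [2^-1 * _]mulrC cos_sub1; field.
  by rewrite gt_eqF.
have e2 : letters_num J' xi = Complex (- (ep / 2)) 0 * \sum_(j <- J) Complex (j.1 * (cos (dotp xi j.2.1) - 1)) 0 * j.2.2.
  rewrite /letters_num big_map mulr_sumr; apply: eq_bigr => j _ /=.
  rewrite mulrA -ComplexM; congr (Complex _ 0 * _).
  by rewrite dotp_scalet [2^-1 * _]mulrC cos_sub1; field.
rewrite letters_cosE mJ' e1 e2 -mulrA mulrCA -ComplexM.
congr (_ * Complex _ 0).
have s0 := letters_sin_ge0 J' xi hJ'.
move: (\sum_(j <- J') _) s0 => S S0.
have -> : 1 - (ep * lam - S) = ep * (de / 2) + S.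
  by rewrite /ep; field; rewrite gt_eqF //; lra.
have q : 0 < ep * (de / 2) + S by rewrite ltr_wpDr // mulr_gt0 // divr_gt0.
have -> : - 2 / ep * S - de = - (2 / ep) * (ep * (de / 2) + S) by field; rewrite gt_eqF.
move: (ep * (de / 2) + S) q => Q q; have Qn : Q != 0 by rewrite gt_eqF.
have epn : ep != 0 by rewrite gt_eqF.
move: ep epn {ep0 J' hJ' mJ' lt1 G1 G2 e1 e2} => ep epn.
by field; rewrite Qn epn.
Qed.

Lemma Rintegral_sumZ {dd} {T : measurableType dd} {R : realType} (mu : {measure set T -> \bar R})
  (I : Type) (r : seq I) (c : I -> R) (h : I -> T -> R) :
  (forall i, mu.-integrable setT (EFin \o h i)) ->
  mu.-integrable setT (EFin \o (fun x => \sum_(i <- r) c i * h i x)) /\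
  \int[mu]_x (\sum_(i <- r) c i * h i x) = \sum_(i <- r) c i * \int[mu]_x h i x.
Proof.
move=> hi; elim: r => [|i r [IH1 IH2]].
  rewrite big_nil; split.
    rewrite (_ : EFin \o _ = cst 0%E); first exact: integrable0.
    by apply/funext => x; rewrite /= big_nil.
  by under eq_Rintegral do rewrite big_nil; rewrite /Rintegral integral0.
have [i1 e1] := Rintegral_lincomb3 mu _ _ _ (c i) 1 0 (hi i) IH1 IH1.
rewrite big_cons -IH2; split.
  rewrite (_ : EFin \o _ = EFin \o (fun x => c i * h i x + 1 * (\sum_(j <- r) c j * h j x) + 0 * (\sum_(j <- r) c j * h j x))); first exact: i1.
  by apply/funext => x; rewrite /= big_cons mul1r mul0r addr0.
rewrite mul1r mul0r addr0 in e1; rewrite -e1; apply: eq_Rintegral => x _.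
by rewrite big_cons mul1r mul0r addr0.
Qed.

Lemma integrable_cindic_mul {R : realType} {d : nat} (V : {measure set (d.-tuple R) -> \bar R})
  (A : set (d.-tuple R)) (h : d.-tuple R -> R) : measurable A -> (V A < +oo)%E ->
  measurable_fun setT h -> (forall x, `|h x| <= 1) ->
  V.-integrable setT (EFin \o (fun x => \1_A x * h x)).
Proof.
move=> mA VA mh h1.
have i1 : V.-integrable setT (EFin \o \1_A).
  apply/integrableP; split; first by apply/measurable_EFinP; exact: measurable_indic.
  rewrite (_ : (\int[V]_x _)%E = (\int[V]_x (\1_A x)%:E)%E); last first.
    by apply: eq_integral => x _; rewrite /= ger0_norm.
  by rewrite integral_indic ?setIT //; exact: measurableT.
apply: (le_integrable measurableT _ _ i1).
  by apply/measurable_EFinP; apply: measurable_funM => //; exact: measurable_indic.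
by move=> x _; rewrite /= lee_fin normrM; apply: ler_piMr.
Qed.

(** For w the integral, |w|^2 is the integral over A of the real part of conj(w) phi, hence at most
    |w| V(A). It makes the averages of phi over cells admissible coefficients. *)
Lemma cabs_cintegral_indic {R : realType} {d : nat} (V : {measure set (d.-tuple R) -> \bar R})
  (A : set (d.-tuple R)) (phi : d.-tuple R -> R[i]) : measurable A -> (V A < +oo)%E ->
  cmeasurable phi -> (forall x, cabs (phi x) <= 1) ->
  cabs (cintegral V setT (fun x => cindic A x * phi x)) <= \int[V]_x \1_A x.
Proof.
move=> mA VA [mr mi] p1.
have r1 x : `|cRe (phi x)| <= 1 by apply: le_trans (ler_cRe _) (p1 x).
have i1 x : `|cIm (phi x)| <= 1 by apply: le_trans (ler_cIm _) (p1 x).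
have ir := integrable_cindic_mul V A _ mA VA mr r1.
have ii := integrable_cindic_mul V A _ mA VA mi i1.
have i0 := integrable_cindic_mul V A (fun=> 1) mA VA (measurable_cst _) (fun=> ltac:(by rewrite normr1)).
set w := cintegral _ _ _.
have wR : cRe w = \int[V]_x (\1_A x * cRe (phi x)).
  by apply: eq_Rintegral => x _; rewrite cReM /= mul0r subr0.
have wI : cIm w = \int[V]_x (\1_A x * cIm (phi x)).
  by apply: eq_Rintegral => x _; rewrite cImM /= mul0r addr0.
have [i2 e2] := Rintegral_lincomb3 V _ _ _ (cRe w) (cIm w) 0 ir ii ii.
have [i3 e3] := Rintegral_lincomb3 V _ _ _ (cabs w) 0 0 i0 i0 i0.
have h : cabs w ^+ 2 <= cabs w * \int[V]_x \1_A x.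
  have -> : cabs w ^+ 2 = cRe w * cRe w + cIm w * cIm w + 0 * cIm w by rewrite cabs_sqr; ring.
  rewrite {2}wR {2 3}wI -[X in X <= _]e2.
  have -> : cabs w * \int[V]_x \1_A x = cabs w * (\int[V]_x (\1_A x * 1)) + 0 * (\int[V]_x (\1_A x * 1)) + 0 * (\int[V]_x (\1_A x * 1)).
    by rewrite !mul0r !addr0; congr (_ * _); apply: eq_Rintegral => x _; rewrite mulr1.
  rewrite -[X in _ <= X]e3; apply: (le_Rintegral measurableT i2 i3) => x _.
  rewrite !mul0r !addr0 mulr1.
  have := cdot_le w (phi x); rewrite ler_norml => /andP[_ h].
  have h2 : cRe w * cRe (phi x) + cIm w * cIm (phi x) <= cabs w.
    by apply: (le_trans h); apply: ler_piMr; [exact: cabs_ge0|exact: p1].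
  rewrite mulrCA [cIm w * _]mulrCA -mulrDr mulrC; apply: ler_wpM2r => //.
have [w0|w0] := eqVneq (cabs w) 0.
  by rewrite w0; apply: Rintegral_ge0.
rewrite -(ler_pM2l (x := cabs w)); first by rewrite -expr2.
by rewrite lt_neqAle eq_sym w0 cabs_ge0.
Qed.

Lemma measurable_set1_tuple {R : realType} {d : nat} (v : d.-tuple R) : measurable [set v].
Proof.
rewrite (_ : [set v] = box v v); first exact: measurable_box.
apply/seteqP; split => x /= => [-> i|h]; first by rewrite !lexx.
by apply: tuple_ext => i; apply/esym/le_anti; exact: h.
Qed.

(** A map r with finitely many values replaces z inside the cosines while phi keeps its own
    argument: each value becomes a letter weighted by the measure of its cell. *)
Lemma Good_simple {R : realType} {d : nat} (leb V : {measure set (d.-tuple R) -> \bar R}) (c de : R)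
  (I : finType) (u : I -> d.-tuple R) (r : d.-tuple R -> d.-tuple R) (phi : d.-tuple R -> R[i]) :
  is_lebesgue leb -> 0 < c -> 0 < de -> injective u -> measurable_fun setT r ->
  (forall z, exists i, r z = u i) ->
  (forall i, u i != zerot R d -> (V [set z | r z = u i] < +oo)%E) ->
  cmeasurable phi -> (forall z, cabs (phi z) <= 1) ->
  Good leb (c + 1) (burk_const c `^ (c + 1)) (fun xi =>
    cintegral V setT (fun z => Complex (cos (dotp xi (r z)) - 1) 0 * phi z) *
    Complex ((\int[V]_z (cos (dotp xi (r z)) - 1)) - de)^-1 0).
Proof.
move=> hl c0 de0 uI mr ru Vfin mphi phi1.
(* The cell of the value 0 may have infinite measure, but its contribution carries the factor cos 0
   - 1 = 0; emptying it keeps all weights finite. *)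
pose A i := if u i == zerot R d then set0 else [set z | r z = u i].
have mA i : measurable (A i).
  rewrite /A; case: ifP => _; first exact: measurable0.
  by have := mr measurableT _ (measurable_set1_tuple (u i)); rewrite setTI.
have VA i : (V (A i) < +oo)%E.
  by rewrite /A; case: ifP => [_|/negbT /Vfin //]; rewrite measure0.
have expand xi (psi : d.-tuple R -> R) z : (cos (dotp xi (r z)) - 1) * psi z =
    \sum_(i <- index_enum I) (cos (dotp xi (u i)) - 1) * (\1_(A i) z * psi z).
  have [i ri] := ru z; rewrite (bigD1 i) //= big1 ?addr0.
    rewrite ri /A; have [->|nz] := eqVneq (u i) (zerot R d).
      rewrite indicE in_set0 !mul0r mulr0 (_ : dotp _ _ = 0) ?cos0 ?subrr ?mul0r //.
      by rewrite /dotp big1 // => k _; rewrite tnth_nseq mulr0.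
    by rewrite indicE mem_set // mul1r.
  move=> j /eqP ji; have nA : ~ A j z.
    by rewrite /A; case: ifP => _ //=; rewrite ri => /uI/esym.
  by rewrite indicE (memNset nA) mul0r mulr0.
have intA (psi : d.-tuple R -> R) (mp : measurable_fun setT psi) (p1 : forall z, `|psi z| <= 1) i :=
  integrable_cindic_mul V (A i) psi (mA i) (VA i) mp p1.
have sumE xi (psi : d.-tuple R -> R) : measurable_fun setT psi -> (forall z, `|psi z| <= 1) ->
    \int[V]_z ((cos (dotp xi (r z)) - 1) * psi z) =
    \sum_(i <- index_enum I) (cos (dotp xi (u i)) - 1) * \int[V]_z (\1_(A i) z * psi z).
  move=> mp p1; have [_ <-] := Rintegral_sumZ V _ (index_enum I) (fun i => cos (dotp xi (u i)) - 1) _ (intA psi mp p1).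
  by apply: eq_Rintegral => z _; exact: expand.
pose w i := cintegral V setT (fun x => cindic (A i) x * phi x).
pose v i := \int[V]_x \1_(A i) x.
have v0 i : 0 <= v i by apply: Rintegral_ge0.
have wv i : cabs (w i) <= v i := cabs_cintegral_indic V (A i) phi (mA i) (VA i) mphi phi1.
pose J := [seq (v i, (u i, Complex (v i)^-1 0 * w i)) | i <- index_enum I].
have hJ j : j \in J -> 0 <= j.1 /\ cabs j.2.2 <= 1.
  move=> /mapP[i _ ->] /=; split; first exact: v0.
  rewrite cabsM cabs_real ger0_norm ?invr_ge0 //.
  have [z|nz] := eqVneq (v i) 0; first by rewrite z invr0 mul0r.
  have vp : 0 < v i by rewrite lt_neqAle eq_sym nz v0.
  by rewrite mulrC ler_pdivrMr // mul1r.
(* On a null cell the quotient is 0 by convention, and the integral [w i] is 0 as well by [wv]. *)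
have wE i : Complex (v i) 0 * (Complex (v i)^-1 0 * w i) = w i.
  rewrite mulrA -ComplexM; have [z|nz] := eqVneq (v i) 0.
    have := wv i; rewrite z => w0.
    by rewrite (cabs_eq0P (w i)) ?mulr0 //; apply/le_anti; rewrite w0 cabs_ge0.
  by rewrite mulfV // mul1r.
have := Good_discrete leb c de J hl c0 de0 hJ.
set G1 := (X in Good _ _ _ X); set G2 := (X in _ -> Good _ _ _ X).
rewrite (_ : G1 = G2); first exact: id.
apply/funext => xi; rewrite /G1 /G2 !big_map /=.
have [mre mim] := mphi.
congr (_ * Complex (_ - _)^-1 0).
  rewrite (_ : \sum_(i <- index_enum I) _ = \sum_(i <- index_enum I) Complex (cos (dotp xi (u i)) - 1) 0 * w i); last first.
    by apply: eq_bigr => i _; rewrite mulrC ComplexM mulrA [_ * Complex (v i) 0]mulrC wE mulrC.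
  apply/esym; apply: complex_ext.
    transitivity (\int[V]_z ((cos (dotp xi (r z)) - 1) * cRe (phi z))).
      by rewrite /cintegral [LHS]/=; apply: eq_Rintegral => z _; rewrite cReM /= mul0r subr0.
    rewrite sumE //; last by move=> z; exact: le_trans (ler_cRe _) (phi1 z).
    elim: (index_enum I) => [|i s IH]; first by rewrite !big_nil.
    rewrite !big_cons cReD IH cReM /= mul0r subr0; congr (_ * _ + _).
    by apply: eq_Rintegral => z _; rewrite cReM /= mul0r subr0.
  transitivity (\int[V]_z ((cos (dotp xi (r z)) - 1) * cIm (phi z))).
    by rewrite /cintegral [LHS]/=; apply: eq_Rintegral => z _; rewrite cImM /= mul0r addr0.
  rewrite sumE //; last by move=> z; exact: le_trans (ler_cIm _) (phi1 z).
  elim: (index_enum I) => [|i s IH]; first by rewrite !big_nil.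
  rewrite !big_cons cImD IH cImM /= mul0r addr0; congr (_ * _ + _).
  by apply: eq_Rintegral => z _; rewrite cImM /= mul0r addr0.
apply/esym; transitivity (\int[V]_z ((cos (dotp xi (r z)) - 1) * cst 1 z)).
  by apply: eq_Rintegral => z _; rewrite mulr1.
rewrite sumE //; last by move=> z; rewrite normr1.
apply: eq_bigr => i _; rewrite mulrC; congr (_ * _).
by apply: eq_Rintegral => z _; rewrite mulr1.
Qed.

Lemma ccvg_components {R : realType} (z : nat -> R[i]) (l : R[i]) :
  (fun n => cRe (z n)) @ \oo --> cRe l -> (fun n => cIm (z n)) @ \oo --> cIm l -> ccvg z l.
Proof.
move=> hr hi.
apply: (@squeeze_cvgr _ _ _ _ (fun=> 0) (fun n => `|cRe (z n) - cRe l| + `|cIm (z n) - cIm l|)).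
- by apply: nearW => n; rewrite cabs_ge0 /=; apply: (le_trans (cabs_le _)); rewrite cReD cReN cImD cImN.
- exact: cvg_cst.
rewrite -[X in _ --> X]addr0; apply: cvgD.
  by rewrite -[X in _ --> X](@normr0 R R) -(subrr (cRe l)); apply: cvg_norm; apply: cvgB => //; exact: cvg_cst.
by rewrite -[X in _ --> X](@normr0 R R) -(subrr (cIm l)); apply: cvg_norm; apply: cvgB => //; exact: cvg_cst.
Qed.

Lemma ccvg_cRe {R : realType} (z : nat -> R[i]) (l : R[i]) :
  ccvg z l -> (fun n => cRe (z n)) @ \oo --> cRe l.
Proof.
move=> /cvgnP h; apply/cvgnP => e e0; have [N hN] := h e e0; exists N => n /hN.
rewrite sub0r normrN ger0_norm ?cabs_ge0 // => /(le_trans _); apply.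
by rewrite distrC -cReN -cReD; exact: ler_cRe.
Qed.

Lemma ccvg_cIm {R : realType} (z : nat -> R[i]) (l : R[i]) :
  ccvg z l -> (fun n => cIm (z n)) @ \oo --> cIm l.
Proof.
move=> /cvgnP h; apply/cvgnP => e e0; have [N hN] := h e e0; exists N => n /hN.
rewrite sub0r normrN ger0_norm ?cabs_ge0 // => /(le_trans _); apply.
by rewrite distrC -cImN -cImD; exact: ler_cIm.
Qed.

Lemma Good_pointwise_lim {R : realType} {d : nat} (leb : {measure set (d.-tuple R) -> \bar R}) (p K : R)
  (u : nat -> d.-tuple R -> R[i]) (m : d.-tuple R -> R[i]) : is_lebesgue leb -> 1 <= p ->
  (forall n, Good leb p K (u n)) -> (forall xi, ccvg (u^~ xi) (m xi)) -> Good leb p K m.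
Proof.
move=> hl p1 hu um; apply: (Good_lim leb p K u m hl p1 hu _ _ um).
  split.
    apply: (@measurable_fun_cvg _ _ _ _ (fun n x => cRe (u n x))).
      by move=> n; have [[]] := hu n.
    by move=> x _; exact: ccvg_cRe (um x).
  apply: (@measurable_fun_cvg _ _ _ _ (fun n x => cIm (u n x))).
    by move=> n; have [[]] := hu n.
  by move=> x _; exact: ccvg_cIm (um x).
move=> xi; have h := ccvg_cabs _ _ (um xi).
rewrite -(cvg_lim _ h) //; apply: limr_le; first by apply/cvg_ex; exists (cabs (m xi)).
by apply: nearW => n; have [_ h1 _] := hu n.
Qed.

(** * Discretization of the measure *)

Section SimpleFunctions.
Import HBSimple HBNNSimple.

(** Simple approximations of the positive part, taken at t and at -t and subtracted. The condition
    |q n t| <= |t| gives cells of finite measure and domination by min(|z|^2, 1). *)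
Lemma quantizer_exists {R : realType} : exists q : nat -> R -> R,
  [/\ forall n, measurable_fun setT (q n), forall n, finite_set (range (q n)),
      forall n t, `|q n t| <= `|t| & forall t, (fun n => q n t) @ \oo --> t].
Proof.
have mf : measurable_fun setT (fun t : R => (Num.max t 0)%:E).
  by apply/measurable_EFinP; exact: measurable_maxr.
pose s := nnsfun_approx measurableT mf.
have s0 n t : 0 <= s n t by [].
have cs t : (fun n => s n t) @ \oo --> Num.max t 0.
  have h : forall t : R, setT t -> (0 <= (Num.max t 0)%:E)%E by move=> t' _; rewrite lee_fin le_max lexx orbT.
  exact: (fine_cvg (@cvg_nnsfun_approx _ _ _ setT measurableT _ mf h t I)).
have sle n t : s n t <= Num.max t 0.
  rewrite -(cvg_lim _ (cs t)) //; apply: nondecreasing_cvgn_le; last by apply/cvg_ex; exists (Num.max t 0); exact: cs.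
  by move=> a b ab; have /lefP := nd_nnsfun_approx measurableT mf ab; apply.
exists (fun n t => s n t - s n (- t)); split.
- move=> n; apply: measurable_funB; first exact: measurable_funPT.
  by apply: (measurableT_comp (f := s n)); [exact: measurable_funPT|exact: measurable_funN].
- move=> n; have fs : finite_set (range (s n)) by exact: fimfunP.
  apply: (@sub_finite_set _ _ ((fun z => z.1 - z.2) @` (range (s n) `*` range (s n)))).
    move=> _ [t _ <-]; exists (s n t, s n (- t)); last by [].
    by split; [exists t|exists (- t)].
  by apply: finite_image; exact: finite_setX.
- move=> n t; have h1 := s0 n t; have h2 := s0 n (- t); have h3 := sle n t; have h4 := sle n (- t).
  have [t0|t0] := lerP 0 t.
    rewrite max_l // in h3; rewrite max_r ?oppr_le0 // in h4.
    by rewrite (ger0_norm t0) ger0_norm; lra.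
  rewrite max_r ?(ltW t0) // in h3; rewrite max_l ?oppr_ge0 ?(ltW t0) // in h4.
  by rewrite (ltr0_norm t0) ler_norml; apply/andP; split; lra.
- move=> t; rewrite -[X in _ --> X](_ : Num.max t 0 - Num.max (- t) 0 = t); first exact: cvgB.
  by case: (lerP t 0) => a1; case: (lerP (- t) 0) => a2; lra.
Qed.

Lemma dotp_bound {R : realType} {d : nat} (xi r z : d.-tuple R) :
  (forall i, `|tnth r i| <= `|tnth z i|) ->
  dotp xi r ^+ 2 <= (\sum_(i < d) `|tnth xi i|) ^+ 2 * sqnorm z.
Proof.
move=> rz; have s0 : 0 <= sqnorm z by apply: sumr_ge0 => i _; rewrite -expr2 sqr_ge0.
rewrite -[sqnorm z]sqr_sqrtr // -exprMn -[dotp xi r ^+ 2]real_normK ?num_real //.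
rewrite lerXn2r ?nnegrE ?mulr_ge0 ?sumr_ge0 ?sqrtr_ge0 //.
apply: (le_trans (ler_norm_sum _ _ _)); rewrite mulr_suml; apply: ler_sum => i _.
rewrite normrM; apply: ler_wpM2l => //; apply: (le_trans (rz i)).
by rewrite -sqrtr_sqr ler_sqrt // sqnorm_coord_le.
Qed.

(** The quadratic bound where |z|^2 <= 1 and the trivial bound 2 elsewhere, with one constant for
    both; monotone rounding of z into r keeps it valid. *)
Lemma cos_sub1_bound {R : realType} {d : nat} (xi r z : d.-tuple R) :
  (forall i, `|tnth r i| <= `|tnth z i|) ->
  `|cos (dotp xi r) - 1| <= ((\sum_(i < d) `|tnth xi i|) ^+ 2 + 2) * Num.min (sqnorm z) 1.
Proof.
move=> /(dotp_bound xi) h; set S := (\sum_(i < d) `|tnth xi i|) ^+ 2 in h *.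
have S0 : 0 <= S by exact: sqr_ge0.
have s0 : 0 <= sqnorm z by apply: sumr_ge0 => i _; rewrite -expr2 sqr_ge0.
have h1 := one_sub_cos_le (dotp xi r); have h2 := cos_max (dotp xi r).
move: h2; rewrite ler_norml => /andP[h2 h3].
rewrite distrC ger0_norm; last by lra.
case: (lerP (sqnorm z) 1) => zz.
  have : 0 <= sqnorm z * 2 by rewrite mulr_ge0.
  by have := mulr_ge0 S0 s0; rewrite mulrDl; lra.
by lra.
Qed.

Lemma measurable_sqnorm {R : realType} {d : nat} : measurable_fun setT (@sqnorm R d).
Proof. by apply: measurable_sum => k; apply: measurable_funM; exact: measurable_coord. Qed.

(** Stated with a weight [psi] so that it serves the denominator and the real and imaginary parts of
    the numerator. *)
Lemma cvg_symbol {R : realType} {d : nat} (V : {measure set (d.-tuple R) -> \bar R})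
  (q : nat -> d.-tuple R -> d.-tuple R) (psi : d.-tuple R -> R) xi :
  (\int[V]_z (Num.min (sqnorm z) 1)%:E < +oo)%E ->
  (forall n, measurable_fun setT (q n)) ->
  (forall n z i, `|tnth (q n z) i| <= `|tnth z i|) ->
  (forall z i, (fun n => tnth (q n z) i) @ \oo --> tnth z i) ->
  measurable_fun setT psi -> (forall z, `|psi z| <= 1) ->
  (fun n => \int[V]_z ((cos (dotp xi (q n z)) - 1) * psi z)) @ \oo -->
  \int[V]_z ((cos (dotp xi z) - 1) * psi z).
Proof.
move=> hV mq qle qc mp p1.
pose S := (\sum_(i < d) `|tnth xi i|) ^+ 2 + 2.
have S0 : 0 <= S by rewrite addr_ge0 // sqr_ge0.
have m0 (z : d.-tuple R) : 0 <= Num.min (sqnorm z) 1.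
  by rewrite le_min ler01 andbT; apply: sumr_ge0 => i _; rewrite -expr2 sqr_ge0.
have iG : V.-integrable setT (fun z => (S * Num.min (sqnorm z) 1)%:E).
  have mm : measurable_fun setT (fun z : d.-tuple R => Num.min (sqnorm z) 1).
    by apply: measurable_minr => //; exact: measurable_sqnorm.
  have : V.-integrable setT (EFin \o (fun z => Num.min (sqnorm z) 1)).
    apply/integrableP; split; first exact/measurable_EFinP.
    rewrite (_ : (\int[V]_z _)%E = (\int[V]_z (Num.min (sqnorm z) 1)%:E)%E) //.
    by apply: eq_integral => z _; rewrite /= (ger0_norm (m0 z)).
  by move=> h; have := integrableZl measurableT S h; exact.
have mcos (r : d.-tuple R -> d.-tuple R) : measurable_fun setT r ->
    measurable_fun setT (fun z => (cos (dotp xi (r z)) - 1) * psi z).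
  move=> mr; apply: measurable_funM => //; apply: measurable_funB; last exact: measurable_cst.
  apply: (measurableT_comp measurable_cos).
  exact: (measurableT_comp (measurable_dotp d xi) mr).
have bnd (r : d.-tuple R) z : (forall i, `|tnth r i| <= `|tnth z i|) ->
    `|(cos (dotp xi r) - 1) * psi z| <= S * Num.min (sqnorm z) 1.
  move=> rz; rewrite normrM; apply: le_trans (cos_sub1_bound xi r z rz).
  by apply: ler_piMr.
have iq (r : d.-tuple R -> d.-tuple R) : measurable_fun setT r ->
    (forall z i, `|tnth (r z) i| <= `|tnth z i|) ->
    V.-integrable setT (EFin \o (fun z => (cos (dotp xi (r z)) - 1) * psi z)).
  move=> mr rz; apply: (le_integrable measurableT _ _ iG); first by apply/measurable_EFinP; exact: mcos.
  by move=> z _; rewrite /= lee_fin; apply: (le_trans (bnd _ z (rz z))); exact: ler_norm.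
have cdot z : (fun n => dotp xi (q n z)) @ \oo --> dotp xi z.
  rewrite /dotp; apply: cvg_big => [|i _]; first exact: add_continuous.
  by apply: cvgM; [exact: cvg_cst|exact: qc].
have i0 := iq id (@measurable_id _ _ _) (fun z i => lexx _).
apply: fine_cvg; rewrite fineK; last by apply: integrable_fin_num => //; exact: i0.
apply: (dominated_cvg measurableT _ _ _ iG).
- by move=> n; apply/measurable_EFinP; exact: mcos.
- move=> z _; apply: cvg_EFinn; apply: cvgM; last exact: cvg_cst.
  apply: cvgB; last exact: cvg_cst.
  by apply: (continuous_cvg _ _ (cdot z)); exact: continuous_cos.
- by [].
- by move=> n z _; rewrite abse_EFin lee_fin; exact: bnd (qle n z).
Qed.

End SimpleFunctions.

Definition symbol_num {R : realType} {d : nat} (V : {measure set (d.-tuple R) -> \bar R})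
  (phi : d.-tuple R -> R[i]) (xi : d.-tuple R) : R[i] :=
  cintegral V setT (fun z => Complex (cos (dotp xi z) - 1) 0 * phi z).

Definition symbol_den {R : realType} {d : nat} (V : {measure set (d.-tuple R) -> \bar R})
  (xi : d.-tuple R) : R := \int[V]_z (cos (dotp xi z) - 1).

Lemma Rintegral_le0 {dd} {T : measurableType dd} {R : realType}
  (mu : {measure set T -> \bar R}) (f : T -> R) :
  (forall x, f x <= 0) -> \int[mu]_x f x <= 0.
Proof.
move=> f0; rewrite /Rintegral fine_le0 // integralE integral0_eq; last first.
  by move=> x _; rewrite funeposE; apply/max_idPr; rewrite lee_fin.
by rewrite sub0e oppe_le0; apply: integral_ge0 => x _; exact: funeneg_ge0.
Qed.

(** Chebyshev's inequality: on the level set some coordinate of z is at least as large as the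
    nonzero coordinate of v, so min(|z|^2, 1) is bounded below there. *)
Lemma fin_levels {R : realType} {d : nat} (V : {measure set (d.-tuple R) -> \bar R})
  (r : d.-tuple R -> d.-tuple R) (v : d.-tuple R) :
  (\int[V]_z (Num.min (sqnorm z) 1)%:E < +oo)%E -> measurable_fun setT r ->
  (forall z i, `|tnth (r z) i| <= `|tnth z i|) -> v != zerot R d ->
  (V [set z | r z = v] < +oo)%E.
Proof.
move=> hV mr rle v0.
have [i vi] : exists i, tnth v i != 0.
  apply: contrapT => h; move/eqP: v0; apply; apply: tuple_ext => i; rewrite tnth_nseq.
  by apply/eqP; apply: contrapT => /negP hi; apply: h; exists i.
set e := Num.min (tnth v i ^+ 2) 1.
have e0 : 0 < e by rewrite lt_min ltr01 andbT exprn_even_gt0.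
have mA : measurable [set z | r z = v].
  by have := mr measurableT _ (measurable_set1_tuple v); rewrite setTI.
have m0 (z : d.-tuple R) : 0 <= Num.min (sqnorm z) 1.
  by rewrite le_min ler01 andbT; apply: sumr_ge0 => k _; rewrite -expr2 sqr_ge0.
have h : (e%:E * V [set z | r z = v] <= \int[V]_z (Num.min (sqnorm z) 1)%:E)%E.
  rewrite -[X in V X](setIT [set z | r z = v]) -integral_indic //.
  rewrite -ge0_integralZl_EFin; last 4 first.
  - exact: measurableT.
  - by move=> z _; rewrite lee_fin.
  - by apply/measurable_EFinP; exact: measurable_indic.
  - exact: ltW.
  apply: ge0_le_integral.
  - exact: measurableT.
  - by move=> z _; rewrite -EFinM lee_fin mulr_ge0 // ltW.
  - by apply: measurable_funeM; apply/measurable_EFinP; exact: measurable_indic.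
  - by apply/measurable_EFinP; apply: measurable_minr => //; exact: measurable_sqnorm.
  move=> z _; rewrite -EFinM lee_fin indicE; have [zA|zA] := pselect (r z = v); last first.
    by rewrite memNset // mulr0.
  rewrite mem_set // mulr1 /e le_min !ge_min lexx orbT andbT.
  apply/orP; left; apply: le_trans (sqnorm_coord_le z i).
  rewrite -(real_normK (num_real (tnth v i))) -(real_normK (num_real (tnth z i))).
  by apply: lerXn2r; rewrite ?nnegrE //; rewrite -zA; exact: rle.
rewrite ltey; apply/eqP => Voo; move: h; rewrite Voo gt0_muley ?lte_fin //.
by move=> /le_lt_trans/(_ hV); rewrite ltxx.
Qed.

Lemma Good_symbol_delta {R : realType} {d : nat} (leb V : {measure set (d.-tuple R) -> \bar R})
  (c de : R) (phi : d.-tuple R -> R[i]) : is_lebesgue leb -> 0 < c -> 0 < de ->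
  (\int[V]_z (Num.min (sqnorm z) 1)%:E < +oo)%E -> cmeasurable phi ->
  (forall z, cabs (phi z) <= 1) ->
  Good leb (c + 1) (burk_const c `^ (c + 1))
    (fun xi => symbol_num V phi xi * Complex (symbol_den V xi - de)^-1 0).
Proof.
move=> hl c0 de0 hV mphi p1; have [q [mq fq qle qc]] := @quantizer_exists R.
pose r n (z : d.-tuple R) := [tuple q n (tnth z i) | i < d].
have mr n : measurable_fun setT (r n).
  apply/measurable_fun_tnthP => i.
  rewrite (_ : _ \o _ = q n \o (fun z => tnth z i)); last by apply/funext => z /=; rewrite tnth_mktuple.
  by apply: measurableT_comp; [exact: mq|exact: measurable_coord].
have rle n z i : `|tnth (r n z) i| <= `|tnth z i| by rewrite tnth_mktuple; exact: qle.
have rc z i : (fun n => tnth (r n z) i) @ \oo --> tnth z i.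
  by under eq_fun do rewrite tnth_mktuple; exact: qc.
have den_neg (s : d.-tuple R -> d.-tuple R) xi : \int[V]_z (cos (dotp xi (s z)) - 1) <= 0.
  apply: Rintegral_le0 => z.
  by have := cos_max (dotp xi (s z)); rewrite ler_norml => /andP[_]; rewrite subr_le0.
have G n : Good leb (c + 1) (burk_const c `^ (c + 1)) (fun xi =>
    cintegral V setT (fun z => Complex (cos (dotp xi (r n z)) - 1) 0 * phi z) *
    Complex ((\int[V]_z (cos (dotp xi (r n z)) - 1)) - de)^-1 0).
  have [s0 es0] : exists s0 : seq R, range (q n) = [set` s0] by exact/finite_seqP.
  (* Duplicates are removed so that distinct multi-indices give distinct grid points; the grid
     consists of all tuples of values of [q n], including points with an empty cell. *)
  pose s := undup s0.
  have us : uniq s by exact: undup_uniq.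
  have ms t : q n t \in s.
    have : range (q n) (q n t) by exists t.
    by rewrite mem_undup es0.
  pose u (k : {ffun 'I_d -> 'I_(size s)}) := [tuple nth 0 s (k i) | i < d].
  apply: (Good_simple leb V c de _ u (r n) phi hl c0 de0 _ (mr n) _ _ mphi p1).
  - move=> k1 k2 /(congr1 (fun v => tnth v)) e; apply/ffunP => i.
    have := congr1 (fun v => v i) e; rewrite !tnth_mktuple => /eqP.
    by rewrite nth_uniq // => /eqP/val_inj.
  - move=> z; have lt i : (index (q n (tnth z i)) s < size s)%N by rewrite index_mem.
    exists [ffun i => Ordinal (lt i)]; apply: tuple_ext => i.
    by rewrite !tnth_mktuple ffunE /= nth_index.
  - by move=> k uk; exact: (fin_levels V (r n) (u k) hV (mr n) (rle n) uk).
have c1 : 1 <= c + 1 by lra.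
apply: (Good_pointwise_lim leb (c + 1) _ _ _ hl c1 G) => xi.
have [mre mim] := mphi.
have cd : (fun n => \int[V]_z (cos (dotp xi (r n z)) - 1)) @ \oo --> symbol_den V xi.
  have := cvg_symbol V r (fun=> 1) xi hV mr rle rc (measurable_cst _) (fun=> ltac:(by rewrite normr1)).
  rewrite (_ : \int[V]_z ((cos (dotp xi z) - 1) * 1) = symbol_den V xi); last first.
    by apply: eq_Rintegral => z _; rewrite mulr1.
  rewrite (_ : (fun n => _) = fun n => \int[V]_z (cos (dotp xi (r n z)) - 1)); first exact: id.
  by apply/funext => n; apply: eq_Rintegral => z _; rewrite mulr1.
have ci : (fun n => (\int[V]_z (cos (dotp xi (r n z)) - 1) - de)^-1) @ \oo --> (symbol_den V xi - de)^-1.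
  (* The integral in the denominator is nonpositive, so subtracting [de] keeps the limit away from
     0. *)
  apply: cvgV; first by have := den_neg id xi; rewrite /symbol_den => h; rewrite lt_eqF //; lra.
  by apply: cvgB => //; exact: cvg_cst.
have cre := cvg_symbol V r _ xi hV mr rle rc mre (fun z => le_trans (ler_cRe _) (p1 z)).
have cim := cvg_symbol V r _ xi hV mr rle rc mim (fun z => le_trans (ler_cIm _) (p1 z)).
have eR (s : d.-tuple R -> d.-tuple R) :
    cRe (cintegral V setT (fun z => Complex (cos (dotp xi (s z)) - 1) 0 * phi z)) =
    \int[V]_z ((cos (dotp xi (s z)) - 1) * cRe (phi z)).
  by rewrite /cintegral [LHS]/=; apply: eq_Rintegral => z _; rewrite cReM /= mul0r subr0.
have eI (s : d.-tuple R -> d.-tuple R) :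
    cIm (cintegral V setT (fun z => Complex (cos (dotp xi (s z)) - 1) 0 * phi z)) =
    \int[V]_z ((cos (dotp xi (s z)) - 1) * cIm (phi z)).
  by rewrite /cintegral [LHS]/=; apply: eq_Rintegral => z _; rewrite cImM /= mul0r addr0.
apply: ccvg_components.
  under eq_fun do rewrite cReM eR [X in _ - X]mulr0 subr0.
  rewrite cReM [X in _ - X]mulr0 subr0 /symbol_num (eR id).
  by apply: cvgM; [exact: cre|exact: ci].
under eq_fun do rewrite cImM eI [X in X + _]mulr0 add0r.
rewrite cImM [X in X + _]mulr0 add0r /symbol_num (eI id).
by apply: cvgM; [exact: cim|exact: ci].
Qed.

Lemma inv_Complex_real {R : realType} (a : R) : (Complex a 0)^-1 = Complex a^-1 0.
Proof.
have [->|a0] := eqVneq a 0; first by rewrite !invr0.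
have n0 : Complex a 0 != 0 :> R[i] by apply/eqP => /(congr1 cRe) /= /eqP; rewrite (negbTE a0).
by apply: (mulfI n0); rewrite mulfV // -ComplexM mulfV.
Qed.

Lemma Good_multM {R : realType} {d : nat} (leb V : {measure set (d.-tuple R) -> \bar R})
  (c : R) (phi : d.-tuple R -> R[i]) : is_lebesgue leb -> 0 < c ->
  (\int[V]_z (Num.min (sqnorm z) 1)%:E < +oo)%E -> cmeasurable phi ->
  (forall z, cabs (phi z) <= 1) ->
  Good leb (c + 1) (burk_const c `^ (c + 1)) (multM V phi).
Proof.
move=> hl c0 hV mphi p1; have c1 : 1 <= c + 1 by lra.
have de0 n : 0 < (n.+1%:R : R)^-1 by rewrite invr_gt0.
apply: (Good_pointwise_lim leb (c + 1) _ _ _ hl c1 (fun n => Good_symbol_delta leb V c _ phi hl c0 (de0 n) hV mphi p1)) => xi.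
rewrite /multM -/(symbol_den V xi) -/(symbol_num V phi xi); case: ifPn => [/eqP D0|D0].
  (* Where the denominator vanishes, the bound by 1 on the perturbed multipliers reads |numerator|
     <= e for every e > 0. The approximations are thus 0 there, in agreement with the value
     prescribed in [multM]. *)
  have N0 : symbol_num V phi xi = 0.
    apply: cabs_eq0P; apply/le_anti; rewrite cabs_ge0 andbT.
    apply/ler_addgt0Pr => e e0; rewrite add0r.
    have [_ /(_ xi) + _] := Good_symbol_delta leb V c e phi hl c0 e0 hV mphi p1.
    rewrite D0 sub0r cabsM cabs_real normfV normrN (gtr0_norm e0).
    by rewrite ler_pdivrMr // mul1r.
  by apply: (ccvg_eventually _ _ 0) => n _; rewrite N0 mul0r.
rewrite inv_Complex_real.
have ci : (fun n => (symbol_den V xi - n.+1%:R^-1)^-1) @ \oo --> (symbol_den V xi)^-1.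
  apply: cvgV => //; rewrite -[X in _ --> X]subr0; apply: cvgB; first exact: cvg_cst.
  exact: cvg_harmonic.
apply: ccvg_components.
  under eq_fun do rewrite cReM [X in _ - X]mulr0 subr0.
  rewrite cReM [X in _ - X]mulr0 subr0.
  by apply: cvgM; [exact: cvg_cst|exact: ci].
under eq_fun do rewrite cImM [X in X + _]mulr0 add0r.
rewrite cImM [X in X + _]mulr0 add0r.
by apply: cvgM; [exact: cvg_cst|exact: ci].
Qed.

(** * Extension to L^p *)

Definition Mrel {R : realType} {d : nat} (leb : {measure set (d.-tuple R) -> \bar R})
  (m f g : d.-tuple R -> R[i]) : Prop :=
  exists F, FT leb f F /\ FT leb g (fun xi => m xi * F xi).

Lemma Mrel_inLp {R : realType} {d : nat} (leb : {measure set (d.-tuple R) -> \bar R})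
  (m f g : d.-tuple R -> R[i]) : Mrel leb m f g -> inLp leb 2 f /\ inLp leb 2 g.
Proof. by case=> F [[hf _ _] [hg _ _]]. Qed.

(** [Good] estimates some function with the required transform; injectivity of the transform
    identifies it with g almost everywhere. *)
Lemma Mrel_le {R : realType} {d : nat} (leb : {measure set (d.-tuple R) -> \bar R}) (p K : R)
  (m f g : d.-tuple R -> R[i]) : is_lebesgue leb -> Good leb p K m -> Mrel leb m f g ->
  (Ip leb p g <= K%:E * Ip leb p f)%E.
Proof.
move=> hl [_ _ hG] [F [hF hg]]; have [g' [hg' le]] := hG f F hF.
apply: le_trans le; rewrite le_eqVlt; apply/orP; left; apply/eqP.
have [[mg _] _ _] := hg; have [[mg' _] _ _] := hg'.
apply: (Ip_ae_eq _ leb p _ _ mg mg'); apply: (FT_inj leb _ _ _ _ hl hg hg').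
by exists set0; split; [exact: measurable0|exact: measure0|move=> x /= h; case: h].
Qed.

Lemma Mrel_lincomb {R : realType} {d : nat} (leb : {measure set (d.-tuple R) -> \bar R})
  (m : d.-tuple R -> R[i]) (a : R[i]) (f g f' g' : d.-tuple R -> R[i]) : is_lebesgue leb ->
  Mrel leb m f g -> Mrel leb m f' g' ->
  Mrel leb m (fun x => a * f x + f' x) (fun x => a * g x + g' x).
Proof.
move=> hl [F [hF hg]] [F' [hF' hg']]; exists (fun xi => a * F xi + F' xi); split.
  exact: FT_lincomb.
have := FT_lincomb leb a _ _ _ _ hl hg hg'.
rewrite (_ : (fun xi => a * (m xi * F xi) + m xi * F' xi) = fun xi => m xi * (a * F xi + F' xi)); first exact: id.
by apply/funext => xi; rewrite mulrDr mulrCA.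
Qed.

Lemma Mrel_exists {R : realType} {d : nat} (leb : {measure set (d.-tuple R) -> \bar R}) (p K : R)
  (m f : d.-tuple R -> R[i]) : is_lebesgue leb -> Good leb p K m -> inLp leb 2 f ->
  exists g, Mrel leb m f g.
Proof.
move=> hl [_ _ hG] hf; have [F hF] := FT_exists leb f hl hf.
by have [g [hg _]] := hG f F hF; exists g, F.
Qed.

Lemma Mrel_diff_le {R : realType} {d : nat} (leb : {measure set (d.-tuple R) -> \bar R}) (p K : R)
  (m f g f' g' : d.-tuple R -> R[i]) : is_lebesgue leb -> Good leb p K m ->
  Mrel leb m f g -> Mrel leb m f' g' ->
  (Ip leb p (fun x => (g x - g' x)%R) <= K%:E * Ip leb p (fun x => (f x - f' x)%R))%E.
Proof.
move=> hl hG h h'; have := Mrel_le leb p K m _ _ hl hG (Mrel_lincomb leb m (-1) _ _ _ _ hl h' h).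
rewrite (_ : (fun x => -1 * g' x + g x) = fun x => g x - g' x); last by apply/funext => x; rewrite cmulN1D.
by rewrite (_ : (fun x => -1 * f' x + f x) = fun x => f x - f' x); last by apply/funext => x; rewrite cmulN1D.
Qed.

(* The L^p-closure of the graph of the multiplier operator on L^2. *)
Definition Mcl {R : realType} {d : nat} (leb : {measure set (d.-tuple R) -> \bar R}) (p : R)
  (m f g : d.-tuple R -> R[i]) : Prop :=
  cmeasurable g /\ exists h k : nat -> d.-tuple R -> R[i],
  [/\ forall n, Mrel leb m (h n) (k n), tends0 (fun n => Ip leb p (fun x => h n x - f x)) &
      tends0 (fun n => Ip leb p (fun x => k n x - g x))].

(** The bound on differences makes the operator closable in L^p: two sequences approximating the
    same f have images that approach each other. *)
Lemma Mcl_unique {R : realType} {d : nat} (leb : {measure set (d.-tuple R) -> \bar R}) (p K : R)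
  (m f g g' : d.-tuple R -> R[i]) : is_lebesgue leb -> 0 <= p -> 0 <= K -> Good leb p K m ->
  cmeasurable f -> Mcl leb p m f g -> Mcl leb p m f g' -> aeq_c leb g g'.
Proof.
move=> hl p0 K0 hG mf [mg [h [k [hk h1 h2]]]] [mg' [h' [k' [hk' h1' h2']]]].
have mh n : cmeasurable (h n) := proj1 (proj1 (Mrel_inLp leb m _ _ (hk n))).
have mk n : cmeasurable (k n) := proj1 (proj2 (Mrel_inLp leb m _ _ (hk n))).
have mh' n : cmeasurable (h' n) := proj1 (proj1 (Mrel_inLp leb m _ _ (hk' n))).
have mk' n : cmeasurable (k' n) := proj1 (proj2 (Mrel_inLp leb m _ _ (hk' n))).
have c0 : (0 : R) <= 2 `^ p by exact: powR_ge0.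
apply: (Ip_limit_unique d leb p k' g g' p0 mk' mg mg' _ h2').
have a1 : tends0 (fun n => Ip leb p (fun x => h' n x - h n x)).
  apply: (tends0_le _ _ _ (tends0Z _ _ c0 (tends0D _ _ h1' h1))) => n.
  by rewrite (IpB_sym _ leb p (h n) f); exact: Ip_triangle.
have a2 : tends0 (fun n => Ip leb p (fun x => k' n x - k n x)).
  apply: (tends0_le _ _ _ (tends0Z _ _ K0 a1)) => n.
  exact: Mrel_diff_le hl hG (hk' n) (hk n).
apply: (tends0_le _ _ _ (tends0Z _ _ c0 (tends0D _ _ a2 h2))) => n.
exact: Ip_triangle.
Qed.

Lemma Mcl_lincomb {R : realType} {d : nat} (leb : {measure set (d.-tuple R) -> \bar R}) (p : R)
  (m : d.-tuple R -> R[i]) (a : R[i]) (f g f' g' : d.-tuple R -> R[i]) : is_lebesgue leb -> 0 <= p ->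
  cmeasurable f -> cmeasurable f' -> Mcl leb p m f g -> Mcl leb p m f' g' ->
  Mcl leb p m (fun x => a * f x + f' x) (fun x => a * g x + g' x).
Proof.
move=> hl p0 mf mf' [mg [h [k [hk h1 h2]]]] [mg' [h' [k' [hk' h1' h2']]]].
have mh n : cmeasurable (h n) := proj1 (proj1 (Mrel_inLp leb m _ _ (hk n))).
have mk n : cmeasurable (k n) := proj1 (proj2 (Mrel_inLp leb m _ _ (hk n))).
have mh' n : cmeasurable (h' n) := proj1 (proj1 (Mrel_inLp leb m _ _ (hk' n))).
have mk' n : cmeasurable (k' n) := proj1 (proj2 (Mrel_inLp leb m _ _ (hk' n))).
have c0 : (0 : R) <= 2 `^ p by exact: powR_ge0.
have a0 : 0 <= cabs a `^ p by exact: powR_ge0.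
have key (u u' : nat -> d.-tuple R -> R[i]) (v v' : d.-tuple R -> R[i]) :
    (forall n, cmeasurable (u n)) -> (forall n, cmeasurable (u' n)) -> cmeasurable v -> cmeasurable v' ->
    tends0 (fun n => Ip leb p (fun x => u n x - v x)) ->
    tends0 (fun n => Ip leb p (fun x => u' n x - v' x)) ->
    tends0 (fun n => Ip leb p (fun x => (a * u n x + u' n x) - (a * v x + v' x))).
  move=> mu mu' mv mv' t t'.
  apply: (tends0_le _ _ _ (tends0Z _ _ c0 (tends0D _ _ (tends0Z _ _ a0 t) t'))) => n.
  have mB := cmeasurableB _ _ _ (mu n) mv; have mB' := cmeasurableB _ _ _ (mu' n) mv'.
  rewrite -(IpZ _ leb p a _ mB).
  rewrite (_ : (fun x => (a * u n x + u' n x) - (a * v x + v' x)) =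
     fun x => a * (u n x - v x) + (u' n x - v' x)); last first.
    by apply/funext => x; rewrite mulrBr opprD addrACA.
  exact: (IpD _ leb p _ _ p0 (cmeasurableM _ _ _ (cmeasurableC d a) mB) mB').
split.
  by apply: cmeasurableD; [apply: cmeasurableM; [exact: cmeasurableC|exact: mg]|exact: mg'].
exists (fun n x => a * h n x + h' n x), (fun n x => a * k n x + k' n x); split.
- by move=> n; exact: Mrel_lincomb.
- exact: key.
- exact: key.
Qed.

Lemma Mcl_refl {R : realType} {d : nat} (leb : {measure set (d.-tuple R) -> \bar R}) (p : R)
  (m f g : d.-tuple R -> R[i]) : 0 < p -> Mrel leb m f g -> Mcl leb p m f g.
Proof.
move=> p0 h; have pn : p != 0 by rewrite gt_eqF.
have t (u : d.-tuple R -> R[i]) : tends0 (fun n : nat => Ip leb p (fun x => u x - u x)).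
  move=> e e0; exists 0%N => n _.
  rewrite (_ : (fun x => u x - u x) = fun=> 0); last by apply/funext => x; rewrite subrr.
  by rewrite (Ip0 d leb p pn) lee_fin ltW.
split; first exact: (proj1 (proj2 (Mrel_inLp leb m _ _ h))).
by exists (fun=> f), (fun=> g); split; [move=> _; exact: h|exact: t|exact: t].
Qed.

(** Cutting in space and in height puts any measurable f into L^2, while keeping |f| as a majorant
    for convergence in L^p. *)
Definition htrunc {R : realType} {d : nat} (f : d.-tuple R -> R[i]) (n : nat) (x : d.-tuple R) : R[i] :=
  cindic [set z | cabs (f z) <= n%:R] x * btrunc f n x.

Lemma htrunc_cases {R : realType} {d : nat} (f : d.-tuple R -> R[i]) n x :
  htrunc f n x = f x \/ htrunc f n x = 0.
Proof.
rewrite /htrunc /btrunc /cindic !indicE; case: (_ \in _); case: (_ \in _).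
- by left; apply: complex_ext; rewrite ?cReM ?cImM /= ?cReM ?cImM /= !(mul0r, mul1r, mulr0, subr0, addr0).
- by right; apply: complex_ext; rewrite ?cReM ?cImM /= ?cReM ?cImM /= !(mul0r, mul1r, mulr0, subr0, addr0).
- by right; apply: complex_ext; rewrite ?cReM ?cImM /= ?cReM ?cImM /= !(mul0r, mul1r, mulr0, subr0, addr0).
- by right; apply: complex_ext; rewrite ?cReM ?cImM /= ?cReM ?cImM /= !(mul0r, mul1r, mulr0, subr0, addr0).
Qed.

Lemma cabs_htrunc_le {R : realType} {d : nat} (f : d.-tuple R -> R[i]) n x :
  cabs (htrunc f n x) <= cabs (f x).
Proof. by case: (htrunc_cases f n x) => -> //; rewrite cabs0 cabs_ge0. Qed.

Lemma cmeasurable_htrunc {R : realType} {d : nat} (f : d.-tuple R -> R[i]) n :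
  cmeasurable f -> cmeasurable (htrunc f n).
Proof.
move=> mf; apply: cmeasurableM; last exact: cmeasurable_btrunc.
apply: cmeasurable_cindic.
have := measurable_cabs _ _ mf measurableT `]-oo, (n%:R : R)]%classic (measurable_itv _).
by rewrite setTI; congr measurable; apply/seteqP; split => z /=; rewrite in_itv.
Qed.

Lemma inLp_htrunc {R : realType} {d : nat} (leb : {measure set (d.-tuple R) -> \bar R}) (p : R)
  (f : d.-tuple R -> R[i]) n : 0 <= p -> inLp leb p f -> inLp leb p (htrunc f n).
Proof.
move=> p0 [mf ff]; have mh := cmeasurable_htrunc f n mf; split; first exact: mh.
by apply: le_lt_trans ff; apply: (Ip_le _ leb p _ _ p0 mh mf) => x; exact: cabs_htrunc_le.
Qed.

Lemma L2_htrunc {R : realType} {d : nat} (leb : {measure set (d.-tuple R) -> \bar R})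
  (f : d.-tuple R -> R[i]) n : is_lebesgue leb -> cmeasurable f -> inLp leb 2 (htrunc f n).
Proof.
move=> hl mf; have mh := cmeasurable_htrunc f n mf; split; first exact: mh.
have mi : cmeasurable (cindic (@cube R d n)) by apply: cmeasurable_cindic; exact: measurable_cube.
have mni := cmeasurableM _ _ _ (cmeasurableC d (Complex n%:R 0 : R[i])) mi.
apply: (@le_lt_trans _ _ (Ip leb 2 (fun x => Complex n%:R 0 * cindic (cube d n) x))).
  apply: (Ip_le _ leb 2 _ _ (ler0n _ 2) mh mni) => x.
  rewrite cabsM cabs_real cabs_cindic (ger0_norm (ler0n _ n)).
  have [xc|xc] := pselect (cube d n x).
    rewrite indicE mem_set // mulr1 /htrunc cabsM cabs_cindic indicE.
    case: (boolP (_ \in _)) => [|_]; last by rewrite mul0r.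
    by rewrite inE /= => h; rewrite mul1r; exact: le_trans (cabs_btrunc_le f n x) h.
  rewrite /htrunc /btrunc {2}/cindic [\1_[set z | sqnorm z <= _] x]indicE memNset; last by move=> /= /ball_cube.
  by rewrite (_ : Complex 0 0 * f x = 0) ?mulr0 ?cabs0 ?mulr_ge0 //; exact: mul0r.
have n2 : (2 : R) != 0 by rewrite gt_eqF.
rewrite (IpZ _ leb 2 _ _ mi) Ip_cindic //; last exact: measurable_cube.
by apply: lte_mul_pinfty; [rewrite lee_fin powR_ge0|by []|exact: lebesgue_cube].
Qed.

Lemma htrunc_tends0 {R : realType} {d : nat} (leb : {measure set (d.-tuple R) -> \bar R}) (p : R)
  (f : d.-tuple R -> R[i]) : 1 <= p -> inLp leb p f ->
  tends0 (fun n => Ip leb p (fun x => htrunc f n x - f x)).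
Proof.
move=> p1 [mf ff]; apply: (Ip_dominated d leb p (htrunc f) f f p1 (fun n => cmeasurable_htrunc f n mf) mf mf _ ff).
- apply: aeW => x; have [M hM] := btrunc_eventually f x.
  apply: (ccvg_eventually _ _ (maxn M (Num.truncn (cabs (f x))).+1)) => n.
  rewrite geq_max => /andP[h1 h2]; rewrite /htrunc (hM _ h1) /cindic indicE mem_set; last first.
    by rewrite /=; apply: (le_trans (ltW (truncnS_gt _))); rewrite ler_nat.
  by apply: complex_ext; rewrite ?cReM ?cImM /= !mul0r ?mul1r ?subr0 ?addr0.
- move=> n x; case: (htrunc_cases f n x) => ->; first by rewrite subrr cabs0 cabs_ge0.
  by rewrite sub0r cabsN.
Qed.

(** The truncations of f converge in L^p, so their images are Cauchy in L^p by the bound on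
    differences. Fatou's lemma transfers the constant K to the limit. *)
Lemma Mcl_exists {R : realType} {d : nat} (leb : {measure set (d.-tuple R) -> \bar R}) (p K : R)
  (m f : d.-tuple R -> R[i]) : is_lebesgue leb -> 1 <= p -> 0 <= K -> Good leb p K m ->
  inLp leb p f -> exists g, Mcl leb p m f g /\ (Ip leb p g <= K%:E * Ip leb p f)%E.
Proof.
move=> hl p1 K0 hG hf; have p0 : 0 <= p by lra.
have mf := proj1 hf.
have [k hk] := choice (fun n => Mrel_exists leb p K m _ hl hG (L2_htrunc leb f n hl mf)).
have mk n : cmeasurable (k n) := proj1 (proj2 (Mrel_inLp leb m _ _ (hk n))).
have mh n := cmeasurable_htrunc f n mf.
have T := htrunc_tends0 leb p f p1 hf.
have c0 : (0 : R) <= 2 `^ p by exact: powR_ge0.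
have [g [mg hg]] : exists g, cmeasurable g /\ tends0 (fun n => Ip leb p (fun x => k n x - g x)).
  apply: (Lp_complete d leb p k p1 mk) => e e0.
  have d0 : 0 < K * (2 `^ p * 2) + 1 by rewrite ltr_wpDl // !mulr_ge0.
  have [N2 hN2] := T _ (divr_gt0 e0 d0); exists N2 => n l Nn Nl.
  apply: (le_trans (Mrel_diff_le leb p K m _ _ _ _ hl hG (hk n) (hk l))).
  set q := e / (K * (2 `^ p * 2) + 1).
  apply: (@le_trans _ _ (K%:E * ((2 `^ p)%:E * (q%:E + q%:E)))%E).
    apply: lee_wpmul2l; first by rewrite lee_fin.
    apply: (le_trans (Ip_triangle _ leb p _ _ _ p0 (mh n) mf (mh l))).
    apply: lee_wpmul2l; first by rewrite lee_fin.
    by apply: leeD; [exact: hN2|rewrite IpB_sym; exact: hN2].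
  rewrite -EFinD -!EFinM lee_fin (_ : K * (2 `^ p * (q + q)) = K * (2 `^ p * 2) * q); last by ring.
  rewrite /q mulrCA; apply: ler_piMr; first exact: ltW.
  by rewrite ler_pdivrMr // mul1r lerDl.
exists g; split.
  split; first exact: mg.
  by exists (htrunc f), k; split; [exact: hk|exact: T|exact: hg].
have [phi hphi] := Ip_subseq_ae d leb p k g p1 mk mg hg.
apply: (Ip_fatou d leb p (fun n => k (phi n)) g _ p1 (fun n => mk _) mg hphi) => n.
apply: (le_trans (Mrel_le leb p K m _ _ hl hG (hk (phi n)))).
apply: lee_wpmul2l; first by rewrite lee_fin.
by apply: (Ip_le _ leb p _ _ p0 (mh _) mf) => x; exact: cabs_htrunc_le.
Qed.

Lemma is_MopP {R : realType} {d : nat} (leb V : {measure set (d.-tuple R) -> \bar R})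
  (phi f g : d.-tuple R -> R[i]) : is_lebesgue leb ->
  is_Mop leb V phi f g <-> Mrel leb (multM V phi) f g.
Proof.
move=> hl; split=> [[hf [hg [F [h1 h2]]]]|h].
  by exists F; split; exact/(is_FT2P leb _ _ hl).
have [hf hg] := Mrel_inLp leb _ _ _ h; case: h => F [h1 h2].
split; [exact: hf|split; [exact: hg|exists F]].
by split; exact/(is_FT2P leb _ _ hl).
Qed.

Lemma fine_le_mul {R : realType} (k : R) (x y : \bar R) : x \is a fin_num -> y \is a fin_num ->
  (y <= k%:E * x)%E <-> fine y <= k * fine x.
Proof. by case: x => [a||] //; case: y => [b||] //= _ _; rewrite -EFinM lee_fin. Qed.

Lemma Lpnorm_le {R : realType} {d : nat} (leb : {measure set (d.-tuple R) -> \bar R}) (p K : R)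
  (f g : d.-tuple R -> R[i]) : 0 < p -> 0 <= K -> inLp leb p f -> inLp leb p g ->
  (Ip leb p g <= (K `^ p)%:E * Ip leb p f)%E -> Lpnorm leb p g <= K * Lpnorm leb p f.
Proof.
move=> p0 K0 [_ ff] [_ fg] h.
have nf : Ip leb p f \is a fin_num by rewrite (ge0_fin_numE (Ip_ge0 _ leb p f)); exact: ff.
have ng : Ip leb p g \is a fin_num by rewrite (ge0_fin_numE (Ip_ge0 _ leb p g)); exact: fg.
have f0 : 0 <= fine (Ip leb p f) by apply: fine_ge0; exact: Ip_ge0.
have g0 : 0 <= fine (Ip leb p g) by apply: fine_ge0; exact: Ip_ge0.
have h' : fine (Ip leb p g) <= K `^ p * fine (Ip leb p f).
  exact: (proj1 (fine_le_mul _ _ _ nf ng) h).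
rewrite /Lpnorm -/(Ip leb p g) -/(Ip leb p f).
apply: (@le_trans _ _ ((K `^ p * fine (Ip leb p f)) `^ p^-1)).
  apply: ge0_ler_powR; [by rewrite invr_ge0 ltW|exact: g0|apply: mulr_ge0; [exact: powR_ge0|exact: f0]|exact: h'].
by rewrite (powRM _ (powR_ge0 _ _) f0) -powRrM divff ?gt_eqF // powRr1.
Qed.

Lemma Ip_le_Lpnorm {R : realType} {d : nat} (leb : {measure set (d.-tuple R) -> \bar R}) (p C : R)
  (f g : d.-tuple R -> R[i]) : 0 < p -> inLp leb p f -> inLp leb p g ->
  Lpnorm leb p g <= C * Lpnorm leb p f -> (Ip leb p g <= (`|C| `^ p)%:E * Ip leb p f)%E.
Proof.
move=> p0 [_ ff] [_ fg] h.
have nf : Ip leb p f \is a fin_num by rewrite (ge0_fin_numE (Ip_ge0 _ leb p f)); exact: ff.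
have ng : Ip leb p g \is a fin_num by rewrite (ge0_fin_numE (Ip_ge0 _ leb p g)); exact: fg.
have f0 : 0 <= fine (Ip leb p f) by apply: fine_ge0; exact: Ip_ge0.
have g0 : 0 <= fine (Ip leb p g) by apply: fine_ge0; exact: Ip_ge0.
have pE (x : R) : 0 <= x -> (x `^ p^-1) `^ p = x.
  by move=> x0; rewrite -powRrM mulVf ?gt_eqF // powRr1.
have n0 (u : d.-tuple R -> R[i]) : 0 <= Lpnorm leb p u by exact: powR_ge0.
have h2 : Lpnorm leb p g <= `|C| * Lpnorm leb p f.
  by apply: (le_trans h); apply: ler_wpM2r => //; exact: ler_norm.
have key (a b k : R) : 0 <= a -> 0 <= b -> 0 <= k -> a `^ p^-1 <= k * b `^ p^-1 -> a <= k `^ p * b.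
  move=> a0 b0 k0 hab; rewrite -(pE a a0) -[X in _ * X](pE b b0) -(powRM _ k0 (powR_ge0 _ _)).
  apply: ge0_ler_powR; [exact: ltW|exact: powR_ge0|apply: mulr_ge0; [exact: k0|exact: powR_ge0]|exact: hab].
apply: (proj2 (fine_le_mul _ _ _ nf ng)); exact: (key _ _ _ g0 f0 (normr_ge0 C) h2).
Qed.

(** For p >= 2 the maximum is p; for p < 2 it is q, and q - 1 = 1 / (p - 1). *)
Lemma pstar_burk_const {R : realType} (p : R) : 1 < p ->
  Num.max p (p / (p - 1)) - 1 = burk_const (p - 1).
Proof.
move=> p1; have c0 : 0 < p - 1 by lra.
rewrite /burk_const; case: ifPn => [h|]; last rewrite -ltNge => h.
  by rewrite max_l // ler_pdivrMr // ler_peMr; lra.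
rewrite max_r; first by field; rewrite gt_eqF.
by rewrite ler_pdivlMr // ler_piMr; lra.
Qed.

Theorem theorem1p1 (R : realType) (d : nat) (hd : (0 < d)%N)
  (V : {measure set (d.-tuple R) -> \bar R})
  (hV0 : V [set zerot R d] = 0%E)
  (hVnz : exists A, measurable A /\ V A <> 0%E)
  (hVint : (\int[V]_z (Num.min (sqnorm z) 1)%:E < +oo)%E)
  (hVsym : forall B, measurable B -> V (negt @` B) = V B)
  (phi : d.-tuple R -> R[i])
  (hphim : cmeasurable phi)
  (hphisym : forall z, phi (negt z) = phi z)
  (hphib : forall z, cabs (phi z) <= 1)
  (leb : {measure set (d.-tuple R) -> \bar R}) (hleb : is_lebesgue leb)
  (p : R) (hp : 1 < p) :
  let pstar := Num.max p (p / (p - 1)) in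
  exists T : (d.-tuple R -> R[i]) -> (d.-tuple R -> R[i]),
    [/\ Lp_linear leb p T,
        extends_M leb V phi p T,
        (forall f, inLp leb p f -> Lpnorm leb p (T f) <= (pstar - 1) * Lpnorm leb p f)
      & (forall S : (d.-tuple R -> R[i]) -> (d.-tuple R -> R[i]),
           Lp_linear leb p S -> extends_M leb V phi p S ->
           (exists C : R, forall f, inLp leb p f -> Lpnorm leb p (S f) <= C * Lpnorm leb p f) ->
           forall f, inLp leb p f -> aeq_c leb (S f) (T f))].
Proof.
move=> pstar; have c0 : 0 < p - 1 by lra.
have p0 : 0 < p by lra.
have p1 : 1 <= p by lra.
have pw : 0 <= p by lra.
have ep : p - 1 + 1 = p by ring.
have := Good_multM leb V (p - 1) phi hleb c0 hVint hphim hphib.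
rewrite ep; set K := burk_const (p - 1); set m := multM V phi => hG.
have K0 : 0 <= K.
  by rewrite /K /burk_const; case: ifP => _; rewrite ?invr_ge0; exact: ltW.
have Kp0 : 0 <= K `^ p by exact: powR_ge0.
(* On the intersection of L^2 and L^p the value is taken from the L^2 operator itself, as
   [extends_M] demands that exact relation; elsewhere it comes from the closure. Both lie in the
   closed graph, so linearity across the two cases follows from uniqueness. *)
have ex f : exists g, inLp leb p f ->
    [/\ Mcl leb p m f g, (Ip leb p g <= (K `^ p)%:E * Ip leb p f)%E &
        inLp leb 2 f -> Mrel leb m f g].
  have [hf|nf] := pselect (inLp leb p f); last by exists f => hf.
  have [h2|n2] := pselect (inLp leb 2 f).
    have [g hg] := Mrel_exists leb p _ m f hleb hG h2; exists g => _.
    split; [exact: Mcl_refl p0 hg|exact: Mrel_le hleb hG hg|by move=> _; exact: hg].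
  have [g [h1 h3]] := Mcl_exists leb p _ m f hleb p1 Kp0 hG hf.
  by exists g => _; split; [exact: h1|exact: h3|move=> /n2].
have [T hT] := choice ex.
have Tp f : inLp leb p f -> inLp leb p (T f).
  move=> hf; have [[mT _] h _] := hT f hf; split; first exact: mT.
  apply: (le_lt_trans h); apply: lte_mul_pinfty; [by rewrite lee_fin|by []|exact: (proj2 hf)].
exists T; split.
- split; first exact: Tp.
  move=> a f g hf hg; have hfg := inLp_lincomb leb p a f g pw hf hg.
  have [h1 _ _] := hT f hf; have [h2 _ _] := hT g hg; have [h3 _ _] := hT _ hfg.
  have h4 := Mcl_lincomb leb p m a _ _ _ _ hleb pw (proj1 hf) (proj1 hg) h1 h2.
  exact: (Mcl_unique leb p _ m _ _ _ hleb pw Kp0 hG (proj1 hfg) h3 h4).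
- move=> f h2 hf; have [_ _ h] := hT f hf.
  exact/(is_MopP leb V phi f (T f) hleb)/(h h2).
- move=> f hf; rewrite /pstar pstar_burk_const // -/K.
  by have [_ h _] := hT f hf; exact: (Lpnorm_le leb p K f (T f) p0 K0 hf (Tp f hf) h).
- move=> S [Sp Slin] Sext [C hC] f hf.
  have [h1 _ _] := hT f hf.
  (* It suffices to place (f, S f) in the closed graph: the truncations of f lie in L^2 and L^p,
     where S is the multiplier operator, and boundedness of S carries their images to S f. *)
  suff h2 : Mcl leb p m f (S f) by exact: (Mcl_unique leb p _ m _ _ _ hleb pw Kp0 hG (proj1 hf) h2 h1).
  split; first exact: (proj1 (Sp f hf)).
  have hh n := inLp_htrunc leb p f n pw hf.
  exists (htrunc f), (fun n => S (htrunc f n)); split.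
  + move=> n; apply/(is_MopP leb V phi _ _ hleb); apply: Sext; [exact: L2_htrunc (proj1 hf)|exact: hh].
  + exact: htrunc_tends0.
  (* [C] has no prescribed sign, hence the absolute value. Linearity of S holds almost everywhere
     only, so the difference of images is compared through [Ip_ae_eq]. *)
  have k0 : 0 <= `|C| `^ p by exact: powR_ge0.
  apply: (tends0_le _ _ _ (tends0Z _ _ k0 (htrunc_tends0 leb p f p1 hf))) => n.
  have hu := inLp_lincomb leb p (-1) _ _ pw hf (hh n).
  have := Ip_le_Lpnorm leb p C _ _ p0 hu (Sp _ hu) (hC _ hu).
  have ae := Slin (-1) _ _ hf (hh n).
  have hS := inLp_lincomb leb p (-1) _ _ pw (Sp _ hf) (Sp _ (hh n)).
  rewrite (Ip_ae_eq _ leb p _ _ (proj1 (Sp _ hu)) (proj1 hS) ae).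
  rewrite (_ : (fun y => -1 * S f y + S (htrunc f n) y) = fun x => S (htrunc f n) x - S f x); last first.
    by apply/funext => x; rewrite cmulN1D.
  rewrite (_ : (fun y => -1 * f y + htrunc f n y) = fun x => htrunc f n x - f x); first exact: id.
  by apply/funext => x; rewrite cmulN1D.
Qed.
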